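(* Let $q,p\in\mathbb{C}$ with $0<|q|,|p|<1$, let $t_1,\ldots,t_5\in\mathbb{C}\setminus\{0\}$ and put $A=\prod_{m=1}^5 t_m$. Define $$\rho(z,t_1,\ldots,t_5)=\frac{\prod_{m=1}^5\Gamma(t_mz)\,\Gamma(t_mz^{-1})\,\Gamma(At_m^{-1})}{\Gamma(z^{2})\,\Gamma(z^{-2})\,\Gamma(Az)\,\Gamma(Az^{-1})\prod_{1\leq m<s\leq 5}\Gamma(t_mt_s)},$$ where $\Gamma(x)=\Gamma(x;q,p)$ is the standard elliptic gamma function, the parameters being such that the $z$-independent factors $\Gamma(At_m^{-1})$ and $1/\Gamma(t_mt_s)$ are finite. Let $$\mathcal{P}=\{t_mq^jp^k,\ A^{-1}q^{j+1}p^{k+1}\ :\ m=1,\ldots,5,\ j,k\in\mathbb{N}\},\qquad \mathcal{P}^{-1}=\{x^{-1}: x\in\mathcal{P}\},$$ and let $C$ be a positively oriented contour in the complex plane separating $\mathcal{P}$ and $\mathcal{P}^{-1}$. Then $$\int_C\rho(z,t_1,\ldots,t_5)\frac{dz}{z}=\frac{4\pi i}{(q;q)_\infty(p;p)_\infty}.$$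
   Context: Notation: $\mathbb{N}=\{0,1,2,\ldots\}$; $(a;p)_\infty=\prod_{j=0}^\infty(1-ap^j)$. The standard elliptic gamma function is $$\Gamma(z;q,p)=\prod_{j,k=0}^\infty\frac{1-z^{-1}q^{j+1}p^{k+1}}{1-zq^jp^k},$$ a meromorphic function of $z\in\mathbb{C}\setminus\{0\}$. The points of $\mathcal{P}$ (resp. $\mathcal{P}^{-1}$) are the sequences of poles of $\rho$ in $z$ converging to $0$ (resp. diverging to infinity). ''$C$ separates $\mathcal{P}$ and $\mathcal{P}^{-1}$'' means that $C$ is a closed contour in $\mathbb{C}\setminus\{0\}$ with $\mathcal{P}$ (and the point $0$) in its interior and $\mathcal{P}^{-1}$ in its exterior (in particular $\mathcal{P}\cap\mathcal{P}^{-1}=\emptyset$). For instance, if $|t_m|<1$ for all $m$ and $|pq|<|A|$, one may take $C$ to be the unit circle $\mathbb{T}$. *)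

(* Defs.v *)
From Stdlib Require Export Reals.
From Coquelicot Require Export Coquelicot.

Local Open Scope C_scope.

Fixpoint Cprod (f : nat -> C) (n : nat) : C :=
  match n with
  | O => 1
  | S k => Cprod f k * f k
  end.

Definition CLim_seq (u : nat -> C) : C :=
  (real (Lim_seq (fun n => Re (u n))), real (Lim_seq (fun n => Im (u n)))).

Definition qpoch_inf (a p : C) : C :=
  CLim_seq (Cprod (fun j => 1 - a * p ^ j)).

(* The double product converges absolutely when |q|, |p| < 1, so taking it over
   the squares j, k < n is immaterial.  The value carries no meaning at the
   poles of Gamma, where a denominator is 0. *)
Definition egamma (q p z : C) : C :=
  CLim_seq (fun n =>
    Cprod (fun j =>
      Cprod (fun k =>
        (1 - / z * q ^ S j * p ^ S k) / (1 - z * q ^ j * p ^ k)) n) n).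

Definition egamma_finite (q p x : C) : Prop :=
  forall j k : nat, 1 - x * q ^ j * p ^ k <> 0.

Definition inv_egamma_finite (q p x : C) : Prop :=
  forall j k : nat, 1 - / x * q ^ S j * p ^ S k <> 0.

(* The five parameters are t 0, ..., t 4. *)
Definition Aprod (t : nat -> C) : C := Cprod t 5.

Definition rho_expr (q p : C) (t : nat -> C) (z : C) : C :=
  let G := egamma q p in
  let A := Aprod t in
  Cprod (fun m => G (t m * z) * G (t m * / z) * G (A * / t m)) 5
  / (G (z ^ 2) * G (/ z ^ 2) * G (A * z) * G (A * / z)
     * Cprod (fun s => Cprod (fun m => G (t m * t s)) s) 5).

(* rho is the meromorphic function given by rho_expr.  At isolated points that
   are not poles of rho (for instance z ^ 2 = q * p) a zero of one factor meets
   a pole of another and rho_expr cannot be evaluated term by term; the value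
   of rho at every regular point is the limit of rho_expr.  C_lim, a limit along
   the horizontal line, agrees with it (is_C_lim_unique). *)
Definition rho (q p : C) (t : nat -> C) (z : C) : C :=
  C_lim (rho_expr q p t) z.

Definition poles_to_zero (q p : C) (t : nat -> C) (x : C) : Prop :=
  (exists m j k : nat, (m < 5)%nat /\ x = t m * q ^ j * p ^ k) \/
  (exists j k : nat, x = / Aprod t * q ^ S j * p ^ S k).

Definition poles_to_infinity (q p : C) (t : nat -> C) (x : C) : Prop :=
  exists y : C, poles_to_zero q p t y /\ x = / y.

Definition C1_on (gamma : R -> C) (a b : R) : Prop :=
  exists g dg : R -> C,
    (forall s : R, @is_derive R_AbsRing C_R_NormedModule g s (dg s)) /\
    (forall s : R, continuous dg s) /\
    (forall s : R, (a <= s <= b)%R -> gamma s = g s).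

Inductive piecewise_C1 (gamma : R -> C) : R -> R -> Prop :=
| pw_C1_piece (a b : R) :
    (a < b)%R -> C1_on gamma a b -> piecewise_C1 gamma a b
| pw_C1_join (a b c : R) :
    piecewise_C1 gamma a b -> piecewise_C1 gamma b c ->
    piecewise_C1 gamma a c.

Definition simple_closed (gamma : R -> C) (a b : R) : Prop :=
  gamma a = gamma b /\
  forall s s' : R, (a <= s)%R -> (s < s')%R -> (s' <= b)%R ->
    gamma s = gamma s' -> s = a /\ s' = b.

Definition on_curve (gamma : R -> C) (a b : R) (z : C) : Prop :=
  exists s : R, (a <= s <= b)%R /\ gamma s = z.

(* Meaningful off the finitely many break points of a piecewise C1 curve,
   which do not affect integrals. *)
Definition velocity (gamma : R -> C) (s : R) : C :=
  (Derive (fun r => Re (gamma r)) s, Derive (fun r => Im (gamma r)) s).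

Definition is_contour_int (f : C -> C) (gamma : R -> C) (a b : R) (l : C) :
    Prop :=
  @is_RInt C_R_NormedModule (fun s => f (gamma s) * velocity gamma s) a b l.

Definition Cconnected (S : C -> Prop) : Prop :=
  forall U V : C -> Prop, open U -> open V ->
    (forall z, S z -> U z \/ V z) ->
    (forall z, S z -> U z -> V z -> False) ->
    (exists z, S z /\ U z) -> (exists z, S z /\ V z) -> False.

Definition component (D : C -> Prop) (z w : C) : Prop :=
  exists S : C -> Prop,
    Cconnected S /\ (forall v, S v -> D v) /\ S z /\ S w.

Definition Cbounded (S : C -> Prop) : Prop :=
  exists M : R, forall z, S z -> (Cmod z <= M)%R.

Definition interior_of (gamma : R -> C) (a b : R) (z : C) : Prop :=
  ~ on_curve gamma a b z /\
  Cbounded (component (fun w => ~ on_curve gamma a b w) z).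

Definition exterior_of (gamma : R -> C) (a b : R) (z : C) : Prop :=
  ~ on_curve gamma a b z /\
  ~ Cbounded (component (fun w => ~ on_curve gamma a b w) z).

(* Winding number +1 about the interior points. *)
Definition positively_oriented (gamma : R -> C) (a b : R) : Prop :=
  forall w : C, interior_of gamma a b w ->
    is_contour_int (fun z => / (z - w)) gamma a b (2 * PI * Ci).

Definition separates (gamma : R -> C) (a b : R) (P Q : C -> Prop) : Prop :=
  ~ on_curve gamma a b 0 /\
  interior_of gamma a b 0 /\
  (forall x, P x -> interior_of gamma a b x) /\
  (forall x, Q x -> exterior_of gamma a b x).

(* Main.v *)
(* With t_6 = p q / A the integrand is symmetric in six parameters of product p q, and the poles
   tending to 0 are the points t_m q^j p^k with m <= 6.

   Suppose first that all |t_m| < 1 and that C is the unit circle, and divide the integral by the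
   product of the Gamma(t_m t_s) over m < s <= 6. A theta function identity expresses the difference
   between the quotients at (q t_1, ..., t_6) and (t_1, ..., q t_6) as the integral of
   g(z) + g(1/z), where g(1/(q z)) = - g(z); shifting the circle shows that it vanishes. So the
   quotient, as a function of t_1, is invariant under t_1 -> q t_1, hence constant, and by symmetry it
   depends on no parameter. Its value is found at t_1 = i l, t_2 = - i l with l -> 1, where the circle
   is pinched at the points +-i and only their residues survive.

   In general, move the parameters along powers of a variable l in an annulus. Partial fractions
   turn the integral, multiplied by finitely many factors 1 - x y with x, y in P, into a holomorphic
   function of l that is the same for every separating contour. It agrees with the expected value
   on a circle where the parameters are small, hence at l = 1; there the factors 1 - x y do not
   vanish because P and 1/P are separated. *)
Require Import Defs.
From Stdlib Require Import Reals Lra Lia List Psatz ZArith Permutation.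
From Coquelicot Require Import Coquelicot.
Import ListNotations.
Local Open Scope C_scope.
Set Bullet Behavior "Strict Subproofs".

(** The obstacle is the arbitrary piecewise C1 contour. It enters the proof through the values of
    its normalised integral on the powers of z, of 1/(1 - x z) and of 1/(1 - x/z). Primitives give
    these values once the winding numbers about 0 and about the poles are known. What is left of the
    integrand is holomorphic on a whole annulus about 0, hence a uniform limit of Laurent
    polynomials there, so Cauchy's formula is proved for circles alone. A holomorphic function is a
    uniform limit of rational expressions whose denominators are bounded below. Stability under
    substitution and under integration over a parameter then becomes an induction on expressions.
    The invariance under t_1 -> q t_1 is available where |t_m| < 1 and |p| < |A|^2: the second bound
    keeps the theta functions that must be divided out away from their zeros. That region is still
    wide enough to contain a pinching family of parameters, and the continuation in l starts from a
    circle chosen to lie in it. The constant 4 pi i is 2 pi i times 2, and the 2 is half of the 4 =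
    (1 - z^2)^2 produced by the kernel at z = i and z = -i. *)

Lemma Cmod_prod_norm (z : C) : @norm R_AbsRing C_R_NormedModule z = Cmod z.
Proof.
  unfold Cmod, norm; simpl; unfold prod_norm, norm; simpl; unfold abs; simpl.
  rewrite !Rmult_1_r, <- !Rabs_mult, !Rabs_pos_eq; auto; apply Rle_0_sqr.
Qed.

Lemma Cmod_triangle_sub (x y : C) : (Cmod (x - y) <= Cmod x + Cmod y)%R.
Proof. unfold Cminus. rewrite <- (Cmod_opp y). apply Cmod_triangle. Qed.

Lemma Cmod_triangle_rev (x y : C) : (Cmod x - Cmod y <= Cmod (x - y))%R.
Proof.
  assert (H := Cmod_triangle (x - y) y). replace (x - y + y) with x in H by ring. lra.
Qed.

Lemma Cmod_sub_sym (x y : C) : Cmod (x - y) = Cmod (y - x).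
Proof. rewrite <- Cmod_opp. f_equal. ring. Qed.

Lemma Cmod_nz (z : C) : (0 < Cmod z)%R -> z <> 0.
Proof. intros H ->. rewrite Cmod_0 in H. lra. Qed.

Lemma C_eq_of_small (x y : C) :
  (forall e, (0 < e)%R -> (Cmod (x - y) <= e)%R) -> x = y.
Proof.
  intros H. apply Ceq_minus, Cmod_eq_0. destruct (Rle_lt_or_eq_dec _ _ (Cmod_ge_0 (x - y))) as [h|h]; [|auto].
  specialize (H (Cmod (x - y) / 2)%R). lra.
Qed.

(** * Calculus of complex-valued functions of a real variable *)

Lemma is_derive_C_comp (f : R -> C) (s : R) (l : C) :
  is_derive (fun s => Re (f s)) s (Re l) -> is_derive (fun s => Im (f s)) s (Im l) ->
  @is_derive R_AbsRing C_R_NormedModule f s l.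
Proof.
  intros H1 H2.
  assert (H := is_derive_plus _ _ _ _ _ (is_derive_scal_l (V := C_R_NormedModule) _ s _ ((1, 0)%R : C) H1)
     (is_derive_scal_l (V := C_R_NormedModule) _ s _ ((0, 1)%R : C) H2)).
  eapply is_derive_ext; [|eapply (eq_rect _ (is_derive _ s) H)].
  - intros t. apply injective_projections; simpl; unfold plus, scal, mult; simpl; unfold mult; simpl; unfold Re, Im; ring.
  - apply injective_projections; simpl; unfold plus, scal, mult; simpl; unfold mult; simpl; unfold Re, Im; ring.
Qed.

Lemma is_derive_Re (f : R -> C) (s : R) (l : C) :
  @is_derive R_AbsRing C_R_NormedModule f s l ->
  is_derive (fun s => Re (f s)) s (Re l).
Proof.
  intros H.
  assert (Hl : is_linear (K := R_AbsRing) (U := C_R_NormedModule) (V := R_NormedModule) (fun x : C => fst x))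
    by apply (is_linear_fst (U := R_NormedModule) (V := R_NormedModule)).
  exact (filterdiff_comp (U := R_NormedModule) (V := C_R_NormedModule) (W := R_NormedModule) f (fun x : C => fst x) _ _ H
    (filterdiff_linear _ Hl)).
Qed.

Lemma is_derive_Im (f : R -> C) (s : R) (l : C) :
  @is_derive R_AbsRing C_R_NormedModule f s l ->
  is_derive (fun s => Im (f s)) s (Im l).
Proof.
  intros H.
  assert (Hl : is_linear (K := R_AbsRing) (U := C_R_NormedModule) (V := R_NormedModule) (fun x : C => snd x))
    by apply (is_linear_snd (U := R_NormedModule) (V := R_NormedModule)).
  exact (filterdiff_comp (U := R_NormedModule) (V := C_R_NormedModule) (W := R_NormedModule) f (fun x : C => snd x) _ _ H
    (filterdiff_linear _ Hl)).
Qed.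

Lemma is_derive_mult_C_comp (u v x y : R -> R) (s u' v' x' y' : R) :
  is_derive u s u' -> is_derive v s v' -> is_derive x s x' -> is_derive y s y' ->
  is_derive (fun t => u t * x t - v t * y t)%R s (u' * x s + u s * x' - v' * y s - v s * y')%R /\
  is_derive (fun t => u t * y t + v t * x t)%R s (u' * y s + u s * y' + v' * x s + v s * x')%R.
Proof.
  intros F1 F2 G1 G2.
  assert (D1 := is_derive_unique _ _ _ F1). assert (D2 := is_derive_unique _ _ _ F2).
  assert (D3 := is_derive_unique _ _ _ G1). assert (D4 := is_derive_unique _ _ _ G2).
  assert (E1 : ex_derive u s) by (eexists; eauto).
  assert (E2 : ex_derive v s) by (eexists; eauto).
  assert (E3 : ex_derive x s) by (eexists; eauto).
  assert (E4 : ex_derive y s) by (eexists; eauto).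
  split; (auto_derive; [repeat split; auto|]); rewrite <- D1, <- D2, <- D3, <- D4;
    change (fun t => u t) with u; change (fun t => v t) with v; change (fun t => x t) with x; change (fun t => y t) with y; ring.
Qed.

Lemma is_derive_inv_C_comp (u v : R -> R) (s u' v' : R) :
  is_derive u s u' -> is_derive v s v' -> (u s ^ 2 + v s ^ 2 <> 0)%R ->
  is_derive (fun t => u t / (u t ^ 2 + v t ^ 2))%R s
    ((u' * (u s ^ 2 + v s ^ 2) - u s * (2 * u s * u' + 2 * v s * v')) / (u s ^ 2 + v s ^ 2) ^ 2)%R /\
  is_derive (fun t => - v t / (u t ^ 2 + v t ^ 2))%R s
    ((- v' * (u s ^ 2 + v s ^ 2) + v s * (2 * u s * u' + 2 * v s * v')) / (u s ^ 2 + v s ^ 2) ^ 2)%R.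
Proof.
  intros F1 F2 Hn.
  assert (D1 := is_derive_unique _ _ _ F1). assert (D2 := is_derive_unique _ _ _ F2).
  assert (E1 : ex_derive u s) by (eexists; eauto).
  assert (E2 : ex_derive v s) by (eexists; eauto).
  split; (auto_derive; [repeat split; auto|]); rewrite <- D1, <- D2;
    change (fun t => u t) with u; change (fun t => v t) with v; field; intro h; apply Hn; lra.
Qed.

Lemma is_derive_Cmult (f g : R -> C) (s : R) (f' g' : C) :
  @is_derive R_AbsRing C_R_NormedModule f s f' ->
  @is_derive R_AbsRing C_R_NormedModule g s g' ->
  @is_derive R_AbsRing C_R_NormedModule (fun s => f s * g s) s (f' * g s + f s * g').
Proof.
  intros Hf Hg.
  destruct (is_derive_mult_C_comp _ _ _ _ _ _ _ _ _ (is_derive_Re _ _ _ Hf) (is_derive_Im _ _ _ Hf)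
    (is_derive_Re _ _ _ Hg) (is_derive_Im _ _ _ Hg)) as [A1 A2].
  apply is_derive_C_comp.
  - eapply (eq_rect _ (is_derive _ s) A1). unfold Re, Im; simpl; ring.
  - eapply (eq_rect _ (is_derive _ s) A2). unfold Re, Im; simpl; ring.
Qed.

Lemma is_derive_Cinv (f : R -> C) (s : R) (f' : C) :
  @is_derive R_AbsRing C_R_NormedModule f s f' -> f s <> 0 ->
  @is_derive R_AbsRing C_R_NormedModule (fun s => / f s) s (- f' / (f s * f s)).
Proof.
  intros Hf Hz.
  assert (Hn : (Re (f s) ^ 2 + Im (f s) ^ 2)%R <> 0%R).
  { intro h. apply Hz. apply Cmod_eq_0. rewrite <- sqrt_0. rewrite <- h. reflexivity. }
  destruct (is_derive_inv_C_comp _ _ _ _ _ (is_derive_Re _ _ _ Hf) (is_derive_Im _ _ _ Hf) Hn) as [A1 A2].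
  assert (Hn2 : f s * f s <> 0) by (apply Cmult_neq_0; auto).
  assert (Hd : ((Re (f s) * Re (f s) - Im (f s) * Im (f s)) ^ 2 + (Re (f s) * Im (f s) + Im (f s) * Re (f s)) ^ 2 =
     (Re (f s) ^ 2 + Im (f s) ^ 2) ^ 2)%R) by ring.
  assert (Hd0 : ((Re (f s) ^ 2 + Im (f s) ^ 2) ^ 2 <> 0)%R) by (apply pow_nonzero; auto).
  apply is_derive_C_comp.
  - eapply (eq_rect _ (is_derive _ s) A1). unfold Cdiv, Cinv, Cmult, Copp, Re, Im in *; simpl in *.
    field. rewrite Rmult_1_r in *. split; intro h; [apply Hd0|apply Hn]; rewrite <- h; ring.
  - eapply (eq_rect _ (is_derive _ s) A2). unfold Cdiv, Cinv, Cmult, Copp, Re, Im in *; simpl in *.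
    field. rewrite Rmult_1_r in *. split; intro h; [apply Hd0|apply Hn]; rewrite <- h; ring.
Qed.

Lemma continuous_C_R_eps (f : R -> C) (s : R) :
  (forall e, (0 < e)%R -> exists d, (0 < d)%R /\ forall t, (Rabs (t - s) < d)%R -> (Cmod (f t - f s) < e)%R) ->
  @continuous R_UniformSpace C_R_NormedModule f s.
Proof.
  intros H P [e He]. destruct (H e (cond_pos e)) as (d & Hd & HH).
  exists (mkposreal d Hd). intros t Ht. apply He.
  assert (h := HH t Ht). split.
  - eapply Rle_lt_trans; [|exact h]. apply (re_le_Cmod (f t - f s)%C).
  - eapply Rle_lt_trans; [|exact h]. eapply Rle_trans; [|apply Rmax_Cmod]. apply (Rmax_r (Rabs (fst (f t - f s)%C))).
Qed.

Lemma continuous_C_R_inv (f : R -> C) (s : R) :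
  @continuous R_UniformSpace C_R_NormedModule f s ->
  (forall e, (0 < e)%R -> exists d, (0 < d)%R /\ forall t, (Rabs (t - s) < d)%R -> (Cmod (f t - f s) < e)%R).
Proof.
  intros H e He.
  assert (Hp : (0 < e / 2)%R) by lra.
  destruct (H (ball (f s) (mkposreal _ Hp)) (locally_ball _ _)) as [d Hd].
  exists d. split; [apply cond_pos|]. intros t Ht.
  destruct (Hd t Ht) as [h1 h2]. 
  assert (hm := Cmod_2Rmax (f t - f s)%C).
  assert (hmx : (Rmax (Rabs (fst (f t - f s)%C)) (Rabs (snd (f t - f s)%C)) < e / 2)%R).
  { apply Rmax_lub_lt; [exact h1|exact h2]. }
  assert (hs : (sqrt 2 <= 2)%R).
  { rewrite <- (sqrt_Rsqr 2) at 2 by lra. apply sqrt_le_1_alt. unfold Rsqr; lra. }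
  assert (0 <= Rmax (Rabs (fst (f t - f s)%C)) (Rabs (snd (f t - f s)%C)))%R.
  { eapply Rle_trans; [|apply Rmax_l]. apply Rabs_pos. }
  nra.
Qed.

Lemma is_RInt_Re (f : R -> C) (a b : R) (l : C) :
  @is_RInt C_R_NormedModule f a b l -> is_RInt (fun s => Re (f s)) a b (Re l).
Proof. apply (is_RInt_fct_extend_fst (U := R_NormedModule) (V := R_NormedModule)). Qed.

Lemma is_RInt_Im (f : R -> C) (a b : R) (l : C) :
  @is_RInt C_R_NormedModule f a b l -> is_RInt (fun s => Im (f s)) a b (Im l).
Proof. apply (is_RInt_fct_extend_snd (U := R_NormedModule) (V := R_NormedModule)). Qed.

Lemma is_RInt_C_pair (f : R -> C) (a b : R) (l : C) :
  is_RInt (fun s => Re (f s)) a b (Re l) -> is_RInt (fun s => Im (f s)) a b (Im l) ->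
  @is_RInt C_R_NormedModule f a b l.
Proof.
  intros H1 H2. rewrite (surjective_pairing l).
  apply (is_RInt_fct_extend_pair (U := R_NormedModule) (V := R_NormedModule)); assumption.
Qed.

Lemma is_RInt_Cmult (f : R -> C) (a b : R) (c l : C) :
  @is_RInt C_R_NormedModule f a b l -> @is_RInt C_R_NormedModule (fun s => c * f s) a b (c * l).
Proof.
  intros H. assert (H1 := is_RInt_Re _ _ _ _ H). assert (H2 := is_RInt_Im _ _ _ _ H).
  apply is_RInt_C_pair.
  - exact (is_RInt_minus _ _ a b _ _ (is_RInt_scal _ a b (Re c) _ H1) (is_RInt_scal _ a b (Im c) _ H2)).
  - exact (is_RInt_plus _ _ a b _ _ (is_RInt_scal _ a b (Re c) _ H2) (is_RInt_scal _ a b (Im c) _ H1)).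
Qed.

Lemma is_RInt_C_bound (f : R -> C) (a b M : R) (l : C) :
  (a <= b)%R -> (forall s, (a <= s <= b)%R -> (Cmod (f s) <= M)%R) ->
  @is_RInt C_R_NormedModule f a b l -> (Cmod l <= (b - a) * M)%R.
Proof.
  intros Hab HM H. rewrite <- Cmod_prod_norm.
  apply (norm_RInt_le_const (V := C_R_NormedModule) f a b l M Hab); [|exact H].
  intros x Hx. rewrite Cmod_prod_norm. auto.
Qed.

(** * Holomorphic functions as uniform limits of rational functions *)

Ltac C_eq := match goal with |- ?a = ?b => change (@eq C a b) end; cbv beta.

(* [gen] holds the coordinate functions. *)
Inductive Rat {X : Type} (gen : (X -> C) -> Prop) (K : X -> Prop) : (X -> C) -> Prop :=
| Rat_gen f M : gen f -> (forall x, K x -> (Cmod (f x) <= M)%R) -> Rat gen K f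
| Rat_const c : Rat gen K (fun _ => c)
| Rat_add f g : Rat gen K f -> Rat gen K g -> Rat gen K (fun x => f x + g x)
| Rat_mul f g : Rat gen K f -> Rat gen K g -> Rat gen K (fun x => f x * g x)
| Rat_inv f d : Rat gen K f -> (0 < d)%R -> (forall x, K x -> (d <= Cmod (f x))%R) ->
    Rat gen K (fun x => / f x).

(* Uniform limits of rational functions play the role of holomorphic functions. *)
Definition Hol {X : Type} (gen : (X -> C) -> Prop) (K : X -> Prop) (f : X -> C) : Prop :=
  forall e, (0 < e)%R -> exists g, Rat gen K g /\ forall x, K x -> (Cmod (f x - g x) <= e)%R.

Lemma Rat_bounded {X} gen (K : X -> Prop) f :
  Rat gen K f -> exists M, (0 < M)%R /\ forall x, K x -> (Cmod (f x) <= M)%R.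
Proof.
  induction 1 as [f M Hg HM|c|f g Hf [M [HM0 HM]] Hg [N [HN0 HN]]|f g Hf [M [HM0 HM]] Hg [N [HN0 HN]]|f d Hf [M [HM0 HM]] Hd HI].
  - exists (Rmax M 1). split. + eapply Rlt_le_trans; [|apply Rmax_r]; lra.
    + intros x Hx. eapply Rle_trans; [apply HM; auto|apply Rmax_l].
  - exists (Cmod c + 1)%R. split; [|intros; lra]. assert (h := Cmod_ge_0 c). lra.
  - exists (M + N)%R. split; [lra|]. intros x Hx. eapply Rle_trans; [apply Cmod_triangle|].
    specialize (HM x Hx). specialize (HN x Hx). lra.
  - exists (M * N)%R. split; [nra|]. intros x Hx. rewrite Cmod_mult.
    apply Rmult_le_compat; auto using Cmod_ge_0.
  - exists (/ d)%R. split; [apply Rinv_0_lt_compat; auto|]. intros x Hx.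
    assert (h := HI x Hx). rewrite Cmod_inv by (apply Cmod_nz; lra).
    apply Rinv_le_contravar; auto.
Qed.

Lemma Rat_Hol {X} gen (K : X -> Prop) f : Rat gen K f -> Hol gen K f.
Proof.
  intros H e He. exists f. split; auto. intros x _.
  replace (f x - f x) with (RtoC 0) by ring. rewrite Cmod_0. lra.
Qed.

Lemma Hol_bounded {X} gen (K : X -> Prop) f :
  Hol gen K f -> exists M, (0 < M)%R /\ forall x, K x -> (Cmod (f x) <= M)%R.
Proof.
  intros H. destruct (H 1%R Rlt_0_1) as (g & Hg & Hfg).
  destruct (Rat_bounded _ _ _ Hg) as (M & HM & HB).
  exists (M + 1)%R. split; [lra|]. intros x Hx.
  replace (f x) with (g x + (f x - g x)) by ring.
  eapply Rle_trans; [apply Cmod_triangle|]. specialize (HB x Hx). specialize (Hfg x Hx). lra.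
Qed.

Lemma Hol_lim {X} gen (K : X -> Prop) f :
  (forall e, (0 < e)%R -> exists g, Hol gen K g /\ forall x, K x -> (Cmod (f x - g x) <= e)%R) ->
  Hol gen K f.
Proof.
  intros H e He. destruct (H (e / 2)%R ltac:(lra)) as (g & Hg & Hfg).
  destruct (Hg (e / 2)%R ltac:(lra)) as (h & Hh & Hgh).
  exists h. split; auto. intros x Hx.
  replace (f x - h x) with ((f x - g x) + (g x - h x)) by ring.
  eapply Rle_trans; [apply Cmod_triangle|]. specialize (Hfg x Hx). specialize (Hgh x Hx). lra.
Qed.

Lemma Hol_ext {X} gen (K : X -> Prop) f g :
  (forall x, K x -> f x = g x) -> Hol gen K f -> Hol gen K g.
Proof.
  intros HE Hf. apply Hol_lim. intros e He. exists f. split; auto.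
  intros x Hx. rewrite HE by auto. replace (g x - g x) with (RtoC 0) by ring. rewrite Cmod_0. lra.
Qed.

Lemma Hol_const {X} gen (K : X -> Prop) c : Hol gen K (fun _ => c).
Proof. apply Rat_Hol, Rat_const. Qed.

Lemma Hol_add {X} gen (K : X -> Prop) f g :
  Hol gen K f -> Hol gen K g -> Hol gen K (fun x => f x + g x).
Proof.
  intros Hf Hg e He.
  destruct (Hf (e / 2)%R ltac:(lra)) as (f1 & Hf1 & Hff).
  destruct (Hg (e / 2)%R ltac:(lra)) as (g1 & Hg1 & Hgg).
  exists (fun x => f1 x + g1 x). split; [apply Rat_add; auto|]. intros x Hx.
  replace (f x + g x - (f1 x + g1 x)) with ((f x - f1 x) + (g x - g1 x)) by ring.
  eapply Rle_trans; [apply Cmod_triangle|]. specialize (Hff x Hx). specialize (Hgg x Hx). lra.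
Qed.

Lemma Hol_mul {X} gen (K : X -> Prop) f g :
  Hol gen K f -> Hol gen K g -> Hol gen K (fun x => f x * g x).
Proof.
  intros Hf Hg e He.
  destruct (Hol_bounded _ _ _ Hg) as (N & HN & HNb).
  destruct (Hf (e / (2 * N))%R) as (f1 & Hf1 & Hff).
  { apply Rdiv_lt_0_compat; lra. }
  destruct (Rat_bounded _ _ _ Hf1) as (M & HM & HMb).
  destruct (Hg (e / (2 * M))%R) as (g1 & Hg1 & Hgg).
  { apply Rdiv_lt_0_compat; lra. }
  exists (fun x => f1 x * g1 x). split; [apply Rat_mul; auto|]. intros x Hx.
  replace (f x * g x - (f1 x * g1 x)) with ((f x - f1 x) * g x + f1 x * (g x - g1 x)) by ring.
  eapply Rle_trans; [apply Cmod_triangle|]. rewrite !Cmod_mult.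
  specialize (Hff x Hx). specialize (Hgg x Hx). specialize (HNb x Hx). specialize (HMb x Hx).
  assert (e / (2 * N) * N = e / 2)%R by (field; lra).
  assert (e / (2 * M) * M = e / 2)%R by (field; lra).
  assert (Cmod (f x - f1 x) * Cmod (g x) <= e / (2 * N) * N)%R by (apply Rmult_le_compat; auto using Cmod_ge_0).
  assert (Cmod (f1 x) * Cmod (g x - g1 x) <= M * (e / (2 * M)))%R by (apply Rmult_le_compat; auto using Cmod_ge_0).
  lra.
Qed.

Lemma Hol_inv {X} gen (K : X -> Prop) f d :
  (0 < d)%R -> (forall x, K x -> (d <= Cmod (f x))%R) -> Hol gen K f -> Hol gen K (fun x => / f x).
Proof.
  intros Hd HL Hf e He.
  (* The bound d / 2 keeps the approximant [g] away from 0. The bound e d^2 / 2 compensates the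
     factor 1 / (d * d/2) in the difference of the two inverses. *)
  assert (Hm : (0 < Rmin (d / 2) (e * d * d / 2))%R).
  { apply Rmin_glb_lt; [lra|]. assert (0 < e * d * d)%R by (repeat apply Rmult_lt_0_compat; auto). lra. }
  destruct (Hf _ Hm) as (g & Hg & Hfg).
  assert (Hgl : forall x, K x -> (d / 2 <= Cmod (g x))%R).
  { intros x Hx. specialize (HL x Hx). specialize (Hfg x Hx).
    assert (h := Cmod_triangle_rev (f x) (f x - g x)).
    replace (f x - (f x - g x)) with (g x) in h by ring.
    assert (h2 := Rmin_l (d / 2) (e * d * d / 2)). lra. }
  exists (fun x => / g x). split; [eapply Rat_inv with (d := (d / 2)%R); auto; lra|].
  intros x Hx. specialize (HL x Hx). specialize (Hfg x Hx). specialize (Hgl x Hx).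
  assert (f x <> 0) by (apply Cmod_nz; lra). assert (g x <> 0) by (apply Cmod_nz; lra).
  replace (/ f x - / g x) with (- (f x - g x) * (/ f x * / g x)) by (field; auto).
  rewrite !Cmod_mult, Cmod_opp, !Cmod_inv by auto.
  assert (h2 := Rmin_r (d / 2) (e * d * d / 2)).
  assert (/ Cmod (f x) * / Cmod (g x) <= / d * / (d / 2))%R.
  { apply Rmult_le_compat; try (left; apply Rinv_0_lt_compat; lra); apply Rinv_le_contravar; lra. }
  eapply Rle_trans; [apply Rmult_le_compat; [apply Cmod_ge_0| |apply Rle_trans with (1 := Hfg); exact h2|exact H1]|].
  - apply Rmult_le_pos; left; apply Rinv_0_lt_compat; lra.
  - right. field. lra.
Qed.

Lemma Hol_opp {X} gen (K : X -> Prop) f : Hol gen K f -> Hol gen K (fun x => - f x).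
Proof.
  intros H. apply Hol_ext with (f := fun x => (- (1)) * f x); [intros; ring|].
  apply Hol_mul; auto. apply Hol_const.
Qed.

Lemma Hol_sub {X} gen (K : X -> Prop) f g :
  Hol gen K f -> Hol gen K g -> Hol gen K (fun x => f x - g x).
Proof. intros. unfold Cminus. apply Hol_add; auto. apply Hol_opp; auto. Qed.

Lemma Hol_pow {X} gen (K : X -> Prop) f n : Hol gen K f -> Hol gen K (fun x => f x ^ n).
Proof.
  intros H. induction n; simpl; [apply Hol_const|]. apply Hol_mul; auto.
Qed.

Lemma Hol_gen {X} gen (K : X -> Prop) f M :
  gen f -> (forall x, K x -> (Cmod (f x) <= M)%R) -> Hol gen K f.
Proof. intros. apply Rat_Hol. eapply Rat_gen; eauto. Qed.

Lemma Hol_Cprod {X} gen (K : X -> Prop) (f : nat -> X -> C) n :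
  (forall i, Hol gen K (f i)) -> Hol gen K (fun x => Cprod (fun i => f i x) n).
Proof.
  intros H. induction n; simpl; [apply Hol_const|]. apply Hol_mul; auto.
Qed.

(** Rational expressions pull back by induction on their construction, so only the generators have
    to be checked. Slices, projections and the substitution z -> 1/z are instances. *)
Lemma Hol_comp {X Y} gX (KX : X -> Prop) gY (KY : Y -> Prop) (f : X -> C) (phi : Y -> X) :
  (forall y, KY y -> KX (phi y)) ->
  (forall g, gX g -> Hol gY KY (fun y => g (phi y))) ->
  Hol gX KX f -> Hol gY KY (fun y => f (phi y)).
Proof.
  intros HK Hg Hf.
  assert (HR : forall g, Rat gX KX g -> Hol gY KY (fun y => g (phi y))).
  { induction 1.
    - auto.
    - apply Hol_const.
    - apply Hol_add; auto.
    - apply Hol_mul; auto.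
    - eapply Hol_inv; eauto. }
  apply Hol_lim. intros e He. destruct (Hf e He) as (g & Hg1 & Hfg).
  exists (fun y => g (phi y)). split; auto.
Qed.

(** The distance [d] is left abstract so that one induction serves both |x - y| in one variable and
    the sum of two such distances in two variables. *)
Lemma Rat_lipschitz {X} gen (K : X -> Prop) (d : X -> X -> R) f :
  (forall x y, (0 <= d x y)%R) ->
  (forall g, gen g -> forall x y, K x -> K y -> (Cmod (g x - g y) <= d x y)%R) ->
  Rat gen K f ->
  exists L, (0 < L)%R /\ forall x y, K x -> K y -> (Cmod (f x - f y) <= L * d x y)%R.
Proof.
  intros Hd0 Hd. induction 1 as [f M Hg HM|c|f g Hf [L [HL0 HL]] Hg [N [HN0 HN]]|f g Hf [L [HL0 HL]] Hg [N [HN0 HN]]|f e Hf [L [HL0 HL]] He HI].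
  - exists 1%R. split; [lra|]. intros. rewrite Rmult_1_l. auto.
  - exists 1%R. split; [lra|]. intros. replace (c - c) with (RtoC 0) by ring.
    rewrite Cmod_0, Rmult_1_l. auto.
  - exists (L + N)%R. split; [lra|]. intros x y Hx Hy.
    replace (f x + g x - (f y + g y)) with ((f x - f y) + (g x - g y)) by ring.
    eapply Rle_trans; [apply Cmod_triangle|]. specialize (HL x y Hx Hy). specialize (HN x y Hx Hy). lra.
  - destruct (Rat_bounded _ _ _ Hf) as (A & HA & HAb). destruct (Rat_bounded _ _ _ Hg) as (B & HB & HBb).
    exists (L * B + A * N)%R. split; [nra|]. intros x y Hx Hy.
    replace (f x * g x - (f y * g y)) with ((f x - f y) * g x + f y * (g x - g y)) by ring.
    eapply Rle_trans; [apply Cmod_triangle|]. rewrite !Cmod_mult.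
    assert (Cmod (f x - f y) * Cmod (g x) <= L * d x y * B)%R by (apply Rmult_le_compat; auto using Cmod_ge_0).
    assert (Cmod (f y) * Cmod (g x - g y) <= A * (N * d x y))%R by (apply Rmult_le_compat; auto using Cmod_ge_0).
    lra.
  - exists (L * (/ e * / e))%R. split.
    { repeat apply Rmult_lt_0_compat; auto using Rinv_0_lt_compat. }
    intros x y Hx Hy. assert (h1 := HI x Hx). assert (h2 := HI y Hy).
    assert (f x <> 0) by (apply Cmod_nz; lra). assert (f y <> 0) by (apply Cmod_nz; lra).
    replace (/ f x - / f y) with (- (f x - f y) * (/ f x * / f y)) by (field; auto).
    rewrite !Cmod_mult, Cmod_opp, !Cmod_inv by auto.
    replace (L * (/ e * / e) * d x y)%R with ((L * d x y) * (/ e * / e))%R by ring.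
    apply Rmult_le_compat; auto using Cmod_ge_0.
    + apply Rmult_le_pos; left; apply Rinv_0_lt_compat; lra.
    + apply Rmult_le_compat; try (left; apply Rinv_0_lt_compat; lra); apply Rinv_le_contravar; lra.
Qed.

Definition gen1 : (C -> C) -> Prop := fun f => f = (fun z => z).
Definition ann (r1 r2 : R) (z : C) : Prop := (r1 <= Cmod z <= r2)%R.
Notation Hol1 r1 r2 := (Hol gen1 (ann r1 r2)).

Definition gen2 : (C * C -> C) -> Prop := fun f => f = (fun x => fst x) \/ f = (fun x => snd x).
Definition ann2 (r1 r2 s1 s2 : R) (x : C * C) : Prop := ann r1 r2 (fst x) /\ ann s1 s2 (snd x).
Notation Hol2 r1 r2 s1 s2 := (Hol gen2 (ann2 r1 r2 s1 s2)).

Lemma Hol1_id r1 r2 : Hol1 r1 r2 (fun z => z).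
Proof. apply Hol_gen with (M := r2); [reflexivity|]. intros x [_ H]; auto. Qed.

Lemma Hol1_inv r1 r2 : (0 < r1)%R -> Hol1 r1 r2 (fun z => / z).
Proof.
  intros Hr. apply Hol_inv with (d := r1); auto using Hol1_id. intros x [H _]; auto.
Qed.

Lemma Hol2_fst r1 r2 s1 s2 : Hol2 r1 r2 s1 s2 (fun x => fst x).
Proof. apply Hol_gen with (M := r2); [left; reflexivity|]. intros x [[_ H] _]; auto. Qed.

Lemma Hol2_snd r1 r2 s1 s2 : Hol2 r1 r2 s1 s2 (fun x => snd x).
Proof. apply Hol_gen with (M := s2); [right; reflexivity|]. intros x [_ [_ H]]; auto. Qed.

Lemma Hol2_slice_l r1 r2 s1 s2 f z : ann r1 r2 z -> Hol2 r1 r2 s1 s2 f -> Hol1 s1 s2 (fun w => f (z, w)).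
Proof.
  intros Hz Hf. apply (Hol_comp gen2 (ann2 r1 r2 s1 s2) _ _ f (fun w => (z, w))); auto.
  - intros y Hy; split; auto.
  - intros g [->| ->]; simpl; [apply Hol_const|apply Hol1_id].
Qed.

Lemma Hol2_slice_r r1 r2 s1 s2 f w : ann s1 s2 w -> Hol2 r1 r2 s1 s2 f -> Hol1 r1 r2 (fun z => f (z, w)).
Proof.
  intros Hw Hf. apply (Hol_comp gen2 (ann2 r1 r2 s1 s2) _ _ f (fun z => (z, w))); auto.
  - intros y Hy; split; auto.
  - intros g [->| ->]; simpl; [apply Hol1_id|apply Hol_const].
Qed.

Lemma Hol1_fst r1 r2 s1 s2 f : Hol1 r1 r2 f -> Hol2 r1 r2 s1 s2 (fun x => f (fst x)).
Proof.
  intros Hf. apply (Hol_comp gen1 (ann r1 r2) _ _ f (fun x => fst x)); auto.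
  - intros y [Hy _]; auto.
  - intros g ->. apply Hol2_fst.
Qed.

Lemma Hol1_snd r1 r2 s1 s2 f : Hol1 s1 s2 f -> Hol2 r1 r2 s1 s2 (fun x => f (snd x)).
Proof.
  intros Hf. apply (Hol_comp gen1 (ann s1 s2) _ _ f (fun x => snd x)); auto.
  - intros y [_ Hy]; auto.
  - intros g ->. apply Hol2_snd.
Qed.

Lemma Hol_subset {X} gen (K K' : X -> Prop) f :
  (forall x, K' x -> K x) -> Hol gen K f -> Hol gen K' f.
Proof.
  intros HK Hf.
  assert (HR : forall g, Rat gen K g -> Rat gen K' g).
  { induction 1; [eapply Rat_gen|apply Rat_const|apply Rat_add|apply Rat_mul|eapply Rat_inv]; eauto. }
  intros e He. destruct (Hf e He) as (g & Hg & Hfg). exists g; auto.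
Qed.

Lemma Hol1_sub r1 r2 s1 s2 f : (r1 <= s1)%R -> (s2 <= r2)%R -> Hol1 r1 r2 f -> Hol1 s1 s2 f.
Proof. intros H1 H2. apply Hol_subset. unfold ann. intros; lra. Qed.

Lemma Rat1_lipschitz (K : C -> Prop) f :
  Rat gen1 K f -> exists L, (0 < L)%R /\ forall x y, K x -> K y -> (Cmod (f x - f y) <= L * Cmod (x - y))%R.
Proof.
  apply (Rat_lipschitz gen1 K (fun x y => Cmod (x - y))).
  - intros; apply Cmod_ge_0.
  - intros g -> x y _ _. lra.
Qed.

Lemma Hol1_unif_cont (K : C -> Prop) f :
  Hol gen1 K f -> forall e, (0 < e)%R -> exists d, (0 < d)%R /\
  forall x y, K x -> K y -> (Cmod (x - y) < d)%R -> (Cmod (f x - f y) < e)%R.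
Proof.
  intros Hf e He. destruct (Hf (e / 4)%R ltac:(lra)) as (g & Hg & Hfg).
  destruct (Rat1_lipschitz _ _ Hg) as (L & HL & HLip).
  exists (e / (4 * L))%R. split; [apply Rdiv_lt_0_compat; lra|].
  intros x y Hx Hy Hxy.
  replace (f x - f y) with ((f x - g x) + (g x - g y) - (f y - g y)) by ring.
  eapply Rle_lt_trans; [apply Cmod_triangle_sub|].
  assert (h := Cmod_triangle (f x - g x) (g x - g y)).
  assert (h1 := Hfg x Hx). assert (h2 := Hfg y Hy). assert (h3 := HLip x y Hx Hy).
  assert (L * Cmod (x - y) < e / 4)%R.
  { replace (e / 4)%R with (L * (e / (4 * L)))%R by (field; lra). apply Rmult_lt_compat_l; auto. }
  lra.
Qed.

(** The quadratic remainder is carried through the construction of the expression instead of being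
    integrated along a segment. It therefore holds for any two points of [K], whatever the shape of
    [K], which makes it usable on annuli. *)
Lemma Rat_derive (K : C -> Prop) f : Rat gen1 K f ->
  exists f', Rat gen1 K f' /\
  (forall phi s l, K (phi s) -> @is_derive R_AbsRing C_R_NormedModule phi s l ->
     @is_derive R_AbsRing C_R_NormedModule (fun s => f (phi s)) s (f' (phi s) * l)) /\
  exists B, (0 <= B)%R /\ forall x y, K x -> K y ->
    (Cmod (f y - f x - f' x * (y - x)) <= B * Cmod (y - x) ^ 2)%R.
Proof.
  induction 1 as [f M Hg HM|c|f g Hf [f' (Hf' & Df & A & HA0 & HA)] Hg [g' (Hg' & Dg & B & HB0 & HB)]
    |f g Hf [f' (Hf' & Df & A & HA0 & HA)] Hg [g' (Hg' & Dg & B & HB0 & HB)]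
    |f e Hf [f' (Hf' & Df & A & HA0 & HA)] He HI].
  - rewrite Hg. exists (fun _ => 1). split; [apply Rat_const|]. split.
    + intros phi s l _ H. rewrite Cmult_1_l. exact H.
    + exists 0%R. split; [lra|]. intros x y _ _. replace (y - x - 1 * (y - x)) with (RtoC 0) by ring.
      rewrite Cmod_0. lra.
  - exists (fun _ => 0). split; [apply Rat_const|]. split.
    + intros phi s l _ H. rewrite Cmult_0_l. apply @is_derive_const.
    + exists 0%R. split; [lra|]. intros x y _ _. replace (c - c - 0 * (y - x)) with (RtoC 0) by ring.
      rewrite Cmod_0. lra.
  - exists (fun x => f' x + g' x). split; [apply Rat_add; auto|]. split.
    + intros phi s l HK H.
      eapply (eq_rect _ (is_derive _ s)); [apply @is_derive_plus; [apply Df|apply Dg]; eauto|].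
      unfold plus; simpl. change (f' (phi s) * l + g' (phi s) * l = (f' (phi s) + g' (phi s)) * l). ring.
    + exists (A + B)%R. split; [lra|]. intros x y Hx Hy.
      replace (f y + g y - (f x + g x) - (f' x + g' x) * (y - x)) with
        ((f y - f x - f' x * (y - x)) + (g y - g x - g' x * (y - x))) by ring.
      eapply Rle_trans; [apply Cmod_triangle|]. specialize (HA x y Hx Hy). specialize (HB x y Hx Hy). lra.
  - exists (fun x => f' x * g x + f x * g' x).
    split; [apply Rat_add; apply Rat_mul; auto|]. split.
    + intros phi s l HK H.
      eapply (eq_rect _ (is_derive _ s)); [apply is_derive_Cmult; [apply Df|apply Dg]; eauto|].
      C_eq; ring.
    + destruct (Rat_bounded _ _ _ Hf) as (M & HM & HMb). destruct (Rat_bounded _ _ _ Hg) as (N & HN & HNb).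
      destruct (Rat1_lipschitz _ _ Hf) as (L & HL & HLb). destruct (Rat1_lipschitz _ _ Hg) as (L' & HL' & HLb').
      exists (A * N + M * B + L * L')%R. split; [nra|]. intros x y Hx Hy.
      replace (f y * g y - (f x * g x) - (f' x * g x + f x * g' x) * (y - x)) with
        ((f y - f x - f' x * (y - x)) * g x + f x * (g y - g x - g' x * (y - x)) + (f y - f x) * (g y - g x)) by ring.
      eapply Rle_trans; [apply Cmod_triangle|]. eapply Rle_trans; [apply Rplus_le_compat_r, Cmod_triangle|].
      rewrite !Cmod_mult.
      specialize (HA x y Hx Hy). specialize (HB x y Hx Hy). specialize (HMb x Hx). specialize (HNb x Hx).
      specialize (HLb y x Hy Hx). specialize (HLb' y x Hy Hx).
      assert (P1 := Rmult_le_compat _ _ _ _ (Cmod_ge_0 _) (Cmod_ge_0 _) HA HNb).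
      assert (P2 := Rmult_le_compat _ _ _ _ (Cmod_ge_0 _) (Cmod_ge_0 _) HMb HB).
      assert (P3 := Rmult_le_compat _ _ _ _ (Cmod_ge_0 _) (Cmod_ge_0 _) HLb HLb').
      lra.
  - exists (fun x => - (1) * (f' x * (/ f x * / f x))). split.
    { apply Rat_mul; [apply Rat_const|]. apply Rat_mul; auto. apply Rat_mul; eapply Rat_inv; eauto. }
    split.
    + intros phi s l HK H. assert (f (phi s) <> 0) by (apply Cmod_nz; specialize (HI _ HK); lra).
      eapply (eq_rect _ (is_derive _ s)); [apply is_derive_Cinv; [apply Df; eauto|auto]|].
      C_eq; field; auto.
    + destruct (Rat1_lipschitz _ _ Hf) as (L & HL & HLb).
      exists (L * L * (/ e * (/ e * / e)) + A * (/ e * / e))%R.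
      assert (Hie : (0 < / e)%R) by (apply Rinv_0_lt_compat; auto).
      split.
      { apply Rplus_le_le_0_compat; repeat apply Rmult_le_pos; lra. }
      intros x y Hx Hy. assert (h1 := HI x Hx). assert (h2 := HI y Hy).
      assert (f x <> 0) by (apply Cmod_nz; lra). assert (f y <> 0) by (apply Cmod_nz; lra).
      replace (/ f y - / f x - - (1) * (f' x * (/ f x * / f x)) * (y - x)) with
        ((f y - f x) * (f y - f x) * (/ f y * (/ f x * / f x)) - (f y - f x - f' x * (y - x)) * (/ f x * / f x))
        by (field; auto).
      eapply Rle_trans; [apply Cmod_triangle_sub|]. rewrite !Cmod_mult, !Cmod_inv by auto.
      specialize (HA x y Hx Hy). specialize (HLb y x Hy Hx).
      assert (i1 : (/ Cmod (f x) <= / e)%R) by (apply Rinv_le_contravar; auto).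
      assert (i2 : (/ Cmod (f y) <= / e)%R) by (apply Rinv_le_contravar; auto).
      assert (j1 : (0 <= / Cmod (f x))%R) by (left; apply Rinv_0_lt_compat; lra).
      assert (j2 : (0 <= / Cmod (f y))%R) by (left; apply Rinv_0_lt_compat; lra).
      assert (P1 : (/ Cmod (f x) * / Cmod (f x) <= / e * / e)%R) by (apply Rmult_le_compat; auto).
      assert (P2 : (/ Cmod (f y) * (/ Cmod (f x) * / Cmod (f x)) <= / e * (/ e * / e))%R).
      { apply Rmult_le_compat; auto. apply Rmult_le_pos; auto. }
      assert (P3 := Rmult_le_compat _ _ _ _ (Cmod_ge_0 _) (Cmod_ge_0 _) HLb HLb).
      assert (P4 := Rmult_le_compat _ _ _ _ (Rmult_le_pos _ _ (Cmod_ge_0 _) (Cmod_ge_0 _)) (Rmult_le_pos _ _ j2 (Rmult_le_pos _ _ j1 j1)) P3 P2).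
      assert (P5 := Rmult_le_compat _ _ _ _ (Cmod_ge_0 _) (Rmult_le_pos _ _ j1 j1) HA P1).
      lra.
Qed.

(** The difference quotient is again a rational expression, regular at [s = x] as well. This takes
    the place of the removable singularity theorem in [Rat_Cauchy]. *)
Lemma Rat_diff_quot (K : C -> Prop) f x : Rat gen1 K f -> K x ->
  exists h, Rat gen1 K h /\ forall s, K s -> f s - f x = (s - x) * h s.
Proof.
  intros H HKx. induction H as [f M Hg HM|c|f g Hf [h1 [H1 E1]] Hg [h2 [H2 E2]]
    |f g Hf [h1 [H1 E1]] Hg [h2 [H2 E2]]|f e Hf [h1 [H1 E1]] He HI].
  - rewrite Hg. exists (fun _ => 1). split; [apply Rat_const|]. intros; ring.
  - exists (fun _ => 0). split; [apply Rat_const|]. intros; ring.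
  - exists (fun s => h1 s + h2 s). split; [apply Rat_add; auto|]. intros s Hs.
    replace (f s + g s - (f x + g x)) with ((f s - f x) + (g s - g x)) by ring.
    rewrite E1, E2 by auto. ring.
  - exists (fun s => h1 s * g s + f x * h2 s). split.
    { apply Rat_add; apply Rat_mul; auto; apply Rat_const. }
    intros s Hs. replace (f s * g s - f x * g x) with ((f s - f x) * g s + f x * (g s - g x)) by ring.
    rewrite E1, E2 by auto. ring.
  - exists (fun s => - / f x * (h1 s * / f s)). split.
    { apply Rat_mul; [apply Rat_const|]. apply Rat_mul; auto. eapply Rat_inv; eauto. }
    intros s Hs. assert (f x <> 0) by (apply Cmod_nz; specialize (HI _ HKx); lra).
    assert (f s <> 0) by (apply Cmod_nz; specialize (HI _ Hs); lra).
    replace (/ f s - / f x) with (- (f s - f x) * (/ f s * / f x)) by (field; auto).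
    rewrite E1 by auto. ring.
Qed.

Lemma Hol_div {X} gen (K : X -> Prop) f g :
  Hol gen K f -> Hol gen K (fun x => / g x) -> Hol gen K (fun x => f x / g x).
Proof. apply Hol_mul. Qed.

Ltac hol := repeat match goal with
  | |- Hol _ _ (fun _ => ?c) => apply (Hol_const _ _ c)
  | |- Hol _ _ (fun z => z) => apply Hol1_id
  | |- Hol _ _ (fun z => / z) => apply Hol1_inv; first [assumption | lra]
  | |- Hol gen1 _ (Cmult ?t) => apply (Hol_mul gen1 _ (fun _ => t) (fun z => z))
  | |- Hol gen1 _ Cinv => apply Hol1_inv; first [assumption | lra]
  | |- Hol _ _ (fun x => @?f x * @?g x) => apply (Hol_mul _ _ f g)
  | |- Hol _ _ (fun x => @?f x / @?g x) => apply (Hol_div _ _ f g)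
  | |- Hol _ _ (fun x => @?f x + @?g x) => apply (Hol_add _ _ f g)
  | |- Hol _ _ (fun x => @?f x - @?g x) => apply (Hol_sub _ _ f g)
  | |- Hol _ _ (fun x => - @?f x) => apply (Hol_opp _ _ f)
  | |- Hol _ _ (fun x => @?f x ^ ?n) => apply (Hol_pow _ _ f n)
  | H : Hol _ _ ?f |- Hol _ _ ?f => exact H
  end.

(** * Means over circles *)

Definition cis (s : R) : C := (cos s, sin s).

Lemma Cmod_cis s : Cmod (cis s) = 1%R.
Proof.
  unfold Cmod, cis; simpl. rewrite !Rmult_1_r.
  replace (cos s * cos s + sin s * sin s)%R with (Rsqr (sin s) + Rsqr (cos s))%R by (unfold Rsqr; ring).
  rewrite sin2_cos2. apply sqrt_1.
Qed.

Lemma cis_nz s : cis s <> 0.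
Proof. apply Cmod_nz. rewrite Cmod_cis. lra. Qed.

Lemma cis_add a b : cis (a + b) = cis a * cis b.
Proof. unfold cis, Cmult; simpl. rewrite cos_plus, sin_plus. f_equal; ring. Qed.

Lemma cis_opp a : cis (- a) = / cis a.
Proof.
  assert (h : cis a * cis (- a) = 1).
  { rewrite <- cis_add, Rplus_opp_r. unfold cis. rewrite cos_0, sin_0. reflexivity. }
  rewrite <- (Cmult_1_r (/ cis a)), <- h. field. apply cis_nz.
Qed.

Lemma cis_2PI : cis (2 * PI) = 1.
Proof. unfold cis. rewrite cos_2PI, sin_2PI. reflexivity. Qed.

Lemma cis_PI : cis PI = - (1).
Proof. unfold cis. rewrite cos_PI, sin_PI. unfold Copp, RtoC; simpl. f_equal; ring. Qed.

Lemma cis_0 : cis 0 = 1.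
Proof. unfold cis. rewrite cos_0, sin_0. reflexivity. Qed.

Lemma cis_pow a n : cis (INR n * a) = cis a ^ n.
Proof.
  induction n.
  - simpl. rewrite Rmult_0_l. apply cis_0.
  - rewrite S_INR, Rmult_plus_distr_r, Rmult_1_l, cis_add, IHn. simpl. ring.
Qed.

Lemma is_derive_cis s : @is_derive R_AbsRing C_R_NormedModule cis s (Ci * cis s).
Proof.
  apply is_derive_C_comp.
  - unfold cis, Ci; simpl. eapply is_derive_ext; [reflexivity|]. unfold Re; simpl. auto_derive; auto. ring.
  - unfold cis, Ci; simpl. unfold Im; simpl. auto_derive; auto. ring.
Qed.

Lemma Cmod_cis_sub a b : (Cmod (cis a - cis b) <= Rabs (a - b))%R.
Proof.
  assert (H : Cmod (cis a - cis b) = Rabs (2 * sin ((a - b) / 2))).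
  { rewrite <- sqrt_Rsqr_abs. unfold Cmod. f_equal. unfold cis; simpl.
    assert (E := cos_minus a b).
    assert (E2 := cos_2a_sin ((a - b) / 2)). replace (2 * ((a - b) / 2))%R with (a - b)%R in E2 by field.
    assert (Ea := sin2_cos2 a). assert (Eb := sin2_cos2 b). unfold Rsqr in *. nra. }
  rewrite H, Rabs_mult, (Rabs_pos_eq 2) by lra.
  assert (h : forall x, (Rabs (sin x) <= Rabs x)%R).
  { intros x. assert (P : forall y, (0 <= y)%R -> (Rabs (sin y) <= y)%R).
    { intros y Hy. destruct (Rle_lt_dec y 1).
      - destruct (Rle_lt_or_eq_dec 0 y Hy) as [h|h].
        + assert (h1 := sin_lt_x y h). assert (h2 : (0 <= sin y)%R).
          { apply sin_ge_0; auto. assert (h3 := PI2_1). lra. }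
          rewrite Rabs_pos_eq; lra.
        + rewrite <- h, sin_0, Rabs_R0. lra.
      - assert (h1 := SIN_bound y). apply Rabs_le. lra. }
    destruct (Rle_lt_dec 0 x).
    - rewrite (Rabs_pos_eq x) by auto. auto.
    - rewrite <- (Rabs_Ropp (sin x)), <- sin_neg, <- (Rabs_Ropp x), (Rabs_pos_eq (- x)) by lra. apply P; lra. }
  specialize (h ((a - b) / 2)%R). unfold Rdiv in *. rewrite (Rabs_mult (a - b)), (Rabs_pos_eq (/ 2)) in h by lra. lra.
Qed.

Lemma polar (z : C) : exists a, z = RtoC (Cmod z) * cis a.
Proof.
  destruct (Ceq_dec z 0) as [->|Hz].
  { exists 0%R. rewrite Cmod_0. ring. }
  assert (Hm : (0 < Cmod z)%R) by (apply Cmod_gt_0; auto).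
  assert (Hx : (-1 <= Re z / Cmod z <= 1)%R).
  { assert (h := re_le_Cmod z). apply Rabs_le_between in h.
    split; [apply Rle_div_r|apply Rle_div_l]; lra. }
  assert (E := Cmod2_alt z).
  assert (S2 : sin (acos (Re z / Cmod z)) = (Rabs (Im z) / Cmod z)%R).
  { rewrite sin_acos by auto. rewrite <- sqrt_Rsqr_abs.
    rewrite <- (sqrt_Rsqr (Cmod z)) at 2 by lra. rewrite <- sqrt_div_alt.
    - f_equal. unfold Rsqr. field_simplify; [|lra|lra]. rewrite E. f_equal. ring.
    - unfold Rsqr; nra. }
  destruct (Rle_lt_dec 0 (Im z)) as [h|h].
  - exists (acos (Re z / Cmod z)). unfold cis. rewrite cos_acos, S2, Rabs_pos_eq by auto.
    unfold RtoC, Cmult; simpl. apply injective_projections; simpl; unfold Re, Im; field; lra.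
  - exists (- acos (Re z / Cmod z))%R. unfold cis. rewrite cos_neg, sin_neg, cos_acos, S2, Rabs_left by auto.
    unfold RtoC, Cmult; simpl. apply injective_projections; simpl; unfold Re, Im; field; lra.
Qed.

Definition CRInt (f : R -> C) (a b : R) : C := @RInt C_R_CompleteNormedModule f a b.

Lemma CRInt_correct f a b : @ex_RInt C_R_NormedModule f a b ->
  @is_RInt C_R_NormedModule f a b (CRInt f a b).
Proof. apply (@RInt_correct C_R_CompleteNormedModule). Qed.

Lemma CRInt_unique f a b l : @is_RInt C_R_NormedModule f a b l -> CRInt f a b = l.
Proof. apply (@is_RInt_unique C_R_CompleteNormedModule). Qed.

(* Constant term of [f] on the circle through [w] centred at [0]. *)
Definition mean (f : C -> C) (w : C) : C :=
  RtoC (/ (2 * PI)) * CRInt (fun s => f (w * cis s)) 0 (2 * PI).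

Arguments mean f%_C_scope w%_C_scope.

Definition circ_ok (f : C -> C) (w : C) : Prop :=
  @ex_RInt C_R_NormedModule (fun s => f (w * cis s)) 0 (2 * PI).

Lemma PI2_pos : (0 < 2 * PI)%R.
Proof. assert (h := PI_RGT_0). lra. Qed.

Lemma mean_is_RInt f w : circ_ok f w ->
  @is_RInt C_R_NormedModule (fun s => f (w * cis s)) 0 (2 * PI) (RtoC (2 * PI) * mean f w).
Proof.
  intros H. unfold mean. replace (RtoC (2 * PI) * _) with (CRInt (fun s => f (w * cis s)) 0 (2 * PI)).
  - apply CRInt_correct, H.
  - rewrite Cmult_assoc, <- RtoC_mult, Rinv_r; [ring|]. assert (h := PI2_pos). lra.
Qed.

Lemma mean_unique f w l :
  @is_RInt C_R_NormedModule (fun s => f (w * cis s)) 0 (2 * PI) (RtoC (2 * PI) * l) -> mean f w = l.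
Proof.
  intros H. unfold mean. rewrite (CRInt_unique _ _ _ _ H), Cmult_assoc, <- RtoC_mult, Rinv_l; [ring|].
  assert (h := PI2_pos). lra.
Qed.

Lemma mean_ext f g w : (forall z, Cmod z = Cmod w -> f z = g z) -> mean f w = mean g w.
Proof.
  intros H. unfold mean. f_equal. unfold CRInt. apply (@RInt_ext C_R_CompleteNormedModule).
  intros s _. apply H. rewrite Cmod_mult, Cmod_cis. ring.
Qed.

Lemma mean_add f g w : circ_ok f w -> circ_ok g w -> mean (fun z => f z + g z) w = mean f w + mean g w.
Proof.
  intros Hf Hg. apply mean_unique. rewrite Cmult_plus_distr_l.
  apply (is_RInt_plus (V := C_R_NormedModule)); apply mean_is_RInt; auto.
Qed.

Lemma mean_scal c f w : circ_ok f w -> mean (fun z => c * f z) w = c * mean f w.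
Proof.
  intros Hf. apply mean_unique. replace (RtoC (2 * PI) * (c * mean f w)) with (c * (RtoC (2 * PI) * mean f w)) by ring.
  apply is_RInt_Cmult. apply mean_is_RInt; auto.
Qed.

Lemma mean_sub f g w : circ_ok f w -> circ_ok g w -> mean (fun z => f z - g z) w = mean f w - mean g w.
Proof.
  intros Hf Hg. apply mean_unique. unfold Cminus. rewrite Cmult_plus_distr_l.
  replace (RtoC (2 * PI) * - mean g w) with (- (RtoC (2 * PI) * mean g w)) by ring.
  apply (is_RInt_minus (V := C_R_NormedModule)); apply mean_is_RInt; auto.
Qed.

Lemma mean_bound f w M : circ_ok f w -> (forall z, Cmod z = Cmod w -> (Cmod (f z) <= M)%R) ->
  (Cmod (mean f w) <= M)%R.
Proof.
  intros Hf HM. assert (H := mean_is_RInt f w Hf). assert (hp := PI2_pos).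
  apply is_RInt_C_bound with (M := M) in H; [|lra|].
  - rewrite Cmod_mult, Cmod_R, Rabs_pos_eq, Rminus_0_r in H by lra. eapply Rmult_le_reg_l; eauto.
  - intros s _. apply HM. rewrite Cmod_mult, Cmod_cis. ring.
Qed.

Lemma mean_const c w : mean (fun _ => c) w = c.
Proof.
  apply mean_unique.
  assert (H := is_RInt_const (V := C_R_NormedModule) 0 (2 * PI) c).
  eapply (eq_rect _ _ H). rewrite scal_R_Cmult. rewrite Rminus_0_r. reflexivity.
Qed.

Lemma circle_path_continuous (K : C -> Prop) f w s :
  Hol gen1 K f -> (forall z, Cmod z = Cmod w -> K z) ->
  @continuous R_UniformSpace C_R_NormedModule (fun s => f (w * cis s)) s.
Proof.
  intros Hf HK. apply continuous_C_R_eps. intros e He.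
  destruct (Hol1_unif_cont _ _ Hf e He) as (d & Hd & HH).
  exists (d / (Cmod w + 1))%R. assert (h := Cmod_ge_0 w). split; [apply Rdiv_lt_0_compat; lra|].
  intros t Ht. apply HH; try (apply HK; rewrite Cmod_mult, Cmod_cis; ring).
  replace (w * cis t - w * cis s) with (w * (cis t - cis s)) by ring. rewrite Cmod_mult.
  eapply Rle_lt_trans; [apply Rmult_le_compat_l; [auto|apply Cmod_cis_sub]|].
  apply Rle_lt_trans with ((Cmod w + 1) * Rabs (t - s))%R.
  { apply Rmult_le_compat_r; [apply Rabs_pos|lra]. }
  replace d with ((Cmod w + 1) * (d / (Cmod w + 1)))%R by (field; lra).
  apply Rmult_lt_compat_l; lra.
Qed.

Lemma ann_circle r1 r2 w z : ann r1 r2 w -> Cmod z = Cmod w -> ann r1 r2 z.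
Proof. unfold ann. intros H E. rewrite E. auto. Qed.

Lemma Hol_circ_ok r1 r2 f w : Hol1 r1 r2 f -> ann r1 r2 w -> circ_ok f w.
Proof.
  intros Hf Hw. apply (@ex_RInt_continuous C_R_CompleteNormedModule). intros s _.
  eapply circle_path_continuous; eauto. intros z; apply ann_circle; auto.
Qed.

(** Over n equal steps the increments add up to at most n * B / n^2 = B / n. This is the principle
    that a vanishing derivative forces constancy, stated without a derivative. *)
Lemma quadratic_constant (phi : R -> C) (B : R) :
  (forall s t, (0 <= s <= 1)%R -> (0 <= t <= 1)%R -> (Cmod (phi s - phi t) <= B * (s - t) ^ 2)%R) ->
  phi 0%R = phi 1%R.
Proof.
  intros H. apply C_eq_of_small. intros e He.
  assert (HB : (0 <= B)%R).
  { assert (h := H 0%R 1%R ltac:(lra) ltac:(lra)). assert (h2 := Cmod_ge_0 (phi 0%R - phi 1%R)). lra. }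
  destruct (archimed_cor1 (e / (B + 1))%R) as (n & Hn1 & Hn).
  { apply Rdiv_lt_0_compat; lra. }
  assert (Hn0 : (0 < INR n)%R) by (apply lt_0_INR; auto).
  assert (P : forall k, (k <= n)%nat -> (Cmod (phi 0%R - phi (INR k / INR n)%R) <= INR k * (B / INR n ^ 2))%R).
  { induction k; intros Hk.
    - simpl INR. unfold Rdiv. rewrite Rmult_0_l. replace (phi 0%R - phi 0%R) with (RtoC 0) by ring.
      rewrite Cmod_0. lra.
    - replace (phi 0%R - phi (INR (S k) / INR n)%R) with
       ((phi 0%R - phi (INR k / INR n)%R) + (phi (INR k / INR n)%R - phi (INR (S k) / INR n)%R)) by ring.
      eapply Rle_trans; [apply Cmod_triangle|].
      assert (Hb : forall j, (j <= n)%nat -> (0 <= INR j / INR n <= 1)%R).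
      { intros j Hj. apply le_INR in Hj. assert (h := pos_INR j). split; [apply Rdiv_le_0_compat; lra|].
        apply Rle_div_l; lra. }
      assert (h1 := H _ _ (Hb k ltac:(lia)) (Hb (S k) Hk)). specialize (IHk ltac:(lia)).
      rewrite S_INR in *. 
      replace (B * (INR k / INR n - (INR k + 1) / INR n) ^ 2)%R with (B / INR n ^ 2)%R in h1 by (field; lra).
      lra. }
  specialize (P n (Nat.le_refl n)). replace (INR n / INR n)%R with 1%R in P by (field; lra).
  eapply Rle_trans; [exact P|].
  replace (INR n * (B / INR n ^ 2))%R with (B * / INR n)%R by (field; lra).
  apply Rle_trans with (B * (e / (B + 1)))%R; [apply Rmult_le_compat_l; lra|].
  replace (B * (e / (B + 1)))%R with (e * (B / (B + 1)))%R by (field; lra).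
  rewrite <- (Rmult_1_r e) at 2. apply Rmult_le_compat_l; [lra|]. apply Rle_div_l; lra.
Qed.

(** The first-order change of the mean in [w] is a multiple of the mean of g'(z) i z. This is the
    derivative of g along the circle, so it integrates to 0 over a full turn, and only the quadratic
    remainder is left. *)
Lemma Rat_mean_quadratic r1 r2 g : (0 < r1)%R -> Rat gen1 (ann r1 r2) g ->
  exists B, forall w w', ann r1 r2 w -> ann r1 r2 w' -> (Cmod (mean g w' - mean g w) <= B * Cmod (w' - w) ^ 2)%R.
Proof.
  intros Hr1 Hg. destruct (Rat_derive _ _ Hg) as (g' & Hg' & HD & B & HB0 & HB).
  exists B. intros w w' Hw Hw'.
  assert (Hc : forall v, ann r1 r2 v -> forall z, Cmod z = Cmod v -> ann r1 r2 z) by (intros; eapply ann_circle; eauto).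
  assert (Hwn : w <> 0) by (apply Cmod_nz; destruct Hw; lra).
  assert (Hz : mean (fun z => g' z * (Ci * z)) w = 0).
  { apply mean_unique. rewrite Cmult_0_r.
    assert (D : @is_RInt C_R_NormedModule (fun s => g' (w * cis s) * (w * (Ci * cis s))) 0 (2 * PI)
       (minus (g (w * cis (2 * PI))) (g (w * cis 0)))).
    { apply (@is_RInt_derive C_R_CompleteNormedModule (fun s => g (w * cis s))).
      - intros s _. apply (HD (fun s => w * cis s)).
        + apply (Hc w Hw). rewrite Cmod_mult, Cmod_cis; ring.
        + eapply (eq_rect _ (is_derive _ s)).
          * apply is_derive_Cmult; [apply @is_derive_const|apply is_derive_cis].
          * C_eq. change (@zero C_R_NormedModule) with (RtoC 0). ring.
      - intros s _. eapply continuous_ext; [|eapply circle_path_continuous with (f := fun z => g' z * (Ci * z)) (w := w) (K := ann r1 r2)].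
        + intros t. C_eq. ring.
        + apply Hol_mul; [apply Rat_Hol; auto|]. apply Hol_mul; [apply Hol_const|apply Hol1_id].
        + exact (Hc w Hw). }
    rewrite cis_2PI, cis_0 in D.
    replace (minus (g (w * 1)) (g (w * 1))) with (RtoC 0) in D
      by (unfold minus, plus, opp; simpl; change (RtoC 0 = g (w * 1) - g (w * 1)); ring).
    eapply (@is_RInt_ext C_R_NormedModule); [|exact D]. intros s _. C_eq. ring. }
  assert (Hk : circ_ok (fun z => g' z * (Ci * z)) w).
  { apply Hol_circ_ok with r1 r2; auto. apply Hol_mul; [apply Rat_Hol; auto|]. apply Hol_mul; [apply Hol_const|apply Hol1_id]. }
  assert (Hg1 : circ_ok g w) by (apply Hol_circ_ok with r1 r2; auto; apply Rat_Hol; auto).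
  assert (Hg2 : circ_ok g w') by (apply Hol_circ_ok with r1 r2; auto; apply Rat_Hol; auto).
  assert (I1 := mean_is_RInt _ _ Hg1). assert (I2 := mean_is_RInt _ _ Hg2). assert (I3 := mean_is_RInt _ _ Hk).
  rewrite Hz, Cmult_0_r in I3.
  (* Subtracting a multiple of the vanishing integral inserts the linear Taylor term: (w' - w) / (i
     w) times i w cis s is the increment w' cis s - w cis s. *)
  assert (I := @is_RInt_minus C_R_NormedModule _ _ _ _ _ _ (@is_RInt_minus C_R_NormedModule _ _ _ _ _ _ I2 I1)
     (is_RInt_Cmult _ _ _ ((w' - w) / (Ci * w)) _ I3)).
  assert (hp := PI2_pos).
  apply is_RInt_C_bound with (M := (B * Cmod (w' - w) ^ 2)%R) in I; [|lra|].
  - match type of I with (Cmod ?x <= _)%R => assert (E : x = RtoC (2 * PI) * (mean g w' - mean g w)) end.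
    { change (RtoC (2 * PI) * mean g w' - RtoC (2 * PI) * mean g w - (w' - w) / (Ci * w) * 0 = RtoC (2 * PI) * (mean g w' - mean g w)). ring. }
    rewrite E, Cmod_mult, Cmod_R, Rabs_pos_eq, Rminus_0_r in I by lra. eapply Rmult_le_reg_l; eauto.
  - intros s _.
    match goal with |- (Cmod ?x <= _)%R => replace x with (g (w' * cis s) - g (w * cis s) - g' (w * cis s) * (w' * cis s - w * cis s)) end.
    + eapply Rle_trans; [apply HB|].
      * apply (Hc w Hw). rewrite Cmod_mult, Cmod_cis; ring.
      * apply (Hc w' Hw'). rewrite Cmod_mult, Cmod_cis; ring.
      * replace (w' * cis s - w * cis s) with ((w' - w) * cis s) by ring. rewrite Cmod_mult, Cmod_cis, Rmult_1_r. lra.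
    + change (g (w' * cis s) - g (w * cis s) - g' (w * cis s) * (w' * cis s - w * cis s) =
        g (w' * cis s) - g (w * cis s) - (w' - w) / (Ci * w) * (g' (w * cis s) * (Ci * (w * cis s)))).
      field. split; auto. apply Ci_nz.
Qed.

Lemma Rat_mean_const r1 r2 g w w' : (0 < r1)%R -> Rat gen1 (ann r1 r2) g ->
  ann r1 r2 w -> ann r1 r2 w' -> mean g w = mean g w'.
Proof.
  intros Hr1 Hg Hw Hw'. destruct (Rat_mean_quadratic _ _ _ Hr1 Hg) as (B & HB).
  destruct (polar w) as (a & Ha). destruct (polar w') as (b & Hb).
  set (u := Cmod w) in *. set (v := Cmod w') in *.
  assert (Hu : (r1 <= u <= r2)%R) by exact Hw. assert (Hv : (r1 <= v <= r2)%R) by exact Hw'.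
  (* Interpolating modulus and argument separately keeps the path inside the annulus, whereas a
     straight segment could cross the hole. *)
  set (path := fun s : R => RtoC (u + s * (v - u)) * cis (a + s * (b - a))).
  assert (Hp : forall s, (0 <= s <= 1)%R -> ann r1 r2 (path s)).
  { intros s Hs. unfold ann, path. rewrite Cmod_mult, Cmod_cis, Rmult_1_r, Cmod_R, Rabs_pos_eq; nra. }
  assert (H := quadratic_constant (fun s => mean g (path s)) (Rabs B * (Rabs (v - u) + r2 * Rabs (b - a)) ^ 2)).
  replace w with (path 0%R). replace w' with (path 1%R).
  - apply H. intros s t Hs Ht. eapply Rle_trans; [apply HB; auto|].
    assert (Cmod (path s - path t) <= (Rabs (v - u) + r2 * Rabs (b - a)) * Rabs (s - t))%R.
    { unfold path.
      replace (RtoC (u + s * (v - u)) * cis (a + s * (b - a)) - RtoC (u + t * (v - u)) * cis (a + t * (b - a))) with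
        (RtoC ((v - u) * (s - t)) * cis (a + s * (b - a)) + RtoC (u + t * (v - u)) * (cis (a + s * (b - a)) - cis (a + t * (b - a)))).
      2: { rewrite RtoC_mult, !RtoC_plus, !RtoC_mult, !RtoC_minus. ring. }
      eapply Rle_trans; [apply Cmod_triangle|]. rewrite !Cmod_mult, Cmod_cis, !Cmod_R, Rabs_mult.
      assert (h1 := Cmod_cis_sub (a + s * (b - a)) (a + t * (b - a))).
      replace (a + s * (b - a) - (a + t * (b - a)))%R with ((b - a) * (s - t))%R in h1 by ring.
      rewrite Rabs_mult in h1.
      assert (Rabs (u + t * (v - u)) <= r2)%R by (rewrite Rabs_pos_eq; nra).
      assert (P := Rmult_le_compat _ _ _ _ (Rabs_pos _) (Cmod_ge_0 _) H0 h1). lra. }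
    assert (h2 := Cmod_ge_0 (path s - path t)).
    assert (h3 : (Cmod (path s - path t) ^ 2 <= ((Rabs (v - u) + r2 * Rabs (b - a)) * Rabs (s - t)) ^ 2)%R).
    { apply pow_incr. auto. }
    rewrite Rpow_mult_distr in h3. replace (Rabs (s - t) ^ 2)%R with ((s - t) ^ 2)%R in h3 by (rewrite pow2_abs; auto).
    assert (h4 := Rle_abs B). assert (h5 := pow2_ge_0 (Cmod (path s - path t))). assert (h6 := Rabs_pos B).
    apply Rle_trans with (Rabs B * Cmod (path s - path t) ^ 2)%R.
    + apply Rmult_le_compat_r; auto.
    + rewrite Rmult_assoc. apply Rmult_le_compat_l; auto.
  - rewrite Hb. unfold path. rewrite !Rmult_1_l. f_equal; f_equal; ring.
  - rewrite Ha. unfold path. rewrite !Rmult_0_l, !Rplus_0_r. reflexivity.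
Qed.

Lemma mean_close r1 r2 f g w e : Hol1 r1 r2 f -> Hol1 r1 r2 g -> ann r1 r2 w ->
  (forall z, ann r1 r2 z -> (Cmod (f z - g z) <= e)%R) -> (Cmod (mean f w - mean g w) <= e)%R.
Proof.
  intros Hf Hg Hw H. rewrite <- mean_sub by (eapply Hol_circ_ok; eauto).
  apply mean_bound.
  - eapply Hol_circ_ok; eauto. apply Hol_sub; auto.
  - intros z Hz. apply H. eapply ann_circle; eauto.
Qed.

Lemma Hol_mean_const r1 r2 f w w' : (0 < r1)%R -> Hol1 r1 r2 f ->
  ann r1 r2 w -> ann r1 r2 w' -> mean f w = mean f w'.
Proof.
  intros Hr1 Hf Hw Hw'. apply C_eq_of_small. intros e He.
  destruct (Hf (e / 2)%R ltac:(lra)) as (g & Hg & Hfg).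
  assert (H1 := mean_close _ _ _ _ _ _ Hf (Rat_Hol _ _ _ Hg) Hw Hfg).
  assert (H2 := mean_close _ _ _ _ _ _ Hf (Rat_Hol _ _ _ Hg) Hw' Hfg).
  rewrite <- (Rat_mean_const _ _ _ w w' Hr1 Hg Hw Hw') in H2.
  replace (mean f w - mean f w') with ((mean f w - mean g w) - (mean f w' - mean g w)) by ring.
  eapply Rle_trans; [apply Cmod_triangle_sub|]. lra.
Qed.

Lemma mean_dilate c f w : mean (fun z => f (c * z)) w = mean f (c * w).
Proof.
  unfold mean. f_equal. unfold CRInt. apply (@RInt_ext C_R_CompleteNormedModule). intros s _.
  f_equal. ring.
Qed.

Lemma mean_inv (f : C -> C) (w : C) : w <> 0 -> circ_ok f (/ w) -> mean (fun z => f (/ z)) w = mean f (/ w).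
Proof.
  intros Hw Hf. apply mean_unique. assert (H := mean_is_RInt _ _ Hf).
  assert (S := @is_RInt_comp_lin C_R_NormedModule (fun s => f (/ w * cis s)) (-1) (2 * PI) 0 (2 * PI) (- (RtoC (2 * PI) * mean f (/ w)))).
  replace (-1 * 0 + 2 * PI)%R with (2 * PI)%R in S by ring.
  replace (-1 * (2 * PI) + 2 * PI)%R with 0%R in S by ring.
  specialize (S (@is_RInt_swap C_R_NormedModule _ _ _ _ H)).
  apply (@is_RInt_opp C_R_NormedModule) in S.
  assert (E : opp (- (RtoC (2 * PI) * mean f (/ w))) = RtoC (2 * PI) * mean f (/ w)).
  { change (- (- (RtoC (2 * PI) * mean f (/ w))) = RtoC (2 * PI) * mean f (/ w)). ring. }
  eapply (@is_RInt_ext C_R_NormedModule); [|rewrite <- E; exact S]. intros s _.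
  cbv beta. replace (/ w * cis (-1 * s + 2 * PI)) with (/ (w * cis s)).
  - cbv beta. generalize (f (/ (w * cis s))). intros [x y]. apply injective_projections; unfold opp, scal; simpl; unfold opp, scal; simpl; unfold mult; simpl; ring.
  - rewrite cis_add, cis_2PI. replace (-1 * s)%R with (- s)%R by ring. rewrite cis_opp.
    field. repeat split; try apply cis_nz; exact Hw.
Qed.

(** * Integer powers and their means *)

Definition zpow (z : C) (n : Z) : C :=
  match n with
  | Z0 => 1
  | Zpos k => z ^ Pos.to_nat k
  | Zneg k => (/ z) ^ Pos.to_nat k
  end.

Lemma zpow_nat z n : zpow z (Z.of_nat n) = z ^ n.
Proof. destruct n; [reflexivity|]. simpl. rewrite SuccNat2Pos.id_succ. reflexivity. Qed.

Lemma zpow_opp_nat z n : zpow z (- Z.of_nat n) = (/ z) ^ n.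
Proof. destruct n; [reflexivity|]. simpl. rewrite SuccNat2Pos.id_succ. reflexivity. Qed.

Lemma zpow_succ (z : C) (n : Z) : z <> 0 -> zpow z (n + 1) = z * zpow z n.
Proof.
  intros Hz. destruct (Z_lt_le_dec n 0) as [h|h].
  - destruct (Z.to_nat (- n)) as [|k] eqn:E; [lia|].
    replace (n + 1)%Z with (- Z.of_nat k)%Z by lia. replace n with (- Z.of_nat (S k))%Z by lia.
    rewrite !zpow_opp_nat. simpl. field. auto.
  - replace n with (Z.of_nat (Z.to_nat n)) by lia. replace (Z.of_nat (Z.to_nat n) + 1)%Z with (Z.of_nat (S (Z.to_nat n))) by lia.
    rewrite !zpow_nat. reflexivity.
Qed.

Lemma zpow_pred (z : C) (n : Z) : z <> 0 -> zpow z (n - 1) = / z * zpow z n.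
Proof.
  intros Hz. replace n with (n - 1 + 1)%Z at 2 by lia. rewrite zpow_succ by auto. field. auto.
Qed.

Lemma zpow_add (z : C) (m n : Z) : z <> 0 -> zpow z (m + n) = zpow z m * zpow z n.
Proof.
  intros Hz. revert m. apply Z.bi_induction.
  - intros ? ? ->; reflexivity.
  - simpl. ring.
  - intros m. split; intros H.
    + replace (Z.succ m + n)%Z with ((m + n) + 1)%Z by lia. unfold Z.succ. rewrite !zpow_succ, H by auto. ring.
    + replace (m + n)%Z with ((Z.succ m + n) - 1)%Z by lia. rewrite zpow_pred, H by auto.
      unfold Z.succ. rewrite zpow_succ by auto. field. auto.
Qed.

Lemma zpow_mult_l (x y : C) (n : Z) : zpow (x * y) n = zpow x n * zpow y n.
Proof.
  destruct n as [|k|k]; simpl.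
  - ring.
  - apply Cpow_mult_l.
  - destruct (Ceq_dec x 0) as [->|Hx].
    { rewrite Cmult_0_l. assert (H : / RtoC 0 = 0) by (unfold Cinv, RtoC; simpl; f_equal; unfold Rdiv; ring).
      rewrite H. destruct (Pos2Nat.is_succ k) as [m ->]. simpl. ring. }
    destruct (Ceq_dec y 0) as [->|Hy].
    { rewrite Cmult_0_r. assert (H : / RtoC 0 = 0) by (unfold Cinv, RtoC; simpl; f_equal; unfold Rdiv; ring).
      rewrite H. destruct (Pos2Nat.is_succ k) as [m ->]. simpl. ring. }
    rewrite <- Cpow_mult_l. f_equal. field. auto.
Qed.

Lemma zpow_nz (z : C) (n : Z) : z <> 0 -> zpow z n <> 0.
Proof.
  intros Hz. destruct n; simpl; [apply C1_nz| |]; apply Cpow_nz; auto.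
  intro h. assert (E := Cinv_r z Hz). rewrite h in E. apply C1_nz. rewrite <- E. ring.
Qed.

Lemma zpow_opp (z : C) (n : Z) : z <> 0 -> zpow z (- n) = / zpow z n.
Proof.
  intros Hz. assert (E := zpow_add z n (- n) Hz). rewrite Z.add_opp_diag_r in E. simpl in E.
  assert (h := zpow_nz z n Hz). rewrite <- (Cmult_1_r (/ zpow z n)), E. field. auto.
Qed.

Lemma Hol1_zpow r1 r2 n : (0 < r1)%R -> Hol1 r1 r2 (fun z => zpow z n).
Proof.
  intros Hr. destruct n; simpl; [apply Hol_const| |]; apply Hol_pow; [apply Hol1_id|apply Hol1_inv; auto].
Qed.

(** Rotating the circle by [c] with c^n = -1 leaves the mean unchanged, but it also multiplies the
    integrand by -1. *)
Lemma mean_zpow n (w : C) : w <> 0 -> (n <> 0)%Z -> mean (fun z => zpow z n) w = 0.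
Proof.
  intros Hw Hn. assert (Hm : (0 < Cmod w)%R) by (apply Cmod_gt_0; auto).
  set (c := cis (PI / IZR (Z.abs n))).
  assert (Hc : zpow c n = - (1)).
  { assert (E : c ^ Z.to_nat (Z.abs n) = - (1)).
    { unfold c. rewrite <- cis_pow, INR_IZR_INZ, Z2Nat.id by lia.
      replace (IZR (Z.abs n) * (PI / IZR (Z.abs n)))%R with PI; [apply cis_PI|]. field.
      apply not_0_IZR. lia. }
    destruct (Z_lt_le_dec n 0) as [h|h].
    - replace n with (- Z.of_nat (Z.to_nat (Z.abs n)))%Z by lia. rewrite zpow_opp by apply cis_nz.
      rewrite zpow_nat, E. field.
    - replace n with (Z.of_nat (Z.to_nat (Z.abs n))) by lia. rewrite zpow_nat. exact E. }
  assert (H1 : mean (fun z => zpow z n) w = mean (fun z => zpow z n) (c * w)).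
  { apply Hol_mean_const with (Cmod w) (Cmod w); auto.
    - apply Hol1_zpow; auto.
    - split; lra.
    - unfold ann. rewrite Cmod_mult. unfold c. rewrite Cmod_cis. lra. }
  rewrite <- mean_dilate in H1.
  assert (H2 : mean (fun z => zpow (c * z) n) w = - mean (fun z => zpow z n) w).
  { transitivity (mean (fun z => (- (1)) * zpow z n) w).
    - apply mean_ext. intros z _. rewrite zpow_mult_l, Hc. reflexivity.
    - rewrite mean_scal; [ring|]. apply Hol_circ_ok with (Cmod w) (Cmod w).
      + apply Hol1_zpow; auto.
      + split; lra. }
  rewrite H2 in H1.
  set (m := mean (fun z => zpow z n) w) in *.
  assert (E : RtoC 2 * m = 0).
  { replace (RtoC 2 * m) with (m + m) by ring. rewrite H1 at 1. ring. }
  replace m with (/ RtoC 2 * (RtoC 2 * m)). + rewrite E. ring.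
  + field. Qed.

Lemma Hol_sub_const_inv r1 r2 x d : (0 < d)%R -> (forall z, ann r1 r2 z -> (d <= Cmod (z - x))%R) ->
  Hol1 r1 r2 (fun z => / (z - x)).
Proof.
  intros Hd H. apply Hol_inv with d; auto. apply Hol_sub; [apply Hol1_id|apply Hol_const].
Qed.

Lemma mean_kernel_out (w x : C) : (Cmod x < Cmod w)%R -> mean (fun s => s / (s - x)) w = 1.
Proof.
  intros H. apply C_eq_of_small. intros e He.
  assert (h0 := Cmod_ge_0 x).
  (* On |z| = T the deviation of the kernel from 1 is |x| / |z - x| <= |x| / (T - |x|) <= e. Moving
     the circle out to this radius does not change the mean. *)
  set (T := (Cmod w + Cmod x + Cmod x / e)%R).
  assert (HT : (Cmod x / e * e = Cmod x)%R) by (field; lra).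
  assert (HT0 : (0 <= Cmod x / e)%R) by (apply Rdiv_le_0_compat; lra).
  assert (HTm : Cmod (RtoC T) = T) by (rewrite Cmod_R, Rabs_pos_eq; auto; unfold T; lra).
  assert (HH : forall r, (Cmod w <= r)%R -> Hol1 (Cmod w) r (fun s => / (s - x))).
  { intros r Hr. apply Hol_sub_const_inv with (Cmod w - Cmod x)%R; [lra|].
    intros z [Hz _]. eapply Rle_trans; [|apply Cmod_triangle_rev]. lra. }
  assert (HH2 : Hol1 (Cmod w) T (fun s => s / (s - x))).
  { apply Hol_mul; [apply Hol1_id|]. apply HH. unfold T; lra. }
  rewrite (Hol_mean_const (Cmod w) T _ w (RtoC T)); auto; [|lra|unfold ann, T in *; lra|unfold ann; rewrite HTm; unfold T; lra].
  rewrite <- (mean_const 1 (RtoC T)).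
  rewrite <- mean_sub.
  - apply mean_bound.
    + apply Hol_circ_ok with (Cmod w) T; [apply Hol_sub; auto; apply Hol_const|unfold ann; rewrite HTm; unfold T; lra].
    + intros z Hz. rewrite HTm in Hz.
      assert (h := Cmod_triangle_rev z x).
      assert (Hzx : z - x <> 0) by (apply Cmod_nz; unfold T in *; lra).
      replace (z / (z - x) - 1) with (x / (z - x)) by (field; auto).
      rewrite Cmod_div by auto. apply Rle_div_l; [unfold T in *; lra|].
      unfold T in *. nra.
  - apply Hol_circ_ok with (Cmod w) T; auto. unfold ann; rewrite HTm; unfold T; lra.
  - apply Hol_circ_ok with (Cmod w) T; [apply Hol_const|]. unfold ann; rewrite HTm; unfold T; lra.
Qed.

(** The inversion z -> 1/z reduces this to [mean_kernel_out], because (1/z) / (1/z - 1/x) = 1 - z /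
    (z - x). *)
Lemma mean_kernel_in (w x : C) : (0 < Cmod w < Cmod x)%R -> mean (fun s => s / (s - x)) w = 0.
Proof.
  intros H. assert (Hw : w <> 0) by (apply Cmod_nz; lra). assert (Hx : x <> 0) by (apply Cmod_nz; lra).
  assert (Hi : (Cmod (/ x) < Cmod (/ w))%R).
  { rewrite !Cmod_inv by auto. apply Rinv_lt_contravar; [apply Rmult_lt_0_compat; lra|lra]. }
  assert (Hi0 : (0 < Cmod (/ x))%R) by (rewrite Cmod_inv by auto; apply Rinv_0_lt_compat; lra).
  assert (E := mean_kernel_out (/ w) (/ x) Hi).
  assert (HH : Hol1 (Cmod (/ w)) (Cmod (/ w)) (fun s => s / (s - / x))).
  { apply Hol_mul; [apply Hol1_id|]. apply Hol_sub_const_inv with (Cmod (/ w) - Cmod (/ x))%R; [lra|].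
    intros z [Hz _]. eapply Rle_trans; [|apply Cmod_triangle_rev]. lra. }
  assert (Hok : circ_ok (fun s => s / (s - / x)) (/ w)).
  { eapply Hol_circ_ok; [apply HH|]. split; lra. }
  rewrite <- mean_inv in E by auto.
  assert (HH3 : Hol1 (Cmod w) (Cmod w) (fun s => s / (s - x))).
  { apply Hol_mul; [apply Hol1_id|]. apply Hol_sub_const_inv with (Cmod x - Cmod w)%R; [lra|].
    intros z [_ Hz]. rewrite Cmod_sub_sym. eapply Rle_trans; [|apply Cmod_triangle_rev]. lra. }
  assert (E3 : mean (fun z => / z / (/ z - / x)) w = mean (fun z => 1 - z / (z - x)) w).
  { apply mean_ext. intros z Hz. assert (z <> 0) by (apply Cmod_nz; lra).
    assert (z - x <> 0).
    { intro h. apply Ceq_minus in h. subst. lra. }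
    assert (x - z <> 0).
    { intro h. apply Ceq_minus in h. subst. lra. }
    field. auto. }
  rewrite E3, mean_sub, mean_const in E.
  - replace (mean (fun s => s / (s - x)) w) with (1 - (1 - mean (fun s => s / (s - x)) w)) by ring.
    rewrite E. ring.
  - eapply Hol_circ_ok; [apply Hol_const|]. split; apply Rle_refl.
  - eapply Hol_circ_ok; [apply HH3|]. split; apply Rle_refl.
Qed.

(** Write f(s) = f(x) + (s - x) h(s). The contribution s h(s) has the same mean on both circles and
    cancels, while the kernel s / (s - x) has mean 1 on the outer circle and 0 on the inner one. *)
Lemma Rat_Cauchy r1 r2 f w1 w2 x : (0 < r1)%R -> Rat gen1 (ann r1 r2) f ->
  ann r1 r2 w1 -> ann r1 r2 w2 -> (Cmod w1 < Cmod x < Cmod w2)%R ->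
  f x = mean (fun s => f s * (s / (s - x))) w2 - mean (fun s => f s * (s / (s - x))) w1.
Proof.
  intros Hr Hf Hw1 Hw2 Hx.
  assert (HKx : ann r1 r2 x) by (destruct Hw1, Hw2; split; lra).
  destruct (Rat_diff_quot _ _ x Hf HKx) as (h & Hh & E).
  assert (Hsx : forall z, Cmod z <> Cmod x -> z - x <> 0).
  { intros z Hz H. apply Ceq_minus in H. subst. auto. }
  assert (A : forall w, ann r1 r2 w -> Cmod w <> Cmod x ->
     mean (fun s => f s * (s / (s - x))) w = f x * mean (fun s => s / (s - x)) w + mean (fun s => s * h s) w).
  { intros w Hw Hwx.
    assert (O1 : circ_ok (fun s => s / (s - x)) w).
    { apply Hol_circ_ok with (Cmod w) (Cmod w); [|split; lra].
      apply Hol_mul; [apply Hol1_id|]. apply Hol_sub_const_inv with (Rabs (Cmod w - Cmod x)).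
      - apply Rabs_pos_lt. lra.
      - intros z Hz. assert (Cmod z = Cmod w) by (destruct Hz; lra).
        apply Rabs_le. assert (t1 := Cmod_triangle_rev z x). assert (t2 := Cmod_triangle_rev x z).
        rewrite (Cmod_sub_sym x z) in t2. lra. }
    assert (O2 : circ_ok (fun s => s * h s) w).
    { apply Hol_circ_ok with r1 r2; auto. apply Hol_mul; [apply Hol1_id|apply Rat_Hol; auto]. }
    rewrite <- mean_scal by auto. rewrite <- mean_add; auto.
    - apply mean_ext. intros z Hz. assert (Hz1 : z - x <> 0) by (apply Hsx; lra).
      assert (E1 := E z (ann_circle _ _ _ _ Hw Hz)).
      replace (f z) with (f x + (z - x) * h z) by (rewrite <- E1; ring). field. auto.
    - destruct O1 as [l Hl]. exists (f x * l). apply is_RInt_Cmult. exact Hl. }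
  rewrite (A w2), (A w1), mean_kernel_out, mean_kernel_in by (auto; destruct Hw1; try lra).
  rewrite (Hol_mean_const r1 r2 (fun s => s * h s) w1 w2); auto.
  - ring.
  - apply Hol_mul; [apply Hol1_id|apply Rat_Hol; auto].
Qed.

Lemma kernel_Hol (w x : C) : Cmod w <> Cmod x ->
  Hol1 (Cmod w) (Cmod w) (fun s => s / (s - x)).
Proof.
  intros H. apply Hol_mul; [apply Hol1_id|]. apply Hol_sub_const_inv with (Rabs (Cmod w - Cmod x)).
  - apply Rabs_pos_lt. lra.
  - intros z Hz. assert (Cmod z = Cmod w) by (destruct Hz; lra).
    apply Rabs_le. assert (t1 := Cmod_triangle_rev z x). assert (t2 := Cmod_triangle_rev x z).
    rewrite (Cmod_sub_sym x z) in t2. lra.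
Qed.

Lemma kernel_bound (w x z : C) : Cmod w <> Cmod x -> Cmod z = Cmod w ->
  (Cmod (z / (z - x)) <= Cmod w / Rabs (Cmod w - Cmod x))%R.
Proof.
  intros H Hz. assert (h : (Rabs (Cmod w - Cmod x) <= Cmod (z - x))%R).
  { apply Rabs_le. assert (t1 := Cmod_triangle_rev z x). assert (t2 := Cmod_triangle_rev x z).
    rewrite (Cmod_sub_sym x z) in t2. lra. }
  assert (h2 : (0 < Rabs (Cmod w - Cmod x))%R) by (apply Rabs_pos_lt; lra).
  rewrite Cmod_div by (apply Cmod_nz; lra). rewrite Hz. apply Rmult_le_compat_l; [apply Cmod_ge_0|].
  apply Rinv_le_contravar; auto.
Qed.

Lemma Hol_Cauchy r1 r2 f w1 w2 x : (0 < r1)%R -> Hol1 r1 r2 f ->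
  ann r1 r2 w1 -> ann r1 r2 w2 -> (Cmod w1 < Cmod x < Cmod w2)%R ->
  f x = mean (fun s => f s * (s / (s - x))) w2 - mean (fun s => f s * (s / (s - x))) w1.
Proof.
  intros Hr Hf Hw1 Hw2 Hx. apply C_eq_of_small. intros e He.
  set (A := (Cmod w2 / Rabs (Cmod w2 - Cmod x))%R). set (B := (Cmod w1 / Rabs (Cmod w1 - Cmod x))%R).
  assert (HA : (0 <= A)%R) by (apply Rdiv_le_0_compat; [apply Cmod_ge_0|apply Rabs_pos_lt; lra]).
  assert (HB : (0 <= B)%R) by (apply Rdiv_le_0_compat; [apply Cmod_ge_0|apply Rabs_pos_lt; lra]).
  (* [A] and [B] bound the kernel on the two circles, so the errors in f(x) and in the two means add
     up to e. *)
  destruct (Hf (e / (1 + A + B))%R) as (g & Hg & Hfg); [apply Rdiv_lt_0_compat; lra|].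
  set (d := (e / (1 + A + B))%R) in *.
  assert (Hd : (d * (1 + A + B) = e)%R) by (unfold d; field; lra).
  assert (Hd0 : (0 < d)%R) by (apply Rdiv_lt_0_compat; lra).
  assert (E := Rat_Cauchy r1 r2 g w1 w2 x Hr Hg Hw1 Hw2 Hx).
  assert (P : forall w, ann r1 r2 w -> Cmod w <> Cmod x ->
    (Cmod (mean (fun s => f s * (s / (s - x)))%C w - mean (fun s => g s * (s / (s - x)))%C w) <= d * (Cmod w / Rabs (Cmod w - Cmod x)))%R).
  { intros w Hw Hwx.
    assert (S1 : Hol1 (Cmod w) (Cmod w) f) by (apply Hol1_sub with r1 r2; auto; apply Hw).
    assert (S2 : Hol1 (Cmod w) (Cmod w) g) by (apply Hol1_sub with r1 r2; auto; [apply Hw|apply Hw|apply Rat_Hol; auto]).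
    apply mean_close with (Cmod w) (Cmod w).
    - apply Hol_mul; auto. apply kernel_Hol; auto.
    - apply Hol_mul; auto. apply kernel_Hol; auto.
    - split; lra.
    - intros z Hz. assert (Hzw : Cmod z = Cmod w) by (destruct Hz; lra).
      replace (f z * (z / (z - x)) - g z * (z / (z - x))) with ((f z - g z) * (z / (z - x))) by ring.
      rewrite Cmod_mult. apply Rmult_le_compat; auto using Cmod_ge_0.
      + apply Hfg. eapply ann_circle; eauto.
      + apply kernel_bound; auto. }
  assert (P1 := P w1 Hw1 ltac:(lra)). assert (P2 := P w2 Hw2 ltac:(lra)). fold A in P2. fold B in P1.
  assert (P0 : (Cmod (f x - g x) <= d)%R) by (apply Hfg; destruct Hw1, Hw2; split; lra).
  rewrite E in P0.
  set (a := mean (fun s => f s * (s / (s - x))) w2) in *. set (b := mean (fun s => f s * (s / (s - x))) w1) in *.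
  set (a' := mean (fun s => g s * (s / (s - x))) w2) in *. set (b' := mean (fun s => g s * (s / (s - x))) w1) in *.
  replace (f x - (a - b)) with ((f x - (a' - b')) - (a - a') + (b - b')) by ring.
  eapply Rle_trans; [apply Cmod_triangle|]. eapply Rle_trans; [apply Rplus_le_compat_r, Cmod_triangle_sub|]. lra.
Qed.

(** * Laurent expansions and the identity theorem *)

Definition lcoef (f : C -> C) (n : Z) (w : C) : C := mean (fun z => f z * zpow z (- n)) w.

Fixpoint Csum (F : nat -> C) (n : nat) : C :=
  match n with O => 0 | S k => Csum F k + F k end.

Definition Lsum (c : Z -> C) (N : nat) (x : C) : C :=
  Csum (fun n => c (Z.of_nat n) * zpow x (Z.of_nat n)) N +
  Csum (fun n => c (- Z.of_nat (S n))%Z * zpow x (- Z.of_nat (S n))) N.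

Lemma Csum_ext F G n : (forall i, (i < n)%nat -> F i = G i) -> Csum F n = Csum G n.
Proof.
  induction n; intros H; simpl; [reflexivity|]. rewrite IHn, H by (intros; auto). reflexivity.
Qed.

Lemma Csum_0 n : Csum (fun _ => 0) n = 0.
Proof. induction n; simpl; [|rewrite IHn]; ring. Qed.

Lemma lcoef_const r1 r2 f n (w w' : C) : (0 < r1)%R -> Hol1 r1 r2 f -> ann r1 r2 w -> ann r1 r2 w' ->
  lcoef f n w = lcoef f n w'.
Proof.
  intros. unfold lcoef. eapply Hol_mean_const with (r1 := r1); eauto.
  apply Hol_mul; auto. apply Hol1_zpow; auto.
Qed.

Lemma Hol_ann_point r1 r2 f (w : C) : Hol1 r1 r2 f -> ann r1 r2 w -> Hol1 (Cmod w) (Cmod w) f.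
Proof. intros Hf [H1 H2]. apply Hol1_sub with r1 r2; auto. Qed.

Lemma circ_ok_point f (w : C) : Hol1 (Cmod w) (Cmod w) f -> circ_ok f w.
Proof. intros H. eapply Hol_circ_ok; [exact H|]. split; lra. Qed.

Lemma Csum_S F n : Csum F (S n) = Csum F n + F n.
Proof. reflexivity. Qed.

(** Finite geometric expansion of the kernel by s/(s - x) = 1 + (x/s) s/(s - x). The remainder is
    small when |x| < |w|. *)
Lemma Laurent_out f (w x : C) N : (0 < Cmod w)%R -> Hol1 (Cmod w) (Cmod w) f -> Cmod w <> Cmod x ->
  mean (fun s => f s * (s / (s - x))) w =
  Csum (fun n => lcoef f (Z.of_nat n) w * zpow x (Z.of_nat n)) N +
  x ^ N * mean (fun s => f s * (zpow s (- Z.of_nat N) * (s / (s - x)))) w.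
Proof.
  intros Hw Hf Hx. induction N.
  - simpl. rewrite Cplus_0_l, Cmult_1_l. apply mean_ext. intros; ring.
  - rewrite IHN, Csum_S. rewrite <- Cplus_assoc. f_equal.
    rewrite zpow_nat, (Cmult_comm _ (x ^ N)). simpl (x ^ S N). rewrite (Cmult_comm x), <- Cmult_assoc, <- Cmult_plus_distr_l.
    f_equal. unfold lcoef. rewrite <- mean_scal, <- mean_add.
    + apply mean_ext. intros z Hz. assert (z <> 0) by (apply Cmod_nz; lra).
      assert (z - x <> 0) by (intro h; apply Ceq_minus in h; subst; auto).
      replace (- Z.of_nat (S N))%Z with (- Z.of_nat N - 1)%Z by lia. rewrite zpow_pred by auto. field. auto.
    + apply circ_ok_point. apply Hol_mul; auto. apply Hol1_zpow; auto.
    + apply circ_ok_point. apply Hol_mul; [apply Hol_const|]. apply Hol_mul; auto. apply Hol_mul; [apply Hol1_zpow; auto|apply kernel_Hol; auto].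
    + apply circ_ok_point. apply Hol_mul; auto. apply Hol_mul; [apply Hol1_zpow; auto|apply kernel_Hol; auto].
Qed.

(** The expansion in the other direction, by s/(s - x) = -s/x + (s/x) s/(s - x). The remainder is
    small when |w| < |x|. *)
Lemma Laurent_in f (w x : C) N : (0 < Cmod w)%R -> Hol1 (Cmod w) (Cmod w) f -> Cmod w <> Cmod x -> x <> 0 ->
  - mean (fun s => f s * (s / (s - x))) w =
  Csum (fun n => lcoef f (- Z.of_nat (S n)) w * zpow x (- Z.of_nat (S n))) N -
  (/ x) ^ N * mean (fun s => f s * (zpow s (Z.of_nat N) * (s / (s - x)))) w.
Proof.
  intros Hw Hf Hx Hx0. induction N.
  - simpl. replace (mean (fun s => f s * (1 * (s / (s - x)))) w) with (mean (fun s => f s * (s / (s - x))) w).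
    + ring.
    + apply mean_ext. intros; ring.
  - rewrite IHN, Csum_S.
    assert (E : mean (fun s => f s * (zpow s (Z.of_nat N) * (s / (s - x)))) w =
       / x * mean (fun s => f s * (zpow s (Z.of_nat (S N)) * (s / (s - x)))) w - / x * lcoef f (- Z.of_nat (S N)) w).
    { unfold lcoef. rewrite <- !mean_scal, <- mean_sub.
      + apply mean_ext. intros z Hz. assert (z <> 0) by (apply Cmod_nz; lra).
        assert (z - x <> 0) by (intro h; apply Ceq_minus in h; subst; auto).
        rewrite Z.opp_involutive. replace (Z.of_nat (S N))%Z with (Z.of_nat N + 1)%Z by lia. rewrite zpow_succ by auto. field. auto.
      + apply circ_ok_point. apply Hol_mul; [apply Hol_const|]. apply Hol_mul; auto. apply Hol_mul; [apply Hol1_zpow; auto|apply kernel_Hol; auto].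
      + apply circ_ok_point. apply Hol_mul; [apply Hol_const|]. apply Hol_mul; auto. apply Hol1_zpow; auto.
      + apply circ_ok_point. apply Hol_mul; auto. apply Hol1_zpow; auto.
      + apply circ_ok_point. apply Hol_mul; auto. apply Hol_mul; [apply Hol1_zpow; auto|apply kernel_Hol; auto]. }
    rewrite E, zpow_opp_nat. change ((/ x) ^ S N) with (/ x * (/ x) ^ N). ring.
Qed.

Lemma pow_small (r K e : R) : (0 <= r < 1)%R -> (0 <= K)%R -> (0 < e)%R -> exists N, (r ^ N * K < e)%R.
Proof.
  intros Hr HK He. destruct (pow_lt_1_zero r) with (y := (e / (K + 1))%R) as [N HN].
  - rewrite Rabs_pos_eq; lra.
  - apply Rdiv_lt_0_compat; lra.
  - exists N. specialize (HN N (Nat.le_refl N)). assert (h := pow_le r N (proj1 Hr)).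
    rewrite Rabs_pos_eq in HN by auto.
    apply Rle_lt_trans with (r ^ N * (K + 1))%R; [nra|].
    replace e with (e / (K + 1) * (K + 1))%R by (field; lra). apply Rmult_lt_compat_r; lra.
Qed.

(** Cauchy's formula on the two bounding circles, with both kernels expanded to order N. The strict
    inclusion of the radii gives the ratios p2/r2 and r1/p1 below 1, so both remainders are small
    uniformly in x. *)
Lemma Laurent_approx r1 r2 f (w : C) p1 p2 e : (0 < r1)%R -> Hol1 r1 r2 f -> ann r1 r2 w ->
  (r1 < p1)%R -> (p1 <= p2)%R -> (p2 < r2)%R -> (0 < e)%R ->
  exists N, forall x, ann p1 p2 x -> (Cmod (f x - Lsum (fun n => lcoef f n w) N x) <= e)%R.
Proof.
  intros Hr Hf Hw H1 H2 H3 He.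
  set (w1 := RtoC r1). set (w2 := RtoC r2).
  assert (M1 : Cmod w1 = r1) by (unfold w1; rewrite Cmod_R, Rabs_pos_eq; lra).
  assert (M2 : Cmod w2 = r2) by (unfold w2; rewrite Cmod_R, Rabs_pos_eq; lra).
  assert (A1 : ann r1 r2 w1) by (unfold ann; lra). assert (A2 : ann r1 r2 w2) by (unfold ann; lra).
  destruct (Hol_bounded _ _ _ Hf) as (M & HM & HMb).
  destruct (pow_small (p2 / r2) (M * (r2 / (r2 - p2))) (e / 2)) as [N2 HN2]; [| |lra|].
  { split; [apply Rdiv_le_0_compat; lra|apply Rlt_div_l; lra]. }
  { apply Rmult_le_pos; [lra|apply Rdiv_le_0_compat; lra]. }
  destruct (pow_small (r1 / p1) (M * (r1 / (p1 - r1))) (e / 2)) as [N1 HN1]; [| |lra|].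
  { split; [apply Rdiv_le_0_compat; lra|apply Rlt_div_l; lra]. }
  { apply Rmult_le_pos; [lra|apply Rdiv_le_0_compat; lra]. }
  exists (N1 + N2)%nat. intros x [Hx1 Hx2]. set (N := (N1 + N2)%nat).
  assert (Hxn : x <> 0) by (apply Cmod_nz; lra).
  assert (B2 : ((p2 / r2) ^ N * (M * (r2 / (r2 - p2))) < e / 2)%R).
  { eapply Rle_lt_trans; [|exact HN2]. apply Rmult_le_compat_r.
    - apply Rmult_le_pos; [lra|apply Rdiv_le_0_compat; lra].
    - unfold N. rewrite Rdef_pow_add. rewrite <- (Rmult_1_l ((p2 / r2) ^ N2)) at 2.
      apply Rmult_le_compat_r; [apply pow_le, Rdiv_le_0_compat; lra|].
      rewrite <- (pow1 N1). apply pow_incr. split; [apply Rdiv_le_0_compat; lra|apply Rle_div_l; lra]. }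
  assert (B1 : ((r1 / p1) ^ N * (M * (r1 / (p1 - r1))) < e / 2)%R).
  { eapply Rle_lt_trans; [|exact HN1]. apply Rmult_le_compat_r.
    - apply Rmult_le_pos; [lra|apply Rdiv_le_0_compat; lra].
    - unfold N. rewrite Rdef_pow_add. rewrite <- (Rmult_1_r ((r1 / p1) ^ N1)) at 2.
      apply Rmult_le_compat_l; [apply pow_le, Rdiv_le_0_compat; lra|].
      rewrite <- (pow1 N2). apply pow_incr. split; [apply Rdiv_le_0_compat; lra|apply Rle_div_l; lra]. }
  clearbody N. clear HN1 HN2 N1 N2.
  assert (P1 : Hol1 (Cmod w1) (Cmod w1) f) by (exact (Hol_ann_point r1 r2 f w1 Hf A1)).
  assert (P2 : Hol1 (Cmod w2) (Cmod w2) f) by (exact (Hol_ann_point r1 r2 f w2 Hf A2)).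
  rewrite (Hol_Cauchy r1 r2 f w1 w2 x Hr Hf A1 A2) by lra.
  unfold Cminus at 2. rewrite (Laurent_out f w2 x N), (Laurent_in f w1 x N) by (auto; lra).
  unfold Lsum.
  rewrite (Csum_ext (fun n => lcoef f (Z.of_nat n) w2 * _) (fun n => lcoef f (Z.of_nat n) w * zpow x (Z.of_nat n)))
    by (intros; rewrite (lcoef_const r1 r2 f _ w2 w); auto).
  rewrite (Csum_ext (fun n => lcoef f (- Z.of_nat (S n)) w1 * _) (fun n => lcoef f (- Z.of_nat (S n)) w * zpow x (- Z.of_nat (S n))))
    by (intros; rewrite (lcoef_const r1 r2 f _ w1 w); auto).
  set (S1 := Csum _ N). set (S2 := Csum _ N).
  set (m2 := mean _ w2). set (m1 := mean _ w1).
  replace (S1 + x ^ N * m2 + (S2 - (/ x) ^ N * m1) - (S1 + S2)) with (x ^ N * m2 - (/ x) ^ N * m1) by ring.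
  eapply Rle_trans; [apply Cmod_triangle_sub|].
  assert (Q2 : (Cmod (x ^ N * m2) <= (p2 / r2) ^ N * (M * (r2 / (r2 - p2))))%R).
  { rewrite Cmod_mult, Cmod_pow.
    assert (Qm : (Cmod m2 <= M * ((/ r2) ^ N * (r2 / (r2 - p2))))%R).
    { apply mean_bound.
      - apply circ_ok_point. apply Hol_mul; auto. apply Hol_mul; [apply Hol1_zpow; lra|apply kernel_Hol; lra].
      - intros z Hz. rewrite !Cmod_mult. apply Rmult_le_compat; auto using Cmod_ge_0.
        + apply Rmult_le_pos; apply Cmod_ge_0.
        + apply HMb. unfold ann; lra.
        + apply Rmult_le_compat; auto using Cmod_ge_0.
          * rewrite zpow_opp_nat, Cmod_pow, Cmod_inv, Hz, M2 by (apply Cmod_nz; lra). lra.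
          * eapply Rle_trans; [apply (kernel_bound w2); lra|]. rewrite M2. apply Rmult_le_compat_l; [lra|].
            apply Rinv_le_contravar; [lra|]. rewrite Rabs_pos_eq; lra. }
    unfold Rdiv at 1. rewrite Rpow_mult_distr.
    apply Rle_trans with (p2 ^ N * (M * ((/ r2) ^ N * (r2 / (r2 - p2)))))%R; [|right; ring].
    apply Rmult_le_compat; auto using Cmod_ge_0.
    - apply pow_le, Cmod_ge_0.
    - apply pow_incr. split; [apply Cmod_ge_0|lra]. }
  assert (Q1 : (Cmod ((/ x) ^ N * m1) <= (r1 / p1) ^ N * (M * (r1 / (p1 - r1))))%R).
  { rewrite Cmod_mult, Cmod_pow, Cmod_inv by auto.
    assert (Qm : (Cmod m1 <= M * (r1 ^ N * (r1 / (p1 - r1))))%R).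
    { apply mean_bound.
      - apply circ_ok_point. apply Hol_mul; auto. apply Hol_mul; [apply Hol1_zpow; lra|apply kernel_Hol; lra].
      - intros z Hz. rewrite !Cmod_mult. apply Rmult_le_compat; auto using Cmod_ge_0.
        + apply Rmult_le_pos; apply Cmod_ge_0.
        + apply HMb. unfold ann; lra.
        + apply Rmult_le_compat; auto using Cmod_ge_0.
          * rewrite zpow_nat, Cmod_pow, Hz, M1. lra.
          * eapply Rle_trans; [apply (kernel_bound w1); lra|]. rewrite M1. apply Rmult_le_compat_l; [lra|].
            apply Rinv_le_contravar; [lra|]. rewrite Rabs_left; lra. }
    unfold Rdiv at 1. rewrite Rpow_mult_distr.
    apply Rle_trans with ((/ p1) ^ N * (M * (r1 ^ N * (r1 / (p1 - r1)))))%R; [|right; ring].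
    apply Rmult_le_compat; auto using Cmod_ge_0.
    - apply pow_le. left; apply Rinv_0_lt_compat; lra.
    - apply pow_incr. split; [left; apply Rinv_0_lt_compat; lra|apply Rinv_le_contravar; lra]. }
  lra.
Qed.

Lemma Lsum_zero (c : Z -> C) N (x : C) : (forall n, c n = 0) -> Lsum c N x = 0.
Proof.
  intros H. unfold Lsum. rewrite (Csum_ext _ (fun _ => 0)), (Csum_ext (fun n => c (- _)%Z * _) (fun _ => 0)), !Csum_0.
  - ring.
  - intros; rewrite H; ring.
  - intros; rewrite H; ring.
Qed.

Lemma Laurent_zero r1 r2 f (w x : C) : (0 < r1)%R -> Hol1 r1 r2 f -> ann r1 r2 w -> (r1 < Cmod x < r2)%R ->
  (forall n, lcoef f n w = 0) -> f x = 0.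
Proof.
  intros Hr Hf Hw Hx H. apply C_eq_of_small. intros e He.
  destruct (Laurent_approx r1 r2 f w (Cmod x) (Cmod x) e) as [N HN]; auto; try lra.
  specialize (HN x). rewrite (Lsum_zero (fun n => lcoef f n w)) in HN by auto. apply HN. split; lra.
Qed.

(** All Laurent coefficients can be computed on the circle through [w], where [f] vanishes. *)
Lemma identity_annulus r1 r2 f (w x : C) : (0 < r1)%R -> Hol1 r1 r2 f -> ann r1 r2 w -> (r1 < Cmod x < r2)%R ->
  (forall z, Cmod z = Cmod w -> f z = 0) -> f x = 0.
Proof.
  intros Hr Hf Hw Hx H. eapply Laurent_zero; eauto. intros n. unfold lcoef.
  rewrite (mean_ext _ (fun _ => 0)); [apply mean_const|]. intros z Hz. rewrite H by auto. ring.
Qed.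

Lemma lcoef_sub_const r1 r2 f n (w c : C) : (0 < r1)%R -> Hol1 r1 r2 f -> ann r1 r2 w ->
  lcoef (fun z => f z - c) n w = lcoef f n w - (if Z.eqb n 0 then c else 0).
Proof.
  intros Hr Hf Hw. unfold lcoef.
  assert (w <> 0) by (apply Cmod_nz; destruct Hw; lra).
  rewrite (mean_ext (fun z => (f z - c) * zpow z (- n)) (fun z => f z * zpow z (- n) - c * zpow z (- n)))
    by (intros; ring).
  rewrite mean_sub, mean_scal.
  - f_equal. f_equal. destruct (Z.eqb_spec n 0) as [->|hn].
    + simpl. rewrite mean_const. ring.
    + rewrite mean_zpow by (auto; lia). ring.
  - eapply Hol_circ_ok; eauto. apply Hol1_zpow; auto.
  - eapply Hol_circ_ok; eauto. apply Hol_mul; auto. apply Hol1_zpow; auto.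
  - eapply Hol_circ_ok; eauto. apply Hol_mul; [apply Hol_const|]. apply Hol1_zpow; auto.
Qed.

(* A function invariant under z -> q z has c_n = q^n c_n, hence only a constant term. *)
Lemma periodic_constant r1 r2 f (q w x y : C) : (0 < r1)%R -> Hol1 r1 r2 f -> (0 < Cmod q < 1)%R ->
  ann r1 r2 w -> ann r1 r2 (q * w) -> (forall z, Cmod z = Cmod w -> f (q * z) = f z) ->
  (r1 < Cmod x < r2)%R -> (r1 < Cmod y < r2)%R -> f x = f y.
Proof.
  intros Hr Hf Hq Hw Hqw H Hx Hy.
  assert (Hq0 : q <> 0) by (apply Cmod_nz; lra).
  assert (Hc : forall n, n <> 0%Z -> lcoef f n w = 0).
  { intros n Hn. assert (E : lcoef f n w = zpow q (- n) * lcoef f n w).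
    { rewrite (lcoef_const r1 r2 f n w (q * w)) at 1 by auto. unfold lcoef.
      rewrite <- (mean_dilate q (fun z => f z * zpow z (- n)) w), <- mean_scal.
      - apply mean_ext. intros z Hz. rewrite H, zpow_mult_l by auto. ring.
      - eapply Hol_circ_ok; eauto. apply Hol_mul; auto. apply Hol1_zpow; auto. }
    assert (Hn' : (- n <> 0)%Z) by lia. generalize dependent (- n)%Z. clear Hn. rename n into n0. intros n E Hn.
    assert (Hne : 1 - zpow q n <> 0).
    { intro h. apply Ceq_minus in h. assert (hm : Cmod (zpow q n) = 1%R) by (rewrite <- h; apply Cmod_1).
      destruct (Z_lt_le_dec n 0) as [l|l].
      - replace n with (- Z.of_nat (Z.to_nat (- n)))%Z in hm by lia.
        rewrite zpow_opp, zpow_nat, Cmod_inv, Cmod_pow in hm by (auto; apply Cpow_nz; auto).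
        assert (h2 : (Cmod q ^ Z.to_nat (- n) < 1)%R) by (apply pow_lt_1_compat; [lra|lia]).
        assert (h3 : (0 < Cmod q ^ Z.to_nat (- n))%R) by (apply pow_lt; lra).
        apply Rinv_lt_contravar in h2; [|lra]. rewrite hm in h2. lra.
      - replace n with (Z.of_nat (Z.to_nat n))%Z in hm by lia.
        rewrite zpow_nat, Cmod_pow in hm.
        assert (h2 : (Cmod q ^ Z.to_nat n < 1)%R) by (apply pow_lt_1_compat; [lra|lia]). lra. }
    assert (E2 : (1 - zpow q n) * lcoef f n0 w = 0).
    { replace ((1 - zpow q n) * lcoef f n0 w) with (lcoef f n0 w - zpow q n * lcoef f n0 w) by ring. rewrite <- E. ring. }
    replace (lcoef f n0 w) with (/ (1 - zpow q n) * ((1 - zpow q n) * lcoef f n0 w)) by (field; auto).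
    rewrite E2. ring. }
  assert (P : forall u, (r1 < Cmod u < r2)%R -> f u - lcoef f 0 w = 0).
  { intros u Hu. apply (Laurent_zero r1 r2 (fun z => f z - lcoef f 0 w) w); auto.
    - apply Hol_sub; auto. apply Hol_const.
    - intros n. rewrite (lcoef_sub_const r1 r2) by auto. destruct (Z.eqb_spec n 0) as [->|hn]; [ring|].
      rewrite Hc by auto. ring. }
  replace (f x) with (f x - lcoef f 0 w + lcoef f 0 w) by ring.
  replace (f y) with (f y - lcoef f 0 w + lcoef f 0 w) by ring. rewrite !P by auto. reflexivity.
Qed.

(** * Integrals depending holomorphically on a parameter *)

Fixpoint riemann (h : R -> C) (d : R) (n : nat) : C :=
  match n with O => 0 | S k => riemann h d k + RtoC d * h (INR k * d)%R end.

Lemma riemann_error (h : R -> C) (L d : R) (n : nat) : (0 <= d)%R -> (0 <= L)%R ->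
  (forall s t, (Cmod (h s - h t) <= L * Rabs (s - t))%R) ->
  (Cmod (CRInt h 0 (INR n * d) - riemann h d n) <= INR n * (L * d ^ 2))%R.
Proof.
  intros Hd HL Hh.
  assert (Hc : forall s, @continuous R_UniformSpace C_R_NormedModule h s).
  { intros s. apply continuous_C_R_eps. intros e He. exists (e / (L + 1))%R. split; [apply Rdiv_lt_0_compat; lra|].
    intros t Ht. eapply Rle_lt_trans; [apply Hh|]. apply Rle_lt_trans with ((L + 1) * Rabs (t - s))%R.
    - apply Rmult_le_compat_r; [apply Rabs_pos|lra].
    - replace e with ((L + 1) * (e / (L + 1)))%R by (field; lra). apply Rmult_lt_compat_l; lra. }
  assert (Hex : forall a b, @ex_RInt C_R_NormedModule h a b).
  { intros a b. apply (@ex_RInt_continuous C_R_CompleteNormedModule). auto. }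
  induction n.
  - simpl. rewrite Rmult_0_l. unfold CRInt. rewrite (@RInt_point C_R_CompleteNormedModule).
    change (@zero C_R_CompleteNormedModule) with (RtoC 0). replace (0 - 0) with (RtoC 0) by ring. rewrite Cmod_0. lra.
  - simpl riemann. 
    assert (E : CRInt h 0 (INR (S n) * d) = CRInt h 0 (INR n * d) + CRInt h (INR n * d) (INR (S n) * d)).
    { symmetry. apply (@RInt_Chasles C_R_CompleteNormedModule); apply Hex. }
    rewrite E. set (I0 := CRInt h 0 _) in *. set (I1 := CRInt h _ _).
    replace (I0 + I1 - (riemann h d n + d * h (INR n * d)%R)) with ((I0 - riemann h d n) + (I1 - d * h (INR n * d)%R)) by ring.
    eapply Rle_trans; [apply Cmod_triangle|].
    assert (Q : (Cmod (I1 - d * h (INR n * d)%R) <= d * (L * d))%R).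
    { assert (J := CRInt_correct _ _ _ (Hex (INR n * d)%R (INR (S n) * d)%R)). fold I1 in J.
      assert (Jc := @is_RInt_const C_R_NormedModule (INR n * d) (INR (S n) * d) (h (INR n * d)%R)).
      assert (JJ := @is_RInt_minus C_R_NormedModule _ _ _ _ _ _ J Jc).
      rewrite scal_R_Cmult in JJ.
      replace (INR (S n) * d - INR n * d)%R with d in JJ by (rewrite S_INR; ring).
      apply is_RInt_C_bound with (M := (L * d)%R) in JJ.
      - replace (INR (S n) * d - INR n * d)%R with d in JJ by (rewrite S_INR; ring). exact JJ.
      - rewrite S_INR. nra.
      - intros s Hs. eapply Rle_trans; [apply Hh|]. apply Rmult_le_compat_l; auto.
        rewrite S_INR in Hs. rewrite Rabs_pos_eq; nra. }
    rewrite S_INR. simpl pow in *. lra.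
Qed.

(** For a rational expression in (z, l), a Riemann sum in z is a finite combination of slices in l.
    Its error depends only on the Lipschitz constant, which is the same for all l. *)
Lemma Hol2_mean r1 r2 s1 s2 (Psi : C * C -> C) (w : C) : Hol2 r1 r2 s1 s2 Psi -> ann r1 r2 w ->
  Hol1 s1 s2 (fun l => mean (fun z => Psi (z, l)) w).
Proof.
  intros HP Hw. apply Hol_lim. intros e He.
  destruct (HP (e / 2)%R ltac:(lra)) as (g & Hg & Hpg).
  destruct (Rat_lipschitz gen2 (ann2 r1 r2 s1 s2) (fun x y => Cmod (fst x - fst y) + Cmod (snd x - snd y))%R g)
    as (L & HL & HLip); auto.
  { intros. apply Rplus_le_le_0_compat; apply Cmod_ge_0. }
  { intros g0 [->| ->] x y _ _; assert (h1 := Cmod_ge_0 (fst x - fst y)); assert (h2 := Cmod_ge_0 (snd x - snd y)); lra. }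
  assert (hp := PI2_pos).
  set (K := (L * Cmod w)%R). assert (HK : (0 <= K)%R) by (apply Rmult_le_pos; [lra|apply Cmod_ge_0]).
  (* With n steps of length 2 pi / n the error of the normalised sum is at most 2 pi K / n. *)
  destruct (archimed_cor1 (e / 2 / (2 * PI * K + 1))%R) as (n & Hn1 & Hn).
  { assert (0 <= 2 * PI * K)%R by (apply Rmult_le_pos; lra). apply Rdiv_lt_0_compat; lra. }
  assert (Hn0 : (0 < INR n)%R) by (apply lt_0_INR; auto).
  set (d := (2 * PI / INR n)%R). assert (Hd : (0 < d)%R) by (apply Rdiv_lt_0_compat; lra).
  exists (fun l => RtoC (/ (2 * PI)) * riemann (fun s => g ((w * cis s)%C, l)) d n). split.
  - apply Hol_mul; [apply Hol_const|].
    clear Hn1 Hn Hn0. generalize n at 1. intros m. induction m; simpl; [apply Hol_const|].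
    apply Hol_add; auto. apply Hol_mul; [apply Hol_const|].
    apply (Hol2_slice_l r1 r2); [|apply Rat_Hol; auto].
    eapply ann_circle; eauto. rewrite Cmod_mult, Cmod_cis; ring.
  - intros l Hl.
    assert (E1 : (Cmod (mean (fun z => Psi (z, l)) w - mean (fun z => g (z, l)) w) <= e / 2)%R).
    { apply mean_close with r1 r2; auto.
      - apply (Hol2_slice_r r1 r2 s1 s2 Psi); auto.
      - apply (Hol2_slice_r r1 r2 s1 s2 g); auto. apply Rat_Hol; auto.
      - intros z Hz. apply Hpg. split; auto. }
    assert (E2 : (Cmod (mean (fun z => g (z, l)) w - RtoC (/ (2 * PI)) * riemann (fun s => g ((w * cis s)%C, l)) d n) <= e / 2)%R).
    { unfold mean. assert (R := riemann_error (fun s => g ((w * cis s)%C, l)) K d n (Rlt_le _ _ Hd) HK).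
      replace (INR n * d)%R with (2 * PI)%R in R by (unfold d; field; lra).
      match goal with |- (Cmod (?a * ?x - ?a * ?y) <= _)%R => replace (a * x - a * y) with (a * (x - y)) by ring end.
      rewrite Cmod_mult, Cmod_R, Rabs_pos_eq by (left; apply Rinv_0_lt_compat; lra).
      apply Rle_trans with (/ (2 * PI) * (INR n * (K * d ^ 2)))%R.
      - apply Rmult_le_compat_l; [left; apply Rinv_0_lt_compat; lra|]. apply R.
        intros s t. eapply Rle_trans; [apply HLip|].
        + split; auto. eapply ann_circle; eauto. simpl. rewrite Cmod_mult, Cmod_cis; ring.
        + split; auto. eapply ann_circle; eauto. simpl. rewrite Cmod_mult, Cmod_cis; ring.
        + simpl. replace (l - l) with (RtoC 0) by ring. rewrite Cmod_0, Rplus_0_r.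
          replace (w * cis s - w * cis t) with (w * (cis s - cis t)) by ring. rewrite Cmod_mult.
          unfold K. rewrite Rmult_assoc. apply Rmult_le_compat_l; [lra|]. apply Rmult_le_compat_l; [apply Cmod_ge_0|apply Cmod_cis_sub].
      - unfold d. replace (/ (2 * PI) * (INR n * (K * (2 * PI / INR n) ^ 2)))%R with ((2 * PI * K) * / INR n)%R by (field; lra).
        assert (0 <= 2 * PI * K)%R by (apply Rmult_le_pos; lra).
        apply Rle_trans with (2 * PI * K * (e / 2 / (2 * PI * K + 1)))%R; [apply Rmult_le_compat_l; lra|].
        replace (2 * PI * K * (e / 2 / (2 * PI * K + 1)))%R with (e / 2 * (2 * PI * K / (2 * PI * K + 1)))%R by (field; lra).
        rewrite <- (Rmult_1_r (e / 2)) at 2. apply Rmult_le_compat_l; [lra|]. apply Rle_div_l; lra. }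
    match goal with |- (Cmod (?a - ?b) <= _)%R => replace (a - b) with ((a - mean (fun z => g (z, l)) w) + (mean (fun z => g (z, l)) w - b)) by ring end.
    eapply Rle_trans; [apply Cmod_triangle|]. lra.
Qed.

(** * Infinite products *)

Definition Ccv (u : nat -> C) (l : C) : Prop :=
  forall e, (0 < e)%R -> exists N, forall n, (N <= n)%nat -> (Cmod (u n - l) < e)%R.

Lemma Ccv_CLim (u : nat -> C) (l : C) : Ccv u l -> CLim_seq u = l.
Proof.
  intros H. unfold CLim_seq. apply injective_projections; simpl.
  - rewrite (is_lim_seq_unique _ (Re l)); [reflexivity|]. apply is_lim_seq_spec. intros e.
    destruct (H e (cond_pos e)) as [N HN]. exists N. intros n Hn.
    eapply Rle_lt_trans; [apply (re_le_Cmod (u n - l))|auto].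
  - rewrite (is_lim_seq_unique _ (Im l)); [reflexivity|]. apply is_lim_seq_spec. intros e.
    destruct (H e (cond_pos e)) as [N HN]. exists N. intros n Hn.
    eapply Rle_lt_trans; [|apply (HN n Hn)]. eapply Rle_trans; [|apply Rmax_Cmod].
    apply (Rmax_r (Rabs (fst (u n - l)%C)) (Rabs (snd (u n - l)%C))).
Qed.

Lemma Ccv_unique (u : nat -> C) (l l' : C) : Ccv u l -> Ccv u l' -> l = l'.
Proof. intros H H'. rewrite <- (Ccv_CLim _ _ H). apply Ccv_CLim, H'. Qed.

Lemma Ccv_ext (u v : nat -> C) (l : C) : (exists N, forall n, (N <= n)%nat -> u n = v n) -> Ccv u l -> Ccv v l.
Proof.
  intros [N HN] H e He. destruct (H e He) as [M HM]. exists (N + M)%nat. intros n Hn.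
  rewrite <- HN by lia. apply HM; lia.
Qed.

Lemma Ccv_shift (u : nat -> C) (l : C) : Ccv u l -> Ccv (fun n => u (S n)) l.
Proof. intros H e He. destruct (H e He) as [N HN]. exists N. intros n Hn. apply HN. lia. Qed.

Lemma Ccv_bounded (u : nat -> C) (l : C) : Ccv u l -> exists M N, (0 < M)%R /\ forall n, (N <= n)%nat -> (Cmod (u n) <= M)%R.
Proof.
  intros H. destruct (H 1%R Rlt_0_1) as [N HN]. exists (Cmod l + 1)%R, N. assert (h := Cmod_ge_0 l).
  split; [lra|]. intros n Hn. specialize (HN n Hn). assert (h1 := Cmod_triangle_rev (u n) l). lra.
Qed.

Lemma Ccv_mul (u v : nat -> C) (a b : C) : Ccv u a -> Ccv v b -> Ccv (fun n => u n * v n) (a * b).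
Proof.
  intros Hu Hv e He. destruct (Ccv_bounded _ _ Hv) as (M & N0 & HM & HMb).
  assert (ha := Cmod_ge_0 a).
  destruct (Hu (e / (2 * M))%R) as [N1 HN1]; [apply Rdiv_lt_0_compat; lra|].
  destruct (Hv (e / (2 * (Cmod a + 1)))%R) as [N2 HN2]; [apply Rdiv_lt_0_compat; lra|].
  exists (N0 + N1 + N2)%nat. intros n Hn.
  replace (u n * v n - a * b) with ((u n - a) * v n + a * (v n - b)) by ring.
  eapply Rle_lt_trans; [apply Cmod_triangle|]. rewrite !Cmod_mult.
  specialize (HMb n ltac:(lia)). specialize (HN1 n ltac:(lia)). specialize (HN2 n ltac:(lia)).
  assert (P1 : (Cmod (u n - a) * Cmod (v n) <= e / (2 * M) * M)%R) by (apply Rmult_le_compat; auto using Cmod_ge_0; lra).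
  replace (e / (2 * M) * M)%R with (e / 2)%R in P1 by (field; lra).
  assert (P2 : (Cmod a * Cmod (v n - b) <= Cmod a * (e / (2 * (Cmod a + 1))))%R) by (apply Rmult_le_compat_l; lra).
  assert (P3 : (Cmod a * (e / (2 * (Cmod a + 1))) < e / 2)%R).
  { replace (Cmod a * (e / (2 * (Cmod a + 1))))%R with (e / 2 * (Cmod a / (Cmod a + 1)))%R by (field; lra).
    rewrite <- (Rmult_1_r (e / 2)) at 2. apply Rmult_lt_compat_l; [lra|]. apply Rlt_div_l; lra. }
  lra.
Qed.

Lemma Ccv_inv (u : nat -> C) (a : C) : a <> 0 -> Ccv u a -> Ccv (fun n => / u n) (/ a).
Proof.
  intros Ha Hu e He. assert (hm : (0 < Cmod a)%R) by (apply Cmod_gt_0; auto).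
  assert (Hm : (0 < Rmin (Cmod a / 2) (e * (Cmod a * Cmod a) / 2))%R).
  { apply Rmin_glb_lt; [lra|]. apply Rdiv_lt_0_compat; [|lra]. repeat apply Rmult_lt_0_compat; auto. }
  destruct (Hu _ Hm) as [N HN]. exists N. intros n Hn. specialize (HN n Hn).
  assert (h1 := Rmin_l (Cmod a / 2) (e * (Cmod a * Cmod a) / 2)).
  assert (h2 := Rmin_r (Cmod a / 2) (e * (Cmod a * Cmod a) / 2)).
  assert (h3 := Cmod_triangle_rev a (u n)). rewrite Cmod_sub_sym in h3.
  assert (Hun : u n <> 0) by (apply Cmod_nz; lra).
  replace (/ u n - / a) with (- (u n - a) * (/ u n * / a)) by (field; auto).
  rewrite !Cmod_mult, Cmod_opp, !Cmod_inv by auto.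
  assert (h4 : (/ Cmod (u n) <= / (Cmod a / 2))%R) by (apply Rinv_le_contravar; lra).
  assert (h5 : (0 < / Cmod a)%R) by (apply Rinv_0_lt_compat; auto).
  assert (h6 : (0 < / Cmod (u n))%R) by (apply Rinv_0_lt_compat; lra).
  apply Rle_lt_trans with (Cmod (u n - a) * (/ (Cmod a / 2) * / Cmod a))%R.
  { apply Rmult_le_compat_l; [apply Cmod_ge_0|]. apply Rmult_le_compat_r; lra. }
  apply Rlt_le_trans with (e * (Cmod a * Cmod a) / 2 * (/ (Cmod a / 2) * / Cmod a))%R.
  { apply Rmult_lt_compat_r; [|lra]. apply Rmult_lt_0_compat; auto. apply Rinv_0_lt_compat; lra. }
  right. field. lra.
Qed.

(** The explicit rate is kept because it becomes uniform convergence as soon as K and r do not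
    depend on the parameters. *)
Lemma geometric_Ccv (u : nat -> C) (K r : R) : (0 <= r < 1)%R -> (0 <= K)%R ->
  (forall n, (Cmod (u (S n) - u n) <= K * r ^ n)%R) ->
  Ccv u (CLim_seq u) /\ forall n, (Cmod (u n - CLim_seq u) <= K * r ^ n / (1 - r))%R.
Proof.
  intros Hr HK H.
  assert (P : forall n m, (Cmod (u (n + m)%nat - u n) <= K * r ^ n * (1 - r ^ m) / (1 - r))%R).
  { intros n m. induction m.
    - rewrite Nat.add_0_r. replace (u n - u n) with (RtoC 0) by ring. rewrite Cmod_0. simpl. right. field. lra.
    - replace (n + S m)%nat with (S (n + m)) by lia.
      replace (u (S (n + m)) - u n) with ((u (S (n + m)) - u (n + m)%nat) + (u (n + m)%nat - u n)) by ring.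
      eapply Rle_trans; [apply Cmod_triangle|]. specialize (H (n + m)%nat). rewrite Rdef_pow_add in H.
      apply Rle_trans with (K * (r ^ n * r ^ m) + K * r ^ n * (1 - r ^ m) / (1 - r))%R; [lra|].
      right. simpl. field. lra. }
  assert (P2 : forall n m, (Cmod (u (n + m)%nat - u n) <= K * r ^ n / (1 - r))%R).
  { intros n m. eapply Rle_trans; [apply P|]. unfold Rdiv. apply Rmult_le_compat_r; [left; apply Rinv_0_lt_compat; lra|].
    assert (h1 : (0 <= r ^ m)%R) by (apply pow_le; lra). assert (h2 : (0 <= r ^ n)%R) by (apply pow_le; lra).
    assert (h3 : (0 <= K * r ^ n)%R) by (apply Rmult_le_pos; auto). nra. }
  assert (Hsm : forall e, (0 < e)%R -> exists N, forall n, (N <= n)%nat -> (K * r ^ n / (1 - r) < e)%R).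
  { intros e He. destruct (pow_small r (K / (1 - r)) e Hr) as [N HN]; auto.
    { apply Rdiv_le_0_compat; lra. }
    exists N. intros n Hn. eapply Rle_lt_trans; [|exact HN].
    replace (K * r ^ n / (1 - r))%R with (r ^ n * (K / (1 - r)))%R by (field; lra).
    apply Rmult_le_compat_r; [apply Rdiv_le_0_compat; lra|].
    replace n with (N + (n - N))%nat by lia. rewrite Rdef_pow_add. rewrite <- (Rmult_1_r (r ^ N)) at 2.
    apply Rmult_le_compat_l; [apply pow_le; lra|]. rewrite <- (pow1 (n - N)). apply pow_incr; lra. }
  assert (Hcau : forall e, (0 < e)%R -> exists N, forall n m, (N <= n)%nat -> (N <= m)%nat -> (Cmod (u n - u m) < e)%R).
  { intros e He. destruct (Hsm (e / 2)%R ltac:(lra)) as [N HN]. exists N. intros n m Hn Hm.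
    replace (u n - u m) with ((u n - u N) - (u m - u N)) by ring.
    eapply Rle_lt_trans; [apply Cmod_triangle_sub|].
    assert (h1 := P2 N (n - N)%nat). assert (h2 := P2 N (m - N)%nat). specialize (HN N (Nat.le_refl N)).
    replace (N + (n - N))%nat with n in h1 by lia. replace (N + (m - N))%nat with m in h2 by lia. lra. }
  assert (R1 : ex_finite_lim_seq (fun n => Re (u n))).
  { apply ex_lim_seq_cauchy_corr. intros e. destruct (Hcau e (cond_pos e)) as [N HN]. exists N. intros n m Hn Hm.
    eapply Rle_lt_trans; [apply (re_le_Cmod (u n - u m))|auto]. }
  assert (R2 : ex_finite_lim_seq (fun n => Im (u n))).
  { apply ex_lim_seq_cauchy_corr. intros e. destruct (Hcau e (cond_pos e)) as [N HN]. exists N. intros n m Hn Hm.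
    eapply Rle_lt_trans; [|apply (HN n m Hn Hm)]. eapply Rle_trans; [|apply Rmax_Cmod].
    apply (Rmax_r (Rabs (fst (u n - u m)%C)) (Rabs (snd (u n - u m)%C))). }
  destruct R1 as [a Ha]. destruct R2 as [b Hb].
  assert (Hcv : Ccv u (a, b)).
  { apply is_lim_seq_spec in Ha. apply is_lim_seq_spec in Hb. intros e He.
    assert (He2 : (0 < e / 2)%R) by lra.
    destruct (Ha (mkposreal _ He2)) as [N1 HN1]. destruct (Hb (mkposreal _ He2)) as [N2 HN2].
    exists (N1 + N2)%nat. intros n Hn. specialize (HN1 n ltac:(lia)). specialize (HN2 n ltac:(lia)). simpl in HN1, HN2.
    assert (hm := Cmod_2Rmax (u n - (a, b))%C).
    assert (hmx : (Rmax (Rabs (fst (u n - (a, b))%C)) (Rabs (snd (u n - (a, b))%C)) < e / 2)%R).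
    { apply Rmax_lub_lt; [exact HN1|exact HN2]. }
    assert (hs : (sqrt 2 <= 2)%R).
    { rewrite <- (sqrt_Rsqr 2) at 2 by lra. apply sqrt_le_1_alt. unfold Rsqr; lra. }
    assert (0 <= Rmax (Rabs (fst (u n - (a, b))%C)) (Rabs (snd (u n - (a, b))%C)))%R.
    { eapply Rle_trans; [|apply Rmax_l]. apply Rabs_pos. }
    nra. }
  rewrite (Ccv_CLim _ _ Hcv). split; auto.
  intros n. apply Rnot_lt_le. intros hlt.
  destruct (Hcv (Cmod (u n - (a, b)) - K * r ^ n / (1 - r))%R) as [N HN]; [lra|].
  specialize (HN (n + N)%nat ltac:(lia)). specialize (P2 n N).
  replace (u n - (a, b)) with ((u (n + N)%nat - (a, b)) - (u (n + N)%nat - u n)) in hlt, HN by ring.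
  assert (h := Cmod_triangle_sub (u (n + N)%nat - (a, b)) (u (n + N)%nat - u n)).
  replace (u n - (a, b)) with ((u (n + N)%nat - (a, b)) - (u (n + N)%nat - u n)) in HN by ring.
  lra.
Qed.

(** The bound exp s - 1 makes [s] additive under products ([near1_mul]), so a product of many
    factors is controlled by the sum of their exponents. *)
Definition near1 (a : C) (s : R) : Prop := (Cmod (a - 1) <= exp s - 1)%R.

Lemma near1_mod a s : near1 a s -> (Cmod a <= exp s)%R.
Proof.
  intros H. replace a with (1 + (a - 1)) by ring. eapply Rle_trans; [apply Cmod_triangle|].
  rewrite Cmod_1. unfold near1 in H. lra.
Qed.

Lemma near1_mul a b s t : near1 a s -> near1 b t -> near1 (a * b) (s + t).
Proof.
  intros Ha Hb. assert (h := near1_mod _ _ Ha). unfold near1 in *. replace (a * b - 1) with (a * (b - 1) + (a - 1)) by ring.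
  eapply Rle_trans; [apply Cmod_triangle|]. rewrite Cmod_mult, exp_plus.
  assert (P := Rmult_le_compat _ _ _ _ (Cmod_ge_0 _) (Cmod_ge_0 _) h Hb). lra.
Qed.

Lemma near1_mono a s t : (s <= t)%R -> near1 a s -> near1 a t.
Proof.
  intros Hst H. unfold near1 in *. destruct (Rle_lt_or_eq_dec _ _ Hst) as [h| ->]; auto.
  apply exp_increasing in h. lra.
Qed.

Lemma near1_basic u s : (Cmod u <= s)%R -> near1 (1 - u) s.
Proof.
  intros H. apply near1_mono with (Cmod u); auto. unfold near1. replace (1 - u - 1) with (- u) by ring. rewrite Cmod_opp.
  assert (h := exp_ineq1_le (Cmod u)). lra.
Qed.

Lemma near1_1 : near1 1 0.
Proof. unfold near1. replace (1 - 1) with (RtoC 0) by ring. rewrite Cmod_0, exp_0. lra. Qed.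

Lemma geom_bound (a s : R) n : (0 <= a)%R -> (0 <= s < 1)%R -> (a * (1 - s ^ n) / (1 - s) <= a / (1 - s))%R.
Proof.
  intros Ha Hs. unfold Rdiv. apply Rmult_le_compat_r; [left; apply Rinv_0_lt_compat; lra|].
  assert (0 <= s ^ n)%R by (apply pow_le; lra). nra.
Qed.

Lemma near1_Cprod_geom f (a s : R) n : (0 <= a)%R -> (0 <= s < 1)%R -> (forall i, near1 (f i) (a * s ^ i)) ->
  near1 (Cprod f n) (a / (1 - s)).
Proof.
  intros Ha Hs H. apply near1_mono with (a * (1 - s ^ n) / (1 - s))%R; [apply geom_bound; auto|].
  induction n; simpl.
  - apply near1_mono with 0%R; [|apply near1_1]. right. field. lra.
  - apply near1_mono with (a * (1 - s ^ n) / (1 - s) + a * s ^ n)%R; [right; field; lra|].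
    apply near1_mul; auto.
Qed.

Lemma Cprod_ext f g n : (forall i, (i < n)%nat -> f i = g i) -> Cprod f n = Cprod g n.
Proof. induction n; intros H; simpl; [reflexivity|]. rewrite IHn, H by (intros; auto). reflexivity. Qed.

Lemma Cprod_mul f g n : Cprod (fun i => f i * g i) n = Cprod f n * Cprod g n.
Proof. induction n; simpl; [ring|]. rewrite IHn. ring. Qed.

Lemma Cprod_one n : Cprod (fun _ => 1) n = 1.
Proof. induction n; simpl; [|rewrite IHn]; ring. Qed.

Lemma Cprod_S_l f n : Cprod f (S n) = f O * Cprod (fun i => f (S i)) n.
Proof. induction n; simpl in *; [ring|]. rewrite IHn. ring. Qed.

Lemma Cprod_nz (f : nat -> C) n : (forall i, (i < n)%nat -> f i <> 0) -> Cprod f n <> 0.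
Proof.
  induction n; intros H; simpl; [apply C1_nz|]. apply Cmult_neq_0; auto.
Qed.

Lemma Cprod_inv (f : nat -> C) n : (forall i, (i < n)%nat -> f i <> 0) -> Cprod (fun i => / f i) n = / Cprod f n.
Proof.
  induction n; intros H; simpl.
  - field.
  - rewrite IHn by auto. field. split; [auto|apply Cprod_nz; auto].
Qed.

Lemma Cprod_exchange f n m : Cprod (fun j => Cprod (fun k => f j k) m) n = Cprod (fun k => Cprod (fun j => f j k) n) m.
Proof.
  induction n; simpl.
  - symmetry. apply Cprod_one.
  - rewrite IHn, <- Cprod_mul. reflexivity.
Qed.

Definition sqp (q p x : C) (n : nat) : C := Cprod (fun j => Cprod (fun k => 1 - x * q ^ j * p ^ k) n) n.

(* (x; q, p)_oo; the case q = 0 is (x; p)_oo. *)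
Definition dpoch (q p x : C) : C := CLim_seq (sqp q p x).

(** The L-shaped border between the squares of side n and n + 1, with the corner counted in the
    second product. The square products become ordinary products of borders, each within a geometric
    bound of 1. *)
Definition sqp_border (q p x : C) (n : nat) : C :=
  Cprod (fun j => 1 - x * q ^ j * p ^ n) n * Cprod (fun k => 1 - x * q ^ n * p ^ k) (S n).

Lemma sqp_succ q p x n : sqp q p x (S n) = sqp q p x n * sqp_border q p x n.
Proof.
  unfold sqp, sqp_border. simpl Cprod at 1.
  rewrite (Cprod_mul (fun j => Cprod (fun k => 1 - x * q ^ j * p ^ k) n) (fun j => 1 - x * q ^ j * p ^ n)). simpl. ring.
Qed.

Section Bounds.
Context (q p : C) (r T : R) (Hr : (0 <= r < 1)%R) (Hq : (Cmod q <= r)%R) (Hp : (Cmod p <= r)%R) (HT : (0 <= T)%R).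

Lemma monomial_bound x j k : (Cmod x <= T)%R -> (Cmod (x * q ^ j * p ^ k) <= T * r ^ j * r ^ k)%R.
Proof.
  intros Hx. rewrite !Cmod_mult, !Cmod_pow.
  assert (h1 : (Cmod q ^ j <= r ^ j)%R) by (apply pow_incr; split; [apply Cmod_ge_0|auto]).
  assert (h2 : (Cmod p ^ k <= r ^ k)%R) by (apply pow_incr; split; [apply Cmod_ge_0|auto]).
  assert (h3 : (0 <= Cmod q ^ j)%R) by apply pow_le, Cmod_ge_0.
  assert (h4 : (0 <= Cmod p ^ k)%R) by apply pow_le, Cmod_ge_0.
  apply Rmult_le_compat; auto. apply Rmult_le_pos; auto using Cmod_ge_0.
  apply Rmult_le_compat; auto using Cmod_ge_0.
Qed.

Lemma border_near1 x n : (Cmod x <= T)%R -> near1 (sqp_border q p x n) (2 * T / (1 - r) * r ^ n).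
Proof.
  intros Hx. assert (hp : (0 <= T * r ^ n)%R) by (apply Rmult_le_pos; [auto|apply pow_le; lra]).
  apply near1_mono with (T * r ^ n / (1 - r) + T * r ^ n / (1 - r))%R; [right; field; lra|].
  unfold sqp_border. apply near1_mul; apply near1_Cprod_geom; auto; intros i; apply near1_basic.
  - eapply Rle_trans; [apply monomial_bound; auto|]. right; ring.
  - eapply Rle_trans; [apply monomial_bound; auto|]. right; ring.
Qed.

Lemma sqp_near1 x n : (Cmod x <= T)%R -> near1 (sqp q p x n) (2 * T / (1 - r) / (1 - r)).
Proof.
  intros Hx.
  assert (E : sqp q p x n = Cprod (sqp_border q p x) n).
  { induction n; [reflexivity|]. rewrite sqp_succ, IHn. reflexivity. }
  rewrite E. apply near1_Cprod_geom; auto.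
  - apply Rdiv_le_0_compat; lra.
  - intros i. apply border_near1; auto.
Qed.

Lemma sqp_step : exists K, (0 <= K)%R /\ forall x n, (Cmod x <= T)%R -> (Cmod (sqp q p x (S n) - sqp q p x n) <= K * r ^ n)%R.
Proof.
  set (a := (2 * T / (1 - r))%R). assert (Ha : (0 <= a)%R) by (apply Rdiv_le_0_compat; lra).
  exists (exp (a / (1 - r)) * (a * exp a))%R. split.
  { apply Rmult_le_pos; [left; apply exp_pos|]. apply Rmult_le_pos; auto. left; apply exp_pos. }
  intros x n Hx. rewrite sqp_succ. replace (sqp q p x n * sqp_border q p x n - sqp q p x n) with (sqp q p x n * (sqp_border q p x n - 1)) by ring.
  rewrite Cmod_mult, Rmult_assoc. apply Rmult_le_compat; auto using Cmod_ge_0.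
  - apply near1_mod. apply sqp_near1; auto.
  - eapply Rle_trans; [apply border_near1; auto|]. fold a.
    assert (hr : (0 <= r ^ n)%R) by (apply pow_le; lra).
    assert (hr1 : (r ^ n <= 1)%R) by (rewrite <- (pow1 n); apply pow_incr; lra).
    set (s := (a * r ^ n)%R). assert (hs : (0 <= s <= a)%R) by (unfold s; split; nra).
    replace (a * exp a * r ^ n)%R with (s * exp a)%R by (unfold s; ring).
    assert (h1 : (exp s <= exp a)%R).
    { destruct (Rle_lt_or_eq_dec s a (proj2 hs)) as [h| ->]; [left; apply exp_increasing; auto|lra]. }
    (* From 1 - s <= exp (- s) follows exp s - 1 <= s exp s, which turns the exponential bound for
       the border into a linear one in r^n. *)
    assert (h2 := exp_ineq1_le (- s)). rewrite exp_Ropp in h2.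
    assert (h3 := exp_pos s).
    assert (h4 : (exp s * (1 - s) <= 1)%R).
    { apply Rle_trans with (exp s * / exp s)%R; [apply Rmult_le_compat_l; lra|]. right. field. lra. }
    nra.
Qed.

Lemma sqp_tail_near1 x N n : (Cmod x <= T)%R ->
  exists D, sqp q p x (N + n) = sqp q p x N * D /\ near1 D (2 * T / (1 - r) * r ^ N / (1 - r)).
Proof.
  intros Hx. exists (Cprod (fun i => sqp_border q p x (N + i)) n). split.
  - induction n; simpl; [rewrite Nat.add_0_r; ring|]. rewrite Nat.add_succ_r, sqp_succ, IHn. ring.
  - apply near1_Cprod_geom; auto.
    + apply Rmult_le_pos; [apply Rdiv_le_0_compat; lra|apply pow_le; lra].
    + intros i. rewrite Rmult_assoc, <- Rdef_pow_add. apply border_near1; auto.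
Qed.
End Bounds.

Lemma common_bound (q p : C) : (Cmod q < 1)%R -> (Cmod p < 1)%R ->
  exists r, (0 <= r < 1)%R /\ (Cmod q <= r)%R /\ (Cmod p <= r)%R.
Proof.
  intros Hq Hp. exists (Rmax (Cmod q) (Cmod p)). repeat split.
  - eapply Rle_trans; [apply (Cmod_ge_0 q)|apply Rmax_l].
  - apply Rmax_lub_lt; auto.
  - apply Rmax_l.
  - apply Rmax_r.
Qed.

Lemma dpoch_cv (q p x : C) : (Cmod q < 1)%R -> (Cmod p < 1)%R -> Ccv (sqp q p x) (dpoch q p x).
Proof.
  intros Hq Hp. destruct (common_bound q p Hq Hp) as (r & Hr & H1 & H2).
  destruct (sqp_step q p r (Cmod x) Hr H1 H2 (Cmod_ge_0 x)) as (K & HK & HS).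
  apply (geometric_Ccv (sqp q p x) K r Hr HK). intros n. apply HS. lra.
Qed.

Lemma dpoch_comp_Hol {X} gen (K : X -> Prop) (q p : C) (u : X -> C) : (Cmod q < 1)%R -> (Cmod p < 1)%R ->
  Hol gen K u -> Hol gen K (fun x => dpoch q p (u x)).
Proof.
  intros Hq Hp Hu. destruct (common_bound q p Hq Hp) as (r & Hr & H1 & H2).
  destruct (Hol_bounded _ _ _ Hu) as (T & HT & HTb).
  destruct (sqp_step q p r T Hr H1 H2 (Rlt_le _ _ HT)) as (B & HB & HS).
  apply Hol_lim. intros e He.
  destruct (pow_small r (B / (1 - r)) e Hr) as [N HN]; auto.
  { apply Rdiv_le_0_compat; lra. }
  exists (fun x => sqp q p (u x) N). split.
  - unfold sqp. apply (Hol_Cprod gen K (fun j x => Cprod (fun k => 1 - u x * q ^ j * p ^ k) N)). intros j.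
    apply (Hol_Cprod gen K (fun k x => 1 - u x * q ^ j * p ^ k)). intros k.
    apply Hol_sub; [apply Hol_const|]. repeat apply Hol_mul; auto; apply Hol_const.
  - intros x Hx. rewrite Cmod_sub_sym. destruct (geometric_Ccv (sqp q p (u x)) B r Hr HB) as [_ HH].
    + intros n. apply HS. auto.
    + eapply Rle_trans; [apply HH|]. replace (B * r ^ N / (1 - r))%R with (r ^ N * (B / (1 - r)))%R by (field; lra). lra.
Qed.

Lemma sqp_nz (q p x : C) n : (forall j k, 1 - x * q ^ j * p ^ k <> 0) -> sqp q p x n <> 0.
Proof. intros H. apply Cprod_nz. intros j _. apply Cprod_nz. auto. Qed.

(** Beyond a fixed N the remaining factors multiply to a number within 1/2 of 1, for all |x| <= T at
    once. Hence a zero of the infinite product is a zero of a finite one, and lower bounds follow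
    from finitely many factors. *)
Lemma dpoch_tail (q p : C) (T : R) : (Cmod q < 1)%R -> (Cmod p < 1)%R -> (0 <= T)%R ->
  exists N, forall x : C, (Cmod x <= T)%R -> (Cmod (sqp q p x N) / 2 <= Cmod (dpoch q p x))%R.
Proof.
  intros Hq Hp HT. destruct (common_bound q p Hq Hp) as (r & Hr & H1 & H2).
  (* [near1] with exponent ln (3/2) is the distance 1/2 from 1. *)
  destruct (pow_small r (2 * T / (1 - r) / (1 - r)) (ln (3 / 2)) Hr) as [N HN].
  { repeat apply Rdiv_le_0_compat; lra. }
  { rewrite <- ln_1. apply ln_increasing; lra. }
  exists N. intros x Hx. apply Rnot_lt_le. intros hlt.
  destruct (dpoch_cv q p x Hq Hp (Cmod (sqp q p x N) / 2 - Cmod (dpoch q p x))%R) as [M HM]; [lra|].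
  specialize (HM (N + M)%nat ltac:(lia)).
  destruct (sqp_tail_near1 q p r T Hr H1 H2 HT x N M Hx) as (D & HD & Hn).
  rewrite HD in HM.
  assert (Hs : (Cmod (D - 1) <= 1 / 2)%R).
  { assert (Hn' : near1 D (ln (3 / 2))).
    { eapply near1_mono; [|exact Hn]. apply Rlt_le. eapply Rle_lt_trans; [|exact HN]. right. field. lra. }
    unfold near1 in Hn'. rewrite exp_ln in Hn' by lra. lra. }
  assert (h1 := Cmod_triangle_rev (sqp q p x N * D) (dpoch q p x)).
  assert (h2 : (Cmod (sqp q p x N) / 2 <= Cmod (sqp q p x N * D))%R).
  { rewrite Cmod_mult. assert (h3 := Cmod_triangle_rev 1 (1 - D)). replace (1 - (1 - D)) with D in h3 by ring.
    rewrite Cmod_1 in h3. rewrite (Cmod_sub_sym 1 D) in h3. assert (h4 := Cmod_ge_0 (sqp q p x N)). nra. }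
  lra.
Qed.

Lemma dpoch_nz (q p x : C) : (Cmod q < 1)%R -> (Cmod p < 1)%R -> (forall j k, 1 - x * q ^ j * p ^ k <> 0) ->
  dpoch q p x <> 0.
Proof.
  intros Hq Hp H. destruct (dpoch_tail q p (Cmod x) Hq Hp (Cmod_ge_0 x)) as [N HN].
  specialize (HN x (Rle_refl _)). apply Cmod_nz.
  assert (h : (0 < Cmod (sqp q p x N))%R) by (apply Cmod_gt_0, sqp_nz; auto). lra.
Qed.

Lemma Cmod_pow_le_1 (q : C) n : (Cmod q < 1)%R -> (Cmod (q ^ n) <= 1)%R.
Proof.
  intros Hq. rewrite Cmod_pow, <- (pow1 n). apply pow_incr. split; [apply Cmod_ge_0|lra].
Qed.

Lemma Cprod_lower (f : nat -> C) d n : (0 <= d)%R -> (forall i, (d <= Cmod (f i))%R) -> (d ^ n <= Cmod (Cprod f n))%R.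
Proof.
  intros Hd H. induction n; simpl; [rewrite Cmod_1; lra|]. rewrite Cmod_mult, Rmult_comm.
  apply Rmult_le_compat; auto using pow_le.
Qed.

Lemma dpoch_lower (q p : C) (c : R) : (Cmod q < 1)%R -> (Cmod p < 1)%R -> (0 <= c < 1)%R ->
  exists d, (0 < d)%R /\ forall x : C, (Cmod x <= c)%R -> (d <= Cmod (dpoch q p x))%R.
Proof.
  intros Hq Hp Hc. destruct (dpoch_tail q p c Hq Hp (proj1 Hc)) as [N HN].
  exists (((1 - c) ^ N) ^ N / 2)%R. split.
  - apply Rdiv_lt_0_compat; [|lra]. repeat apply pow_lt; lra.
  - intros x Hx. eapply Rle_trans; [|apply HN; auto].
    assert (h : (((1 - c) ^ N) ^ N <= Cmod (sqp q p x N))%R); [|lra].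
    apply Cprod_lower; [apply pow_le; lra|]. intros j. apply Cprod_lower; [lra|]. intros k.
    eapply Rle_trans; [|apply Cmod_triangle_rev]. rewrite Cmod_1, !Cmod_mult.
    assert (h1 := Cmod_pow_le_1 q j Hq). assert (h2 := Cmod_pow_le_1 p k Hp).
    assert (h3 := Cmod_ge_0 x). assert (h4 := Cmod_ge_0 (q ^ j)). assert (h5 := Cmod_ge_0 (p ^ k)).
    assert (Cmod x * Cmod (q ^ j) <= c)%R by nra.
    assert (0 <= Cmod x * Cmod (q ^ j))%R by (apply Rmult_le_pos; auto). nra.
Qed.

Lemma dpoch_inv_Hol {X} gen (K : X -> Prop) (q p : C) (u : X -> C) c : (Cmod q < 1)%R -> (Cmod p < 1)%R ->
  (0 <= c < 1)%R -> (forall x, K x -> (Cmod (u x) <= c)%R) -> Hol gen K u -> Hol gen K (fun x => / dpoch q p (u x)).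
Proof.
  intros Hq Hp Hc HK Hu. destruct (dpoch_lower q p c Hq Hp Hc) as (d & Hd & Hl).
  apply Hol_inv with d; auto. apply dpoch_comp_Hol; auto.
Qed.

Lemma dpoch_sym (q p x : C) : dpoch q p x = dpoch p q x.
Proof.
  unfold dpoch. unfold CLim_seq.
  assert (E : forall n, sqp q p x n = sqp p q x n).
  { intros n. unfold sqp. rewrite (Cprod_exchange (fun j k => 1 - x * q ^ j * p ^ k)).
    apply Cprod_ext. intros k _. apply Cprod_ext. intros j _. ring. }
  f_equal; f_equal; apply Lim_seq_ext; intros n; rewrite E; reflexivity.
Qed.

Lemma Cmod_0_lt_1 : (Cmod 0 < 1)%R.
Proof. rewrite Cmod_0. lra. Qed.

Lemma sqp_0 (p x : C) n : sqp 0 p x (S n) = Cprod (fun k => 1 - x * p ^ k) (S n).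
Proof.
  unfold sqp. rewrite Cprod_S_l.
  rewrite (Cprod_ext (fun i => Cprod (fun k => 1 - x * 0 ^ S i * p ^ k) (S n)) (fun _ => 1)).
  - rewrite Cprod_one, Cmult_1_r. apply Cprod_ext. intros k _. change (0 ^ 0) with (RtoC 1); ring.
  - intros i _. transitivity (Cprod (fun _ => 1) (S n)); [|apply Cprod_one]. apply Cprod_ext. intros k _. rewrite Cpow_S. ring.
Qed.

Lemma dpoch_rec (q p x : C) : (Cmod q < 1)%R -> (Cmod p < 1)%R ->
  dpoch q p x = dpoch 0 p x * dpoch q p (q * x).
Proof.
  intros Hq Hp.
  (* The square product for q x, read in terms of x, covers the rows 1 to n + 1. Compared with the
     square for x it has the additional last row, which tends to 1. *)
  set (row := fun n => Cprod (fun k => 1 - x * q ^ S n * p ^ k) (S n)).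
  destruct (common_bound q p Hq Hp) as (r & Hr & H1 & H2).
  assert (Hrow : Ccv row 1).
  { intros e He. 
    destruct (pow_small r (Cmod x / (1 - r)) (ln (1 + e)) Hr) as [N HN].
    { apply Rdiv_le_0_compat; [apply Cmod_ge_0|lra]. }
    { rewrite <- ln_1. apply ln_increasing; lra. }
    exists N. intros n Hn.
    assert (Hx0 := Cmod_ge_0 x).
    assert (Hrn : (0 <= r ^ n)%R) by (apply pow_le; lra).
    assert (Hx : (0 <= Cmod x * r ^ n)%R) by (apply Rmult_le_pos; auto).
    assert (Hn1 : near1 (row n) (Cmod x * r ^ n / (1 - r))).
    { apply near1_Cprod_geom; auto. intros k. apply near1_basic.
      eapply Rle_trans; [apply (monomial_bound q p r (Cmod x)); auto; lra|].
      assert (hk : (0 <= r ^ k)%R) by (apply pow_le; lra).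
      apply Rmult_le_compat_r; auto. apply Rmult_le_compat_l; auto. simpl. nra. }
    assert (Hlt : (Cmod x * r ^ n / (1 - r) < ln (1 + e))%R).
    { eapply Rle_lt_trans; [|exact HN]. replace (Cmod x * r ^ n / (1 - r))%R with (r ^ n * (Cmod x / (1 - r)))%R by (field; lra).
      apply Rmult_le_compat_r; [apply Rdiv_le_0_compat; lra|].
      replace n with (N + (n - N))%nat by lia. rewrite Rdef_pow_add. rewrite <- (Rmult_1_r (r ^ N)) at 2.
      apply Rmult_le_compat_l; [apply pow_le; lra|]. rewrite <- (pow1 (n - N)). apply pow_incr; lra. }
    unfold near1 in Hn1. apply exp_increasing in Hlt. rewrite exp_ln in Hlt by lra. lra. }
  assert (A := Ccv_mul _ _ _ _ (Ccv_shift _ _ (dpoch_cv q p x Hq Hp)) Hrow).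
  assert (B := Ccv_mul _ _ _ _ (Ccv_shift _ _ (dpoch_cv 0 p x Cmod_0_lt_1 Hp)) (Ccv_shift _ _ (dpoch_cv q p (q * x) Hq Hp))).
  rewrite Cmult_1_r in A. eapply Ccv_unique; [exact A|]. eapply Ccv_ext; [|exact B].
  exists O. intros n _. cbv beta. rewrite sqp_0. unfold sqp, row.
  rewrite (Cprod_S_l (fun j => Cprod (fun k => 1 - x * q ^ j * p ^ k) (S n)) n).
  change (Cprod (fun j => Cprod (fun k => 1 - q * x * q ^ j * p ^ k) (S n)) (S n)) with
    (Cprod (fun j => Cprod (fun k => 1 - q * x * q ^ j * p ^ k) (S n)) n * Cprod (fun k => 1 - q * x * q ^ n * p ^ k) (S n)).
  rewrite (Cprod_ext (fun k => 1 - x * q ^ 0 * p ^ k) (fun k => 1 - x * p ^ k) (S n)) by (intros; simpl; ring).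
  rewrite (Cprod_ext (fun k => 1 - x * q ^ S n * p ^ k) (fun k => 1 - q * x * q ^ n * p ^ k) (S n)) by (intros; simpl; ring).
  rewrite (Cprod_ext (fun i => Cprod (fun k => 1 - x * q ^ S i * p ^ k) (S n)) (fun j => Cprod (fun k => 1 - q * x * q ^ j * p ^ k) (S n)) n).
  - ring.
  - intros i _. apply Cprod_ext. intros k _. simpl; ring.
Qed.

Lemma dpoch_00 (x : C) : dpoch 0 0 x = 1 - x.
Proof.
  eapply Ccv_unique; [apply Ccv_shift, dpoch_cv; apply Cmod_0_lt_1|].
  intros e He. exists O. intros n _. rewrite sqp_0, Cprod_S_l.
  rewrite (Cprod_ext _ (fun _ => 1)) by (intros; simpl; ring). rewrite Cprod_one.
  replace (_ - _) with (RtoC 0) by (simpl; ring). rewrite Cmod_0. lra.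
Qed.

Notation poch p x := (dpoch 0 p x).

Lemma poch_rec (p x : C) : (Cmod p < 1)%R -> poch p x = (1 - x) * poch p (p * x).
Proof.
  intros Hp. rewrite (dpoch_sym 0 p x), (dpoch_rec p 0 x), dpoch_00, (dpoch_sym p 0); auto using Cmod_0_lt_1.
Qed.

Lemma qpoch_inf_poch (a p : C) : (Cmod p < 1)%R -> qpoch_inf a p = poch p a.
Proof.
  intros Hp. unfold qpoch_inf. apply Ccv_CLim.
  assert (H := dpoch_cv 0 p a Cmod_0_lt_1 Hp). eapply Ccv_ext; [|exact H].
  exists 1%nat. intros [|n] Hn; [lia|]. apply sqp_0.
Qed.

Lemma egamma_dpoch (q p z : C) : (Cmod q < 1)%R -> (Cmod p < 1)%R -> (forall j k, 1 - z * q ^ j * p ^ k <> 0) ->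
  egamma q p z = dpoch q p (p * q / z) / dpoch q p z.
Proof.
  intros Hq Hp Hz. unfold egamma. apply Ccv_CLim. unfold Cdiv at 2.
  eapply Ccv_ext; [|apply Ccv_mul; [apply dpoch_cv; auto|apply Ccv_inv; [apply dpoch_nz; auto|apply dpoch_cv; auto]]].
  exists O. intros n _. cbv beta. unfold sqp.
  rewrite <- (Cprod_inv (fun j => Cprod (fun k => 1 - z * q ^ j * p ^ k) n)), <- Cprod_mul.
  - apply Cprod_ext. intros j _. rewrite <- (Cprod_inv (fun k => 1 - z * q ^ j * p ^ k)), <- Cprod_mul by auto.
    apply Cprod_ext. intros k _. unfold Cdiv. simpl. f_equal. ring.
  - intros j _. apply Cprod_nz. auto.
Qed.

(** * Theta functions *)

Definition theta (p x : C) : C := poch p x * poch p (p / x).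

Lemma theta_p (p x : C) : (0 < Cmod p < 1)%R -> x <> 0 -> theta p (p * x) = - / x * theta p x.
Proof.
  intros Hp Hx. assert (p <> 0) by (apply Cmod_nz; lra). unfold theta.
  replace (p / (p * x)) with (/ x) by (field; auto).
  rewrite (poch_rec p x), (poch_rec p (/ x)) by lra.
  replace (p * / x) with (p / x) by (field; auto). field. auto.
Qed.

Lemma theta_inv (p x : C) : (0 < Cmod p < 1)%R -> x <> 0 -> theta p (/ x) = - / x * theta p x.
Proof.
  intros Hp Hx. rewrite <- theta_p by auto. unfold theta.
  assert (p <> 0) by (apply Cmod_nz; lra).
  replace (p / (p * x)) with (/ x) by (field; auto).
  replace (p / / x) with (p * x) by (field; auto). ring.
Qed.

Lemma theta_div_p (p x : C) : (0 < Cmod p < 1)%R -> x <> 0 -> theta p (x / p) = - (x / p) * theta p x.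
Proof.
  intros Hp Hx. assert (p <> 0) by (apply Cmod_nz; lra).
  assert (x / p <> 0) by (apply Cmult_neq_0; auto; apply Cmod_nz; rewrite Cmod_inv by auto; apply Rinv_0_lt_compat; lra).
  assert (E := theta_p p (x / p) Hp H0). replace (p * (x / p)) with x in E by (field; auto). rewrite E. field. auto.
Qed.

Lemma poch_nz (p x : C) : (Cmod p < 1)%R -> (Cmod x < 1)%R -> poch p x <> 0.
Proof.
  intros Hp Hx. destruct (dpoch_lower 0 p (Cmod x)) as (d & Hd & HH); auto using Cmod_0_lt_1.
  - split; [apply Cmod_ge_0|auto].
  - apply Cmod_nz. specialize (HH x (Rle_refl _)). lra.
Qed.

Lemma theta_nz (p x : C) : (0 < Cmod p < 1)%R -> (Cmod p < Cmod x < 1)%R -> theta p x <> 0.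
Proof.
  intros Hp Hx. assert (x <> 0) by (apply Cmod_nz; lra).
  apply Cmult_neq_0; apply poch_nz; try lra. rewrite Cmod_div by auto. apply Rlt_div_l; lra.
Qed.

Lemma theta_1 (p : C) : (Cmod p < 1)%R -> theta p 1 = 0.
Proof. intros Hp. unfold theta. rewrite poch_rec by auto. ring. Qed.

Lemma theta_Hol {X} gen (K : X -> Prop) (p : C) (u : X -> C) : (Cmod p < 1)%R ->
  Hol gen K u -> Hol gen K (fun x => / u x) -> Hol gen K (fun x => theta p (u x)).
Proof.
  intros Hp Hu Hi. unfold theta. apply Hol_mul; apply dpoch_comp_Hol; auto using Cmod_0_lt_1.
  unfold Cdiv. apply Hol_mul; auto. apply Hol_const.
Qed.

(* The class containing z^-1 prod theta(s_m z) - z^3 prod theta(s_m / z) when s_1 ... s_6 = p;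
   its Laurent coefficients are determined by those of z^2 and z^3. *)
Definition theta_class (p : C) (f : C -> C) : Prop :=
  (forall r1 r2, (0 < r1)%R -> Hol1 r1 r2 f) /\
  (forall z : C, z <> 0 -> f (p * z) = / p ^ 2 * zpow z (-6) * f z) /\
  (forall z : C, z <> 0 -> f (/ z) = - zpow z (-2) * f z).

Lemma theta_class_lin (p a b : C) f g : theta_class p f -> theta_class p g ->
  theta_class p (fun z => a * f z + b * g z).
Proof.
  intros (F1 & F2 & F3) (G1 & G2 & G3). repeat split.
  - intros. apply Hol_add; apply Hol_mul; auto; apply Hol_const.
  - intros z Hz. rewrite F2, G2 by auto. ring.
  - intros z Hz. rewrite F3, G3 by auto. ring.
Qed.

Lemma ann_unit r : (1 <= r)%R -> ann (/ r) r 1.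
Proof.
  intros Hr. unfold ann. rewrite Cmod_1. split; auto. rewrite <- Rinv_1. apply Rinv_le_contravar; lra.
Qed.

(** The coefficient is the same on |z| = |p| as on |z| = 1, and the quasi-periodicity under z -> p z
    turns this equality into a recursion with step 6. *)
Lemma theta_class_shift (p : C) f n : (0 < Cmod p < 1)%R -> theta_class p f ->
  lcoef f (n + 6) 1 = zpow p (n + 2) * lcoef f n 1.
Proof.
  intros Hp (F1 & F2 & F3). assert (p <> 0) by (apply Cmod_nz; lra).
  assert (Hf : Hol1 (Cmod p) 1 f) by (apply F1; lra).
  assert (A1 : ann (Cmod p) 1 1) by (unfold ann; rewrite Cmod_1; lra).
  assert (A2 : ann (Cmod p) 1 (p * 1)) by (unfold ann; rewrite Cmult_1_r; lra).
  rewrite (lcoef_const (Cmod p) 1 f n 1 (p * 1)) by (auto; lra).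
  unfold lcoef. rewrite <- (mean_dilate p (fun z => f z * zpow z (- n)) 1).
  rewrite (mean_ext (fun z => f (p * z) * zpow (p * z) (- n)) (fun z => zpow p (- (n + 2)) * (f z * zpow z (- (n + 6))))).
  - rewrite mean_scal; [rewrite zpow_opp by auto|].
    + field. apply zpow_nz; auto.
    + eapply Hol_circ_ok; eauto. apply Hol_mul; auto. apply Hol1_zpow; lra.
  - intros z Hz. rewrite Cmod_1 in Hz. assert (z <> 0) by (apply Cmod_nz; lra).
    rewrite F2, zpow_mult_l by auto. replace (- (n + 2))%Z with (- n + -2)%Z by lia.
    replace (- (n + 6))%Z with (- n + -6)%Z by lia. rewrite !(zpow_add _ (- n)) by auto.
    change (zpow p (-2)) with ((/ p) ^ 2). rewrite Cpow_inv by auto. ring.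
Qed.

(** The inversion z -> 1/z preserves the unit circle and exchanges the exponents n and 2 - n. *)
Lemma theta_class_reflect (p : C) f n : theta_class p f -> lcoef f (2 - n) 1 = - lcoef f n 1.
Proof.
  intros (F1 & F2 & F3). assert (Hf : Hol1 1 1 f) by (apply F1; lra).
  assert (A1 : ann 1 1 1) by (unfold ann; rewrite Cmod_1; lra).
  assert (I1 : / RtoC 1 = 1) by field.
  unfold lcoef. rewrite <- I1 at 2. rewrite <- (mean_inv (fun z => f z * zpow z (- n))).
  - rewrite (mean_ext (fun z => f (/ z) * zpow (/ z) (- n)) (fun z => (- (1)) * (f z * zpow z (- (2 - n))))).
    + rewrite mean_scal; [ring|]. eapply Hol_circ_ok; eauto. apply Hol_mul; auto. apply Hol1_zpow; lra.
    + intros z Hz. rewrite Cmod_1 in Hz. assert (z <> 0) by (apply Cmod_nz; lra).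
      rewrite F3 by auto. replace (- (2 - n))%Z with (-2 + n)%Z by lia. rewrite zpow_add by auto.
      replace (zpow (/ z) (- n)) with (zpow z n); [ring|].
      rewrite zpow_opp by (apply Cmod_nz; rewrite Cmod_inv, Hz by auto; lra).
      assert (E : zpow z n * zpow (/ z) n = 1).
      { rewrite <- zpow_mult_l. replace (z * / z) with (RtoC 1) by (field; auto).
        destruct n; simpl; [reflexivity|apply Cpow_1_l|rewrite I1; apply Cpow_1_l]. }
      assert (zpow (/ z) n <> 0). { intro h. rewrite h in E. apply C1_nz. rewrite <- E. ring. }
      replace (/ zpow (/ z) n) with (/ zpow (/ z) n * (zpow z n * zpow (/ z) n)) by (rewrite E; ring). field. auto.
  - apply C1_nz.
  - rewrite I1. eapply Hol_circ_ok; eauto. apply Hol_mul; auto. apply Hol1_zpow; lra.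
Qed.

Lemma C_eq_opp_0 (x : C) : x = - x -> x = 0.
Proof.
  intros H. assert (E : RtoC 2 * x = 0).
  { replace (RtoC 2 * x) with (x + x) by ring. rewrite H at 1. ring. }
  replace x with (/ RtoC 2 * (RtoC 2 * x)); [rewrite E; ring|]. field.
Qed.

(** The shift propagates a zero along each residue class mod 6. The reflection pairs 0 with 2 and -1
    with 3 and makes the coefficient of z the negative of itself. The same happens for z^4, because
    the shift with multiplier p^0 gives c_4 = c_(-2) while the reflection gives c_(-2) = - c_4. So
    the class is at most two-dimensional. *)
Lemma theta_class_zero (p : C) f : (0 < Cmod p < 1)%R -> theta_class p f -> lcoef f 2 1 = 0 -> lcoef f 3 1 = 0 ->
  forall z : C, z <> 0 -> f z = 0.
Proof.
  intros Hp Hf H2 H3 z Hz. assert (p <> 0) by (apply Cmod_nz; lra).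
  assert (up : forall n, lcoef f n 1 = 0 -> forall k, lcoef f (n + 6 * k) 1 = 0).
  { intros n Hn. apply Z.bi_induction.
    - intros ? ? ->; reflexivity.
    - rewrite Z.mul_0_r, Z.add_0_r. exact Hn.
    - intros k. replace (n + 6 * Z.succ k)%Z with ((n + 6 * k) + 6)%Z by lia.
      rewrite (theta_class_shift p f (n + 6 * k) Hp Hf). split; intros h.
      + rewrite h. ring.
      + assert (hz := zpow_nz p (n + 6 * k + 2) H).
        replace (lcoef f (n + 6 * k) 1) with (/ zpow p (n + 6 * k + 2) * (zpow p (n + 6 * k + 2) * lcoef f (n + 6 * k) 1)) by (field; auto).
        rewrite h. ring. }
  assert (H0 : lcoef f 0 1 = 0).
  { assert (E := theta_class_reflect p f 2 Hf). simpl in E. rewrite E, H2. ring. }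
  assert (H5 : lcoef f (-1) 1 = 0).
  { assert (E := theta_class_reflect p f 3 Hf). simpl in E. rewrite E, H3. ring. }
  assert (H1 : lcoef f 1 1 = 0).
  { apply C_eq_opp_0. apply (theta_class_reflect p f 1 Hf). }
  assert (H4 : lcoef f 4 1 = 0).
  { apply C_eq_opp_0. assert (E := theta_class_reflect p f 4 Hf). simpl in E. rewrite <- E.
    assert (E2 := theta_class_shift p f (-2) Hp Hf). simpl in E2. rewrite E2. ring. }
  assert (Hm : (0 < Cmod z)%R) by (apply Cmod_gt_0; auto).
  set (R := (Cmod z + / Cmod z + 1)%R).
  assert (Hi : (0 < / Cmod z)%R) by (apply Rinv_0_lt_compat; auto).
  assert (HR : (1 <= R)%R) by (unfold R; lra).
  apply (Laurent_zero (/ R) R f 1).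
  - apply Rinv_0_lt_compat; lra.
  - apply (proj1 Hf). apply Rinv_0_lt_compat; lra.
  - apply ann_unit; auto.
  - split; [|unfold R; lra]. rewrite <- (Rinv_inv (Cmod z)). apply Rinv_lt_contravar; [apply Rmult_lt_0_compat; lra|unfold R; lra].
  - intros n. assert (E := Z.div_mod n 6 ltac:(lia)). assert (B := Z.mod_pos_bound n 6 ltac:(lia)).
    rewrite E, Z.add_comm. 
    assert (C6 : (n mod 6 = 0 \/ n mod 6 = 1 \/ n mod 6 = 2 \/ n mod 6 = 3 \/ n mod 6 = 4 \/ n mod 6 = 5)%Z) by lia.
    destruct C6 as [h|[h|[h|[h|[h|h]]]]]; rewrite h; auto.
    replace (5 + 6 * (n / 6))%Z with (-1 + 6 * (n / 6 + 1))%Z by lia. auto.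
Qed.

Lemma lcoef_lin (a b : C) f g n : Hol1 1 1 f -> Hol1 1 1 g ->
  lcoef (fun z => a * f z + b * g z) n 1 = a * lcoef f n 1 + b * lcoef g n 1.
Proof.
  intros Hf Hg. unfold lcoef.
  assert (A1 : ann 1 1 1) by (unfold ann; rewrite Cmod_1; lra).
  rewrite (mean_ext _ (fun z => a * (f z * zpow z (- n)) + b * (g z * zpow z (- n)))) by (intros; ring).
  rewrite mean_add, !mean_scal; auto; eapply Hol_circ_ok; eauto; repeat apply Hol_mul; auto;
    try apply Hol_const; apply Hol1_zpow; lra.
Qed.

Lemma Cmult_cancel (a x : C) : a <> 0 -> a * x = 0 -> x = 0.
Proof. intros Ha H. replace x with (/ a * (a * x)) by (field; auto). rewrite H. ring. Qed.

(** Lagrange interpolation in a space of dimension at most 2: g vanishes at u and h at v, so they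
    form a basis, and f is recovered from its values at u and v. *)
Lemma theta_class_interp (p : C) f g h (u v : C) : (0 < Cmod p < 1)%R ->
  theta_class p f -> theta_class p g -> theta_class p h -> u <> 0 -> v <> 0 ->
  g u = 0 -> h v = 0 -> g v <> 0 -> h u <> 0 ->
  forall z : C, z <> 0 -> f z * (g v * h u) = g z * f v * h u + h z * f u * g v.
Proof.
  intros Hp Hf Hg Hh Hu Hv Gu Hhv Gv Hhu z Hz.
  assert (Kf : Hol1 1 1 f) by (apply (proj1 Hf); lra).
  assert (Kg : Hol1 1 1 g) by (apply (proj1 Hg); lra).
  assert (Kh : Hol1 1 1 h) by (apply (proj1 Hh); lra).
  set (a1 := lcoef f 2 1). set (b1 := lcoef f 3 1).
  set (a2 := lcoef g 2 1). set (b2 := lcoef g 3 1).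
  set (a3 := lcoef h 2 1). set (b3 := lcoef h 3 1).
  assert (Z2 : forall a b, a * a2 + b * a3 = 0 -> a * b2 + b * b3 = 0 -> a = 0 /\ b = 0).
  { intros a b E1 E2.
    assert (Q : forall x : C, x <> 0 -> a * g x + b * h x = 0).
    { apply (theta_class_zero p (fun x => a * g x + b * h x) Hp).
      - apply theta_class_lin; auto.
      - rewrite lcoef_lin by auto. exact E1.
      - rewrite lcoef_lin by auto. exact E2. }
    split.
    - apply (Cmult_cancel (g v)); auto. assert (Q1 := Q v Hv). rewrite Hhv in Q1. rewrite <- Q1. ring.
    - apply (Cmult_cancel (h u)); auto. assert (Q1 := Q u Hu). rewrite Gu in Q1. rewrite <- Q1. ring. }
  set (D := a2 * b3 - a3 * b2).
  (* A vanishing determinant of the coefficients of z^2 and z^3 would give a nontrivial combination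
     of g and h that is zero, and evaluation at u and v excludes this. *)
  assert (HD : D <> 0).
  { intros HD. destruct (Z2 a3 (- a2)) as [h3 h2]; [ring| |].
    { replace (a3 * b2 + - a2 * b3) with (- D) by (unfold D; ring). rewrite HD; ring. }
    destruct (Z2 b3 (- b2)) as [k3 k2]; [|ring|].
    { replace (b3 * a2 + - b2 * a3) with D by (unfold D; ring). exact HD. }
    destruct (Z2 1 0) as [hh _].
    - assert (h2' : a2 = 0) by (replace a2 with (- - a2) by ring; rewrite h2; ring). rewrite h2'. ring.
    - assert (k2' : b2 = 0) by (replace b2 with (- - b2) by ring; rewrite k2; ring). rewrite k2'. ring.
    - apply C1_nz; auto. }
  assert (Q : forall x : C, x <> 0 -> D * f x + 1 * (- (a1 * b3 - a3 * b1) * g x + - (a2 * b1 - a1 * b2) * h x) = 0).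
  { apply (theta_class_zero p (fun x => D * f x + 1 * (- (a1 * b3 - a3 * b1) * g x + - (a2 * b1 - a1 * b2) * h x)) Hp).
    - apply theta_class_lin; auto. apply theta_class_lin; auto.
    - rewrite !lcoef_lin; auto.
      + fold a1 a2 a3. unfold D. ring.
      + apply Hol_add; apply Hol_mul; auto; apply Hol_const.
    - rewrite !lcoef_lin; auto.
      + fold b1 b2 b3. unfold D. ring.
      + apply Hol_add; apply Hol_mul; auto; apply Hol_const. }
  set (al := a1 * b3 - a3 * b1) in *. set (be := a2 * b1 - a1 * b2) in *.
  assert (Qz := Q z Hz). assert (Qu := Q u Hu). assert (Qv := Q v Hv). rewrite Gu in Qu. rewrite Hhv in Qv.
  assert (Eu : D * f u = be * h u) by (apply Ceq_minus; rewrite <- Qu; ring).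
  assert (Ev : D * f v = al * g v) by (apply Ceq_minus; rewrite <- Qv; ring).
  assert (Ez : D * f z = al * g z + be * h z) by (apply Ceq_minus; rewrite <- Qz; ring).
  apply Ceq_minus. apply (Cmult_cancel D); auto.
  replace (D * (f z * (g v * h u) - (g z * f v * h u + h z * f u * g v))) with
    ((D * f z) * (g v * h u) - g z * (D * f v) * h u - h z * (D * f u) * g v) by ring.
  rewrite Eu, Ev, Ez. ring.
Qed.

Lemma Cinv_nz (x : C) : x <> 0 -> / x <> 0.
Proof. intros H h. assert (E := Cinv_r x H). rewrite h in E. apply C1_nz. rewrite <- E. ring. Qed.

Lemma Cdiv_nz (x y : C) : x <> 0 -> y <> 0 -> x / y <> 0.
Proof. intros Hx Hy. apply Cmult_neq_0; auto. apply Cinv_nz; auto. Qed.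

Lemma Cm1_nz : - (1) <> 0.
Proof. apply Cmod_nz. rewrite Cmod_m1. apply Rlt_0_1. Qed.

Ltac nz := repeat match goal with
  | |- Cmult _ _ <> _ => apply Cmult_neq_0
  | |- Cinv _ <> _ => apply Cinv_nz
  | |- Cdiv _ _ <> _ => apply Cdiv_nz
  end; try assumption; try apply C1_nz.

Definition prod6 (f : C -> C) (a b c d e g : C) : C := f a * f b * f c * f d * f e * f g.

Lemma theta_mul_p (p s z : C) : (0 < Cmod p < 1)%R -> s <> 0 -> z <> 0 ->
  theta p (s * (p * z)) = - / (s * z) * theta p (s * z).
Proof.
  intros Hp Hs Hz. replace (s * (p * z)) with (p * (s * z)) by ring. apply theta_p; auto. nz.
Qed.

Lemma theta_div_mul_p (p s z : C) : (0 < Cmod p < 1)%R -> s <> 0 -> z <> 0 ->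
  theta p (s / (p * z)) = - (s / (p * z)) * theta p (s / z).
Proof.
  intros Hp Hs Hz. assert (p <> 0) by (apply Cmod_nz; lra).
  replace (s / (p * z)) with (s / z / p) at 1 by (field; auto).
  rewrite theta_div_p by (auto; apply Cdiv_nz; auto). field. auto.
Qed.

(** Under z -> p z the two products acquire the factors 1 / (s_1 ... s_6 z^6) and s_1 ... s_6 / (p
    z)^6. The balancing condition s_1 ... s_6 = p makes them agree once the prefactors z^-1 and z^3
    are counted. *)
Lemma theta_class_prod6 (p s1 s2 s3 s4 s5 s6 : C) : (0 < Cmod p < 1)%R ->
  s1 <> 0 -> s2 <> 0 -> s3 <> 0 -> s4 <> 0 -> s5 <> 0 -> s6 <> 0 -> s1 * s2 * s3 * s4 * s5 * s6 = p ->
  theta_class p (fun z => / z * prod6 (fun s => theta p (s * z)) s1 s2 s3 s4 s5 s6 -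
    z ^ 3 * prod6 (fun s => theta p (s / z)) s1 s2 s3 s4 s5 s6).
Proof.
  intros Hp H1 H2 H3 H4 H5 H6 E. assert (Hp0 : p <> 0) by (apply Cmod_nz; lra).
  assert (HT : forall (s : C) r1 r2, (0 < r1)%R -> s <> 0 -> Hol1 r1 r2 (fun z => theta p (s * z))).
  { intros s r1 r2 Hr Hs. apply theta_Hol; [lra| |].
    - apply Hol_mul; [apply Hol_const|apply Hol1_id].
    - apply Hol_ext with (fun z => / s * / z).
      + intros z [Hz _]. assert (z <> 0) by (apply Cmod_nz; lra). field. auto.
      + apply Hol_mul; [apply Hol_const|apply Hol1_inv; auto]. }
  assert (HU : forall (s : C) r1 r2, (0 < r1)%R -> s <> 0 -> Hol1 r1 r2 (fun z => theta p (s / z))).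
  { intros s r1 r2 Hr Hs. apply theta_Hol; [lra| |].
    - apply Hol_mul; [apply Hol_const|apply Hol1_inv; auto].
    - apply Hol_ext with (fun z => / s * z).
      + intros z [Hz _]. assert (z <> 0) by (apply Cmod_nz; lra). field. auto.
      + apply Hol_mul; [apply Hol_const|apply Hol1_id]. }
  repeat split.
  - intros r1 r2 Hr. unfold prod6. apply Hol_sub.
    + hol; auto.
    + hol; auto.
  - intros z Hz. unfold prod6. rewrite !theta_mul_p, !theta_div_mul_p by auto.
    change (zpow z (-6)) with ((/ z) ^ 6). rewrite Cpow_inv by auto.
    generalize (theta p (s1 * z)) (theta p (s2 * z)) (theta p (s3 * z)) (theta p (s4 * z)) (theta p (s5 * z)) (theta p (s6 * z)).
    generalize (theta p (s1 / z)) (theta p (s2 / z)) (theta p (s3 / z)) (theta p (s4 / z)) (theta p (s5 / z)) (theta p (s6 / z)).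
    clear HT HU Hp. subst p. intros. field. repeat split; auto.
  - intros z Hz. unfold prod6.
    assert (EE : forall s, s * / z = s / z) by reflexivity. rewrite !EE.
    assert (E2 : forall s, s / / z = s * z) by (intros; field; auto). rewrite !E2.
    change (zpow z (-2)) with ((/ z) ^ 2). rewrite !Cpow_inv by auto. field. auto.
Qed.

Lemma theta_class_pair (p s : C) : (0 < Cmod p < 1)%R -> s <> 0 ->
  theta_class p (fun z => theta p (z * z) * (theta p (s * z) * theta p (s / z))).
Proof.
  intros Hp Hs. assert (Hp0 : p <> 0) by (apply Cmod_nz; lra).
  repeat split.
  - intros r1 r2 Hr. apply Hol_mul; [|apply Hol_mul]; apply theta_Hol; try lra.
    + apply Hol_mul; apply Hol1_id.
    + apply Hol_ext with (fun z => / z * / z).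
      * intros z [Hz _]. assert (z <> 0) by (apply Cmod_nz; lra). field. auto.
      * apply Hol_mul; apply Hol1_inv; auto.
    + apply Hol_mul; [apply Hol_const|apply Hol1_id].
    + apply Hol_ext with (fun z => / s * / z).
      * intros z [Hz _]. assert (z <> 0) by (apply Cmod_nz; lra). field. auto.
      * apply Hol_mul; [apply Hol_const|apply Hol1_inv; auto].
    + apply Hol_mul; [apply Hol_const|apply Hol1_inv; auto].
    + apply Hol_ext with (fun z => / s * z).
      * intros z [Hz _]. assert (z <> 0) by (apply Cmod_nz; lra). field. auto.
      * apply Hol_mul; [apply Hol_const|apply Hol1_id].
  - intros z Hz. rewrite (theta_mul_p p s z), (theta_div_mul_p p s z) by auto.
    replace (p * z * (p * z)) with (p * z * (p * z)) by ring.
    rewrite (theta_mul_p p (p * z) z) by (auto; nz).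
    replace (p * z * z) with (z * (p * z)) by ring. rewrite (theta_mul_p p z z) by auto.
    change (zpow z (-6)) with ((/ z) ^ 6). rewrite Cpow_inv by auto. field. auto.
  - intros z Hz. replace (/ z * / z) with (/ (z * z)) by (field; auto).
    rewrite theta_inv by (auto; nz). replace (s / / z) with (s * z) by (field; auto).
    change (s * / z) with (s / z). change (zpow z (-2)) with ((/ z) ^ 2). rewrite !Cpow_inv by auto. field. auto.
Qed.

(** Interpolation at s_1 and s_6. The basis functions of [theta_class_pair] for s_1 and s_6 vanish
    there because theta(1) = 0. For the same reason one of the two six-fold products on the left
    drops out at each node. *)
Lemma theta_id (p s1 s2 s3 s4 s5 s6 z : C) : (0 < Cmod p < 1)%R ->
  s1 <> 0 -> s2 <> 0 -> s3 <> 0 -> s4 <> 0 -> s5 <> 0 -> s6 <> 0 -> s1 * s2 * s3 * s4 * s5 * s6 = p ->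
  theta p (s1 * s1) <> 0 -> theta p (s6 * s6) <> 0 -> theta p (s1 * s6) <> 0 -> theta p (s1 / s6) <> 0 -> z <> 0 ->
  s6 * theta p (s1 / s6) *
  (/ z * prod6 (fun s => theta p (s * z)) s1 s2 s3 s4 s5 s6 -
    z ^ 3 * prod6 (fun s => theta p (s / z)) s1 s2 s3 s4 s5 s6) =
  theta p (z * z) * (theta p (s1 * z) * theta p (s1 / z) * (theta p (s2 * s6) * theta p (s3 * s6) * theta p (s4 * s6) * theta p (s5 * s6)) -
    theta p (s6 * z) * theta p (s6 / z) * (theta p (s1 * s2) * theta p (s1 * s3) * theta p (s1 * s4) * theta p (s1 * s5))).
Proof.
  intros Hp H1 H2 H3 H4 H5 H6 E N11 N66 N16 N1d6 Hz.
  assert (Hone : theta p 1 = 0) by (apply theta_1; lra).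
  assert (D1 : s1 / s1 = 1) by (field; auto). assert (D6 : s6 / s6 = 1) by (field; auto).
  assert (Hk : theta p (s6 / s1) = - (s6 / s1) * theta p (s1 / s6)).
  { replace (s6 / s1) with (/ (s1 / s6)) at 1 by (field; auto). rewrite theta_inv by (auto; apply Cdiv_nz; auto). field. auto. }
  assert (N6d1 : theta p (s6 / s1) <> 0).
  { rewrite Hk. apply Cmult_neq_0; auto. replace (- (s6 / s1)) with ((- (1)) * (s6 / s1)) by ring.
    apply Cmult_neq_0; [|apply Cdiv_nz; auto]. apply Cmod_nz. rewrite Cmod_m1. lra. }
  assert (N61 : theta p (s6 * s1) <> 0) by (rewrite Cmult_comm; auto).
  assert (Q := theta_class_interp p _ _ _ s1 s6 Hp (theta_class_prod6 p s1 s2 s3 s4 s5 s6 Hp H1 H2 H3 H4 H5 H6 E)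
    (theta_class_pair p s1 Hp H1) (theta_class_pair p s6 Hp H6) H1 H6).
  cbv beta in Q. rewrite D1, D6, Hone in Q.
  specialize (Q ltac:(ring) ltac:(ring) ltac:(nz) ltac:(nz) z Hz).
  unfold prod6 in *. rewrite D1, D6, Hone, Hk, (Cmult_comm s6 s1) in Q.
  rewrite (Cmult_comm s2 s1), (Cmult_comm s3 s1), (Cmult_comm s4 s1), (Cmult_comm s5 s1) in Q.
  apply Ceq_minus. apply (Cmult_cancel (theta p (s1 * s1) * theta p (s6 * s6) * (theta p (s1 * s6) * theta p (s1 * s6)) * theta p (s1 / s6) * / s1)).
  { nz. }
  apply Ceq_minus in Q. rewrite <- (Cmult_0_r (- (1))). rewrite <- Q.
  generalize (theta p (s1 * z)) (theta p (s2 * z)) (theta p (s3 * z)) (theta p (s4 * z)) (theta p (s5 * z)) (theta p (s6 * z)).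
  generalize (theta p (s1 / z)) (theta p (s2 / z)) (theta p (s3 / z)) (theta p (s4 / z)) (theta p (s5 / z)) (theta p (s6 / z)).
  intros. field. auto.
Qed.

(** * Gamma functions and the symmetric kernel *)

Definition Gam (q p x : C) : C := dpoch q p (p * q / x) * / dpoch q p x.
(** The reciprocal gamma function, kept as a product of its own because it is regular at the poles
    of [Gam] and its regularity is governed by p q / x instead of x. *)
Definition iGam (q p x : C) : C := dpoch q p x * / dpoch q p (p * q / x).

Lemma dpoch_nz_small (q p x : C) : (Cmod q < 1)%R -> (Cmod p < 1)%R -> (Cmod x < 1)%R -> dpoch q p x <> 0.
Proof.
  intros Hq Hp Hx. destruct (dpoch_lower q p (Cmod x) Hq Hp) as (d & Hd & HH).
  - split; [apply Cmod_ge_0|auto].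
  - apply Cmod_nz. specialize (HH x (Rle_refl _)). lra.
Qed.

Lemma dpoch_theta (q p x : C) : (0 < Cmod q < 1)%R -> (0 < Cmod p < 1)%R -> x <> 0 ->
  dpoch q p x * dpoch q p (p / x) = theta p x * (dpoch q p (q * x) * dpoch q p (p * q / x)).
Proof.
  intros Hq Hp Hx. rewrite (dpoch_rec q p x), (dpoch_rec q p (p / x)) by lra. unfold theta.
  replace (q * (p / x)) with (p * q / x) by (field; auto). ring.
Qed.

Lemma Gam_q (q p x : C) : (0 < Cmod q < 1)%R -> (0 < Cmod p < 1)%R -> x <> 0 ->
  dpoch q p x <> 0 -> Gam q p (q * x) = theta p x * Gam q p x.
Proof.
  intros Hq Hp Hx HE. assert (q <> 0) by (apply Cmod_nz; lra).
  assert (HE2 : dpoch q p (q * x) <> 0).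
  { intro h. apply HE. rewrite dpoch_rec, h by lra. ring. }
  unfold Gam. replace (p * q / (q * x)) with (p / x) by (field; auto).
  assert (E := dpoch_theta q p x Hq Hp Hx).
  replace (theta p x * (dpoch q p (p * q / x) * / dpoch q p x)) with
    (theta p x * (dpoch q p (q * x) * dpoch q p (p * q / x)) * / dpoch q p x * / dpoch q p (q * x)) by (field; auto).
  rewrite <- E. field. auto.
Qed.

Lemma iGam_q (q p x : C) : (0 < Cmod q < 1)%R -> (0 < Cmod p < 1)%R -> x <> 0 ->
  dpoch q p (p / x) <> 0 -> iGam q p (q * x) * theta p x = iGam q p x.
Proof.
  intros Hq Hp Hx HE. assert (q <> 0) by (apply Cmod_nz; lra).
  assert (HE2 : dpoch q p (p * q / x) <> 0).
  { intro h. apply HE. rewrite dpoch_rec by lra. replace (q * (p / x)) with (p * q / x) by (field; auto). rewrite h. ring. }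
  unfold iGam. replace (p * q / (q * x)) with (p / x) by (field; auto).
  assert (E := dpoch_theta q p x Hq Hp Hx).
  replace (dpoch q p (q * x) * / dpoch q p (p / x) * theta p x) with
    (theta p x * (dpoch q p (q * x) * dpoch q p (p * q / x)) * / dpoch q p (p / x) * / dpoch q p (p * q / x)) by (field; auto).
  rewrite <- E. field. auto.
Qed.

(** This is 1 / (Gamma(z^2) Gamma(z^-2)) with the quotients cancelled ([iGam_Vfac]), hence
    holomorphic on the whole punctured plane. *)
Definition Vfac (q p z : C) : C :=
  poch p (z * z) * poch p (/ (z * z)) * (poch q (q * (z * z)) * poch q (q / (z * z))).

Lemma Vfac_theta (q p z : C) : (Cmod q < 1)%R -> (Cmod p < 1)%R -> z <> 0 ->
  Vfac q p z = theta p (z * z) * theta q (/ (z * z)).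
Proof.
  intros Hq Hp Hz. unfold Vfac, theta. rewrite (poch_rec p (/ (z * z))), (poch_rec q (/ (z * z))) by auto.
  replace (q / / (z * z)) with (q * (z * z)) by (field; auto).
  change (p * / (z * z)) with (p / (z * z)). change (q * / (z * z)) with (q / (z * z)). ring.
Qed.

Definition GG (q p t z : C) : C := Gam q p (t * z) * Gam q p (t / z).

Definition Ker (q p t1 t2 t3 t4 t5 t6 z : C) : C :=
  Vfac q p z * prod6 (fun t => GG q p t z) t1 t2 t3 t4 t5 t6.

Definition pairs6 (f : C -> C) (a b c d e g : C) : C :=
  (f (a * b) * f (a * c) * f (a * d) * f (a * e) * f (a * g)) *
  (f (b * c) * f (b * d) * f (b * e) * f (b * g)) *
  (f (c * d) * f (c * e) * f (c * g)) * (f (d * e) * f (d * g)) * f (e * g).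

Definition F6 (q p t1 t2 t3 t4 t5 t6 : C) : C :=
  mean (Ker q p t1 t2 t3 t4 t5 t6) 1 * pairs6 (iGam q p) t1 t2 t3 t4 t5 t6.

(** The term with z^-1 on the left of [theta_id], multiplied by theta(z^-2; q) and by the gamma
    factors of the kernel. The term with z^3 then becomes the same function at 1/z. *)
Definition gaux (q p s1 s2 s3 s4 s5 s6 z : C) : C :=
  / z * theta q (/ (z * z)) * prod6 (fun s => Gam q p (q * s * z) * Gam q p (s / z)) s1 s2 s3 s4 s5 s6.

Lemma Gam_Hol {X} gen (K : X -> Prop) (q p : C) (u : X -> C) c : (Cmod q < 1)%R -> (Cmod p < 1)%R ->
  (0 <= c < 1)%R -> (forall x, K x -> (Cmod (u x) <= c)%R) -> Hol gen K u -> Hol gen K (fun x => / u x) ->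
  Hol gen K (fun x => Gam q p (u x)).
Proof.
  intros. unfold Gam. apply Hol_mul.
  - apply dpoch_comp_Hol; auto. unfold Cdiv. apply Hol_mul; auto. apply Hol_const.
  - apply dpoch_inv_Hol with c; auto.
Qed.

Lemma iGam_Hol {X} gen (K : X -> Prop) (q p : C) (u : X -> C) c : (Cmod q < 1)%R -> (Cmod p < 1)%R ->
  (0 <= c < 1)%R -> (forall x, K x -> (Cmod (p * q / u x) <= c)%R) -> Hol gen K u -> Hol gen K (fun x => / u x) ->
  Hol gen K (fun x => iGam q p (u x)).
Proof.
  intros. unfold iGam. apply Hol_mul.
  - apply dpoch_comp_Hol; auto.
  - apply dpoch_inv_Hol with c; auto. unfold Cdiv. apply Hol_mul; auto. apply Hol_const.
Qed.

Lemma gaux_antisym (q p s1 s2 s3 s4 s5 s6 z : C) : (0 < Cmod q < 1)%R -> z <> 0 ->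
  gaux q p s1 s2 s3 s4 s5 s6 (/ (q * z)) = - gaux q p s1 s2 s3 s4 s5 s6 z.
Proof.
  intros Hq Hz. assert (q <> 0) by (apply Cmod_nz; lra). unfold gaux, prod6.
  assert (A : forall s, q * s * / (q * z) = s / z) by (intros; field; auto).
  assert (B : forall s, s / / (q * z) = q * s * z) by (intros; field; auto).
  rewrite !A, !B.
  replace (/ (/ (q * z) * / (q * z))) with ((q * z) * (q * z)) by (field; auto).
  rewrite (theta_mul_p q (q * z) z) by (auto; nz).
  replace (q * z * z) with (z * (q * z)) by ring. rewrite (theta_mul_p q z z) by auto.
  replace (theta q (z * z)) with (- (z * z) * theta q (/ (z * z))).
  - field. auto.
  - replace (theta q (z * z)) with (theta q (/ / (z * z))) by (f_equal; field; auto).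
    rewrite theta_inv with (x := / (z * z)) by (auto; apply Cinv_nz; nz). field. auto.
Qed.

(** The function is regular for 1 <= |z| <= 1/|q|, and z -> 1/(q z) exchanges the two bounding
    circles. By [gaux_antisym] the mean equals its own negative. *)
Lemma mean_gaux (q p s1 s2 s3 s4 s5 s6 : C) : (0 < Cmod q < 1)%R -> (0 < Cmod p < 1)%R ->
  (0 < Cmod s1 < 1)%R -> (0 < Cmod s2 < 1)%R -> (0 < Cmod s3 < 1)%R -> (0 < Cmod s4 < 1)%R -> (0 < Cmod s5 < 1)%R -> (0 < Cmod s6 < 1)%R ->
  Hol1 1 1 (gaux q p s1 s2 s3 s4 s5 s6) /\ mean (gaux q p s1 s2 s3 s4 s5 s6) 1 = 0.
Proof.
  intros Hq Hp H1 H2 H3 H4 H5 H6. assert (Hq0 : q <> 0) by (apply Cmod_nz; lra).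
  assert (Hiq : (1 < / Cmod q)%R) by (rewrite <- Rinv_1; apply Rinv_lt_contravar; lra).
  assert (HH : Hol1 1 (/ Cmod q) (gaux q p s1 s2 s3 s4 s5 s6)).
  { assert (HG : forall s, (0 < Cmod s < 1)%R -> Hol1 1 (/ Cmod q) (fun z => Gam q p (q * s * z) * Gam q p (s / z))).
    { intros s Hs. assert (s <> 0) by (apply Cmod_nz; lra). apply Hol_mul; apply Gam_Hol with (Cmod s); try lra.
      - intros z [Hz1 Hz2]. rewrite !Cmod_mult. replace (Cmod s) with (Cmod q * Cmod s * / Cmod q)%R at 2 by (field; lra).
        apply Rmult_le_compat_l; auto. apply Rmult_le_pos; lra.
      - apply Hol_mul; [apply Hol_const|apply Hol1_id].
      - apply Hol_ext with (fun z => / (q * s) * / z).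
        + intros z [Hz _]. assert (z <> 0) by (apply Cmod_nz; lra). field. auto.
        + apply Hol_mul; [apply Hol_const|apply Hol1_inv; lra].
      - intros z [Hz1 Hz2]. assert (z <> 0) by (apply Cmod_nz; lra). rewrite Cmod_div by auto.
        apply Rle_div_l; [lra|]. nra.
      - apply Hol_mul; [apply Hol_const|apply Hol1_inv; lra].
      - apply Hol_ext with (fun z => / s * z).
        + intros z [Hz _]. assert (z <> 0) by (apply Cmod_nz; lra). field. auto.
        + apply Hol_mul; [apply Hol_const|apply Hol1_id]. }
    unfold gaux, prod6. assert (Ht : Hol1 1 (/ Cmod q) (fun z => theta q (/ (z * z)))).
    { apply theta_Hol; [lra| |].
      + apply Hol_ext with (fun z => / z * / z).
        * intros z [Hz _]. assert (z <> 0) by (apply Cmod_nz; lra). field. auto.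
        * apply Hol_mul; apply Hol1_inv; lra.
      + apply Hol_ext with (fun z => z * z).
        * intros z [Hz _]. assert (z <> 0) by (apply Cmod_nz; lra). field. auto.
        * apply Hol_mul; apply Hol1_id. }
    assert (K1 := HG _ H1). assert (K2 := HG _ H2). assert (K3 := HG _ H3). assert (K4 := HG _ H4). assert (K5 := HG _ H5). assert (K6 := HG _ H6).
    repeat match goal with
      | H : Hol _ _ ?f |- Hol _ _ ?f => exact H
      | |- Hol _ _ (fun z => / z) => apply Hol1_inv; lra
      | |- Hol _ _ (fun x => @?f x * @?g x) => apply (Hol_mul _ _ f g)
      end. }
  assert (H11 : Hol1 1 1 (gaux q p s1 s2 s3 s4 s5 s6)) by (apply Hol1_sub with 1%R (/ Cmod q)%R; auto; lra).
  split; auto. set (g := gaux q p s1 s2 s3 s4 s5 s6) in *.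
  assert (Aiq : ann 1 (/ Cmod q) (/ q)) by (unfold ann; rewrite Cmod_inv by auto; lra).
  assert (A1 : ann 1 (/ Cmod q) 1) by (unfold ann; rewrite Cmod_1; lra).
  apply C_eq_opp_0.
  assert (E1 : mean (fun z => g (/ (q * z))) 1 = mean g 1).
  { rewrite (mean_dilate q (fun y => g (/ y)) 1), Cmult_1_r.
    rewrite (mean_inv g q); [|exact Hq0|exact (Hol_circ_ok _ _ _ _ HH Aiq)].
    exact (Hol_mean_const 1 (/ Cmod q) g (/ q) 1 Rlt_0_1 HH Aiq A1). }
  rewrite <- E1 at 1.
  rewrite (mean_ext _ (fun z => (- (1)) * g z)).
  - rewrite mean_scal; [ring|]. exact (Hol_circ_ok _ _ _ _ HH A1).
  - intros z Hz. rewrite Cmod_1 in Hz. unfold g. rewrite gaux_antisym by (auto; apply Cmod_nz; lra). ring.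
Qed.

(** * The parameter dependence on the unit circle *)

(** Replacing s by q s multiplies the kernel by theta(s z) theta(s / z). After this the difference
    is the right side of [theta_id] times common gamma factors, and the left side splits into [gaux]
    at z and at 1/z. *)
Lemma Ker_difference (q p s1 s2 s3 s4 s5 s6 z : C) : (0 < Cmod q < 1)%R -> (0 < Cmod p < 1)%R ->
  (0 < Cmod s1 < 1)%R -> (0 < Cmod s2 < 1)%R -> (0 < Cmod s3 < 1)%R -> (0 < Cmod s4 < 1)%R -> (0 < Cmod s5 < 1)%R -> (0 < Cmod s6 < 1)%R ->
  s1 * s2 * s3 * s4 * s5 * s6 = p ->
  theta p (s1 * s1) <> 0 -> theta p (s6 * s6) <> 0 -> theta p (s1 * s6) <> 0 -> theta p (s1 / s6) <> 0 -> Cmod z = 1%R ->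
  Ker q p (q * s1) s2 s3 s4 s5 s6 z * (theta p (s2 * s6) * theta p (s3 * s6) * theta p (s4 * s6) * theta p (s5 * s6)) -
  Ker q p s1 s2 s3 s4 s5 (q * s6) z * (theta p (s1 * s2) * theta p (s1 * s3) * theta p (s1 * s4) * theta p (s1 * s5)) =
  s6 * theta p (s1 / s6) * (gaux q p s1 s2 s3 s4 s5 s6 z + gaux q p s1 s2 s3 s4 s5 s6 (/ z)).
Proof.
  intros Hq Hp H1 H2 H3 H4 H5 H6 E N11 N66 N16 N1d6 Hz.
  assert (Hz0 : z <> 0) by (apply Cmod_nz; lra).
  assert (Hn : forall s : C, (0 < Cmod s < 1)%R -> s <> 0) by (intros; apply Cmod_nz; lra).
  assert (A1 : forall s, (0 < Cmod s < 1)%R -> Gam q p (q * s * z) = theta p (s * z) * Gam q p (s * z)).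
  { intros s Hs. rewrite <- Cmult_assoc. apply Gam_q; auto; nz; auto.
    apply dpoch_nz_small; try lra. rewrite Cmod_mult, Hz. lra. }
  assert (A2 : forall s, (0 < Cmod s < 1)%R -> Gam q p (q * s / z) = theta p (s / z) * Gam q p (s / z)).
  { intros s Hs. replace (q * s / z) with (q * (s / z)) by (field; auto). apply Gam_q; auto; nz; auto.
    apply dpoch_nz_small; try lra. rewrite Cmod_div, Hz by auto. lra. }
  assert (B2 : forall s, q * s * / z = q * s / z) by reflexivity.
  assert (B3 : forall s, s / / z = s * z) by (intros; field; auto).
  assert (T := theta_id p s1 s2 s3 s4 s5 s6 z Hp (Hn _ H1) (Hn _ H2) (Hn _ H3) (Hn _ H4) (Hn _ H5) (Hn _ H6) E N11 N66 N16 N1d6 Hz0).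
  unfold Ker, gaux, GG. rewrite (Vfac_theta q p z) by (auto; lra). unfold prod6 in *.
  rewrite !B2, !B3. rewrite !A1, !A2 by auto.
  replace (/ (/ z * / z)) with (z * z) by (field; auto). replace (/ / z) with z by (field; auto).
  replace (theta q (z * z)) with (- (z * z) * theta q (/ (z * z))).
  2: { replace (theta q (z * z)) with (theta q (/ / (z * z))) by (f_equal; field; auto).
    rewrite theta_inv with (x := / (z * z)) by (auto; nz). field. auto. }
  set (TQ := theta q (/ (z * z))).
  transitivity (TQ * ((Gam q p (s1 * z) * Gam q p (s1 / z)) * (Gam q p (s2 * z) * Gam q p (s2 / z)) * (Gam q p (s3 * z) * Gam q p (s3 / z)) *
     (Gam q p (s4 * z) * Gam q p (s4 / z)) * (Gam q p (s5 * z) * Gam q p (s5 / z)) * (Gam q p (s6 * z) * Gam q p (s6 / z))) *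
     (theta p (z * z) * (theta p (s1 * z) * theta p (s1 / z) * (theta p (s2 * s6) * theta p (s3 * s6) * theta p (s4 * s6) * theta p (s5 * s6)) -
       theta p (s6 * z) * theta p (s6 / z) * (theta p (s1 * s2) * theta p (s1 * s3) * theta p (s1 * s4) * theta p (s1 * s5))))).
  - ring.
  - rewrite <- T. ring.
Qed.

Lemma GG_Hol1 (q p t : C) r1 r2 c : (Cmod q < 1)%R -> (Cmod p < 1)%R -> (0 < r1)%R -> t <> 0 ->
  (c < 1)%R -> (Cmod t * r2 <= c)%R -> (Cmod t / r1 <= c)%R -> Hol1 r1 r2 (fun z => GG q p t z).
Proof.
  intros Hq Hp Hr Ht Hc1 H1 H2. assert (Ht0 := Cmod_ge_0 t).
  assert (Hc0 : (0 <= c)%R) by (eapply Rle_trans; [|exact H2]; apply Rdiv_le_0_compat; lra).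
  assert (E1 : Hol1 r1 r2 (fun z => / (t * z))).
  { apply Hol_ext with (fun z => / t * / z); [|hol].
    intros z [Hz _]. assert (z <> 0) by (apply Cmod_nz; lra). field. auto. }
  assert (E2 : Hol1 r1 r2 (fun z => / (t / z))).
  { apply Hol_ext with (fun z => / t * z); [|hol].
    intros z [Hz _]. assert (z <> 0) by (apply Cmod_nz; lra). field. auto. }
  unfold GG. apply Hol_mul; apply Gam_Hol with c; auto; try (unfold Cdiv; hol; fail).
  - intros z [Hz1 Hz2]. rewrite Cmod_mult. eapply Rle_trans; [|exact H1]. apply Rmult_le_compat_l; auto.
  - intros z [Hz1 Hz2]. rewrite Cmod_div by (apply Cmod_nz; lra). eapply Rle_trans; [|exact H2].
    apply Rmult_le_compat_l; auto. apply Rinv_le_contravar; auto.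
Qed.

Lemma Vfac_Hol1 (q p : C) r1 r2 : (Cmod q < 1)%R -> (Cmod p < 1)%R -> (0 < r1)%R -> Hol1 r1 r2 (fun z => Vfac q p z).
Proof.
  intros Hq Hp Hr.
  assert (E1 : Hol1 r1 r2 (fun z => / (z * z))).
  { apply Hol_ext with (fun z => / z * / z); [|hol].
    intros z [Hz _]. assert (z <> 0) by (apply Cmod_nz; lra). field. auto. }
  unfold Vfac. apply (Hol_mul gen1 (ann r1 r2)); apply (Hol_mul gen1 (ann r1 r2)); apply dpoch_comp_Hol; auto using Cmod_0_lt_1; hol.
Qed.

Lemma Ker_circ_ok (q p t1 t2 t3 t4 t5 t6 : C) : (Cmod q < 1)%R -> (Cmod p < 1)%R ->
  (0 < Cmod t1 < 1)%R -> (0 < Cmod t2 < 1)%R -> (0 < Cmod t3 < 1)%R -> (0 < Cmod t4 < 1)%R -> (0 < Cmod t5 < 1)%R -> (0 < Cmod t6 < 1)%R ->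
  circ_ok (Ker q p t1 t2 t3 t4 t5 t6) 1.
Proof.
  intros Hq Hp H1 H2 H3 H4 H5 H6.
  assert (HG : forall t, (0 < Cmod t < 1)%R -> Hol1 1 1 (fun z => GG q p t z)).
  { intros t Ht. apply GG_Hol1 with (Cmod t); try lra; try (apply Cmod_nz; lra). }
  assert (HV := Vfac_Hol1 q p 1 1 Hq Hp Rlt_0_1).
  apply Hol_circ_ok with 1%R 1%R; [|unfold ann; rewrite Cmod_1; lra].
  assert (K1 := HG _ H1). assert (K2 := HG _ H2). assert (K3 := HG _ H3). assert (K4 := HG _ H4). assert (K5 := HG _ H5). assert (K6 := HG _ H6).
  unfold Ker, prod6. hol.
Qed.

Lemma theta_nz_low (p x : C) : (0 < Cmod p < 1)%R -> (Cmod p ^ 2 < Cmod x < Cmod p)%R -> theta p x <> 0.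
Proof.
  intros Hp Hx. assert (p <> 0) by (apply Cmod_nz; lra).
  assert (x <> 0) by (apply Cmod_nz; nra).
  replace x with (p * (x / p)) by (field; auto). rewrite theta_p by (auto; nz). apply Cmult_neq_0.
  - replace (- / (x / p)) with ((- (1)) * / (x / p)) by ring. nz. apply Cm1_nz.
  - apply theta_nz; auto. rewrite Cmod_div by auto. split; [apply Rlt_div_r|apply Rlt_div_l]; try lra.
Qed.

(** The mean of [Ker_difference] is zero, and the theta factors that weight the two kernels are
    absorbed by the functional equation [iGam_q] of the prefactor. The bound on s_1 ... s_5 places
    the arguments of the theta functions in annuli where they have no zeros. *)
Lemma F6_shift (q p s1 s2 s3 s4 s5 s6 : C) : (0 < Cmod q < 1)%R -> (0 < Cmod p < 1)%R ->
  (0 < Cmod s1 < 1)%R -> (0 < Cmod s2 < 1)%R -> (0 < Cmod s3 < 1)%R -> (0 < Cmod s4 < 1)%R -> (0 < Cmod s5 < 1)%R -> (0 < Cmod s6 < 1)%R ->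
  s1 * s2 * s3 * s4 * s5 * s6 = p -> (Cmod p < Cmod (s1 * s2 * s3 * s4 * s5) ^ 2)%R ->
  F6 q p (q * s1) s2 s3 s4 s5 s6 = F6 q p s1 s2 s3 s4 s5 (q * s6).
Proof.
  intros Hq Hp H1 H2 H3 H4 H5 H6 E HB.
  assert (Hn : forall s : C, (0 < Cmod s < 1)%R -> s <> 0) by (intros; apply Cmod_nz; lra).
  assert (n1 := Hn _ H1). assert (n2 := Hn _ H2). assert (n3 := Hn _ H3). assert (n4 := Hn _ H4). assert (n5 := Hn _ H5). assert (n6 := Hn _ H6).
  assert (EB : (Cmod (s1 * s2 * s3 * s4 * s5) * Cmod s6 = Cmod p)%R) by (rewrite <- E, !Cmod_mult; ring).
  set (B := Cmod (s1 * s2 * s3 * s4 * s5)) in *.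
  assert (EB2 : B = (Cmod s1 * Cmod (s2 * s3 * s4 * s5))%R) by (unfold B; rewrite !Cmod_mult; ring).
  assert (HB1 : (Cmod (s2 * s3 * s4 * s5) < 1)%R).
  { rewrite !Cmod_mult. assert (Cmod s2 * Cmod s3 < 1)%R by nra. assert (0 < Cmod s2 * Cmod s3)%R by nra.
    assert (Cmod s2 * Cmod s3 * Cmod s4 < 1)%R by nra. assert (0 < Cmod s2 * Cmod s3 * Cmod s4)%R by nra. nra. }
  assert (HB0 : (0 < Cmod (s2 * s3 * s4 * s5))%R).
  { apply Cmod_gt_0. nz. }
  assert (HBp : (0 < B < 1)%R) by (rewrite EB2; split; [apply Rmult_lt_0_compat; lra|nra]).
  assert (HBs : (B < Cmod s1)%R) by (rewrite EB2; nra).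
  assert (N11 : theta p (s1 * s1) <> 0) by (apply theta_nz; auto; rewrite Cmod_mult; nra).
  (* With B = |s_1 ... s_5| one has |s_6| = |p| / B, so B^2 > |p| gives |s_6|^2 < |p|: this argument
     lies in the second annulus |p|^2 < |x| < |p|. *)
  assert (N66 : theta p (s6 * s6) <> 0).
  { assert (Hs6 : (Cmod p < Cmod s6)%R) by nra.
    apply theta_nz_low; auto. rewrite Cmod_mult. split; [nra|]. apply Rnot_le_lt. intros hle.
    assert (hB : (0 < B ^ 2)%R) by (apply pow_lt; lra).
    assert (h1 : (Cmod p * B ^ 2 <= Cmod s6 * Cmod s6 * B ^ 2)%R) by (apply Rmult_le_compat_r; lra).
    replace (Cmod s6 * Cmod s6 * B ^ 2)%R with ((B * Cmod s6) * (B * Cmod s6))%R in h1 by ring.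
    rewrite EB in h1. assert (h2 : (Cmod p * Cmod p < Cmod p * B ^ 2)%R) by (apply Rmult_lt_compat_l; lra). lra. }
  assert (Hpair : forall x y : C, (0 < Cmod x < 1)%R -> (0 < Cmod y < 1)%R -> (Cmod p < Cmod x * Cmod y)%R -> theta p (x * y) <> 0).
  { intros x y Hx Hy Hxy. apply theta_nz; auto. rewrite Cmod_mult. split; nra. }
  assert (N16 : theta p (s1 * s6) <> 0) by (apply Hpair; auto; nra).
  assert (N61 : theta p (s6 / s1) <> 0).
  { apply theta_nz; auto. rewrite Cmod_div by auto. split; [apply Rlt_div_r|apply Rlt_div_l]; try lra; nra. }
  assert (N1d6 : theta p (s1 / s6) <> 0).
  { replace (s1 / s6) with (/ (s6 / s1)) by (field; auto). rewrite theta_inv by (auto; nz).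
    apply Cmult_neq_0; auto. replace (- / (s6 / s1)) with ((- (1)) * / (s6 / s1)) by ring. nz. apply Cm1_nz. }
  (* The remaining four parameters have a product of modulus below 1, so |x y| exceeds |p|. *)
  assert (P2 : forall x y u v w k : C, (0 < Cmod x < 1)%R -> (0 < Cmod y < 1)%R -> (0 < Cmod u < 1)%R -> (0 < Cmod v < 1)%R -> (0 < Cmod w < 1)%R -> (0 < Cmod k < 1)%R ->
     x * y * u * v * w * k = p -> theta p (x * y) <> 0).
  { intros x y u v w k Hx Hy Hu Hv Hw Hk Ep. apply Hpair; auto. rewrite <- Ep, !Cmod_mult.
    assert (Cmod u * Cmod v < 1)%R by nra. assert (0 < Cmod u * Cmod v)%R by nra.
    assert (Cmod u * Cmod v * Cmod w < 1)%R by nra. assert (0 < Cmod u * Cmod v * Cmod w)%R by nra.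
    assert (Cmod u * Cmod v * Cmod w * Cmod k < 1)%R by nra. assert (0 < Cmod x * Cmod y)%R by nra. nra. }
  assert (M12 : theta p (s1 * s2) <> 0) by (apply (P2 s1 s2 s3 s4 s5 s6); auto).
  assert (M13 : theta p (s1 * s3) <> 0) by (apply (P2 s1 s3 s2 s4 s5 s6); auto; rewrite <- E; ring).
  assert (M14 : theta p (s1 * s4) <> 0) by (apply (P2 s1 s4 s2 s3 s5 s6); auto; rewrite <- E; ring).
  assert (M15 : theta p (s1 * s5) <> 0) by (apply (P2 s1 s5 s2 s3 s4 s6); auto; rewrite <- E; ring).
  assert (M26 : theta p (s2 * s6) <> 0) by (apply (P2 s2 s6 s1 s3 s4 s5); auto; rewrite <- E; ring).
  assert (M36 : theta p (s3 * s6) <> 0) by (apply (P2 s3 s6 s1 s2 s4 s5); auto; rewrite <- E; ring).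
  assert (M46 : theta p (s4 * s6) <> 0) by (apply (P2 s4 s6 s1 s2 s3 s5); auto; rewrite <- E; ring).
  assert (M56 : theta p (s5 * s6) <> 0) by (apply (P2 s5 s6 s1 s2 s3 s4); auto; rewrite <- E; ring).
  assert (Q : mean (Ker q p (q * s1) s2 s3 s4 s5 s6) 1 * (theta p (s2 * s6) * theta p (s3 * s6) * theta p (s4 * s6) * theta p (s5 * s6)) =
     mean (Ker q p s1 s2 s3 s4 s5 (q * s6)) 1 * (theta p (s1 * s2) * theta p (s1 * s3) * theta p (s1 * s4) * theta p (s1 * s5))).
  { set (P6 := theta p (s2 * s6) * _ * _ * _). set (P1 := theta p (s1 * s2) * _ * _ * _).
    assert (Hqs : forall s : C, (0 < Cmod s < 1)%R -> (0 < Cmod (q * s) < 1)%R) by (intros; rewrite Cmod_mult; nra).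
    assert (O1 : circ_ok (Ker q p (q * s1) s2 s3 s4 s5 s6) 1) by (apply Ker_circ_ok; auto; lra).
    assert (O2 : circ_ok (Ker q p s1 s2 s3 s4 s5 (q * s6)) 1) by (apply Ker_circ_ok; auto; lra).
    destruct (mean_gaux q p s1 s2 s3 s4 s5 s6) as [G1 G2]; auto.
    assert (A1 : ann 1 1 1) by (unfold ann; rewrite Cmod_1; lra).
    assert (I1 : / RtoC 1 = 1) by field.
    assert (O3 : circ_ok (gaux q p s1 s2 s3 s4 s5 s6) 1) by (eapply Hol_circ_ok; eauto).
    assert (G3 : Hol1 1 1 (fun z => gaux q p s1 s2 s3 s4 s5 s6 (/ z))).
    { apply (Hol_comp gen1 (ann 1 1) gen1 (ann 1 1) _ (fun z => / z)); auto.
      - intros z Hz. assert (Cmod z = 1%R) by (destruct Hz; lra). unfold ann. rewrite Cmod_inv, H by (apply Cmod_nz; lra). rewrite Rinv_1; lra.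
      - intros f ->. apply Hol1_inv; lra. }
    assert (O4 : circ_ok (fun z => gaux q p s1 s2 s3 s4 s5 s6 (/ z)) 1) by (eapply Hol_circ_ok; eauto).
    apply Ceq_minus. rewrite (Cmult_comm _ P6), (Cmult_comm _ P1), <- !mean_scal, <- mean_sub.
    - rewrite (mean_ext _ (fun z => s6 * theta p (s1 / s6) * (gaux q p s1 s2 s3 s4 s5 s6 z + gaux q p s1 s2 s3 s4 s5 s6 (/ z)))).
      + rewrite mean_scal, mean_add, G2.
        * rewrite mean_inv, I1, G2; [ring|apply C1_nz|rewrite I1; auto].
        * auto.
        * auto.
        * eapply Hol_circ_ok; [|exact A1]. apply Hol_add; auto.
      + intros z Hz. rewrite Cmod_1 in Hz. rewrite <- Ker_difference by auto. fold P1 P6. ring.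
    - destruct O1 as [l Hl]. exists (P6 * l). apply is_RInt_Cmult. exact Hl.
    - destruct O2 as [l Hl]. exists (P1 * l). apply is_RInt_Cmult. exact Hl.
    - auto.
    - auto. }
  assert (IQ : forall x y u v w k : C, (0 < Cmod x < 1)%R -> (0 < Cmod y < 1)%R -> (0 < Cmod u < 1)%R -> (0 < Cmod v < 1)%R -> (0 < Cmod w < 1)%R -> (0 < Cmod k < 1)%R ->
     x * y * u * v * w * k = p -> iGam q p (q * (x * y)) * theta p (x * y) = iGam q p (x * y)).
  { intros x y u v w k Hx Hy Hu Hv Hw Hk Ep. assert (nx := Hn _ Hx). assert (ny := Hn _ Hy).
    apply iGam_q; auto; nz. apply dpoch_nz_small; try lra.
    replace (p / (x * y)) with (u * v * w * k) by (rewrite <- Ep; field; auto). rewrite !Cmod_mult.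
    assert (Cmod u * Cmod v < 1)%R by nra. assert (0 < Cmod u * Cmod v)%R by nra.
    assert (Cmod u * Cmod v * Cmod w < 1)%R by nra. assert (0 < Cmod u * Cmod v * Cmod w)%R by nra. nra. }
  assert (J12 := IQ s1 s2 s3 s4 s5 s6 ltac:(auto) ltac:(auto) ltac:(auto) ltac:(auto) ltac:(auto) ltac:(auto) E).
  assert (J13 := IQ s1 s3 s2 s4 s5 s6 ltac:(auto) ltac:(auto) ltac:(auto) ltac:(auto) ltac:(auto) ltac:(auto) ltac:(rewrite <- E; ring)).
  assert (J14 := IQ s1 s4 s2 s3 s5 s6 ltac:(auto) ltac:(auto) ltac:(auto) ltac:(auto) ltac:(auto) ltac:(auto) ltac:(rewrite <- E; ring)).
  assert (J15 := IQ s1 s5 s2 s3 s4 s6 ltac:(auto) ltac:(auto) ltac:(auto) ltac:(auto) ltac:(auto) ltac:(auto) ltac:(rewrite <- E; ring)).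
  assert (J26 := IQ s2 s6 s1 s3 s4 s5 ltac:(auto) ltac:(auto) ltac:(auto) ltac:(auto) ltac:(auto) ltac:(auto) ltac:(rewrite <- E; ring)).
  assert (J36 := IQ s3 s6 s1 s2 s4 s5 ltac:(auto) ltac:(auto) ltac:(auto) ltac:(auto) ltac:(auto) ltac:(auto) ltac:(rewrite <- E; ring)).
  assert (J46 := IQ s4 s6 s1 s2 s3 s5 ltac:(auto) ltac:(auto) ltac:(auto) ltac:(auto) ltac:(auto) ltac:(auto) ltac:(rewrite <- E; ring)).
  assert (J56 := IQ s5 s6 s1 s2 s3 s4 ltac:(auto) ltac:(auto) ltac:(auto) ltac:(auto) ltac:(auto) ltac:(auto) ltac:(rewrite <- E; ring)).
  unfold F6, pairs6.
  assert (K1 : forall s, q * s1 * s = q * (s1 * s)) by (intros; ring). rewrite !K1.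
  assert (K6 : forall s, s * (q * s6) = q * (s * s6)) by (intros; ring). rewrite !K6.
  rewrite <- J12, <- J13, <- J14, <- J15, <- J26, <- J36, <- J46, <- J56.
  set (m1 := mean (Ker q p (q * s1) s2 s3 s4 s5 s6) 1) in *. set (m2 := mean (Ker q p s1 s2 s3 s4 s5 (q * s6)) 1) in *.
  (* The substitutions above leave the common factor [c] on both sides, and the rest is the
     integrated identity [Q]. *)
  match type of Q with ?a = ?b => match goal with |- ?l = ?r =>
    let c := constr:(iGam q p (q * (s1 * s2)) * iGam q p (q * (s1 * s3)) * iGam q p (q * (s1 * s4)) * iGam q p (q * (s1 * s5)) * iGam q p (q * (s1 * s6)) *
      (iGam q p (s2 * s3) * iGam q p (s2 * s4) * iGam q p (s2 * s5) * iGam q p (q * (s2 * s6))) *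
      (iGam q p (s3 * s4) * iGam q p (s3 * s5) * iGam q p (q * (s3 * s6))) * (iGam q p (s4 * s5) * iGam q p (q * (s4 * s6))) * iGam q p (q * (s5 * s6))) in
    replace l with (c * a) by ring; replace r with (c * b) by ring end end.
  rewrite Q. reflexivity.
Qed.

Lemma Hol_inv_mul {X} gen (K : X -> Prop) (u v : X -> C) : (forall x, K x -> u x <> 0) -> (forall x, K x -> v x <> 0) ->
  Hol gen K (fun x => / u x) -> Hol gen K (fun x => / v x) -> Hol gen K (fun x => / (u x * v x)).
Proof.
  intros Hu Hv H1 H2. apply Hol_ext with (fun x => / u x * / v x); [|hol].
  intros x Hx. specialize (Hu x Hx). specialize (Hv x Hx). field. repeat split; auto.
Qed.

Lemma Hol_inv_div {X} gen (K : X -> Prop) (u v : X -> C) : (forall x, K x -> u x <> 0) -> (forall x, K x -> v x <> 0) ->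
  Hol gen K (fun x => / u x) -> Hol gen K v -> Hol gen K (fun x => / (u x / v x)).
Proof.
  intros Hu Hv H1 H2. apply Hol_ext with (fun x => / u x * v x); [|hol].
  intros x Hx. specialize (Hu x Hx). specialize (Hv x Hx). field. repeat split; auto.
Qed.

Lemma GG_Hol {X} gen (K : X -> Prop) (q p : C) (u v : X -> C) c : (Cmod q < 1)%R -> (Cmod p < 1)%R -> (0 <= c < 1)%R ->
  (forall x, K x -> u x <> 0) -> (forall x, K x -> v x <> 0) ->
  (forall x, K x -> (Cmod (u x * v x) <= c)%R) -> (forall x, K x -> (Cmod (u x / v x) <= c)%R) ->
  Hol gen K u -> Hol gen K (fun x => / u x) -> Hol gen K v -> Hol gen K (fun x => / v x) ->
  Hol gen K (fun x => GG q p (u x) (v x)).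
Proof.
  intros. unfold GG. apply (Hol_mul gen K); apply Gam_Hol with c; auto; try (unfold Cdiv; hol; fail).
  - apply Hol_inv_mul; auto.
  - apply Hol_inv_div; auto.
Qed.

Lemma Vfac_Hol {X} gen (K : X -> Prop) (q p : C) (v : X -> C) : (Cmod q < 1)%R -> (Cmod p < 1)%R ->
  (forall x, K x -> v x <> 0) -> Hol gen K v -> Hol gen K (fun x => / v x) -> Hol gen K (fun x => Vfac q p (v x)).
Proof.
  intros Hq Hp Hn Hv Hi. assert (Hi2 := Hol_inv_mul gen K v v Hn Hn Hi Hi).
  unfold Vfac. apply (Hol_mul gen K); apply (Hol_mul gen K); apply dpoch_comp_Hol; auto using Cmod_0_lt_1; hol.
Qed.

(** Eliminating t_6 turns [F6_shift], in which two parameters move, into a periodicity in t_1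
    alone. *)
Definition F5 (q p t1 t2 t3 t4 t5 : C) : C := F6 q p t1 t2 t3 t4 t5 (p * q / (t1 * t2 * t3 * t4 * t5)).

Lemma Cmod_lt1_mul (x y : C) : (0 < Cmod x < 1)%R -> (0 < Cmod y < 1)%R -> (0 < Cmod (x * y) < 1)%R.
Proof. intros. rewrite Cmod_mult. split; nra. Qed.

Lemma F5_Hol (q p t2 t3 t4 t5 : C) r1 r2 : (0 < Cmod q < 1)%R -> (0 < Cmod p < 1)%R ->
  (0 < Cmod t2 < 1)%R -> (0 < Cmod t3 < 1)%R -> (0 < Cmod t4 < 1)%R -> (0 < Cmod t5 < 1)%R ->
  (r1 <= r2 < 1)%R -> (Cmod (p * q) < r1 * Cmod (t2 * t3 * t4 * t5))%R ->
  Hol1 r1 r2 (fun x => F5 q p x t2 t3 t4 t5).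
Proof.
  intros Hq Hp H2 H3 H4 H5 Hr HB.
  assert (Hn : forall s : C, (0 < Cmod s < 1)%R -> s <> 0) by (intros; apply Cmod_nz; lra).
  assert (n2 := Hn _ H2). assert (n3 := Hn _ H3). assert (n4 := Hn _ H4). assert (n5 := Hn _ H5).
  assert (nq := Hn _ Hq). assert (np := Hn _ Hp).
  set (b := t2 * t3 * t4 * t5) in *.
  assert (Hb : (0 < Cmod b < 1)%R) by (unfold b; repeat apply Cmod_lt1_mul; auto).
  assert (nb := Hn _ Hb).
  assert (Hpq : (0 < Cmod (p * q) < 1)%R) by (apply Cmod_lt1_mul; auto).
  assert (Hr0 : (0 < r1)%R) by nra.
  (* all moduli that must stay below 1 are at most c *)
  set (c0 := (Cmod (p * q) / (r1 * Cmod b))%R).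
  assert (Hc0 : (0 < c0 < 1)%R).
  { unfold c0. assert (0 < r1 * Cmod b)%R by nra. split; [apply Rdiv_lt_0_compat; lra|apply Rlt_div_l; lra]. }
  set (c := Rmax (Rmax c0 r2) (Rmax (Rmax (Cmod t2) (Cmod t3)) (Rmax (Cmod t4) (Cmod t5)))).
  assert (Hc : (0 <= c < 1)%R /\ (c0 <= c)%R /\ (r2 <= c)%R /\ (Cmod t2 <= c)%R /\ (Cmod t3 <= c)%R /\ (Cmod t4 <= c)%R /\ (Cmod t5 <= c)%R).
  { assert (c0 <= c)%R by (unfold c; eauto 6 using Rmax_l, Rmax_r, Rle_trans).
    assert (r2 <= c)%R by (unfold c; eauto 6 using Rmax_l, Rmax_r, Rle_trans).
    assert (Cmod t2 <= c)%R by (unfold c; eauto 6 using Rmax_l, Rmax_r, Rle_trans).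
    assert (Cmod t3 <= c)%R by (unfold c; eauto 6 using Rmax_l, Rmax_r, Rle_trans).
    assert (Cmod t4 <= c)%R by (unfold c; eauto 6 using Rmax_l, Rmax_r, Rle_trans).
    assert (Cmod t5 <= c)%R by (unfold c; eauto 6 using Rmax_l, Rmax_r, Rle_trans).
    assert (c < 1)%R by (unfold c; repeat apply Rmax_lub_lt; lra). repeat split; lra. }
  clearbody c. destruct Hc as (Hc & Hcc0 & Hcr & Hc2 & Hc3 & Hc4 & Hc5).
  assert (T6 : forall x, ann r1 r2 x -> x <> 0 /\ p * q / (x * t2 * t3 * t4 * t5) <> 0 /\ (Cmod (p * q / (x * t2 * t3 * t4 * t5)) <= c0)%R).
  { intros x [Hx1 Hx2]. assert (nx : x <> 0) by (apply Cmod_nz; lra). split; [auto|]. split; [nz|].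
    replace (x * t2 * t3 * t4 * t5) with (x * b) by (unfold b; ring). rewrite Cmod_div by nz. rewrite (Cmod_mult x).
    unfold c0. apply Rmult_le_compat_l; [lra|]. apply Rinv_le_contravar; [nra|]. apply Rmult_le_compat_r; lra. }
  assert (Hid := Hol1_id r1 r2). assert (Hiv := Hol1_inv r1 r2 Hr0).
  assert (HT6 : Hol1 r1 r2 (fun x => p * q / (x * t2 * t3 * t4 * t5))).
  { apply Hol_ext with (fun x => p * q / b * / x); [|hol].
    intros x Hx. destruct (T6 x Hx) as (nx & _). unfold b. field. repeat split; auto. }
  assert (HT6i : Hol1 r1 r2 (fun x => / (p * q / (x * t2 * t3 * t4 * t5)))).
  { apply Hol_ext with (fun x => b / (p * q) * x); [|hol].
    intros x Hx. destruct (T6 x Hx) as (nx & _). unfold b. field. repeat split; auto. }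
  unfold F5, F6. apply (Hol_mul gen1 (ann r1 r2)).
  - apply (Hol2_mean 1 1 r1 r2 (fun y => Ker q p (snd y) t2 t3 t4 t5 (p * q / (snd y * t2 * t3 * t4 * t5)) (fst y)) 1).
    2: { unfold ann. rewrite Cmod_1. lra. }
    assert (Z1 := Hol2_fst 1 1 r1 r2).
    assert (Z2 : Hol2 1 1 r1 r2 (fun y => / fst y)) by (apply (Hol1_fst 1 1 r1 r2 (fun z => / z)), Hol1_inv; lra).
    assert (nZ : forall y, ann2 1 1 r1 r2 y -> fst y <> 0 /\ Cmod (fst y) = 1%R).
    { intros y [[a1 a2] _]. assert (Cmod (fst y) = 1)%R by lra. split; auto. apply Cmod_nz; lra. }
    assert (HGG : forall u : C -> C, (forall x, ann r1 r2 x -> u x <> 0 /\ (Cmod (u x) <= c)%R) -> Hol1 r1 r2 u -> Hol1 r1 r2 (fun x => / u x) ->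
      Hol2 1 1 r1 r2 (fun y => GG q p (u (snd y)) (fst y))).
    { intros u Hu Hu1 Hu2. apply (GG_Hol gen2 (ann2 1 1 r1 r2) q p (fun y => u (snd y)) (fun y => fst y) c); auto; try lra.
      - intros y [_ Hy]. apply Hu; auto.
      - intros y Hy. apply nZ; auto.
      - intros y Hy. rewrite Cmod_mult, (proj2 (nZ y Hy)), Rmult_1_r. apply Hu, Hy.
      - intros y Hy. rewrite Cmod_div, (proj2 (nZ y Hy)) by (apply nZ; auto). unfold Rdiv. rewrite Rinv_1, Rmult_1_r. apply Hu, Hy.
      - apply (Hol1_snd 1 1 r1 r2 u); auto.
      - apply (Hol1_snd 1 1 r1 r2 (fun x => / u x)); auto. }
    assert (G1 := HGG (fun x => x) ltac:(intros x Hx; destruct (T6 x Hx); destruct Hx; split; [auto|lra]) Hid Hiv).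
    assert (HGc : forall s : C, (0 < Cmod s < 1)%R -> (Cmod s <= c)%R -> Hol2 1 1 r1 r2 (fun y => GG q p s (fst y))).
    { intros s Hs Hs2. apply (HGG (fun _ => s)); [|apply Hol_const|apply Hol_const]. intros; split; auto. }
    assert (G2 := HGc t2 H2 Hc2). assert (G3 := HGc t3 H3 Hc3). assert (G4 := HGc t4 H4 Hc4). assert (G5 := HGc t5 H5 Hc5).
    assert (G6 := HGG (fun x => p * q / (x * t2 * t3 * t4 * t5)) ltac:(intros x Hx; destruct (T6 x Hx) as (? & ? & ?); split; [auto|lra]) HT6 HT6i).
    assert (GV : Hol2 1 1 r1 r2 (fun y => Vfac q p (fst y))).
    { apply (Vfac_Hol gen2 (ann2 1 1 r1 r2) q p (fun y => fst y)); auto; try lra. intros y Hy; apply nZ; auto. }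
    unfold Ker, prod6. cbv beta in *. hol.
  -
    assert (IG : forall u v : C -> C, (forall x, ann r1 r2 x -> u x <> 0) -> (forall x, ann r1 r2 x -> v x <> 0) ->
       (forall x, ann r1 r2 x -> (Cmod (p * q / (u x * v x)) <= c)%R) ->
       Hol1 r1 r2 u -> Hol1 r1 r2 (fun x => / u x) -> Hol1 r1 r2 v -> Hol1 r1 r2 (fun x => / v x) ->
       Hol1 r1 r2 (fun x => iGam q p (u x * v x))).
    { intros u v nu nv Huv Hu Hui Hv Hvi. apply iGam_Hol with c; auto; try lra; [hol|]. apply Hol_inv_mul; auto. }
    assert (nx : forall x, ann r1 r2 x -> x <> 0) by (intros x Hx; apply T6; auto).
    assert (n6 : forall x, ann r1 r2 x -> p * q / (x * t2 * t3 * t4 * t5) <> 0) by (intros x Hx; apply T6; auto).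
    assert (IG1 : forall s : C, (0 < Cmod s < 1)%R -> (Cmod b <= Cmod s)%R -> Hol1 r1 r2 (fun x => iGam q p (x * s))).
    { intros s Hs Hsb. apply (IG (fun x => x) (fun _ => s)); auto; hol.
      intros x Hx. assert (nx1 := nx x Hx). assert (ns := Hn _ Hs). rewrite Cmod_div by nz. rewrite (Cmod_mult x).
      eapply Rle_trans; [|exact Hcc0]. unfold c0. apply Rmult_le_compat_l; [lra|]. apply Rinv_le_contravar; [nra|]. destruct Hx.
      apply Rmult_le_compat; lra. }
    assert (IG6 : forall s s' : C, (0 < Cmod s < 1)%R -> (0 < Cmod s' < 1)%R -> s * s' = b -> Hol1 r1 r2 (fun x => iGam q p (s * (p * q / (x * t2 * t3 * t4 * t5))))).
    { intros s s' Hs Hs' Es. apply (IG (fun _ => s) (fun x => p * q / (x * t2 * t3 * t4 * t5))); auto; hol.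
      intros x Hx. assert (nx1 := nx x Hx). assert (ns := Hn _ Hs).
      replace (p * q / (s * (p * q / (x * t2 * t3 * t4 * t5)))) with (x * s').
      - rewrite Cmod_mult. destruct Hx. nra.
      - replace (x * t2 * t3 * t4 * t5) with (x * (s * s')) by (rewrite Es; unfold b; ring). field. repeat split; auto. }
    assert (b2 : (Cmod b <= Cmod t2)%R). { assert (h := Cmod_lt1_mul _ _ (Cmod_lt1_mul _ _ H3 H4) H5). replace b with (t2 * (t3 * t4 * t5)) by (unfold b; ring). rewrite Cmod_mult. nra. }
    assert (b3 : (Cmod b <= Cmod t3)%R). { assert (h := Cmod_lt1_mul _ _ (Cmod_lt1_mul _ _ H2 H4) H5). replace b with (t3 * (t2 * t4 * t5)) by (unfold b; ring). rewrite Cmod_mult. nra. }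
    assert (b4 : (Cmod b <= Cmod t4)%R). { assert (h := Cmod_lt1_mul _ _ (Cmod_lt1_mul _ _ H2 H3) H5). replace b with (t4 * (t2 * t3 * t5)) by (unfold b; ring). rewrite Cmod_mult. nra. }
    assert (b5 : (Cmod b <= Cmod t5)%R). { assert (h := Cmod_lt1_mul _ _ (Cmod_lt1_mul _ _ H2 H3) H4). replace b with (t5 * (t2 * t3 * t4)) by (unfold b; ring). rewrite Cmod_mult. nra. }
    assert (Q2 := IG1 t2 H2 b2). assert (Q3 := IG1 t3 H3 b3). assert (Q4 := IG1 t4 H4 b4). assert (Q5 := IG1 t5 H5 b5).
    assert (W2 := IG6 t2 (t3 * t4 * t5) H2 ltac:(repeat apply Cmod_lt1_mul; auto) ltac:(unfold b; ring)).
    assert (W3 := IG6 t3 (t2 * t4 * t5) H3 ltac:(repeat apply Cmod_lt1_mul; auto) ltac:(unfold b; ring)).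
    assert (W4 := IG6 t4 (t2 * t3 * t5) H4 ltac:(repeat apply Cmod_lt1_mul; auto) ltac:(unfold b; ring)).
    assert (W5 := IG6 t5 (t2 * t3 * t4) H5 ltac:(repeat apply Cmod_lt1_mul; auto) ltac:(unfold b; ring)).
    assert (W1 : Hol1 r1 r2 (fun x => iGam q p (x * (p * q / (x * t2 * t3 * t4 * t5))))).
    { apply Hol_ext with (fun _ => iGam q p (p * q / b)); [|apply Hol_const]. intros x Hx. f_equal. unfold b. assert (nx1 := nx x Hx). field. repeat split; auto. }
    unfold pairs6. hol.
Qed.

Lemma F5_const1 (q p x y t2 t3 t4 t5 : C) : (0 < Cmod q < 1)%R -> (0 < Cmod p < 1)%R ->
  (0 < Cmod x < 1)%R -> (0 < Cmod y < 1)%R ->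
  (0 < Cmod t2 < 1)%R -> (0 < Cmod t3 < 1)%R -> (0 < Cmod t4 < 1)%R -> (0 < Cmod t5 < 1)%R ->
  (Cmod p < Cmod (x * t2 * t3 * t4 * t5) ^ 2)%R -> (Cmod p < Cmod (y * t2 * t3 * t4 * t5) ^ 2)%R ->
  F5 q p x t2 t3 t4 t5 = F5 q p y t2 t3 t4 t5.
Proof.
  intros Hq Hp Hx Hy H2 H3 H4 H5 Dx Dy.
  assert (Hn : forall s : C, (0 < Cmod s < 1)%R -> s <> 0) by (intros; apply Cmod_nz; lra).
  assert (n2 := Hn _ H2). assert (n3 := Hn _ H3). assert (n4 := Hn _ H4). assert (n5 := Hn _ H5).
  assert (nq := Hn _ Hq). assert (np := Hn _ Hp).
  set (b := t2 * t3 * t4 * t5).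
  assert (Hb : (0 < Cmod b < 1)%R) by (unfold b; repeat apply Cmod_lt1_mul; auto).
  assert (nb := Hn _ Hb).
  assert (lowb : forall w, (0 < Cmod w < 1)%R -> (Cmod p < Cmod (w * t2 * t3 * t4 * t5) ^ 2)%R -> (Cmod p < Cmod w * Cmod b)%R).
  { intros w Hw Dw. replace (w * t2 * t3 * t4 * t5) with (w * b) in Dw by (unfold b; ring).
    assert (h := Cmod_lt1_mul w b Hw Hb). rewrite <- Cmod_mult. nra. }
  assert (Lx := lowb x Hx Dx). assert (Ly := lowb y Hy Dy).
  set (m := Rmin (Cmod x) (Cmod y)).
  assert (Hm : (Cmod p < m * Cmod b)%R) by (unfold m, Rmin; destruct (Rle_dec (Cmod x) (Cmod y)); auto).
  assert (Hm1 : (m <= Cmod x)%R) by apply Rmin_l. assert (Hm2 : (m <= Cmod y)%R) by apply Rmin_r.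
  assert (Hm0 : (0 < m)%R) by (apply Rmin_glb_lt; lra).
  set (M := Rmax (Cmod x) (Cmod y)).
  assert (HM1 : (Cmod x <= M)%R) by apply Rmax_l. assert (HM2 : (Cmod y <= M)%R) by apply Rmax_r.
  assert (HM : (M < 1)%R) by (apply Rmax_lub_lt; lra).
  (* At |t_1| = r0 the modulus of t_6 reaches 1. The lower bound on the parameters leaves room for a
     radius r1 with r0 < r1 < |q| m, so that the annulus contains the circle through x together with
     its image under multiplication by q. *)
  set (r0 := (Cmod p * Cmod q / Cmod b)%R).
  assert (Hr0 : (r0 * Cmod b = Cmod p * Cmod q)%R) by (unfold r0; field; lra).
  assert (Hr0m : (r0 < Cmod q * m)%R) by nra.
  assert (Hr00 : (0 < r0)%R) by (apply Rdiv_lt_0_compat; nra).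
  set (r1 := ((r0 + Cmod q * m) / 2)%R). set (r2 := ((1 + M) / 2)%R).
  assert (Hr1 : (r0 < r1 < Cmod q * m)%R) by (unfold r1; lra).
  assert (Hr2 : (M < r2 < 1)%R) by (unfold r2; lra).
  assert (Hqm : (Cmod q * m < m)%R) by nra.
  apply (periodic_constant r1 r2 (fun x => F5 q p x t2 t3 t4 t5) q x); auto; try lra.
  - apply F5_Hol; auto; try lra. fold b. rewrite Cmod_mult. nra.
  - unfold ann. lra.
  - unfold ann. rewrite Cmod_mult. split; [|nra]. apply Rle_trans with (Cmod q * m)%R; [lra|]. apply Rmult_le_compat_l; lra.
  - intros z Hz. assert (nz0 : z <> 0) by (apply Cmod_nz; lra). unfold F5.
    set (s6 := p / (z * t2 * t3 * t4 * t5)).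
    replace (p * q / (q * z * t2 * t3 * t4 * t5)) with s6 by (unfold s6; field; repeat split; auto).
    replace (p * q / (z * t2 * t3 * t4 * t5)) with (q * s6) by (unfold s6; field; repeat split; auto).
    assert (Hzb : (Cmod (z * t2 * t3 * t4 * t5) = Cmod z * Cmod b)%R).
    { replace (z * t2 * t3 * t4 * t5) with (z * b) by (unfold b; ring). apply Cmod_mult. }
    apply F6_shift; auto; try lra.
    + unfold s6. rewrite Cmod_div, Hzb by nz. split; [apply Rdiv_lt_0_compat; nra|apply Rlt_div_l; nra].
    + unfold s6. field. repeat split; auto.
    + rewrite Hzb, Hz. replace (x * t2 * t3 * t4 * t5) with (x * b) in Dx by (unfold b; ring). rewrite Cmod_mult in Dx. exact Dx.
Qed.

Lemma F5_swap (q p t1 t2 t3 t4 t5 : C) : F5 q p t1 t2 t3 t4 t5 = F5 q p t2 t1 t3 t4 t5.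
Proof.
  unfold F5, F6. replace (t2 * t1 * t3 * t4 * t5) with (t1 * t2 * t3 * t4 * t5) by ring.
  set (t6 := p * q / (t1 * t2 * t3 * t4 * t5)). f_equal.
  - apply mean_ext. intros z _. unfold Ker, prod6. ring.
  - unfold pairs6. rewrite (Cmult_comm t2 t1). ring.
Qed.

(** * The constant, from a pinched contour *)

(* (x; q, p)_oo with its first factor 1 - x removed. *)
Definition dpoch0 (q p x : C) : C := poch p (p * x) * dpoch q p (q * x).

Lemma dpoch_dpoch0 (q p x : C) : (Cmod q < 1)%R -> (Cmod p < 1)%R -> dpoch q p x = (1 - x) * dpoch0 q p x.
Proof. intros Hq Hp. unfold dpoch0. rewrite dpoch_rec, poch_rec by auto. ring. Qed.

Lemma dpoch0_nz (q p x : C) : (Cmod q < 1)%R -> (Cmod p < 1)%R -> (Cmod (p * x) < 1)%R -> (Cmod (q * x) < 1)%R -> dpoch0 q p x <> 0.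
Proof.
  intros. unfold dpoch0. apply Cmult_neq_0; apply dpoch_nz_small; auto using Cmod_0_lt_1.
Qed.

Lemma dpoch0_inv_Hol {X} gen (K : X -> Prop) (q p : C) (u : X -> C) c : (Cmod q < 1)%R -> (Cmod p < 1)%R -> (0 <= c < 1)%R ->
  (forall x, K x -> (Cmod (p * u x) <= c)%R) -> (forall x, K x -> (Cmod (q * u x) <= c)%R) ->
  Hol gen K u -> Hol gen K (fun x => / dpoch0 q p (u x)).
Proof.
  intros Hq Hp Hc H1 H2 Hu. unfold dpoch0.
  apply Hol_ext with (fun x => / poch p (p * u x) * / dpoch q p (q * u x)).
  - intros x Hx. specialize (H1 x Hx). specialize (H2 x Hx). field.
    split; apply dpoch_nz_small; auto using Cmod_0_lt_1; lra.
  - apply (Hol_mul gen K); apply dpoch_inv_Hol with c; auto using Cmod_0_lt_1; hol.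
Qed.

(** The kernel without the four factors 1 - t_1 z, 1 - t_1 / z, 1 - t_2 z, 1 - t_2 / z in its
    denominator, whose zeros pinch the unit circle when |t_1| and |t_2| tend to 1. *)
Definition Rker (q p t1 t2 t3 t4 t5 t6 z : C) : C :=
  Vfac q p z *
  (dpoch q p (p * q / (t1 * z)) * dpoch q p (p * q / (t1 / z)) * dpoch q p (p * q / (t2 * z)) * dpoch q p (p * q / (t2 / z))) *
  (/ dpoch0 q p (t1 * z) * / dpoch0 q p (t1 / z) * / dpoch0 q p (t2 * z) * / dpoch0 q p (t2 / z)) *
  (GG q p t3 z * GG q p t4 z * GG q p t5 z * GG q p t6 z).

Lemma Ci_sq : Ci * Ci = - (1).
Proof. unfold Ci, Cmult, Copp, RtoC; simpl. f_equal; ring. Qed.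

(** For t_1 = i l and t_2 = - i l the removed factors multiply to (1 + l^2 z^2)(1 + l^2 / z^2).
    Partial fractions separate the poles outside the unit circle from those inside, so each term can
    be moved to a circle of its own before l reaches 1. *)
Lemma Ker_Rker (q p l t3 t4 t5 t6 z : C) : (0 < Cmod q < 1)%R -> (0 < Cmod p < 1)%R -> (0 < Cmod l < 1)%R -> Cmod z = 1%R ->
  Ker q p (Ci * l) (- Ci * l) t3 t4 t5 t6 z * ((1 - l * l) * (1 + l * l)) =
  Rker q p (Ci * l) (- Ci * l) t3 t4 t5 t6 z * (/ (1 + l * l * (z * z)) + / (1 + l * l / (z * z)) - 1).
Proof.
  intros Hq Hp Hl Hz. assert (nz : z <> 0) by (apply Cmod_nz; lra).
  unfold Ker, Rker, prod6. unfold GG at 1 2. unfold Gam.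
  rewrite !(dpoch_dpoch0 q p (Ci * l * z)), !(dpoch_dpoch0 q p (Ci * l / z)), !(dpoch_dpoch0 q p (- Ci * l * z)), !(dpoch_dpoch0 q p (- Ci * l / z)) by lra.
  assert (Hn : forall u : C, (Cmod u < 1)%R -> dpoch0 q p u <> 0 /\ 1 - u <> 0).
  { intros u Hu. assert (h := Cmod_ge_0 u). split.
    - apply dpoch0_nz; try lra; rewrite Cmod_mult; nra.
    - intro e. apply Ceq_minus in e. rewrite <- e, Cmod_1 in Hu. lra. }
  assert (mC : Cmod (- Ci) = 1%R) by (rewrite Cmod_opp; apply Cmod_Ci).
  destruct (Hn (Ci * l * z)) as [a1 b1]. { rewrite !Cmod_mult, Cmod_Ci, Hz. lra. }
  destruct (Hn (Ci * l / z)) as [a2 b2]. { rewrite Cmod_div, Cmod_mult, Cmod_Ci, Hz by auto. lra. }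
  destruct (Hn (- Ci * l * z)) as [a3 b3]. { rewrite !Cmod_mult, mC, Hz. lra. }
  destruct (Hn (- Ci * l / z)) as [a4 b4]. { rewrite Cmod_div, Cmod_mult, mC, Hz by auto. lra. }
  assert (f1 : (1 - Ci * l * z) * (1 - - Ci * l * z) = 1 + l * l * (z * z)).
  { replace ((1 - Ci * l * z) * (1 - - Ci * l * z)) with (1 - (Ci * Ci) * (l * l * (z * z))) by ring. rewrite Ci_sq. ring. }
  assert (f2 : (1 - Ci * l / z) * (1 - - Ci * l / z) = 1 + l * l / (z * z)).
  { replace ((1 - Ci * l / z) * (1 - - Ci * l / z)) with (1 - (Ci * Ci) * (l * l / (z * z))) by (field; auto). rewrite Ci_sq. field; auto. }
  assert (n1 : 1 + l * l * (z * z) <> 0) by (rewrite <- f1; nz).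
  assert (n2 : 1 + l * l / (z * z) <> 0) by (rewrite <- f2; nz).
  set (d1 := dpoch0 q p (Ci * l * z)) in *. set (d2 := dpoch0 q p (Ci * l / z)) in *.
  set (d3 := dpoch0 q p (- Ci * l * z)) in *. set (d4 := dpoch0 q p (- Ci * l / z)) in *.
  set (N1 := dpoch q p (p * q / (Ci * l * z))). set (N2 := dpoch q p (p * q / (Ci * l / z))).
  set (N3 := dpoch q p (p * q / (- Ci * l * z))). set (N4 := dpoch q p (p * q / (- Ci * l / z))).
  set (W := GG q p t3 z * GG q p t4 z * GG q p t5 z * GG q p t6 z).
  (* With A = l^2 z^2 and B = l^2 / z^2 this is 1/(1 + A) + 1/(1 + B) - 1 = (1 - A B) / ((1 + A)(1 +
     B)), where A B = l^4. *)
  assert (K1 : / (1 + l * l * (z * z)) + / (1 + l * l / (z * z)) - 1 =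
     ((1 - l * l) * (1 + l * l)) * (/ (1 + l * l * (z * z)) * / (1 + l * l / (z * z)))).
  { replace ((1 - l * l) * (1 + l * l)) with (1 - (l * l * (z * z)) * (l * l / (z * z))) by (field; auto).
    set (A := l * l * (z * z)) in *. set (B := l * l / (z * z)) in *. field. auto. }
  rewrite K1. rewrite <- f1, <- f2.
  set (e1 := 1 - Ci * l * z) in *. set (e2 := 1 - Ci * l / z) in *. set (e3 := 1 - - Ci * l * z) in *. set (e4 := 1 - - Ci * l / z) in *.
  transitivity (Vfac q p z * (N1 * / (e1 * d1) * (N2 * / (e2 * d2)) * (N3 * / (e3 * d3) * (N4 * / (e4 * d4))) * W) * ((1 - l * l) * (1 + l * l))).
  - unfold W. ring.
  - field. repeat split; auto.
Qed.

(** A margin s > 1: moduli at most M stay below 1 after multiplication by the powers of z, l and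
    their inverses that occur when |z| ranges up to s^2 and |l| up to s. *)
Lemma pow6_bound (M : R) : (0 < M < 1)%R -> exists s, (1 < s)%R /\ (M * s ^ 6 < 1)%R.
Proof.
  (* The binomial coefficients 6, 15, 20, 15, 6, 1 sum to 63, so (1 + e)^6 <= 1 + 63 e, and 64
     leaves a strict inequality. *)
  intros HM. exists (1 + (1 - M) / 64)%R. set (e := ((1 - M) / 64)%R).
  assert (He : (0 < e < 1)%R) by (unfold e; lra). split; [lra|].
  assert (H : ((1 + e) ^ 6 <= 1 + 63 * e)%R).
  { assert (e2 : (0 <= e ^ 2 <= e)%R) by nra. assert (e3 : (0 <= e ^ 3 <= e)%R) by nra. assert (e4 : (0 <= e ^ 4 <= e)%R) by nra.
    assert (e5 : (0 <= e ^ 5 <= e)%R) by nra. assert (e6 : (0 <= e ^ 6 <= e)%R) by nra.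
    replace ((1 + e) ^ 6)%R with (1 + 6 * e + 15 * e ^ 2 + 20 * e ^ 3 + 15 * e ^ 4 + 6 * e ^ 5 + e ^ 6)%R by ring. lra. }
  apply Rle_lt_trans with (M * (1 + 63 * e))%R; [apply Rmult_le_compat_l; lra|]. unfold e. nra.
Qed.

(** The prefactor without its factor 1 - t_1 t_2. Along the pinching family this factor is 1 - l^2,
    and its zero at l = 1 meets the divergence of the integral. *)
Definition Rlam (q p t1 t2 t3 t4 t5 t6 : C) : C :=
  dpoch0 q p (t1 * t2) * / dpoch q p (p * q / (t1 * t2)) *
  ((iGam q p (t1 * t3) * iGam q p (t1 * t4) * iGam q p (t1 * t5) * iGam q p (t1 * t6)) *
   (iGam q p (t2 * t3) * iGam q p (t2 * t4) * iGam q p (t2 * t5) * iGam q p (t2 * t6)) *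
   (iGam q p (t3 * t4) * iGam q p (t3 * t5) * iGam q p (t3 * t6) * (iGam q p (t4 * t5) * iGam q p (t4 * t6)) * iGam q p (t5 * t6))).

Lemma pairs6_Rlam (q p t1 t2 t3 t4 t5 t6 : C) : (Cmod q < 1)%R -> (Cmod p < 1)%R ->
  pairs6 (iGam q p) t1 t2 t3 t4 t5 t6 = (1 - t1 * t2) * Rlam q p t1 t2 t3 t4 t5 t6.
Proof.
  intros Hq Hp. unfold pairs6, Rlam. unfold iGam at 1. rewrite (dpoch_dpoch0 q p (t1 * t2)) by auto. ring.
Qed.

Lemma iGam_reflect (q p x y : C) : (0 < Cmod q < 1)%R -> (0 < Cmod p < 1)%R -> (0 < Cmod x < 1)%R -> (0 < Cmod y < 1)%R -> x * y = p * q ->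
  iGam q p x * iGam q p y = 1.
Proof.
  intros Hq Hp Hx Hy E. assert (x <> 0) by (apply Cmod_nz; lra). assert (y <> 0) by (apply Cmod_nz; lra).
  unfold iGam. rewrite <- E. replace (x * y / x) with y by (field; auto). replace (x * y / y) with x by (field; auto).
  field. split; apply dpoch_nz_small; lra.
Qed.

Lemma Gam_iGam (q p x : C) : (0 < Cmod q < 1)%R -> (0 < Cmod p < 1)%R -> (0 < Cmod x < 1)%R -> (Cmod (p * q / x) < 1)%R ->
  Gam q p x * iGam q p x = 1.
Proof.
  intros Hq Hp Hx Hy. unfold Gam, iGam. field. split; apply dpoch_nz_small; lra.
Qed.

(** Everything depending on the parameters cancels: the kernel factor of each t at z = i or -i
    against the prefactor at i t and - i t, and the six pairs among t_3, ..., t_6 against each other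
    by the reflection Gamma(x) Gamma(p q / x) = 1. At z^2 = -1 the factor [Vfac] contributes (1 -
    z^2)^2 = 4. *)
Lemma residue_value (q p t3 t4 t5 t6 z : C) : (0 < Cmod q < 1)%R -> (0 < Cmod p < 1)%R ->
  (0 < Cmod t3 < 1)%R -> (0 < Cmod t4 < 1)%R -> (0 < Cmod t5 < 1)%R -> (0 < Cmod t6 < 1)%R -> t3 * t4 * t5 * t6 = p * q ->
  z = Ci \/ z = - Ci ->
  Rlam q p Ci (- Ci) t3 t4 t5 t6 * Rker q p Ci (- Ci) t3 t4 t5 t6 z = RtoC 4 / (poch p p * poch q q).
Proof.
  intros Hq Hp H3 H4 H5 H6 E Hz.
  assert (Hn : forall s : C, (0 < Cmod s < 1)%R -> s <> 0) by (intros; apply Cmod_nz; lra).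
  assert (n3 := Hn _ H3). assert (n4 := Hn _ H4). assert (n5 := Hn _ H5). assert (n6 := Hn _ H6). assert (nq := Hn _ Hq). assert (np := Hn _ Hp).
  assert (Hpq := Cmod_lt1_mul p q Hp Hq).
  assert (Cn := Ci_nz). assert (C2 := Ci_sq).
  assert (mC : Cmod (- Ci) = 1%R) by (rewrite Cmod_opp; apply Cmod_Ci).
  assert (I12 : Ci * - Ci = 1) by (replace (Ci * - Ci) with (- (Ci * Ci)) by ring; rewrite C2; ring).
  assert (V1 : Vfac q p z = RtoC 4 * (poch p (- p) * poch p (- p)) * (poch q (- q) * poch q (- q))).
  { unfold Vfac. assert (zz : z * z = - (1)) by (destruct Hz as [-> | ->]; [auto|rewrite <- C2; ring]).
    rewrite zz. replace (/ (- (1))) with (- (1)) by field. replace (q / (- (1))) with (- q) by field.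
    replace (q * - (1)) with (- q) by ring. rewrite (poch_rec p (- (1))) by lra. replace (p * - (1)) with (- p) by ring. ring. }
  assert (D1 : dpoch0 q p 1 = poch p p * (poch q q * dpoch q p (p * q))).
  { unfold dpoch0. rewrite !Cmult_1_r. f_equal. rewrite (dpoch_sym q p q), (dpoch_rec p q q) by lra. rewrite (dpoch_sym p q). reflexivity. }
  assert (Dm1 : dpoch0 q p (- (1)) = poch p (- p) * (poch q (- q) * dpoch q p (- (p * q)))).
  { unfold dpoch0. replace (p * - (1)) with (- p) by ring. replace (q * - (1)) with (- q) by ring. f_equal.
    rewrite (dpoch_sym q p (- q)), (dpoch_rec p q (- q)) by lra. rewrite (dpoch_sym p q). do 2 f_equal. ring. }
  assert (nz1 : poch p p <> 0) by (apply poch_nz; lra). assert (nz2 : poch q q <> 0) by (apply poch_nz; lra).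
  assert (nz3 : poch p (- p) <> 0) by (apply poch_nz; rewrite ?Cmod_opp; lra).
  assert (nz4 : poch q (- q) <> 0) by (apply poch_nz; rewrite ?Cmod_opp; lra).
  assert (nz5 : dpoch q p (p * q) <> 0) by (apply dpoch_nz_small; lra).
  assert (nz6 : dpoch q p (- (p * q)) <> 0) by (apply dpoch_nz_small; rewrite ?Cmod_opp; lra).
  assert (Q : (dpoch q p (p * q / (Ci * z)) * dpoch q p (p * q / (Ci / z)) * dpoch q p (p * q / (- Ci * z)) * dpoch q p (p * q / (- Ci / z))) *
    (/ dpoch0 q p (Ci * z) * / dpoch0 q p (Ci / z) * / dpoch0 q p (- Ci * z) * / dpoch0 q p (- Ci / z)) =
    (dpoch q p (p * q) * dpoch q p (- (p * q)) * / dpoch0 q p 1 * / dpoch0 q p (- (1))) *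
    (dpoch q p (p * q) * dpoch q p (- (p * q)) * / dpoch0 q p 1 * / dpoch0 q p (- (1)))).
  { assert (h1 : p * q / 1 = p * q) by field. assert (h2 : p * q / (- (1)) = - (p * q)) by field.
    destruct Hz as [-> | ->].
    - replace (- Ci * Ci) with (Ci * - Ci) by ring. rewrite I12, C2. replace (Ci / Ci) with (RtoC 1) by (field; auto).
      replace (- Ci / Ci) with (- (1)) by (field; auto). rewrite h1, h2. ring.
    - rewrite I12. replace (- Ci * - Ci) with (Ci * Ci) by ring. rewrite C2. replace (Ci / - Ci) with (- (1)) by (field; auto).
      replace (- Ci / - Ci) with (RtoC 1) by (field; auto). rewrite h1, h2. ring. }
  assert (G : forall t, (0 < Cmod t < 1)%R -> (Cmod (p * q / t) < 1)%R -> GG q p t z * (iGam q p (Ci * t) * iGam q p (- Ci * t)) = 1).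
  { intros t Ht Ht2. assert (nt := Hn _ Ht).
    assert (g1 : Gam q p (Ci * t) * iGam q p (Ci * t) = 1).
    { apply Gam_iGam; auto. - rewrite Cmod_mult, Cmod_Ci; lra.
      - replace (p * q / (Ci * t)) with (p * q / t * / Ci) by (field; auto). rewrite Cmod_mult, Cmod_inv, Cmod_Ci by auto. lra. }
    assert (g2 : Gam q p (- Ci * t) * iGam q p (- Ci * t) = 1).
    { apply Gam_iGam; auto. - rewrite Cmod_mult, mC; lra.
      - replace (p * q / (- Ci * t)) with (p * q / t * / (- Ci)) by (field; auto). rewrite Cmod_mult, Cmod_inv, mC by (apply Cmod_nz; lra). lra. }
    assert (gg : GG q p t z = Gam q p (Ci * t) * Gam q p (- Ci * t)).
    { unfold GG. assert (iC : t / Ci = - Ci * t) by (unfold Cdiv; rewrite Ci_inv; ring).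
      assert (iC2 : t / - Ci = Ci * t) by (replace (t / - Ci) with (- (t * / Ci)) by (field; auto); rewrite Ci_inv; ring).
      destruct Hz as [-> | ->].
      - rewrite iC. f_equal. f_equal. ring.
      - rewrite iC2. rewrite Cmult_comm. f_equal. f_equal. ring. }
    rewrite gg. transitivity ((Gam q p (Ci * t) * iGam q p (Ci * t)) * (Gam q p (- Ci * t) * iGam q p (- Ci * t))); [ring|]. rewrite g1, g2. ring. }
  assert (pq3 : (Cmod (p * q / t3) < 1)%R).
  { replace (p * q / t3) with (t4 * t5 * t6) by (rewrite <- E; field; auto). repeat (apply Cmod_lt1_mul; auto). }
  assert (pq4 : (Cmod (p * q / t4) < 1)%R).
  { replace (p * q / t4) with (t3 * t5 * t6) by (rewrite <- E; field; auto). repeat (apply Cmod_lt1_mul; auto). }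
  assert (pq5 : (Cmod (p * q / t5) < 1)%R).
  { replace (p * q / t5) with (t3 * t4 * t6) by (rewrite <- E; field; auto). repeat (apply Cmod_lt1_mul; auto). }
  assert (pq6 : (Cmod (p * q / t6) < 1)%R).
  { replace (p * q / t6) with (t3 * t4 * t5) by (rewrite <- E; field; auto). repeat (apply Cmod_lt1_mul; auto). }
  assert (G3 := G t3 H3 pq3). assert (G4 := G t4 H4 pq4). assert (G5 := G t5 H5 pq5). assert (G6 := G t6 H6 pq6).
  assert (P1 : iGam q p (t3 * t4) * iGam q p (t5 * t6) = 1).
  { apply iGam_reflect; auto; try (apply Cmod_lt1_mul; auto). rewrite <- E; ring. }
  assert (P2 : iGam q p (t3 * t5) * iGam q p (t4 * t6) = 1).
  { apply iGam_reflect; auto; try (apply Cmod_lt1_mul; auto). rewrite <- E; ring. }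
  assert (P3 : iGam q p (t3 * t6) * iGam q p (t4 * t5) = 1).
  { apply iGam_reflect; auto; try (apply Cmod_lt1_mul; auto). rewrite <- E; ring. }
  unfold Rlam, Rker. rewrite I12, V1. replace (p * q / 1) with (p * q) by field.
  match type of Q with ?a * ?b = ?c =>
  transitivity (dpoch0 q p 1 * / dpoch q p (p * q) * (RtoC 4 * (poch p (- p) * poch p (- p)) * (poch q (- q) * poch q (- q))) * (a * b) *
   ((GG q p t3 z * (iGam q p (Ci * t3) * iGam q p (- Ci * t3))) * (GG q p t4 z * (iGam q p (Ci * t4) * iGam q p (- Ci * t4))) *
    (GG q p t5 z * (iGam q p (Ci * t5) * iGam q p (- Ci * t5))) * (GG q p t6 z * (iGam q p (Ci * t6) * iGam q p (- Ci * t6)))) *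
   ((iGam q p (t3 * t4) * iGam q p (t5 * t6)) * (iGam q p (t3 * t5) * iGam q p (t4 * t6)) * (iGam q p (t3 * t6) * iGam q p (t4 * t5)))) end.
  - ring.
  - rewrite G3, G4, G5, G6, P1, P2, P3, Q, D1, Dm1. field. repeat split; auto.
Qed.

(** The gain from removing the four factors: holomorphy on annuli that extend across both |z| = 1
    and |l| = 1. *)
Lemma Rker_Hol2 (q p t3 t4 t5 be : C) (M s : R) : (0 < Cmod q <= M)%R -> (0 < Cmod p <= M)%R ->
  (0 < Cmod t3 <= M)%R -> (0 < Cmod t4 <= M)%R -> (0 < Cmod t5 <= M)%R -> (0 < Cmod be <= M)%R -> (1 < s)%R -> (M * s ^ 6 < 1)%R ->
  Hol2 (/ s ^ 2) (s ^ 2) (/ s) s (fun y => Rker q p (Ci * snd y) (- Ci * snd y) t3 t4 t5 (be / (snd y * snd y)) (fst y)).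
Proof.
  intros Hq Hp H3 H4 H5 Hbe Hs HM.
  set (K := ann2 (/ s ^ 2) (s ^ 2) (/ s) s).
  assert (Hs2 : (1 < s ^ 2)%R) by nra.
  assert (s6 : (s ^ 6 = s ^ 2 * s ^ 2 * s ^ 2)%R) by ring.
  assert (Hs4 : (1 < s ^ 2 * s ^ 2)%R) by nra.
  assert (Hs6 : (1 < s ^ 6)%R) by (rewrite s6; nra).
  set (c := (M * s ^ 6)%R) in *.
  assert (Hb : forall x y, (0 <= x <= M)%R -> (0 <= y <= s ^ 6)%R -> (x * y <= c)%R) by (intros x y Hx Hy; unfold c; apply Rmult_le_compat; lra).
  assert (HM1 : (M < 1)%R) by (assert (h := Hb M 1%R ltac:(lra) ltac:(lra)); lra).
  assert (Hc : (0 <= c < 1)%R) by (split; [unfold c; apply Rmult_le_pos; lra|lra]).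
  assert (Hq1 : (Cmod q < 1)%R) by lra. assert (Hp1 : (Cmod p < 1)%R) by lra.
  assert (Hn : forall u : C, (0 < Cmod u <= M)%R -> u <> 0) by (intros; apply Cmod_nz; lra).
  assert (is : (0 < / s < 1)%R) by (split; [apply Rinv_0_lt_compat; lra|rewrite <- Rinv_1; apply Rinv_lt_contravar; lra]).
  assert (is2 : (0 < / s ^ 2)%R) by (apply Rinv_0_lt_compat; lra).
  assert (B : forall y, K y -> (fst y <> 0 /\ snd y <> 0) /\ (0 < Cmod (fst y) <= s ^ 2)%R /\ (0 < / Cmod (fst y) <= s ^ 2)%R /\ (0 < Cmod (snd y) <= s)%R /\ (0 < / Cmod (snd y) <= s)%R).
  { intros y [[a1 a2] [b1 b2]]. repeat split; try (apply Cmod_nz; lra); try lra; try (apply Rinv_0_lt_compat; lra).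
    - rewrite <- (Rinv_inv (s ^ 2)). apply Rinv_le_contravar; lra.
    - rewrite <- (Rinv_inv s). apply Rinv_le_contravar; lra. }
  assert (Z1 : Hol gen2 K (fun y => fst y)) by apply Hol2_fst.
  assert (L1 : Hol gen2 K (fun y => snd y)) by apply Hol2_snd.
  assert (Z2 : Hol gen2 K (fun y => / fst y)) by (apply (Hol1_fst _ _ _ _ (fun z => / z)), Hol1_inv; auto).
  assert (L2 : Hol gen2 K (fun y => / snd y)) by (apply (Hol1_snd _ _ _ _ (fun z => / z)), Hol1_inv; lra).
  assert (nf : forall y, K y -> fst y <> 0) by (intros y Hy; apply B; auto).
  assert (ns : forall y, K y -> snd y <> 0) by (intros y Hy; apply B; auto).
  assert (mon : forall e : C, Cmod e = 1%R ->
     (forall y, K y -> e * snd y <> 0) /\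
     (Hol gen2 K (fun y => dpoch q p (p * q / (e * snd y * fst y))) /\ Hol gen2 K (fun y => dpoch q p (p * q / (e * snd y / fst y)))) /\
     (Hol gen2 K (fun y => / dpoch0 q p (e * snd y * fst y)) /\ Hol gen2 K (fun y => / dpoch0 q p (e * snd y / fst y)))).
  { intros e He. assert (ne : e <> 0) by (apply Cmod_nz; lra).
    assert (ne1 : forall y, K y -> e * snd y <> 0) by (intros y Hy; apply Cmult_neq_0; auto).
    assert (J : Hol gen2 K (fun y => / (e * snd y))) by (apply Hol_inv_mul; auto; hol).
    split; [exact ne1|]. split; split.
    - apply dpoch_comp_Hol; auto. unfold Cdiv. apply (Hol_mul gen2 K); [apply Hol_const|]. apply (Hol_inv_mul gen2 K (fun y => e * snd y) (fun y => fst y)); auto.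
    - apply dpoch_comp_Hol; auto. apply (Hol_mul gen2 K); [apply Hol_const|]. apply (Hol_inv_div gen2 K (fun y => e * snd y) (fun y => fst y)); auto.
    - apply dpoch0_inv_Hol with c; auto; [| |hol]; intros y Hy; destruct (B y Hy) as (_ & b1 & b2 & b3 & b4);
        rewrite !Cmod_mult, He, Rmult_1_l; apply Hb; try lra; (split; [apply Rmult_le_pos; lra|]);
        (apply Rle_trans with (s * s ^ 2)%R; [apply Rmult_le_compat; lra|rewrite s6; nra]).
    - apply dpoch0_inv_Hol with c; auto; [| |hol]; intros y Hy; destruct (B y Hy) as (_ & b1 & b2 & b3 & b4);
        unfold Cdiv; rewrite !Cmod_mult, Cmod_inv, He, Rmult_1_l by auto; apply Hb; try lra; (split; [apply Rmult_le_pos; lra|]);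
        (apply Rle_trans with (s * s ^ 2)%R; [apply Rmult_le_compat; lra|rewrite s6; nra]). }
  destruct (mon Ci Cmod_Ci) as (m0 & (m1 & m2) & m3 & m4).
  destruct (mon (- Ci)) as (n0 & (n1 & n2) & n3 & n4). { rewrite Cmod_opp; apply Cmod_Ci. }
  assert (GC : forall t : C, (0 < Cmod t <= M)%R -> Hol gen2 K (fun y => GG q p t (fst y))).
  { intros t Ht. apply (GG_Hol gen2 K q p (fun _ => t) (fun y => fst y) c); auto; try apply Hol_const; intros y Hy; destruct (B y Hy) as (_ & b1 & b2 & b3 & b4).
    - rewrite Cmod_mult. apply Hb; try lra. rewrite s6. nra.
    - unfold Cdiv; rewrite Cmod_mult, Cmod_inv by auto. apply Hb; try lra. rewrite s6. nra. }
  assert (G3 := GC t3 H3). assert (G4 := GC t4 H4). assert (G5 := GC t5 H5).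
  assert (nb := Hn be Hbe).
  assert (nss : forall y, K y -> snd y * snd y <> 0) by (intros y Hy; apply Cmult_neq_0; auto).
  assert (LL : Hol gen2 K (fun y => / (snd y * snd y))) by (apply Hol_inv_mul; auto).
  assert (G6 : Hol gen2 K (fun y => GG q p (be / (snd y * snd y)) (fst y))).
  { apply (GG_Hol gen2 K q p (fun y => be / (snd y * snd y)) (fun y => fst y) c); auto.
    - intros y Hy. apply Cdiv_nz; auto.
    - intros y Hy; destruct (B y Hy) as (_ & b1 & b2 & b3 & b4).
      unfold Cdiv; rewrite !Cmod_mult, Cmod_inv, Cmod_mult, Rinv_mult by auto. rewrite Rmult_assoc. apply Hb; try lra.
      split; [repeat apply Rmult_le_pos; lra|]. rewrite s6. apply Rmult_le_compat; try lra; [repeat apply Rmult_le_pos; lra|].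
      apply Rle_trans with (s * s)%R; [apply Rmult_le_compat; lra|nra].
    - intros y Hy; destruct (B y Hy) as (_ & b1 & b2 & b3 & b4).
      unfold Cdiv; rewrite !Cmod_mult, !Cmod_inv, Cmod_mult, Rinv_mult by auto. rewrite Rmult_assoc. apply Hb; try lra.
      split; [repeat apply Rmult_le_pos; lra|]. rewrite s6. apply Rmult_le_compat; try lra; [repeat apply Rmult_le_pos; lra|].
      apply Rle_trans with (s * s)%R; [apply Rmult_le_compat; lra|nra].
    - unfold Cdiv. hol.
    - apply (Hol_inv_div gen2 K (fun _ => be) (fun y => snd y * snd y)); auto; hol. }
  assert (GV : Hol gen2 K (fun y => Vfac q p (fst y))) by (apply (Vfac_Hol gen2 K q p (fun y => fst y)); auto).
  unfold Rker. cbv beta in *. fold K. hol.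
Qed.

Lemma Rlam_Hol1 (q p t3 t4 t5 be : C) (M s : R) : (0 < Cmod q <= M)%R -> (0 < Cmod p <= M)%R ->
  (0 < Cmod t3 <= M)%R -> (0 < Cmod t4 <= M)%R -> (0 < Cmod t5 <= M)%R -> (0 < Cmod be <= M)%R -> (1 < s)%R -> (M * s ^ 6 < 1)%R ->
  t3 * t4 * t5 * be = p * q ->
  Hol1 (/ s) s (fun l => Rlam q p (Ci * l) (- Ci * l) t3 t4 t5 (be / (l * l))).
Proof.
  intros Hq Hp H3 H4 H5 Hbe Hs HM E.
  set (K := ann (/ s) s).
  assert (Hs2 : (1 < s ^ 2)%R) by nra.
  assert (s6 : (s ^ 6 = s ^ 2 * s ^ 2 * s ^ 2)%R) by ring.
  assert (Hs4 : (1 < s ^ 2 * s ^ 2)%R) by nra.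
  assert (Hs6 : (1 < s ^ 6)%R) by (rewrite s6; nra).
  set (c := (M * s ^ 6)%R) in *.
  assert (Hb : forall x y, (0 <= x <= M)%R -> (0 <= y <= s ^ 6)%R -> (x * y <= c)%R) by (intros x y Hx Hy; unfold c; apply Rmult_le_compat; lra).
  assert (HM1 : (M < 1)%R) by (assert (h := Hb M 1%R ltac:(lra) ltac:(lra)); lra).
  assert (Hc : (0 <= c < 1)%R) by (split; [unfold c; apply Rmult_le_pos; lra|lra]).
  assert (Hq1 : (Cmod q < 1)%R) by lra. assert (Hp1 : (Cmod p < 1)%R) by lra.
  assert (Hn : forall u : C, (0 < Cmod u <= M)%R -> u <> 0) by (intros; apply Cmod_nz; lra).
  assert (n3 := Hn _ H3). assert (n4 := Hn _ H4). assert (n5 := Hn _ H5). assert (nb := Hn _ Hbe). assert (nq := Hn _ Hq). assert (np := Hn _ Hp).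
  assert (is : (0 < / s < 1)%R) by (split; [apply Rinv_0_lt_compat; lra|rewrite <- Rinv_1; apply Rinv_lt_contravar; lra]).
  assert (B : forall l, K l -> l <> 0 /\ (0 < Cmod l <= s)%R /\ (0 < / Cmod l <= s)%R).
  { intros l [b1 b2]. repeat split; try (apply Cmod_nz; lra); try lra; try (apply Rinv_0_lt_compat; lra).
    rewrite <- (Rinv_inv s). apply Rinv_le_contravar; lra. }
  assert (L1 : Hol gen1 K (fun l => l)) by apply Hol1_id.
  assert (L2 : Hol gen1 K (fun l => / l)) by (apply Hol1_inv; lra).
  assert (nl : forall l, K l -> l <> 0) by (intros y Hy; apply B; auto).
  assert (nll : forall l, K l -> l * l <> 0) by (intros y Hy; apply Cmult_neq_0; auto).
  assert (LL : Hol gen1 K (fun l => / (l * l))) by (apply Hol_inv_mul; auto).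
  assert (c2 : (s ^ 2 <= s ^ 6)%R) by (rewrite s6; nra).
  assert (I12 : forall l, Ci * l * (- Ci * l) = l * l).
  { intros l. replace (Ci * l * (- Ci * l)) with (- (Ci * Ci) * (l * l)) by ring. rewrite Ci_sq. ring. }
  assert (A0 : Hol gen1 K (fun l => dpoch0 q p (Ci * l * (- Ci * l)))).
  { apply Hol_ext with (fun l => dpoch0 q p (l * l)); [intros; rewrite I12; auto|].
    unfold dpoch0. apply (Hol_mul gen1 K); apply dpoch_comp_Hol; auto using Cmod_0_lt_1; hol. }
  assert (A1 : Hol gen1 K (fun l => / dpoch q p (p * q / (Ci * l * (- Ci * l))))).
  { apply Hol_ext with (fun l => / dpoch q p (p * q / (l * l))); [intros; rewrite I12; auto|].
    apply dpoch_inv_Hol with c; auto; [|unfold Cdiv; hol].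
    intros l Hl. destruct (B l Hl) as (h1 & h2 & h3). unfold Cdiv. rewrite !Cmod_mult, Cmod_inv, Cmod_mult, Rinv_mult by auto. rewrite Rmult_assoc.
    apply Hb; [lra|]. split; [repeat apply Rmult_le_pos; lra|]. rewrite <- (Rmult_1_l (s ^ 6)). apply Rmult_le_compat; try lra; [repeat apply Rmult_le_pos; lra|].
    apply Rle_trans with (s * s)%R; [apply Rmult_le_compat; lra|]. simpl in c2; lra. }
  assert (I : forall u v : C -> C, (forall l, K l -> u l <> 0) -> (forall l, K l -> v l <> 0) ->
     (forall l, K l -> exists x y, (0 <= x <= M)%R /\ (0 <= y <= s ^ 6)%R /\ (Cmod (p * q / (u l * v l)) = x * y)%R) ->
     Hol gen1 K u -> Hol gen1 K (fun l => / u l) -> Hol gen1 K v -> Hol gen1 K (fun l => / v l) -> Hol gen1 K (fun l => iGam q p (u l * v l))).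
  { intros u v nu nv Huv Hu Hui Hv Hvi. apply iGam_Hol with c; auto.
    - intros l Hl. destruct (Huv l Hl) as (x & y & h1 & h2 & h3). rewrite h3. apply Hb; auto.
    - hol.
    - apply Hol_inv_mul; auto. }
  assert (Hbb : Hol gen1 K (fun l => be / (l * l))) by (unfold Cdiv; hol).
  assert (Hbi : Hol gen1 K (fun l => / (be / (l * l)))) by (apply (Hol_inv_div gen1 K (fun _ => be) (fun l => l * l)); auto; hol).
  assert (nbl : forall l, K l -> be / (l * l) <> 0) by (intros; apply Cdiv_nz; auto).
  assert (E1 : forall e t t' t'' : C, Cmod e = 1%R -> (0 < Cmod t <= M)%R -> (0 < Cmod t' <= M)%R -> (0 < Cmod t'' <= M)%R -> t * t' * t'' * be = p * q ->
     Hol gen1 K (fun l => iGam q p (e * l * t))).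
  { intros e t t' t'' He Ht Ht' Ht'' Et. assert (ne : e <> 0) by (apply Cmod_nz; lra). assert (nt := Hn _ Ht).
    apply (I (fun l => e * l) (fun _ => t)); auto; try apply Hol_const; try (apply Hol_inv_mul; auto; hol); try hol.
    - intros l Hl. apply Cmult_neq_0; auto.
    - intros l Hl. destruct (B l Hl) as (h1 & h2 & h3). exists (Cmod t')%R, (Cmod t'' * Cmod be * / Cmod l)%R.
      split; [lra|]. split.
      + assert (0 <= Cmod t'' * Cmod be <= 1)%R by (split; nra). split; [apply Rmult_le_pos; lra|]. nra.
      + rewrite <- Et. replace (t * t' * t'' * be / (e * l * t)) with (t' * t'' * be / (e * l)) by (field; auto).
        unfold Cdiv. rewrite !Cmod_mult, Cmod_inv, Cmod_mult, He, Rmult_1_l by nz. ring. }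
  assert (E6 : forall e : C, Cmod e = 1%R -> Hol gen1 K (fun l => iGam q p (e * l * (be / (l * l))))).
  { intros e He. assert (ne : e <> 0) by (apply Cmod_nz; lra).
    apply (I (fun l => e * l) (fun l => be / (l * l))); auto; try (apply Hol_inv_mul; auto; hol); try hol.
    - intros l Hl. apply Cmult_neq_0; auto.
    - intros l Hl. destruct (B l Hl) as (h1 & h2 & h3). exists (Cmod t3)%R, (Cmod t4 * Cmod t5 * Cmod l)%R.
      split; [lra|]. split.
      + assert (0 <= Cmod t4 * Cmod t5 <= 1)%R by (split; nra). split; [apply Rmult_le_pos; lra|]. nra.
      + rewrite <- E. replace (t3 * t4 * t5 * be / (e * l * (be / (l * l)))) with (t3 * t4 * t5 * l / e) by (field; auto).
        unfold Cdiv. rewrite !Cmod_mult, Cmod_inv, He, Rinv_1 by nz. ring. }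
  assert (E7 : forall t t' t'' : C, (0 < Cmod t <= M)%R -> (0 < Cmod t' <= M)%R -> (0 < Cmod t'' <= M)%R -> t * t' * t'' * be = p * q ->
     Hol gen1 K (fun l => iGam q p (t * (be / (l * l))))).
  { intros t t' t'' Ht Ht' Ht'' Et. assert (nt := Hn _ Ht).
    apply (I (fun l => t) (fun l => be / (l * l))); auto; try apply Hol_const.
    intros l Hl. destruct (B l Hl) as (h1 & h2 & h3). exists (Cmod t')%R, (Cmod t'' * (Cmod l * Cmod l))%R.
    split; [lra|]. split.
    - assert (0 <= Cmod l * Cmod l <= s ^ 2)%R by (split; nra). split; [apply Rmult_le_pos; lra|]. nra.
    - rewrite <- Et. replace (t * t' * t'' * be / (t * (be / (l * l)))) with (t' * t'' * (l * l)) by (field; auto).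
      rewrite !Cmod_mult. ring. }
  assert (mC : Cmod (- Ci) = 1%R) by (rewrite Cmod_opp; apply Cmod_Ci).
  assert (a3 := E1 Ci t3 t4 t5 Cmod_Ci H3 H4 H5 E). assert (a4 := E1 Ci t4 t3 t5 Cmod_Ci H4 H3 H5 ltac:(rewrite <- E; ring)).
  assert (a5 := E1 Ci t5 t3 t4 Cmod_Ci H5 H3 H4 ltac:(rewrite <- E; ring)). assert (a6 := E6 Ci Cmod_Ci).
  assert (b3 := E1 (- Ci) t3 t4 t5 mC H3 H4 H5 E). assert (b4 := E1 (- Ci) t4 t3 t5 mC H4 H3 H5 ltac:(rewrite <- E; ring)).
  assert (b5 := E1 (- Ci) t5 t3 t4 mC H5 H3 H4 ltac:(rewrite <- E; ring)). assert (b6 := E6 (- Ci) mC).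
  assert (d3 := E7 t3 t4 t5 H3 H4 H5 E). assert (d4 := E7 t4 t3 t5 H4 H3 H5 ltac:(rewrite <- E; ring)). assert (d5 := E7 t5 t3 t4 H5 H3 H4 ltac:(rewrite <- E; ring)).
  unfold Rlam. fold K. hol.
Qed.

Lemma Hol_inv_1p {X} gen (K : X -> Prop) (u : X -> C) (c : R) : (c < 1)%R -> (forall x, K x -> (Cmod (u x) <= c)%R) ->
  Hol gen K u -> Hol gen K (fun x => / (1 + u x)).
Proof.
  intros Hc HK Hu. apply Hol_inv with (1 - c)%R; [lra| |].
  - intros x Hx. specialize (HK x Hx). assert (h := Cmod_triangle_rev 1 (- u x)). rewrite Cmod_1, Cmod_opp in h.
    replace (1 - - u x) with (1 + u x) in h by ring. lra.
  - apply Hol_add; [apply Hol_const|auto].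
Qed.

(* Both poles +-i of R/(1+z^2) lie between the two circles. *)
Lemma mean_poles (f : C -> C) (r : R) : (0 < r < 1)%R -> Hol1 r (/ r) f ->
  mean (fun z => f z * / (1 + z * z)) (RtoC r) + mean (fun z => f z * / (1 + / (z * z))) (RtoC (/ r)) - mean f 1 =
  (f Ci + f (- Ci)) / 2.
Proof.
  intros Hr Hf.
  assert (ir : (1 < / r)%R) by (rewrite <- Rinv_1; apply Rinv_lt_contravar; lra).
  assert (m1 : Cmod (RtoC r) = r) by (rewrite Cmod_R, Rabs_pos_eq; lra).
  assert (m2 : Cmod (RtoC (/ r)) = (/ r)%R) by (rewrite Cmod_R, Rabs_pos_eq; lra).
  assert (A1 : ann r (/ r) (RtoC r)) by (unfold ann; lra). assert (A2 : ann r (/ r) (RtoC (/ r))) by (unfold ann; lra).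
  assert (A3 : ann r (/ r) 1) by (unfold ann; rewrite Cmod_1; lra).
  assert (mC : Cmod Ci = 1%R) by apply Cmod_Ci. assert (mC' : Cmod (- Ci) = 1%R) by (rewrite Cmod_opp; auto).
  assert (C1 := Hol_Cauchy r (/ r) f (RtoC r) (RtoC (/ r)) Ci (proj1 Hr) Hf A1 A2 ltac:(lra)).
  assert (C2 := Hol_Cauchy r (/ r) f (RtoC r) (RtoC (/ r)) (- Ci) (proj1 Hr) Hf A1 A2 ltac:(lra)).
  assert (Hk : forall w x, ann r (/ r) w -> Cmod w <> 1%R -> Cmod x = 1%R -> circ_ok (fun s => f s * (s / (s - x))) w).
  { intros w x Hw Hw1 Hx. apply circ_ok_point. apply Hol_mul.
    - apply (Hol_ann_point r (/ r)); auto.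
    - apply kernel_Hol. rewrite Hx; auto. }
  (* Since s/(s - i) + s/(s + i) = 2 s^2 / (1 + s^2), the Cauchy kernels at the two poles add up to
     the integrands in question. *)
  assert (S : forall w, ann r (/ r) w -> Cmod w <> 1%R ->
    mean (fun s => f s * (s / (s - Ci))) w + mean (fun s => f s * (s / (s - - Ci))) w = 2 * mean (fun s => f s * (s * s * / (1 + s * s))) w /\
    circ_ok (fun s => f s * (s * s * / (1 + s * s))) w /\
    mean (fun z => f z * / (1 + z * z)) w = mean f w - mean (fun s => f s * (s * s * / (1 + s * s))) w /\
    mean (fun z => f z * / (1 + / (z * z))) w = mean (fun s => f s * (s * s * / (1 + s * s))) w).
  { intros w Hw Hw1. assert (O1 := Hk w Ci Hw Hw1 mC). assert (O2 := Hk w (- Ci) Hw Hw1 mC').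
    assert (Of : circ_ok f w) by (apply (Hol_circ_ok r (/ r)); auto).
    assert (Hz : forall z, Cmod z = Cmod w -> z <> 0 /\ z - Ci <> 0 /\ z - - Ci <> 0 /\ 1 + z * z <> 0).
    { intros z Hz. assert (a : z - Ci <> 0) by (intro h; apply Ceq_minus in h; subst z; rewrite mC in Hz; auto).
      assert (b : z - - Ci <> 0) by (intro h; apply Ceq_minus in h; rewrite h, mC' in Hz; auto).
      repeat split; auto.
      - apply Cmod_nz. destruct Hw; lra.
      - replace (1 + z * z) with ((z - Ci) * (z - - Ci)); [nz|]. replace ((z - Ci) * (z - - Ci)) with (z * z - Ci * Ci) by ring. rewrite Ci_sq. ring. }
    assert (E : forall z, Cmod z = Cmod w -> f z * (z / (z - Ci)) + f z * (z / (z - - Ci)) = 2 * (f z * (z * z * / (1 + z * z)))).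
    { intros z Hzw. destruct (Hz z Hzw) as (a & b & c & d).
      assert (e : 1 + z * z = (z - Ci) * (z - - Ci)).
      { replace ((z - Ci) * (z - - Ci)) with (z * z - Ci * Ci) by ring. rewrite Ci_sq. ring. }
      rewrite e. field. auto. }
    assert (O3 : circ_ok (fun s => f s * (s * s * / (1 + s * s))) w).
    { destruct O1 as [l1 O1]. destruct O2 as [l2 O2]. exists (/ 2 * (l1 + l2)).
      eapply (@is_RInt_ext C_R_NormedModule); [|apply is_RInt_Cmult, (@is_RInt_plus C_R_NormedModule _ _ _ _ _ _ O1 O2)].
      intros x _. C_eq. assert (mx : Cmod (w * cis x) = Cmod w) by (rewrite Cmod_mult, Cmod_cis; ring).
      assert (Ez := E _ mx). change (plus ?a ?b) with (a + b). rewrite Ez.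
      rewrite Cmult_assoc. replace (/ 2 * 2) with (RtoC 1) by field. ring. }
    split; [|split; [exact O3|split]].
    - rewrite <- mean_add, <- mean_scal by auto. apply mean_ext. auto.
    - rewrite <- mean_sub by auto. apply mean_ext. intros z Hzw. destruct (Hz z Hzw) as (a & b & c & d). field. auto.
    - apply mean_ext. intros z Hzw. destruct (Hz z Hzw) as (a & b & c & d). 
      assert (d' : z * z + 1 <> 0) by (replace (z * z + 1) with (1 + z * z) by ring; auto). field. repeat split; auto. }
  destruct (S (RtoC r) A1 ltac:(lra)) as (S1 & _ & S2 & _). destruct (S (RtoC (/ r)) A2 ltac:(lra)) as (S3 & _ & _ & S4).
  rewrite S2, S4. rewrite (Hol_mean_const r (/ r) f (RtoC r) 1) by (auto; lra).
  rewrite C1, C2.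
  set (a := mean (fun s => f s * (s / (s - Ci))) (RtoC (/ r))) in *. set (b := mean (fun s => f s * (s / (s - - Ci))) (RtoC (/ r))) in *.
  set (a' := mean (fun s => f s * (s / (s - Ci))) (RtoC r)) in *. set (b' := mean (fun s => f s * (s / (s - - Ci))) (RtoC r)) in *.
  replace (a - a' + (b - b')) with ((a + b) - (a' + b')) by ring. rewrite S1, S3. field.
Qed.

Lemma F5_value (q p t1 t2 t3 t4 t5 : C) : (0 < Cmod q < 1)%R -> (0 < Cmod p < 1)%R ->
  (0 < Cmod t1 < 1)%R -> (0 < Cmod t2 < 1)%R -> (0 < Cmod t3 < 1)%R -> (0 < Cmod t4 < 1)%R -> (0 < Cmod t5 < 1)%R ->
  (Cmod p < Cmod (t1 * t2 * t3 * t4 * t5) ^ 2)%R ->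
  F5 q p t1 t2 t3 t4 t5 = RtoC 2 / (poch p p * poch q q).
Proof.
  intros Hq Hp H1 H2 H3 H4 H5 HD.
  assert (Hn : forall s : C, (0 < Cmod s < 1)%R -> s <> 0) by (intros; apply Cmod_nz; lra).
  assert (n1 := Hn _ H1). assert (n2 := Hn _ H2). assert (n3 := Hn _ H3). assert (n4 := Hn _ H4). assert (n5 := Hn _ H5).
  assert (nq := Hn _ Hq). assert (np := Hn _ Hp).
  set (b := t3 * t4 * t5).
  assert (Hb : (0 < Cmod b < 1)%R) by (unfold b; repeat apply Cmod_lt1_mul; auto).
  assert (nb := Hn _ Hb).
  assert (H12 := Cmod_lt1_mul _ _ H1 H2).
  assert (EB : Cmod (t1 * t2 * t3 * t4 * t5) = (Cmod (t1 * t2) * Cmod b)%R).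
  { rewrite <- Cmod_mult. f_equal. unfold b. ring. }
  rewrite EB in HD.
  assert (Hxb : (0 < Cmod (t1 * t2) * Cmod b < Cmod b)%R) by (split; [apply Rmult_lt_0_compat; lra|nra]).
  assert (Hbp : (Cmod p < Cmod b)%R) by nra.
  set (be := p * q / b).
  assert (Ebe : t3 * t4 * t5 * be = p * q) by (unfold be, b; field; repeat split; auto).
  assert (Hbe : (0 < Cmod be < 1)%R).
  { unfold be. rewrite Cmod_div, Cmod_mult by auto. split; [apply Rdiv_lt_0_compat; nra|apply Rlt_div_l; nra]. }
  set (M := Rmax (Rmax (Rmax (Cmod t1) (Cmod t2)) (Rmax (Cmod t3) (Cmod t4))) (Rmax (Rmax (Cmod t5) (Cmod be)) (Rmax (Cmod p) (Cmod q)))).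
  assert (M1 : (Cmod t1 <= M)%R) by (unfold M; eauto 6 using Rmax_l, Rmax_r, Rle_trans).
  assert (M2 : (Cmod t2 <= M)%R) by (unfold M; eauto 6 using Rmax_l, Rmax_r, Rle_trans).
  assert (M3 : (Cmod t3 <= M)%R) by (unfold M; eauto 6 using Rmax_l, Rmax_r, Rle_trans).
  assert (M4 : (Cmod t4 <= M)%R) by (unfold M; eauto 6 using Rmax_l, Rmax_r, Rle_trans).
  assert (M5 : (Cmod t5 <= M)%R) by (unfold M; eauto 6 using Rmax_l, Rmax_r, Rle_trans).
  assert (Mb : (Cmod be <= M)%R) by (unfold M; eauto 6 using Rmax_l, Rmax_r, Rle_trans).
  assert (Mp : (Cmod p <= M)%R) by (unfold M; eauto 6 using Rmax_l, Rmax_r, Rle_trans).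
  assert (Mq : (Cmod q <= M)%R) by (unfold M; eauto 6 using Rmax_l, Rmax_r, Rle_trans).
  assert (HM : (0 < M < 1)%R) by (split; [lra|unfold M; repeat apply Rmax_lub_lt; lra]).
  clearbody M.
  destruct (pow6_bound M HM) as (s & Hs & HMs).
  set (kap := F5 q p t1 t2 t3 t4 t5).
  assert (Hs2 : (1 < s ^ 2)%R) by nra.
  assert (is1 : (0 < / s < 1)%R) by (split; [apply Rinv_0_lt_compat; lra|rewrite <- Rinv_1; apply Rinv_lt_contravar; lra]).
  assert (HMis : (M <= / s)%R).
  { assert (h : (1 <= s ^ 5)%R) by (apply pow_R1_Rle; lra).
    assert (h1 : (M * s <= M * s ^ 6)%R) by (apply Rmult_le_compat_l; [lra|]; replace (s ^ 6)%R with (s * s ^ 5)%R by ring; rewrite <- (Rmult_1_r s) at 1; apply Rmult_le_compat_l; lra).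
    replace M with (M * s * / s)%R by (field; lra). rewrite <- (Rmult_1_l (/ s)) at 2. apply Rmult_le_compat_r; lra. }
  (* On |z| = r with |l| <= s one has |l^2 z^2| <= s^2 r^2 = r < 1, so the poles of 1/(1 + l^2 z^2)
     stay away from this circle for every l in the annulus. The circle of radius 1/r plays the same
     part for 1/(1 + l^2 / z^2). *)
  set (r := (/ s ^ 2)%R).
  assert (Hr : (0 < r < 1)%R) by (unfold r; split; [apply Rinv_0_lt_compat; lra|rewrite <- Rinv_1; apply Rinv_lt_contravar; lra]).
  assert (Er : (/ r = s ^ 2)%R) by (unfold r; apply Rinv_inv).
  assert (rs : (r * s * s = 1)%R) by (unfold r; field; lra).
  assert (I12 : forall l, Ci * l * (- Ci * l) = l * l).
  { intros l. replace (Ci * l * (- Ci * l)) with (- (Ci * Ci) * (l * l)) by ring. rewrite Ci_sq. ring. }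
  set (R2 := fun y : C * C => Rker q p (Ci * snd y) (- Ci * snd y) t3 t4 t5 (be / (snd y * snd y)) (fst y)).
  assert (HR2 : Hol2 r (/ r) (/ s) s R2).
  { rewrite Er. unfold r, R2. apply Rker_Hol2 with M; auto; split; try lra. }
  set (RL := fun l => Rlam q p (Ci * l) (- Ci * l) t3 t4 t5 (be / (l * l))).
  assert (HRL : Hol1 (/ s) s RL) by (unfold RL; apply (Rlam_Hol1 q p t3 t4 t5 be M s); try assumption; split; lra).
  (* For |l| = 1/s all three means agree with means over the unit circle. On the displaced circles
     the first two continue holomorphically across |l| = 1. *)
  set (m1 := fun l => mean (fun z => R2 (z, l) * / (1 + l * l * (z * z))) (RtoC r)).
  set (m2 := fun l => mean (fun z => R2 (z, l) * / (1 + l * l / (z * z))) (RtoC (/ r))).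
  set (m3 := fun l => mean (fun z => R2 (z, l)) 1).
  assert (mr : Cmod (RtoC r) = r) by (rewrite Cmod_R, Rabs_pos_eq; lra).
  assert (mir : Cmod (RtoC (/ r)) = (/ r)%R) by (rewrite Cmod_R, Rabs_pos_eq; lra).
  assert (Ar : ann r (/ r) (RtoC r)) by (unfold ann; lra). assert (Air : ann r (/ r) (RtoC (/ r))) by (unfold ann; lra).
  assert (A1 : ann r (/ r) 1) by (unfold ann; rewrite Cmod_1; lra).
  assert (Hm1 : Hol1 (/ s) s m1).
  { apply (Hol2_mean r r (/ s) s (fun y => R2 y * / (1 + snd y * snd y * (fst y * fst y))) (RtoC r)); [|unfold ann; lra].
    apply Hol_mul.
    - eapply Hol_subset; [|exact HR2]. intros [z l] [[a1 a2] a3]; split; auto. unfold ann; simpl in *; lra.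
    - apply Hol_inv_1p with r; [lra| |].
      + intros [z l] [[a1 a2] [a3 a4]]. simpl in *. rewrite !Cmod_mult. assert (Ez : Cmod z = r) by lra. rewrite Ez.
        replace r with ((s * s) * (r * r))%R at 3 by (replace (s * s * (r * r))%R with ((r * s * s) * r)%R by ring; rewrite rs; ring).
        apply Rmult_le_compat_r; [nra|]. apply Rmult_le_compat; lra.
      + assert (Z1 := Hol2_fst r r (/ s) s). assert (Z2 := Hol2_snd r r (/ s) s). hol. }
  assert (Hm2 : Hol1 (/ s) s m2).
  { apply (Hol2_mean (/ r) (/ r) (/ s) s (fun y => R2 y * / (1 + snd y * snd y / (fst y * fst y))) (RtoC (/ r))); [|unfold ann; lra].
    apply Hol_mul.
    - eapply Hol_subset; [|exact HR2]. intros [z l] [[a1 a2] a3]; split; auto. unfold ann; simpl in *; lra.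
    - apply Hol_inv_1p with r; [lra| |].
      + intros [z l] [[a1 a2] [a3 a4]]. simpl in *. assert (Ez : Cmod z = (/ r)%R) by lra.
        assert (z <> 0) by (apply Cmod_nz; lra).
        rewrite Cmod_div, !Cmod_mult, Ez by nz. unfold Rdiv. rewrite Rinv_mult, Rinv_inv.
        replace r with ((s * s) * (r * r))%R at 3 by (replace (s * s * (r * r))%R with ((r * s * s) * r)%R by ring; rewrite rs; ring).
        apply Rmult_le_compat_r; [nra|]. apply Rmult_le_compat; lra.
      + assert (Z1 := Hol2_fst (/ r) (/ r) (/ s) s). assert (Z2 := Hol2_snd (/ r) (/ r) (/ s) s).
        assert (Z3 : Hol2 (/ r) (/ r) (/ s) s (fun y => / fst y)) by (apply (Hol1_fst _ _ _ _ (fun z => / z)), Hol1_inv; lra).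
        assert (nf : forall y, ann2 (/ r) (/ r) (/ s) s y -> fst y <> 0) by (intros y [[a _] _]; apply Cmod_nz; lra).
        assert (Z4 : Hol2 (/ r) (/ r) (/ s) s (fun y => / (fst y * fst y))) by (apply Hol_inv_mul; auto).
        unfold Cdiv. hol. }
  assert (Hm3 : Hol1 (/ s) s m3) by (apply (Hol2_mean r (/ r) (/ s) s R2 1); auto).
  (* The factor 1 - l^2 of the prefactor has been used against (1 - l^2)(1 + l^2) from the kernel,
     hence the remaining 1 + l^2. [G] vanishes on |l| = 1/s, where the unit circle separates the
     poles, and therefore also at l = 1. *)
  set (G := fun l => RL l * (m1 l + m2 l - m3 l) - (1 + l * l) * kap).
  assert (HG : Hol1 (/ s) s G) by (unfold G; hol).
  assert (HG1 : G 1 = 0).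
  { apply (identity_annulus (/ s) s G (RtoC (/ s))); auto; [lra| | |].
    - unfold ann. rewrite Cmod_R, Rabs_pos_eq; lra.
    - rewrite Cmod_1. lra.
    - intros l Hl. rewrite Cmod_R, Rabs_pos_eq in Hl by lra.
      assert (nl : l <> 0) by (apply Cmod_nz; lra).
      assert (Hl1 : (0 < Cmod l < 1)%R) by lra.
      assert (mC : Cmod (- Ci) = 1%R) by (rewrite Cmod_opp; apply Cmod_Ci).
      assert (Hcl : Cmod (Ci * l) = Cmod l) by (rewrite Cmod_mult, Cmod_Ci; ring).
      assert (Hcl' : Cmod (- Ci * l) = Cmod l) by (rewrite Cmod_mult, mC; ring).
      assert (HB0 : (0 < Cmod (t1 * t2) * Cmod b)%R) by nra.
      assert (Hsq : forall x y : R, (0 < x <= y)%R -> (x ^ 2 <= y ^ 2)%R) by (intros; nra).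
      (* Since |l| = 1/s >= M, replacing t_1 and t_2 by i l and - i l only increases |A|, so the
         hypothesis of [F5_const1] persists through the exchanges. *)
      assert (Hk : F5 q p (Ci * l) (- Ci * l) t3 t4 t5 = kap).
      { unfold kap. rewrite (F5_const1 q p t1 (Ci * l) t2 t3 t4 t5); auto; try lra.
        - rewrite (F5_swap q p (Ci * l) t2), (F5_const1 q p t2 (- Ci * l) (Ci * l) t3 t4 t5); auto; try lra.
          + rewrite F5_swap. reflexivity.
          + eapply Rlt_le_trans; [exact HD|]. apply Hsq. split; auto. 
            replace (t2 * (Ci * l) * t3 * t4 * t5) with (t2 * (Ci * l) * b) by (unfold b; ring). rewrite !Cmod_mult. rewrite Cmod_Ci, Rmult_1_l.
            apply Rmult_le_compat_r; [lra|]. rewrite Rmult_comm. apply Rmult_le_compat_l; lra.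
          + eapply Rlt_le_trans; [exact HD|]. apply Hsq. split; auto. 
            replace (- Ci * l * (Ci * l) * t3 * t4 * t5) with (l * l * b) by (rewrite <- (I12 l); unfold b; ring). rewrite !Cmod_mult.
            apply Rmult_le_compat_r; [lra|]. apply Rmult_le_compat; lra.
        - rewrite EB. exact HD.
        - eapply Rlt_le_trans; [exact HD|]. apply Hsq. split; auto. 
          replace (Ci * l * t2 * t3 * t4 * t5) with (Ci * l * t2 * b) by (unfold b; ring). rewrite !Cmod_mult. rewrite Cmod_Ci, Rmult_1_l.
          apply Rmult_le_compat_r; [lra|]. apply Rmult_le_compat_r; lra. }
      assert (Et6 : p * q / (Ci * l * (- Ci * l) * t3 * t4 * t5) = be / (l * l)).
      { rewrite I12. unfold be, b. field. repeat split; auto. }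
      unfold F5 in Hk. rewrite Et6 in Hk. unfold F6 in Hk. rewrite pairs6_Rlam, I12 in Hk by lra. fold (RL l) in Hk.
      assert (Hlr : (Cmod l * Cmod l = r)%R) by (rewrite Hl; unfold r; field; lra).
      assert (Hl_ann : ann (/ s) s l) by (unfold ann; lra).
      assert (HRz : Hol1 r (/ r) (fun z => R2 (z, l))) by (apply (Hol2_slice_r r (/ r) (/ s) s); auto).
      assert (Ha : Hol1 r 1 (fun z => R2 (z, l) * / (1 + l * l * (z * z)))).
      { apply Hol_mul; [apply Hol1_sub with r (/ r)%R; auto; lra|]. apply Hol_inv_1p with r; [lra| |hol].
        intros z [z1 z2]. rewrite !Cmod_mult, Hlr. rewrite <- (Rmult_1_r r) at 2. apply Rmult_le_compat_l; [lra|]. rewrite <- (Rmult_1_r 1). apply Rmult_le_compat; lra. }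
      assert (Hc : Hol1 1 (/ r) (fun z => R2 (z, l) * / (1 + l * l / (z * z)))).
      { apply Hol_mul; [apply Hol1_sub with r (/ r)%R; auto; lra|]. apply Hol_inv_1p with r; [lra| |].
        - intros z [z1 z2]. assert (z <> 0) by (apply Cmod_nz; lra). rewrite Cmod_div, !Cmod_mult, Hlr by nz.
          assert (hz : (1 * 1 <= Cmod z * Cmod z)%R) by (apply Rmult_le_compat; lra).
          apply Rle_div_l; [lra|]. rewrite <- (Rmult_1_r r) at 1. apply Rmult_le_compat_l; lra.
        - unfold Cdiv. hol. apply Hol_inv_mul; try (intros z [z1 z2]; apply Cmod_nz; lra); apply Hol1_inv; lra. }
      assert (E1 : m1 l = mean (fun z => R2 (z, l) * / (1 + l * l * (z * z))) 1).
      { unfold m1. apply (Hol_mean_const r 1 (fun z => R2 (z, l) * / (1 + l * l * (z * z))) (RtoC r) 1); try assumption; [lra|unfold ann; lra|unfold ann; rewrite Cmod_1; lra]. }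
      assert (E2 : m2 l = mean (fun z => R2 (z, l) * / (1 + l * l / (z * z))) 1).
      { unfold m2. apply (Hol_mean_const 1 (/ r) (fun z => R2 (z, l) * / (1 + l * l / (z * z))) (RtoC (/ r)) 1); try assumption; [lra|unfold ann; lra|unfold ann; rewrite Cmod_1; lra]. }
      assert (O1 : circ_ok (fun z => R2 (z, l) * / (1 + l * l * (z * z))) 1) by (apply (Hol_circ_ok r 1); auto; unfold ann; rewrite Cmod_1; lra).
      assert (O2 : circ_ok (fun z => R2 (z, l) * / (1 + l * l / (z * z))) 1) by (apply (Hol_circ_ok 1 (/ r)); auto; unfold ann; rewrite Cmod_1; lra).
      assert (O3 : circ_ok (fun z => R2 (z, l)) 1) by (apply (Hol_circ_ok r (/ r)); auto).
      assert (Hbl : (0 < Cmod (be / (l * l)) < 1)%R).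
      { rewrite Cmod_div, Cmod_mult, Hlr by nz. split; [apply Rdiv_lt_0_compat; lra|]. apply Rlt_div_l; [lra|]. rewrite Rmult_1_l.
        apply Rle_lt_trans with M; auto. rewrite <- Hlr. rewrite Hl.
        assert (h4 : (1 < s ^ 4)%R) by (replace (s ^ 4)%R with (s ^ 2 * s ^ 2)%R by ring; nra).
        assert (h5 : (M * (s * s) < 1)%R) by (apply Rle_lt_trans with (M * s ^ 6)%R; auto; apply Rmult_le_compat_l; [lra|]; replace (s ^ 6)%R with (s * s * s ^ 4)%R by ring; nra).
        rewrite <- Rinv_mult. rewrite <- (Rmult_1_l (/ (s * s))). apply Rlt_div_r; nra. }
      assert (OK : circ_ok (Ker q p (Ci * l) (- Ci * l) t3 t4 t5 (be / (l * l))) 1) by (apply Ker_circ_ok; auto; lra).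
      assert (E3 : mean (Ker q p (Ci * l) (- Ci * l) t3 t4 t5 (be / (l * l))) 1 * ((1 - l * l) * (1 + l * l)) = m1 l + m2 l - m3 l).
      { rewrite E1, E2. unfold m3. rewrite Cmult_comm, <- mean_scal, <- mean_add, <- mean_sub; auto.
        - apply mean_ext. intros z Hz. rewrite Cmod_1 in Hz. rewrite Cmult_comm, Ker_Rker by auto. unfold R2; simpl. ring.
        - destruct O1 as [l1 O1]. destruct O2 as [l2 O2]. exists (l1 + l2). apply (@is_RInt_plus C_R_NormedModule _ _ _ _ _ _ O1 O2). }
      unfold G. rewrite <- E3, <- Hk. ring. }
  assert (J1 : m1 1 + m2 1 - m3 1 = (R2 (Ci, RtoC 1) + R2 (- Ci, RtoC 1)) / 2).
  { rewrite <- (mean_poles (fun z => R2 (z, RtoC 1)) r); auto.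
    - unfold m1, m2, m3. f_equal. f_equal.
      + apply mean_ext. intros. do 2 f_equal. ring.
      + apply mean_ext. intros. do 2 f_equal. unfold Cdiv. ring.
    - apply (Hol2_slice_r r (/ r) (/ s) s); auto. unfold ann. rewrite Cmod_1. lra. }
  assert (J2 : forall z, R2 (z, RtoC 1) = Rker q p Ci (- Ci) t3 t4 t5 be z).
  { intros z. unfold R2; simpl. rewrite !Cmult_1_r. f_equal. field. }
  assert (J3 : RL 1 = Rlam q p Ci (- Ci) t3 t4 t5 be).
  { unfold RL. rewrite !Cmult_1_r. f_equal. field. }
  unfold G in HG1. rewrite J1, !J2, J3 in HG1.
  assert (V1 := residue_value q p t3 t4 t5 be Ci Hq Hp H3 H4 H5 Hbe Ebe ltac:(auto)).
  assert (V2 := residue_value q p t3 t4 t5 be (- Ci) Hq Hp H3 H4 H5 Hbe Ebe ltac:(auto)).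
  assert (N1 : poch p p <> 0) by (apply poch_nz; lra). assert (N2 : poch q q <> 0) by (apply poch_nz; lra).
  set (A := Rlam q p Ci (- Ci) t3 t4 t5 be) in *. set (X1 := Rker q p Ci (- Ci) t3 t4 t5 be Ci) in *. set (X2 := Rker q p Ci (- Ci) t3 t4 t5 be (- Ci)) in *.
  replace (A * ((X1 + X2) / 2) - (1 + 1 * 1) * kap) with ((A * X1 + A * X2) / 2 - 2 * kap) in HG1 by field.
  rewrite V1, V2 in HG1. fold kap.
  replace kap with (/ 2 * ((RtoC 4 / (poch p p * poch q q) + RtoC 4 / (poch p p * poch q q)) / 2 -
    ((RtoC 4 / (poch p p * poch q q) + RtoC 4 / (poch p p * poch q q)) / 2 - 2 * kap))) by (field; auto).
  rewrite HG1. field. auto.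
Qed.

(** * Contour integrals *)

Lemma piecewise_C1_lt gamma a b : piecewise_C1 gamma a b -> (a < b)%R.
Proof. induction 1; lra. Qed.

(** Clamps the parameter to [a, b]: a path known to stay in [K] on [a, b] becomes a continuous path
    that stays in [K] for all real parameters. *)
Definition clip (a b s : R) : R := Rmax a (Rmin b s).

Lemma clip_in a b s : (a <= b)%R -> (a <= clip a b s <= b)%R.
Proof. intros H. unfold clip, Rmax, Rmin. repeat destruct Rle_dec; lra. Qed.

Lemma clip_id a b s : (a <= s <= b)%R -> clip a b s = s.
Proof. intros H. unfold clip, Rmax, Rmin. repeat destruct Rle_dec; lra. Qed.

Lemma clip_lip a b s t : (Rabs (clip a b s - clip a b t) <= Rabs (s - t))%R.
Proof. unfold clip, Rmax, Rmin. repeat destruct Rle_dec; unfold Rabs; repeat destruct Rcase_abs; lra. Qed.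

Lemma is_derive_continuous_C (g : R -> C) s l : @is_derive R_AbsRing C_R_NormedModule g s l ->
  @continuous R_UniformSpace C_R_NormedModule g s.
Proof. intros H. apply (@ex_derive_continuous R_AbsRing C_R_NormedModule). eexists; eauto. Qed.

Lemma continuous_Cmult (f g : R -> C) s :
  @continuous R_UniformSpace C_R_NormedModule f s -> @continuous R_UniformSpace C_R_NormedModule g s ->
  @continuous R_UniformSpace C_R_NormedModule (fun s => f s * g s) s.
Proof.
  intros Hf Hg. apply continuous_C_R_eps. intros e He.
  assert (h0 := Cmod_ge_0 (f s)). assert (h1 := Cmod_ge_0 (g s)).
  destruct (continuous_C_R_inv f s Hf (Rmin 1 (e / (2 * (Cmod (g s) + 1))))) as (d1 & Hd1 & K1).
  { apply Rmin_glb_lt; [lra|]. apply Rdiv_lt_0_compat; lra. }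
  destruct (continuous_C_R_inv g s Hg (e / (2 * (Cmod (f s) + 1)))%R) as (d2 & Hd2 & K2); [apply Rdiv_lt_0_compat; lra|].
  exists (Rmin d1 d2). split; [apply Rmin_glb_lt; auto|]. intros t Ht.
  assert (t1 : (Rabs (t - s) < d1)%R) by (eapply Rlt_le_trans; [exact Ht|apply Rmin_l]).
  assert (t2 : (Rabs (t - s) < d2)%R) by (eapply Rlt_le_trans; [exact Ht|apply Rmin_r]).
  specialize (K1 t t1). specialize (K2 t t2).
  assert (k1 := Rmin_l 1 (e / (2 * (Cmod (g s) + 1)))). assert (k2 := Rmin_r 1 (e / (2 * (Cmod (g s) + 1)))).
  replace (f t * g t - f s * g s) with ((f t - f s) * g s + f t * (g t - g s)) by ring.
  eapply Rle_lt_trans; [apply Cmod_triangle|]. rewrite !Cmod_mult.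
  assert (ft : (Cmod (f t) <= Cmod (f s) + 1)%R).
  { assert (h := Cmod_triangle_rev (f t) (f s)). lra. }
  assert (P1 : (Cmod (f t - f s) * Cmod (g s) <= e / (2 * (Cmod (g s) + 1)) * Cmod (g s))%R) by (apply Rmult_le_compat_r; lra).
  assert (P2 : (Cmod (f t) * Cmod (g t - g s) <= (Cmod (f s) + 1) * (e / (2 * (Cmod (f s) + 1))))%R) by (apply Rmult_le_compat; auto using Cmod_ge_0; lra).
  replace ((Cmod (f s) + 1) * (e / (2 * (Cmod (f s) + 1))))%R with (e / 2)%R in P2 by (field; lra).
  assert (P3 : (e / (2 * (Cmod (g s) + 1)) * Cmod (g s) < e / 2)%R).
  { replace (e / (2 * (Cmod (g s) + 1)) * Cmod (g s))%R with (e / 2 * (Cmod (g s) / (Cmod (g s) + 1)))%R by (field; lra).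
    rewrite <- (Rmult_1_r (e / 2)) at 2. apply Rmult_lt_compat_l; [lra|]. apply Rlt_div_l; lra. }
  lra.
Qed.

Lemma Hol_path_continuous (K : C -> Prop) f (g : R -> C) s : Hol gen1 K f -> (forall t, K (g t)) ->
  @continuous R_UniformSpace C_R_NormedModule g s -> @continuous R_UniformSpace C_R_NormedModule (fun t => f (g t)) s.
Proof.
  intros Hf HK Hg. apply continuous_C_R_eps. intros e He.
  destruct (Hol1_unif_cont _ _ Hf e He) as (d & Hd & HH).
  destruct (continuous_C_R_inv g s Hg d Hd) as (d' & Hd' & HH'). exists d'. split; auto.
Qed.

Lemma continuous_clip a b (g : R -> C) s : (forall t, @continuous R_UniformSpace C_R_NormedModule g t) ->
  @continuous R_UniformSpace C_R_NormedModule (fun t => g (clip a b t)) s.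
Proof.
  intros Hg. apply continuous_C_R_eps. intros e He.
  destruct (continuous_C_R_inv g (clip a b s) (Hg _) e He) as (d & Hd & HH). exists d. split; auto.
  intros t Ht. apply HH. eapply Rle_lt_trans; [apply clip_lip|exact Ht].
Qed.

(** At interior points the curve coincides with the C1 piece on a neighbourhood. At the end points
    it may have a corner, hence the strict inequalities. *)
Lemma velocity_piece (gamma g : R -> C) (dg : R -> C) a b s :
  (forall s, @is_derive R_AbsRing C_R_NormedModule g s (dg s)) -> (forall s, (a <= s <= b)%R -> gamma s = g s) ->
  (a < s < b)%R -> velocity gamma s = dg s.
Proof.
  intros Hg E Hs. unfold velocity.
  assert (L : locally s (fun t => gamma t = g t)).
  { assert (Hd : (0 < Rmin (s - a) (b - s))%R) by (apply Rmin_glb_lt; lra).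
    exists (mkposreal _ Hd). intros t Ht. apply E. change (Rabs (t - s) < Rmin (s - a) (b - s))%R in Ht.
    assert (h1 := Rmin_l (s - a) (b - s)). assert (h2 := Rmin_r (s - a) (b - s)). apply Rabs_def2 in Ht. lra. }
  apply injective_projections; simpl.
  - apply is_derive_unique. eapply is_derive_ext_loc; [|exact (is_derive_Re _ _ _ (Hg s))].
    eapply filter_imp; [|exact L]. intros t Ht. cbv beta. rewrite Ht. reflexivity.
  - apply is_derive_unique. eapply is_derive_ext_loc; [|exact (is_derive_Im _ _ _ (Hg s))].
    eapply filter_imp; [|exact L]. intros t Ht. cbv beta. rewrite Ht. reflexivity.
Qed.

Lemma contour_int_exists gamma a b (K : C -> Prop) f : piecewise_C1 gamma a b -> (forall s, (a <= s <= b)%R -> K (gamma s)) ->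
  Hol gen1 K f -> exists l, is_contour_int f gamma a b l.
Proof.
  intros H. induction H as [a b Hab (g & dg & Hg & Hdg & E)|a b c H1 IH1 H2 IH2]; intros HK Hf.
  - assert (Ex : @ex_RInt C_R_NormedModule (fun s => f (g (clip a b s)) * dg s) a b).
    { apply (@ex_RInt_continuous C_R_CompleteNormedModule). intros s _. apply continuous_Cmult.
      - apply (Hol_path_continuous K f (fun s => g (clip a b s))); auto.
        + intros t. assert (h := clip_in a b t (Rlt_le _ _ Hab)). rewrite <- E; auto.
        + apply continuous_clip. intros t. eapply is_derive_continuous_C; eauto.
      - apply Hdg. }
    destruct Ex as [l Hl]. exists l. unfold is_contour_int. eapply (@is_RInt_ext C_R_NormedModule); [|exact Hl].
    intros s Hs. rewrite Rmin_left, Rmax_right in Hs by lra. rewrite (velocity_piece gamma g dg a b) by auto.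
    rewrite clip_id, E by lra. reflexivity.
  - assert (h1 := piecewise_C1_lt _ _ _ H1). assert (h2 := piecewise_C1_lt _ _ _ H2).
    destruct IH1 as [l1 Hl1]; [intros; apply HK; lra|auto|]. destruct IH2 as [l2 Hl2]; [intros; apply HK; lra|auto|].
    exists (l1 + l2). apply (@is_RInt_Chasles C_R_NormedModule _ a b c); auto.
Qed.

Lemma continuous_bounded_C (h : R -> C) a b : (a <= b)%R -> (forall s, @continuous R_UniformSpace C_R_NormedModule h s) ->
  exists M, (0 <= M)%R /\ forall s, (a <= s <= b)%R -> (Cmod (h s) <= M)%R.
Proof.
  intros Hab Hc. destruct (continuity_ab_maj (fun s => Cmod (h s)) a b Hab) as (m & Hm & _).
  - intros s _. intros e He. destruct (continuous_C_R_inv h s (Hc s) e He) as (d & Hd & HH).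
    exists d. split; auto. intros t [_ Ht]. unfold dist, R_met in *; simpl in *. unfold R_dist in *.
    eapply Rle_lt_trans; [|apply (HH t Ht)]. apply Rabs_le. assert (h1 := Cmod_triangle_rev (h t) (h s)). assert (h2 := Cmod_triangle_rev (h s) (h t)).
    rewrite (Cmod_sub_sym (h s)) in h2. lra.
  - exists (Cmod (h m)). split; [apply Cmod_ge_0|auto].
Qed.

(** [M] is a bound for the length of the curve, chosen before the integrand. *)
Lemma contour_int_bound gamma a b : piecewise_C1 gamma a b -> exists M, (0 <= M)%R /\
  forall f l B, (forall s, (a <= s <= b)%R -> (Cmod (f (gamma s)) <= B)%R) -> is_contour_int f gamma a b l -> (Cmod l <= M * B)%R.
Proof.
  induction 1 as [a b Hab (g & dg & Hg & Hdg & E)|a b c H1 [M1 [N1 IH1]] H2 [M2 [N2 IH2]]].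
  - destruct (continuous_bounded_C dg a b ltac:(lra) Hdg) as (D & HD0 & HD).
    exists ((b - a) * D)%R. split; [apply Rmult_le_pos; lra|]. intros f l B HB Hl.
    assert (Hl2 : @is_RInt C_R_NormedModule (fun s => f (gamma s) * dg s) a b l).
    { eapply (@is_RInt_ext C_R_NormedModule); [|exact Hl]. intros s Hs. rewrite Rmin_left, Rmax_right in Hs by lra.
      cbv beta. rewrite (velocity_piece gamma g dg a b) by auto. reflexivity. }
    apply is_RInt_C_bound with (M := (B * D)%R) in Hl2; [|lra|].
    + replace ((b - a) * D * B)%R with ((b - a) * (B * D))%R by ring. exact Hl2.
    + intros s Hs. rewrite Cmod_mult. apply Rmult_le_compat; auto using Cmod_ge_0.
  - exists (M1 + M2)%R. split; [lra|]. intros f l B HB Hl.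
    assert (h1 := piecewise_C1_lt _ _ _ H1). assert (h2 := piecewise_C1_lt _ _ _ H2).
    assert (Ex : @ex_RInt C_R_NormedModule (fun s => f (gamma s) * velocity gamma s) a c) by (exists l; exact Hl).
    destruct (@ex_RInt_Chasles_1 C_R_CompleteNormedModule _ a b c ltac:(lra) Ex) as [l1 Hl1].
    destruct (@ex_RInt_Chasles_2 C_R_CompleteNormedModule _ a b c ltac:(lra) Ex) as [l2 Hl2].
    assert (Hl3 := @is_RInt_Chasles C_R_NormedModule _ a b c l1 l2 Hl1 Hl2).
    assert (El : l = l1 + l2).
    { rewrite <- (CRInt_unique _ _ _ _ Hl). apply CRInt_unique. exact Hl3. }
    rewrite El. eapply Rle_trans; [apply Cmod_triangle|].
    assert (b1 := IH1 f l1 B ltac:(intros; apply HB; lra) Hl1). assert (b2 := IH2 f l2 B ltac:(intros; apply HB; lra) Hl2). lra.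
Qed.

Lemma contour_FTC gamma a b (K : C -> Prop) F F' : piecewise_C1 gamma a b -> (forall s, (a <= s <= b)%R -> K (gamma s)) ->
  Hol gen1 K F' ->
  (forall phi s l, K (phi s) -> @is_derive R_AbsRing C_R_NormedModule phi s l ->
     @is_derive R_AbsRing C_R_NormedModule (fun s => F (phi s)) s (F' (phi s) * l)) ->
  is_contour_int F' gamma a b (F (gamma b) - F (gamma a)).
Proof.
  intros H. induction H as [a b Hab (g & dg & Hg & Hdg & E)|a b c H1 IH1 H2 IH2]; intros HK Hf HF.
  - assert (D : @is_RInt C_R_NormedModule (fun s => F' (g (clip a b s)) * dg s) a b (minus (F (g b)) (F (g a)))).
    { apply (@is_RInt_derive C_R_CompleteNormedModule (fun s => F (g s))).
      - intros s Hs. rewrite Rmin_left, Rmax_right in Hs by lra. rewrite clip_id by auto. apply HF; auto.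
        rewrite <- E; auto.
      - intros s _. apply continuous_Cmult.
        + apply (Hol_path_continuous K F' (fun s => g (clip a b s))); auto.
          * intros t. assert (h := clip_in a b t (Rlt_le _ _ Hab)). rewrite <- E; auto.
          * apply continuous_clip. intros t. eapply is_derive_continuous_C; eauto.
        + apply Hdg. }
    rewrite (E b), (E a) by lra. unfold is_contour_int. eapply (@is_RInt_ext C_R_NormedModule); [|exact D].
    intros s Hs. rewrite Rmin_left, Rmax_right in Hs by lra. rewrite (velocity_piece gamma g dg a b) by auto.
    rewrite clip_id, E by lra. reflexivity.
  - assert (h1 := piecewise_C1_lt _ _ _ H1). assert (h2 := piecewise_C1_lt _ _ _ H2).
    specialize (IH1 ltac:(intros; apply HK; lra) Hf HF). specialize (IH2 ltac:(intros; apply HK; lra) Hf HF).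
    replace (F (gamma c) - F (gamma a)) with ((F (gamma b) - F (gamma a)) + (F (gamma c) - F (gamma b))) by ring.
    apply (@is_RInt_Chasles C_R_NormedModule _ a b c); auto.
Qed.

(** * Normalised contour integrals *)

Definition cfun (gamma : R -> C) (a b : R) (f : C -> C) : C :=
  / (2 * PI * Ci) * CRInt (fun s => f (gamma s) / gamma s * velocity gamma s) a b.

Lemma two_pi_i_nz : 2 * PI * Ci <> 0.
Proof.
  apply Cmult_neq_0; [|apply Ci_nz]. apply Cmod_nz. rewrite <- RtoC_mult, Cmod_R, Rabs_pos_eq; assert (h := PI2_pos); lra.
Qed.

Lemma cfun_unique gamma a b f l : is_contour_int (fun z => f z / z) gamma a b (2 * PI * Ci * l) -> cfun gamma a b f = l.
Proof.
  intros H. unfold cfun. rewrite (CRInt_unique _ _ _ _ H). field. split; [apply Ci_nz|].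
  apply Cmod_nz. rewrite Cmod_R, Rabs_pos_eq; assert (h := PI_RGT_0); lra.
Qed.

Lemma cfun_correct gamma a b (K : C -> Prop) f : piecewise_C1 gamma a b -> (forall s, (a <= s <= b)%R -> K (gamma s)) ->
  Hol gen1 K f -> Hol gen1 K (fun z => / z) -> is_contour_int (fun z => f z / z) gamma a b (2 * PI * Ci * cfun gamma a b f).
Proof.
  intros H HK Hf Hi. destruct (contour_int_exists gamma a b K (fun z => f z / z) H HK) as [l Hl].
  - apply Hol_div; auto.
  - assert (E : cfun gamma a b f = l / (2 * PI * Ci)).
    { apply cfun_unique. eapply (eq_rect _ _ Hl). C_eq. field. split; [apply Ci_nz|].
      apply Cmod_nz. rewrite Cmod_R, Rabs_pos_eq; assert (h := PI_RGT_0); lra. }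
    rewrite E. eapply (eq_rect _ _ Hl). C_eq. field. split; [apply Ci_nz|].
      apply Cmod_nz. rewrite Cmod_R, Rabs_pos_eq; assert (h := PI_RGT_0); lra.
Qed.

(* Normalised integrals f |-> (1 / (2 pi i)) int f(z) dz / z over closed paths [K] winding once
   around 0; [polefree K L x] means that the pole 1/x of 1/(1 - x z) lies outside [K]. *)
Record adm (K : C -> Prop) (L : (C -> C) -> C) : Prop := {
  adm_ann : exists r1 r2, (0 < r1)%R /\ forall z, K z -> ann r1 r2 z;
  adm_ext : forall f g, (forall z, K z -> f z = g z) -> L f = L g;
  adm_add : forall f g, Hol gen1 K f -> Hol gen1 K g -> L (fun z => f z + g z) = L f + L g;
  adm_scal : forall c f, Hol gen1 K f -> L (fun z => c * f z) = c * L f;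
  adm_bound : exists M, (0 <= M)%R /\ forall f B, Hol gen1 K f -> (forall z, K z -> (Cmod (f z) <= B)%R) -> (Cmod (L f) <= M * B)%R;
  adm_pow : forall n, L (fun z => zpow z n) = if Z.eqb n 0 then 1 else 0 }.

(** When 1/x lies outside, (1 - x z)^(-k) is holomorphic inside, and its normalised integral is its
    value 1 at z = 0. Requiring this for all k covers poles that coincide. *)
Definition polefree (K : C -> Prop) (L : (C -> C) -> C) (x : C) : Prop :=
  (exists d, (0 < d)%R /\ forall z, K z -> (d <= Cmod (1 - x * z))%R) /\
  forall k, L (fun z => (/ (1 - x * z)) ^ k) = 1.

Lemma Cinv_0 : / RtoC 0 = 0.
Proof. unfold Cinv, RtoC; simpl; f_equal; unfold Rdiv; ring. Qed.

Lemma adm_nz K L z : adm K L -> K z -> z <> 0.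
Proof. intros HA Hz. destruct (adm_ann _ _ HA) as (r1 & r2 & Hr & HK). apply Cmod_nz. destruct (HK z Hz). lra. Qed.

Lemma adm_id_inv K L : adm K L -> Hol gen1 K (fun z => z) /\ Hol gen1 K (fun z => / z).
Proof.
  intros HA. destruct (adm_ann _ _ HA) as (r1 & r2 & Hr & HK). split.
  - apply Hol_subset with (ann r1 r2); auto. apply Hol1_id.
  - apply Hol_subset with (ann r1 r2); auto. apply Hol1_inv; auto.
Qed.

Lemma adm_zpow_Hol K L n : adm K L -> Hol gen1 K (fun z => zpow z n).
Proof.
  intros HA. destruct (adm_ann _ _ HA) as (r1 & r2 & Hr & HK). apply Hol_subset with (ann r1 r2); auto. apply Hol1_zpow; auto.
Qed.

(** The inversion z -> 1/z exchanges inner and outer poles, so results for outer poles apply to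
    inner ones as well. *)
Lemma adm_inversion K L : adm K L -> adm (fun z => K (/ z)) (fun f => L (fun z => f (/ z))).
Proof.
  intros HA. assert (HA0 := HA). destruct HA as [(r1 & r2 & Hr & HK) Hext Hadd Hscal (M & HM & HB) Hpow].
  assert (nz : forall z, K z -> z <> 0) by (intros z Hz; apply Cmod_nz; destruct (HK z Hz); lra).
  assert (ii : forall z : C, z <> 0 -> / / z = z) by (intros; field; auto).
  assert (HC : forall f, Hol gen1 (fun z => K (/ z)) f -> Hol gen1 K (fun z => f (/ z))).
  { intros f Hf. apply (Hol_comp gen1 (fun z => K (/ z)) gen1 K f (fun z => / z)); auto.
    - intros z Hz. rewrite ii; auto.
    - intros g ->. exact (proj2 (adm_id_inv K L HA0)). }
  split.
  - assert (Hr2 : (0 < Rmax r1 r2)%R) by (eapply Rlt_le_trans; [exact Hr|apply Rmax_l]).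
    exists (/ Rmax r1 r2)%R, (/ r1)%R. split; [apply Rinv_0_lt_compat; auto|].
    intros z Hz. assert (z <> 0). { intro h. subst z. rewrite Cinv_0 in Hz. apply (nz _ Hz). auto. }
    assert (hz := HK _ Hz). unfold ann in *. rewrite Cmod_inv in hz by auto.
    assert (hm : (0 < Cmod z)%R) by (apply Cmod_gt_0; auto).
    assert (hm' : (0 < / Cmod z)%R) by (apply Rinv_0_lt_compat; auto).
    assert (hR := Rle_trans _ _ _ (proj2 hz) (Rmax_r r1 r2)).
    rewrite <- (Rinv_inv (Cmod z)). split; apply Rinv_le_contravar; lra.
  - intros f g E. apply Hext. intros z Hz. apply E. rewrite ii; auto.
  - intros f g Hf Hg. apply (Hadd (fun z => f (/ z)) (fun z => g (/ z))); auto.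
  - intros c f Hf. apply (Hscal c (fun z => f (/ z))); auto.
  - exists M. split; auto. intros f B Hf Hb. apply (HB (fun z => f (/ z))); auto.
    intros z Hz. apply Hb. rewrite ii; auto.
  - intros n. rewrite (Hext _ (fun z => zpow z (- n))).
    + rewrite Hpow. destruct (Z.eqb_spec n 0), (Z.eqb_spec (- n) 0); auto; lia.
    + intros z Hz. assert (hz := nz z Hz). rewrite zpow_opp by auto.
      assert (E : zpow z n * zpow (/ z) n = 1).
      { rewrite <- zpow_mult_l. replace (z * / z) with (RtoC 1) by (field; auto).
        destruct n; simpl; [reflexivity|apply Cpow_1_l|]. replace (/ RtoC 1) with (RtoC 1) by field. apply Cpow_1_l. }
      assert (h := zpow_nz z n hz).
      replace (zpow (/ z) n) with (/ zpow z n * (zpow z n * zpow (/ z) n)) by (field; auto). rewrite E. ring.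
Qed.

Definition iprod (X : list C) (z : C) : C := fold_right (fun x acc => / (1 - x * z) * acc) 1 X.

Lemma iprod_perm X Y z : Permutation X Y -> iprod X z = iprod Y z.
Proof. induction 1; simpl; try congruence; ring. Qed.

Lemma polefree_nz K L x z : polefree K L x -> K z -> 1 - x * z <> 0.
Proof. intros [(d & Hd & HH) _] Hz. apply Cmod_nz. specialize (HH z Hz). lra. Qed.

Lemma polefree_Hol K L x : adm K L -> polefree K L x -> Hol gen1 K (fun z => / (1 - x * z)).
Proof.
  intros HA [(d & Hd & HH) _]. apply Hol_inv with d; auto. assert (h := proj1 (adm_id_inv K L HA)). hol.
Qed.

Lemma iprod_Hol K L X : adm K L -> (forall x, In x X -> polefree K L x) -> Hol gen1 K (iprod X).
Proof.
  intros HA. induction X as [|x X IH]; intros HX.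
  - apply Hol_const.
  - apply Hol_ext with (fun z => / (1 - x * z) * iprod X z); [reflexivity|].
    apply (Hol_mul gen1 K).
    + eapply polefree_Hol; eauto. apply HX. left; auto.
    + apply IH. intros; apply HX; right; auto.
Qed.

Lemma iprod_cons x X z : iprod (x :: X) z = / (1 - x * z) * iprod X z.
Proof. reflexivity. Qed.

Lemma adm_opp K L f : adm K L -> Hol gen1 K f -> L (fun z => - f z) = - L f.
Proof.
  intros HA Hf. rewrite (adm_ext _ _ HA _ (fun z => (- (1)) * f z)) by (intros; ring).
  rewrite (adm_scal _ _ HA) by auto. ring.
Qed.

Lemma adm_sub K L f g : adm K L -> Hol gen1 K f -> Hol gen1 K g -> L (fun z => f z - g z) = L f - L g.
Proof.
  intros HA Hf Hg. unfold Cminus. rewrite (adm_add _ _ HA f (fun z => - g z)); auto.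
  - rewrite (adm_opp K L g); auto.
  - apply (Hol_opp gen1 K g); auto.
Qed.

Lemma all_equal_or (x : C) (X : list C) : (forall y, In y X -> y = x) \/ exists y, In y X /\ y <> x.
Proof.
  induction X as [|a X [IH|(y & Hy & Hn)]].
  - left. intros y [].
  - destruct (Ceq_dec a x) as [->|h].
    + left. intros y [<-|hy]; auto.
    + right. exists a. split; [left; auto|auto].
  - right. exists y. split; [right; auto|auto].
Qed.

(** * Independence of the integral from the contour *)

Section Unique.
Context (K K' : C -> Prop) (L L' : (C -> C) -> C) (HA : adm K L) (HA' : adm K' L').

Definition good (x : C) : Prop := x <> 0 /\ polefree K L x /\ polefree K' L' x.

Lemma good_Hol X : (forall x, In x X -> good x) -> Hol gen1 K (iprod X) /\ Hol gen1 K' (iprod X).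
Proof.
  intros H. split; [apply (iprod_Hol K L)|apply (iprod_Hol K' L')]; auto; intros x Hx; apply (H x Hx).
Qed.

(** Two distinct poles are separated by 1/((1 - x z)(1 - y z)) = (x/(1 - x z) - y/(1 - y z)) / (x -
    y), which shortens the product. If all poles coincide, [polefree] gives the value 1 on both
    sides. *)
Lemma iprod_unique_base : forall n X, length X = n -> (forall x, In x X -> good x) -> L (iprod X) = L' (iprod X).
Proof.
  induction n as [n IH] using lt_wf_ind. intros X Hlen HX. destruct X as [|x X].
  - assert (E1 := adm_pow _ _ HA 0). assert (E2 := adm_pow _ _ HA' 0). simpl in E1, E2. unfold iprod; simpl. congruence.
  - destruct (all_equal_or x X) as [Heq|(y & Hy & Hne)].
    + assert (E : forall z, iprod (x :: X) z = (/ (1 - x * z)) ^ length (x :: X)).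
      { intros z. clear Hlen HX IH. induction X as [|a X IH]; simpl in *; [ring|].
        rewrite (Heq a) by auto. unfold iprod in IH. simpl in IH. rewrite <- IH by auto. reflexivity. }
      destruct (HX x) as (_ & [_ P] & [_ P']); [left; auto|].
      rewrite (adm_ext _ _ HA _ (fun z => (/ (1 - x * z)) ^ length (x :: X))) by (intros; apply E).
      rewrite (adm_ext _ _ HA' _ (fun z => (/ (1 - x * z)) ^ length (x :: X))) by (intros; apply E).
      rewrite P, P'. reflexivity.
    + destruct (in_split _ _ Hy) as (l1 & l2 & ->).
      set (W := l1 ++ l2).
      assert (Perm : Permutation (x :: l1 ++ y :: l2) (x :: y :: W)).
      { constructor. symmetry. apply Permutation_middle. }
      assert (Hx := HX x (or_introl eq_refl)). assert (Hyg : good y) by (apply HX; right; auto).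
      assert (HW : forall w, In w W -> good w).
      { intros w Hw. apply HX. right. unfold W in Hw. apply in_app_or in Hw. apply in_or_app. simpl. tauto. }
      assert (Hd : x - y <> 0) by (intro h; apply Ceq_minus in h; auto).
      assert (HxW : forall w, In w (x :: W) -> good w) by (intros w [<-|hw]; auto).
      assert (HyW : forall w, In w (y :: W) -> good w) by (intros w [<-|hw]; auto).
      assert (E : forall z, 1 - x * z <> 0 -> 1 - y * z <> 0 -> iprod (x :: l1 ++ y :: l2) z = x / (x - y) * iprod (x :: W) z - y / (x - y) * iprod (y :: W) z).
      { intros z h1 h2. rewrite (iprod_perm _ _ z Perm), !iprod_cons. field. auto. }
      assert (lenW : (length (x :: W) < n)%nat).
      { rewrite <- Hlen, (Permutation_length Perm). simpl. lia. }
      destruct (good_Hol _ HxW) as [a1 a2]. destruct (good_Hol _ HyW) as [b1 b2].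
      rewrite (adm_ext _ _ HA _ (fun z => x / (x - y) * iprod (x :: W) z - y / (x - y) * iprod (y :: W) z)).
      2: { intros z Hz. apply E; [apply (polefree_nz K L)|apply (polefree_nz K L)]; auto; [apply Hx|apply Hyg]. }
      rewrite (adm_ext _ _ HA' _ (fun z => x / (x - y) * iprod (x :: W) z - y / (x - y) * iprod (y :: W) z)).
      2: { intros z Hz. apply E; [apply (polefree_nz K' L')|apply (polefree_nz K' L')]; auto; [apply Hx|apply Hyg]. }
      rewrite (adm_sub K L (fun z => x / (x - y) * iprod (x :: W) z) (fun z => y / (x - y) * iprod (y :: W) z)) by
        (auto; apply (Hol_mul gen1 K); auto; apply Hol_const).
      rewrite (adm_sub K' L' (fun z => x / (x - y) * iprod (x :: W) z) (fun z => y / (x - y) * iprod (y :: W) z)) by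
        (auto; apply (Hol_mul gen1 K'); auto; apply Hol_const).
      rewrite !(adm_scal _ _ HA), !(adm_scal _ _ HA') by auto.
      rewrite (IH _ lenW (x :: W) eq_refl HxW). 
      assert (lenW2 : (length (y :: W) < n)%nat) by exact lenW.
      rewrite (IH _ lenW2 (y :: W) eq_refl HyW). reflexivity.
Qed.

(** From z/(1 - x z) = (1/(1 - x z) - 1)/x, raising the exponent by one costs only a product with
    one pole fewer. As x is nonzero, the recursion also runs towards negative exponents. *)
Lemma iprod_unique_pow X : (forall x, In x X -> good x) -> forall n, L (fun z => zpow z n * iprod X z) = L' (fun z => zpow z n * iprod X z).
Proof.
  induction X as [|x X IH]; intros HX.
  - intros n. rewrite (adm_ext _ _ HA _ (fun z => zpow z n)) by (intros; unfold iprod; simpl; ring).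
    rewrite (adm_ext _ _ HA' _ (fun z => zpow z n)) by (intros; unfold iprod; simpl; ring).
    rewrite (adm_pow _ _ HA), (adm_pow _ _ HA'). reflexivity.
  - assert (HX' : forall w, In w X -> good w) by (intros; apply HX; right; auto).
    assert (Hx := HX x (or_introl eq_refl)). destruct Hx as (nx & Px & Px').
    destruct (good_Hol _ HX) as [a1 a2]. destruct (good_Hol _ HX') as [b1 b2].
    assert (S : forall n, L (fun z => zpow z (n + 1) * iprod (x :: X) z) = / x * (L (fun z => zpow z n * iprod (x :: X) z) - L (fun z => zpow z n * iprod X z))).
    { intros n. assert (hz := adm_zpow_Hol K L n HA).
      rewrite <- (adm_sub K L (fun z => zpow z n * iprod (x :: X) z) (fun z => zpow z n * iprod X z)) by (assumption || (apply (Hol_mul gen1 K); assumption)).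
      rewrite <- (adm_scal _ _ HA (/ x) (fun z => zpow z n * iprod (x :: X) z - zpow z n * iprod X z)) by
        (apply (Hol_sub gen1 K (fun z => zpow z n * iprod (x :: X) z)); apply (Hol_mul gen1 K); assumption).
      apply (adm_ext _ _ HA). intros z Hz. assert (h1 := polefree_nz K L x z Px Hz). rewrite iprod_cons, zpow_succ by exact (adm_nz K L z HA Hz).
      field. auto. }
    assert (S' : forall n, L' (fun z => zpow z (n + 1) * iprod (x :: X) z) = / x * (L' (fun z => zpow z n * iprod (x :: X) z) - L' (fun z => zpow z n * iprod X z))).
    { intros n. assert (hz := adm_zpow_Hol K' L' n HA').
      rewrite <- (adm_sub K' L' (fun z => zpow z n * iprod (x :: X) z) (fun z => zpow z n * iprod X z)) by (assumption || (apply (Hol_mul gen1 K'); assumption)).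
      rewrite <- (adm_scal _ _ HA' (/ x) (fun z => zpow z n * iprod (x :: X) z - zpow z n * iprod X z)) by
        (apply (Hol_sub gen1 K' (fun z => zpow z n * iprod (x :: X) z)); apply (Hol_mul gen1 K'); assumption).
      apply (adm_ext _ _ HA'). intros z Hz. assert (h1 := polefree_nz K' L' x z Px' Hz). rewrite iprod_cons, zpow_succ by exact (adm_nz K' L' z HA' Hz).
      field. auto. }
    apply Z.bi_induction.
    + intros ? ? ->; reflexivity.
    + rewrite (adm_ext _ _ HA _ (iprod (x :: X))) by (intros; simpl; ring).
      rewrite (adm_ext _ _ HA' _ (iprod (x :: X))) by (intros; simpl; ring).
      apply (iprod_unique_base (length (x :: X))); auto.
    + intros n. unfold Z.succ. rewrite S, S', (IH HX' n). split; intros h.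
      * rewrite h. reflexivity.
      * apply Ceq_minus in h. apply Ceq_minus. apply (Cmult_cancel (/ x)); [apply Cinv_nz; auto|]. rewrite <- h. ring.
Qed.

Lemma adm_Csum K0 L0 (F : nat -> C -> C) N : adm K0 L0 -> (forall i, Hol gen1 K0 (F i)) ->
  L0 (fun z => Csum (fun i => F i z) N) = Csum (fun i => L0 (F i)) N /\ Hol gen1 K0 (fun z => Csum (fun i => F i z) N).
Proof.
  intros HA0 HF. induction N; simpl.
  - split; [|apply Hol_const]. rewrite (adm_ext _ _ HA0 _ (fun z => 0 * 1)) by (intros; ring).
    rewrite (adm_scal _ _ HA0 0 (fun _ => 1)) by apply Hol_const. ring.
  - destruct IHN as [I1 I2]. split.
    + rewrite (adm_add _ _ HA0 (fun z => Csum (fun i => F i z) N) (F N)); auto. rewrite I1. reflexivity.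
    + apply (Hol_add gen1 K0); auto.
Qed.

(** A Laurent polynomial approximates [H] uniformly on an annulus containing both paths. The two
    functionals agree on Laurent polynomials times the pole factors, and both are bounded. *)
Lemma adm_unique r1 r2 p1 p2 H X : (0 < r1)%R -> (r1 < p1)%R -> (p1 <= p2)%R -> (p2 < r2)%R -> Hol1 r1 r2 H ->
  (forall z, K z -> ann p1 p2 z) -> (forall z, K' z -> ann p1 p2 z) ->
  (forall x, In x X -> good x) -> L (fun z => H z * iprod X z) = L' (fun z => H z * iprod X z).
Proof.
  intros Hr H1 H2 H3 HH HK HK' HX.
  destruct (good_Hol _ HX) as [a1 a2].
  destruct (adm_bound _ _ HA) as (M & HM & HMb). destruct (adm_bound _ _ HA') as (M' & HM' & HMb').
  destruct (Hol_bounded _ _ _ a1) as (B & HB & HBb). destruct (Hol_bounded _ _ _ a2) as (B' & HB' & HBb').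
  assert (HHK : Hol gen1 K H) by (apply Hol_subset with (ann r1 r2); auto; intros z Hz; destruct (HK z Hz); split; lra).
  assert (HHK' : Hol gen1 K' H) by (apply Hol_subset with (ann r1 r2); auto; intros z Hz; destruct (HK' z Hz); split; lra).
  apply C_eq_of_small. intros e He.
  set (D := (M * B + M' * B' + 1)%R).
  assert (HD : (0 < D)%R) by (unfold D; assert (0 <= M * B)%R by (apply Rmult_le_pos; lra); assert (0 <= M' * B')%R by (apply Rmult_le_pos; lra); lra).
  assert (Aw : ann r1 r2 (RtoC p1)) by (unfold ann; rewrite Cmod_R, Rabs_pos_eq; lra).
  destruct (Laurent_approx r1 r2 H (RtoC p1) p1 p2 (e / D) Hr HH Aw H1 H2 H3) as [N HN]; [apply Rdiv_lt_0_compat; auto|].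
  set (c := fun n => lcoef H n (RtoC p1)) in *.
  assert (hz := fun n => adm_zpow_Hol K L n HA). assert (hz' := fun n => adm_zpow_Hol K' L' n HA').
  set (F1 := fun i z => c (Z.of_nat i) * (zpow z (Z.of_nat i) * iprod X z)).
  set (F2 := fun i z => c (- Z.of_nat (S i))%Z * (zpow z (- Z.of_nat (S i)) * iprod X z)).
  assert (EL : forall z, Lsum c N z * iprod X z = Csum (fun i => F1 i z) N + Csum (fun i => F2 i z) N).
  { intros z. unfold Lsum, F1, F2. rewrite Cmult_plus_distr_r. f_equal.
    - clear. induction N; simpl; [ring|]. rewrite <- IHN. ring.
    - clear. induction N; [simpl; ring|]. rewrite !Csum_S, <- IHN. ring. }
  assert (G1 : forall i, Hol gen1 K (F1 i)) by (intros i; apply (Hol_mul gen1 K); [apply Hol_const|apply (Hol_mul gen1 K); auto]).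
  assert (G2 : forall i, Hol gen1 K (F2 i)) by (intros i; apply (Hol_mul gen1 K); [apply Hol_const|apply (Hol_mul gen1 K); auto]).
  assert (G1' : forall i, Hol gen1 K' (F1 i)) by (intros i; apply (Hol_mul gen1 K'); [apply Hol_const|apply (Hol_mul gen1 K'); auto]).
  assert (G2' : forall i, Hol gen1 K' (F2 i)) by (intros i; apply (Hol_mul gen1 K'); [apply Hol_const|apply (Hol_mul gen1 K'); auto]).
  destruct (adm_Csum K L F1 N HA G1) as [s1 t1]. destruct (adm_Csum K L F2 N HA G2) as [s2 t2].
  destruct (adm_Csum K' L' F1 N HA' G1') as [s1' t1']. destruct (adm_Csum K' L' F2 N HA' G2') as [s2' t2'].
  assert (EQ : L (fun z => Lsum c N z * iprod X z) = L' (fun z => Lsum c N z * iprod X z)).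
  { rewrite (adm_ext _ _ HA _ _ (fun z _ => EL z)), (adm_ext _ _ HA' _ _ (fun z _ => EL z)).
    rewrite (adm_add _ _ HA), (adm_add _ _ HA'), s1, s2, s1', s2' by auto. f_equal; apply Csum_ext; intros i _.
    - unfold F1. rewrite (adm_scal _ _ HA), (adm_scal _ _ HA') by (first [apply (Hol_mul gen1 K); auto | apply (Hol_mul gen1 K'); auto]).
      f_equal. apply iprod_unique_pow; auto.
    - unfold F2. rewrite (adm_scal _ _ HA), (adm_scal _ _ HA') by (first [apply (Hol_mul gen1 K); auto | apply (Hol_mul gen1 K'); auto]).
      f_equal. apply iprod_unique_pow; auto. }
  assert (HLs : Hol gen1 K (fun z => Lsum c N z * iprod X z)).
  { apply Hol_ext with (fun z => Csum (fun i => F1 i z) N + Csum (fun i => F2 i z) N); [intros; symmetry; apply EL|]. apply (Hol_add gen1 K); auto. }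
  assert (HLs' : Hol gen1 K' (fun z => Lsum c N z * iprod X z)).
  { apply Hol_ext with (fun z => Csum (fun i => F1 i z) N + Csum (fun i => F2 i z) N); [intros; symmetry; apply EL|]. apply (Hol_add gen1 K'); auto. }
  assert (HHi : Hol gen1 K (fun z => H z * iprod X z)) by (apply (Hol_mul gen1 K); auto).
  assert (HHi' : Hol gen1 K' (fun z => H z * iprod X z)) by (apply (Hol_mul gen1 K'); auto).
  assert (b1 : (Cmod (L (fun z => H z * iprod X z) - L (fun z => Lsum c N z * iprod X z))%C <= M * (e / D * B))%R).
  { rewrite <- (adm_sub K L) by auto. apply HMb; [apply (Hol_sub gen1 K); auto|]. intros z Hz.
    replace (H z * iprod X z - Lsum c N z * iprod X z) with ((H z - Lsum c N z) * iprod X z) by ring. rewrite Cmod_mult.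
    apply Rmult_le_compat; auto using Cmod_ge_0. }
  assert (b2 : (Cmod (L' (fun z => H z * iprod X z) - L' (fun z => Lsum c N z * iprod X z))%C <= M' * (e / D * B'))%R).
  { rewrite <- (adm_sub K' L') by auto. apply HMb'; [apply (Hol_sub gen1 K'); auto|]. intros z Hz.
    replace (H z * iprod X z - Lsum c N z * iprod X z) with ((H z - Lsum c N z) * iprod X z) by ring. rewrite Cmod_mult.
    apply Rmult_le_compat; auto using Cmod_ge_0. }
  rewrite EQ in b1.
  set (u := L (fun z => H z * iprod X z)) in *. set (v := L' (fun z => H z * iprod X z)) in *. set (w := L' (fun z => Lsum c N z * iprod X z)) in *.
  replace (u - v) with ((u - w) - (v - w)) by ring. eapply Rle_trans; [apply Cmod_triangle_sub|].
  assert (Q : (M * (e / D * B) + M' * (e / D * B') <= e)%R).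
  { replace (M * (e / D * B) + M' * (e / D * B'))%R with (e * ((M * B + M' * B') / D))%R by (field; lra).
    rewrite <- (Rmult_1_r e) at 2. apply Rmult_le_compat_l; [lra|]. apply Rle_div_l; [auto|]. unfold D; lra. }
  lra.
Qed.
End Unique.

Lemma ann_point_iff r z : ann r r z <-> Cmod z = r.
Proof. unfold ann; lra. Qed.

Lemma adm_mean w : w <> RtoC 0 -> adm (ann (Cmod w) (Cmod w)) (fun f => mean f w).
Proof.
  intros hw. assert (hm := proj1 (Cmod_gt_0 w) hw).
  assert (HK : forall z, Cmod z = Cmod w -> ann (Cmod w) (Cmod w) z) by (intros z Hz; apply ann_point_iff; auto).
  split.
  - exists (Cmod w), (Cmod w). split; auto.
  - intros f g E. apply mean_ext. intros z Hz. apply E; auto.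
  - intros f g Hf Hg. apply mean_add; apply circ_ok_point; auto.
  - intros c f Hf. apply mean_scal; apply circ_ok_point; auto.
  - exists 1%R. split; [lra|]. intros f B Hf Hb. rewrite Rmult_1_l. apply mean_bound; auto. apply circ_ok_point; auto.
  - intros n. destruct (Z.eqb_spec n 0) as [->|h]; cbv beta iota; [exact (mean_const 1 w)|exact (mean_zpow n w hw h)].
Qed.

(** Shrinking the circle towards 0 shows that z (1 - x z)^(-k) has mean 0, since it is at most r /
    d^k on |z| = r. *)
Lemma polefree_mean (w x : C) : w <> 0 -> (Cmod (x * w) < 1)%R -> polefree (ann (Cmod w) (Cmod w)) (fun f => mean f w) x.
Proof.
  intros hw hx. assert (hm := proj1 (Cmod_gt_0 w) hw). rewrite Cmod_mult in hx. set (d := (1 - Cmod x * Cmod w)%R).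
  assert (hd : (0 < d)%R) by (unfold d; lra).
  assert (lb : forall z, (Cmod z <= Cmod w)%R -> (d <= Cmod (1 - x * z))%R).
  { intros z Hz. assert (h := Cmod_triangle_rev 1 (x * z)). rewrite Cmod_1, Cmod_mult in h. unfold d.
    assert (Cmod x * Cmod z <= Cmod x * Cmod w)%R by (apply Rmult_le_compat_l; auto using Cmod_ge_0). lra. }
  split.
  - exists d. split; auto. intros z [_ Hz]. auto.
  - assert (HI : forall r, (0 < r)%R -> Hol1 r (Cmod w) (fun z => / (1 - x * z))).
    { intros r Hr. apply Hol_inv with d; auto; [intros z [_ Hz]; auto|]. assert (h := Hol1_id r (Cmod w)). hol. }
    assert (Z0 : forall k, mean (fun z => z * (/ (1 - x * z)) ^ k) w = 0).
    { intros k. apply C_eq_of_small. intros e He.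
      set (r := Rmin (Cmod w) (e * d ^ k)). assert (hdk : (0 < d ^ k)%R) by (apply pow_lt; auto).
      assert (hr : (0 < r)%R) by (apply Rmin_glb_lt; auto; apply Rmult_lt_0_compat; auto).
      assert (hr1 := Rmin_l (Cmod w) (e * d ^ k)). assert (hr2 := Rmin_r (Cmod w) (e * d ^ k)). fold r in hr1, hr2.
      assert (Hf : Hol1 r (Cmod w) (fun z => z * (/ (1 - x * z)) ^ k)).
      { apply (Hol_mul gen1 (ann r (Cmod w))); [apply Hol1_id|apply Hol_pow; auto]. }
      assert (Ar : ann r (Cmod w) (RtoC r)) by (unfold ann; rewrite Cmod_R, Rabs_pos_eq; lra).
      rewrite (Hol_mean_const r (Cmod w) _ w (RtoC r) hr Hf ltac:(unfold ann; lra) Ar).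
      replace (mean (fun z => z * (/ (1 - x * z)) ^ k) r - 0) with (mean (fun z => z * (/ (1 - x * z)) ^ k) r) by ring.
      apply mean_bound; [eapply Hol_circ_ok; eauto|].
      intros z Hz. rewrite Cmod_R, Rabs_pos_eq in Hz by lra.
      assert (h := lb z ltac:(lra)). rewrite Cmod_mult, Cmod_pow, Cmod_inv, pow_inv by (apply Cmod_nz; lra).
      assert (d ^ k <= Cmod (1 - x * z) ^ k)%R by (apply pow_incr; lra).
      apply Rle_trans with (e * d ^ k * / d ^ k)%R.
      - apply Rmult_le_compat; try lra. + left. apply Rinv_0_lt_compat. lra. + apply Rinv_le_contravar; auto.
      - right. field. lra. }
    induction k as [|k IH].
    + simpl. apply mean_const.
    + assert (HP := fun n => Hol_pow gen1 _ _ n (HI (Cmod w) hm)). cbv beta in HP.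
      (* With u = 1/(1 - x z) the identity u = 1 + x z u gives u^(k+1) = u^k + x z u^(k+1), and the
         last term has mean 0. *)
      rewrite (mean_ext _ (fun z => (/ (1 - x * z)) ^ k + x * (z * (/ (1 - x * z)) ^ S k))).
      * rewrite mean_add, mean_scal, IH, Z0; [ring| | |].
        -- apply circ_ok_point. apply (Hol_mul gen1 (ann (Cmod w) (Cmod w))); [apply Hol1_id|apply HP].
        -- apply circ_ok_point, HP.
        -- apply circ_ok_point. apply (Hol_mul gen1 (ann (Cmod w) (Cmod w))); [apply Hol_const|].
           apply (Hol_mul gen1 (ann (Cmod w) (Cmod w))); [apply Hol1_id|apply HP].
      * intros z Hz. assert (1 - x * z <> 0) by (apply Cmod_nz; specialize (lb z ltac:(lra)); lra). simpl. field. auto.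
Qed.

(** * Closed curves as normalised integrals *)

Lemma curve_away gamma a b (w : C) : piecewise_C1 gamma a b -> ~ on_curve gamma a b w ->
  exists d, (0 < d)%R /\ forall z, on_curve gamma a b z -> (d <= Cmod (z - w))%R.
Proof.
  induction 1 as [a b Hab (g & dg & Hg & Hdg & E)|a b c H1 IH1 H2 IH2]; intros Hw.
  - destruct (continuity_ab_min (fun s => Cmod (g s - w)) a b ltac:(lra)) as (m & Hm & Hmi).
    + intros s _. intros e He. destruct (continuous_C_R_inv g s (is_derive_continuous_C _ _ _ (Hg s)) e He) as (d & Hd & HH).
      exists d. split; auto. intros t [_ Ht]. unfold dist, R_met in *; simpl in *. unfold R_dist in *.
      eapply Rle_lt_trans; [|apply (HH t Ht)]. apply Rabs_le.
      assert (h1 := Cmod_triangle_rev (g t - w) (g s - w)). assert (h2 := Cmod_triangle_rev (g s - w) (g t - w)).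
      replace (g t - w - (g s - w)) with (g t - g s) in h1 by ring. replace (g s - w - (g t - w)) with (g s - g t) in h2 by ring.
      rewrite (Cmod_sub_sym (g s) (g t)) in h2. lra.
    + exists (Cmod (g m - w)). split.
      * apply Cmod_gt_0. intros h. apply Hw. exists m. split; auto. rewrite E by auto. apply Ceq_minus in h. auto.
      * intros z (s & Hs & <-). rewrite E by auto. apply Hm; auto.
  - assert (h1 := piecewise_C1_lt _ _ _ H1). assert (h2 := piecewise_C1_lt _ _ _ H2).
    destruct IH1 as (d1 & p1 & q1). { intros (s & Hs & <-). apply Hw. exists s. split; [lra|auto]. }
    destruct IH2 as (d2 & p2 & q2). { intros (s & Hs & <-). apply Hw. exists s. split; [lra|auto]. }
    exists (Rmin d1 d2). split; [apply Rmin_glb_lt; auto|]. intros z (s & Hs & <-).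
    assert (k1 := Rmin_l d1 d2). assert (k2 := Rmin_r d1 d2).
    destruct (Rle_dec s b) as [h|h].
    + assert (hq := q1 (gamma s) ltac:(exists s; split; [lra|auto])). lra.
    + assert (hq := q2 (gamma s) ltac:(exists s; split; [lra|auto])). lra.
Qed.

Lemma curve_bounded gamma a b : piecewise_C1 gamma a b -> exists M, (0 <= M)%R /\ forall z, on_curve gamma a b z -> (Cmod z <= M)%R.
Proof.
  induction 1 as [a b Hab (g & dg & Hg & Hdg & E)|a b c H1 (M1 & p1 & q1) H2 (M2 & p2 & q2)].
  - destruct (continuous_bounded_C g a b ltac:(lra) (fun s => is_derive_continuous_C _ _ _ (Hg s))) as (D & HD0 & HD).
    exists D. split; auto. intros z (s & Hs & <-). rewrite E; auto.
  - exists (M1 + M2)%R. split; [lra|]. intros z (s & Hs & <-).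
    destruct (Rle_dec s b) as [h|h].
    + assert (hq := q1 (gamma s) ltac:(exists s; split; [lra|auto])). lra.
    + assert (hq := q2 (gamma s) ltac:(exists s; split; [lra|auto])). lra.
Qed.

Lemma is_derive_Cpow (f : R -> C) s (l : C) n : @is_derive R_AbsRing C_R_NormedModule f s l ->
  @is_derive R_AbsRing C_R_NormedModule (fun s => f s ^ S n) s (RtoC (INR (S n)) * f s ^ n * l).
Proof.
  intros H. induction n as [|n IH].
  - apply (@is_derive_ext R_AbsRing C_R_NormedModule f); [intros t; symmetry; exact (Cmult_1_r (f t))|].
    replace (RtoC (INR 1) * f s ^ 0 * l) with l by (simpl; ring). exact H.
  - replace (RtoC (INR (S (S n))) * f s ^ S n * l) with (l * f s ^ S n + f s * (RtoC (INR (S n)) * f s ^ n * l)).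
    + apply (is_derive_Cmult f (fun s => f s ^ S n)); auto.
    + rewrite (S_INR (S n)), RtoC_plus. simpl (f s ^ S n). ring.
Qed.

Lemma is_derive_Caffine (f : R -> C) s (c l : C) : @is_derive R_AbsRing C_R_NormedModule f s l ->
  @is_derive R_AbsRing C_R_NormedModule (fun s => 1 - c * f s) s (- (c * l)).
Proof.
  intros H. assert (D := is_derive_Cmult (fun _ => - c) f s 0 l (is_derive_const (V := C_R_NormedModule) _ _) H).
  assert (D2 := is_derive_plus (V := C_R_NormedModule) (fun _ => RtoC 1) _ s _ _ (is_derive_const (V := C_R_NormedModule) _ _) D).
  replace (- (c * l)) with (0 + (0 * f s + - c * l)) by ring.
  apply (@is_derive_ext R_AbsRing C_R_NormedModule (fun s => 1 + - c * f s)); [|exact D2].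
  intros t. C_eq. ring.
Qed.

Lemma Cmult_eq_plus (f g z v : C) : (f + g) / z * v = f / z * v + g / z * v.
Proof. unfold Cdiv. ring. Qed.

Section Curve.
Context (gamma : R -> C) (a b : R) (hC1 : piecewise_C1 gamma a b) (hcl : gamma a = gamma b).
Context (h0 : ~ on_curve gamma a b 0) (hw : is_contour_int (fun z => / (z - 0)) gamma a b (2 * PI * Ci)).

Local Notation K := (on_curve gamma a b).
Local Notation L := (cfun gamma a b).

Lemma on_curve_path s : (a <= s <= b)%R -> K (gamma s).
Proof. intros Hs. exists s. auto. Qed.

Lemma curve_ann : exists r1 r2, (0 < r1)%R /\ forall z, K z -> ann r1 r2 z.
Proof.
  destruct (curve_away gamma a b 0 hC1 h0) as (r1 & H1 & H2). destruct (curve_bounded gamma a b hC1) as (r2 & _ & H3).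
  exists r1, r2. split; auto. intros z Hz. split; auto. specialize (H2 z Hz). replace (z - 0) with z in H2 by ring. auto.
Qed.

Lemma curve_nz (z : C) : K z -> z <> 0.
Proof. intros Hz ->. auto. Qed.

Lemma curve_Hol_id : Hol gen1 K (fun z => z).
Proof. destruct curve_ann as (r1 & r2 & _ & H). apply Hol_subset with (ann r1 r2); auto. apply Hol1_id. Qed.

Lemma curve_Hol_inv : Hol gen1 K (fun z => / z).
Proof. destruct curve_ann as (r1 & r2 & h & H). apply Hol_subset with (ann r1 r2); auto. apply Hol1_inv; auto. Qed.

Lemma contour_int_ext f g l : (forall z, K z -> f z = g z) -> is_contour_int f gamma a b l -> is_contour_int g gamma a b l.
Proof.
  intros E H. unfold is_contour_int in *. eapply (@is_RInt_ext C_R_NormedModule); [|exact H].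
  intros s Hs. assert (h := piecewise_C1_lt _ _ _ hC1). rewrite Rmin_left, Rmax_right in Hs by lra.
  cbv beta. rewrite E; [reflexivity|]. apply on_curve_path. lra.
Qed.

Lemma cfun_int f : Hol gen1 K f -> is_contour_int (fun z => f z / z) gamma a b (2 * PI * Ci * L f).
Proof. intros Hf. apply cfun_correct with K; auto. apply on_curve_path. apply curve_Hol_inv. Qed.

Lemma cfun_val f g l : (forall z, K z -> f z = z * g z) -> is_contour_int g gamma a b (2 * PI * Ci * l) -> L f = l.
Proof.
  intros E H. apply cfun_unique. eapply contour_int_ext; [|exact H]. intros z Hz. cbv beta. rewrite E by auto.
  assert (z <> 0) by (apply curve_nz; auto). field. auto.
Qed.

Lemma cfun_closed f F F' : (forall z, K z -> f z = z * F' z) -> Hol gen1 K F' ->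
  (forall phi s l, K (phi s) -> @is_derive R_AbsRing C_R_NormedModule phi s l ->
     @is_derive R_AbsRing C_R_NormedModule (fun s => F (phi s)) s (F' (phi s) * l)) -> L f = 0.
Proof.
  intros E HF' HF. apply (cfun_val f F'); auto.
  assert (H := contour_FTC gamma a b K F F' hC1 on_curve_path HF' HF).
  replace (2 * PI * Ci * 0) with (F (gamma b) - F (gamma a)); auto. rewrite hcl. ring.
Qed.

Lemma cfun_1 : L (fun _ => 1) = 1.
Proof.
  apply (cfun_val _ (fun z => / (z - 0))).
  - intros z Hz. assert (z <> 0) by (apply curve_nz; auto). field. intro h. apply H. rewrite <- h. ring.
  - replace (2 * PI * Ci * 1) with (2 * PI * Ci) by ring. exact hw.
Qed.

(** The only clause with content about the curve is the one on powers: z^(n-1) has the primitive z^n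
    / n for n <> 0, and n = 0 is the winding number about 0. *)
Lemma adm_cfun : adm K L.
Proof.
  assert (hid := curve_Hol_id). assert (hinv := curve_Hol_inv).
  split.
  - exact curve_ann.
  - intros f g E. unfold cfun. f_equal. unfold CRInt. apply (@RInt_ext C_R_CompleteNormedModule).
    intros s Hs. assert (h := piecewise_C1_lt _ _ _ hC1). rewrite Rmin_left, Rmax_right in Hs by lra.
    rewrite E; [reflexivity|]. apply on_curve_path. lra.
  - intros f g Hf Hg. apply cfun_unique.
    assert (H := is_RInt_plus (V := C_R_NormedModule) _ _ _ _ _ _ (cfun_int f Hf) (cfun_int g Hg)).
    replace (2 * PI * Ci * (L f + L g)) with (2 * PI * Ci * L f + 2 * PI * Ci * L g) by ring.
    eapply (@is_RInt_ext C_R_NormedModule); [|exact H]. intros s _. cbv beta. symmetry. exact (Cmult_eq_plus _ _ _ _).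
  - intros c f Hf. apply cfun_unique.
    assert (H := is_RInt_Cmult _ _ _ c _ (cfun_int f Hf)).
    replace (2 * PI * Ci * (c * L f)) with (c * (2 * PI * Ci * L f)) by ring.
    eapply (@is_RInt_ext C_R_NormedModule); [|exact H]. intros s _. cbv beta. unfold Cdiv. C_eq. ring.
  - destruct (contour_int_bound gamma a b hC1) as (M & HM & HB). destruct curve_ann as (r1 & r2 & Hr & HA).
    set (T := Cmod (/ (2 * PI * Ci))).
    exists (T * (M * / r1))%R. assert (0 < / r1)%R by (apply Rinv_0_lt_compat; auto). split.
    + apply Rmult_le_pos; [apply Cmod_ge_0|]. apply Rmult_le_pos; lra.
    + intros f B Hf Hb.
      assert (Q := HB (fun z => f z / z) (2 * PI * Ci * L f) (B * / r1)%R).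
      assert (Q' : (Cmod (2 * PI * Ci * L f)%C <= M * (B * / r1))%R).
      { apply Q; [|apply cfun_int; auto]. intros s Hs. assert (hz := on_curve_path s Hs).
        rewrite Cmod_div by (apply curve_nz; auto). unfold Rdiv. apply Rmult_le_compat; auto using Cmod_ge_0.
        - left. apply Rinv_0_lt_compat. apply Cmod_gt_0. apply curve_nz; auto.
        - apply Rinv_le_contravar; auto. apply HA; auto. }
      replace (L f) with (/ (2 * PI * Ci) * (2 * PI * Ci * L f)).
      2: { assert (h := two_pi_i_nz). rewrite Cmult_assoc, Cinv_l by auto. ring. }
      rewrite Cmod_mult. fold T. replace (T * (M * / r1) * B)%R with (T * (M * (B * / r1)))%R by ring.
      apply Rmult_le_compat_l; auto. apply Cmod_ge_0.
  - intros n. destruct n as [|k|k]; simpl Z.eqb; cbv iota.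
    + exact cfun_1.
    + destruct (Pos2Nat.is_succ k) as [m Em].
      apply (cfun_closed _ (fun z => / RtoC (INR (S m)) * z ^ S m) (fun z => z ^ m)).
      * intros z _. simpl. rewrite Em. reflexivity.
      * apply Hol_pow; auto.
      * intros phi s l _ Hp. assert (hn : RtoC (INR (S m)) <> 0) by (intros h; apply (not_0_INR (S m)); [lia|]; apply RtoC_inj in h; auto).
        eapply (eq_rect _ _ (is_derive_Cmult (fun _ => / RtoC (INR (S m))) _ s 0 _ (is_derive_const _ _) (is_derive_Cpow phi s l m Hp))).
        C_eq. field. auto.
    + destruct (Pos2Nat.is_succ k) as [m Em].
      apply (cfun_closed _ (fun z => - / RtoC (INR (S m)) * (/ z) ^ S m) (fun z => (/ z) ^ S (S m))).
      * intros z Hz. simpl zpow. rewrite Em. assert (z <> 0) by (apply curve_nz; auto). simpl. field. auto.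
      * apply Hol_pow; auto.
      * intros phi s l Hphi Hp. assert (hn : RtoC (INR (S m)) <> 0) by (intros h; apply (not_0_INR (S m)); [lia|]; apply RtoC_inj in h; auto).
        assert (hz : phi s <> 0) by (apply curve_nz; auto).
        eapply (eq_rect _ _ (is_derive_Cmult (fun _ => - / RtoC (INR (S m))) _ s 0 _ (is_derive_const _ _) (is_derive_Cpow (fun s => / phi s) s _ m (is_derive_Cinv phi s l Hp hz)))).
        C_eq. simpl Cpow. field. auto.
Qed.

(** By the differential equation, u^(k+2) - u^(k+1) = c z u^k u', and u^k u' is the derivative of
    u^(k+1)/(k+1), so all positive powers of u have the same integral. It holds with c = 1 for u =
    1/(1 - x z) and with c = -1 for u = 1/(1 - y/z). *)
Lemma cfun_powers u u' (c : C) : Hol gen1 K u -> Hol gen1 K u' ->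
  (forall phi s l, K (phi s) -> @is_derive R_AbsRing C_R_NormedModule phi s l ->
     @is_derive R_AbsRing C_R_NormedModule (fun s => u (phi s)) s (u' (phi s) * l)) ->
  (forall z, K z -> u z * (u z - 1) = c * (z * u' z)) ->
  L u = 1 -> forall k, L (fun z => u z ^ k) = 1.
Proof.
  intros Hu Hu' D E H1. destruct k as [|k]; [exact cfun_1|].
  induction k as [|k IH].
  - rewrite (adm_ext _ _ adm_cfun _ u); auto. intros; simpl; ring.
  - assert (HP : Hol gen1 K (fun z => u z ^ k * u' z)) by (apply (Hol_mul gen1 K); auto; apply Hol_pow; auto).
    assert (HQ : Hol gen1 K (fun z => z * (u z ^ k * u' z))) by (apply (Hol_mul gen1 K); auto; apply curve_Hol_id).
    rewrite (adm_ext _ _ adm_cfun _ (fun z => u z ^ S k + c * (z * (u z ^ k * u' z)))).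
    + rewrite (adm_add _ _ adm_cfun (fun z => u z ^ S k) (fun z => c * (z * (u z ^ k * u' z)))).
      * rewrite IH, (adm_scal _ _ adm_cfun) by auto.
        rewrite (cfun_closed _ (fun z => / RtoC (INR (S k)) * u z ^ S k) (fun z => u z ^ k * u' z)); auto; [ring|].
        intros phi s l Hphi Hp. assert (hn : RtoC (INR (S k)) <> 0) by (intros h; apply (not_0_INR (S k)); [lia|]; apply RtoC_inj in h; auto).
        eapply (eq_rect _ _ (is_derive_Cmult (fun _ => / RtoC (INR (S k))) _ s 0 _ (is_derive_const _ _) (is_derive_Cpow (fun s => u (phi s)) s _ k (D phi s l Hphi Hp)))).
        C_eq. field. auto.
      * apply Hol_pow; auto.
      * apply (Hol_mul gen1 K); auto. apply Hol_const.
    + intros z Hz. simpl. replace (u z * (u z * u z ^ k)) with (u z * u z ^ k + (u z * (u z - 1)) * u z ^ k) by ring. rewrite E by auto. ring.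
Qed.

(** The first power suffices by [cfun_powers]: 1/(1 - x z) = 1 + x z/(1 - x z), and the second term
    divided by z is -1/(z - 1/x), whose integral vanishes by hypothesis. *)
Lemma polefree_exterior (x : C) : x <> 0 -> ~ K (/ x) -> is_contour_int (fun z => / (z - / x)) gamma a b 0 -> polefree K L x.
Proof.
  intros hx hK hx0. destruct (curve_away gamma a b (/ x) hC1 hK) as (d & Hd & HH).
  assert (hm := proj1 (Cmod_gt_0 x) hx).
  assert (lb : forall z, K z -> (Cmod x * d <= Cmod (1 - x * z))%R).
  { intros z Hz. replace (1 - x * z) with (- x * (z - / x)) by (field; auto). rewrite Cmod_mult, Cmod_opp. apply Rmult_le_compat_l; auto. lra. }
  assert (hd : (0 < Cmod x * d)%R) by (apply Rmult_lt_0_compat; auto).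
  assert (nz : forall z, K z -> 1 - x * z <> 0) by (intros z Hz; apply Cmod_nz; specialize (lb z Hz); lra).
  assert (Hid := curve_Hol_id).
  assert (HI : Hol gen1 K (fun z => / (1 - x * z))) by (apply Hol_inv with (Cmod x * d)%R; auto; hol).
  split; [exists (Cmod x * d)%R; auto|].
  apply (cfun_powers _ (fun z => x * (/ (1 - x * z) * / (1 - x * z))) 1); auto.
  - apply (Hol_mul gen1 K); [apply Hol_const|]. apply (Hol_mul gen1 K); auto.
  - intros phi s l Hphi Hp.
    assert (D2 := is_derive_Caffine phi s x l Hp).
    eapply (eq_rect _ _ (is_derive_Cinv _ s _ D2 (nz _ Hphi))). assert (h := nz _ Hphi). C_eq. field. auto.
  - intros z Hz. assert (h := nz z Hz). field. auto.
  - rewrite (adm_ext _ _ adm_cfun _ (fun z => 1 + x * (z * / (1 - x * z)))).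
    + rewrite (adm_add _ _ adm_cfun (fun _ => 1) (fun z => x * (z * / (1 - x * z)))).
      * rewrite cfun_1, (adm_scal _ _ adm_cfun) by (apply (Hol_mul gen1 K); auto).
        rewrite (cfun_val _ (fun z => - / x * / (z - / x)) 0); [ring| |].
        -- intros z Hz. assert (h := nz z Hz). field. repeat split; auto. intros e. apply h. replace (1 - x * z) with (- (z * x - 1)) by ring. rewrite e. ring.
        -- assert (Q := is_RInt_Cmult _ _ _ (- / x) _ hx0). replace (2 * PI * Ci * 0) with (- / x * 0) by ring.
           eapply (@is_RInt_ext C_R_NormedModule); [|exact Q]. intros s _. cbv beta. C_eq. ring.
      * apply Hol_const.
      * apply (Hol_mul gen1 K); [apply Hol_const|]. apply (Hol_mul gen1 K); auto.
    + intros z Hz. assert (h := nz z Hz). field. auto.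
Qed.

(** In the inverted variable the first power is 1/(1 - y/z), and dz/z times it is dz/(z - y): the
    value 1 is the winding number about y. *)
Lemma polefree_interior (y : C) : ~ K y -> is_contour_int (fun z => / (z - y)) gamma a b (2 * PI * Ci) ->
  polefree (fun z => K (/ z)) (fun f => L (fun z => f (/ z))) y.
Proof.
  intros hK hy. destruct (curve_away gamma a b y hC1 hK) as (d & Hd & HH). destruct curve_ann as (r1 & r2 & Hr & HA).
  assert (Hr2 : (0 < Rmax r1 r2)%R) by (eapply Rlt_le_trans; [exact Hr|apply Rmax_l]).
  assert (hd : (0 < d * / Rmax r1 r2)%R) by (apply Rmult_lt_0_compat; auto; apply Rinv_0_lt_compat; auto).
  assert (lb : forall z, K z -> (d * / Rmax r1 r2 <= Cmod (1 - y * / z))%R).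
  { intros z Hz. assert (hz := curve_nz z Hz). replace (1 - y * / z) with ((z - y) * / z) by (field; auto). rewrite Cmod_mult, Cmod_inv by auto.
    apply Rmult_le_compat; auto; try lra. + left; apply Rinv_0_lt_compat; auto.
    + apply Rinv_le_contravar; [apply Cmod_gt_0; auto|]. eapply Rle_trans; [apply (HA z Hz)|apply Rmax_r]. }
  assert (nz : forall z, K z -> 1 - y * / z <> 0) by (intros z Hz; apply Cmod_nz; specialize (lb z Hz); lra).
  assert (nzy : forall z, K z -> z - y <> 0) by (intros z Hz; apply Cmod_nz; specialize (HH z Hz); lra).
  assert (Hid := curve_Hol_id). assert (Hinv := curve_Hol_inv).
  assert (HI : Hol gen1 K (fun z => / (1 - y * / z))) by (apply Hol_inv with (d * / Rmax r1 r2)%R; auto; hol).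
  assert (HJ : Hol gen1 K (fun z => / (z - y))) by (apply Hol_inv with d; auto; hol).
  split.
  - exists (d * / Rmax r1 r2)%R. split; auto. intros z Hz. assert (hz := curve_nz _ Hz).
    replace (y * z) with (y * / / z); [apply lb; auto|]. f_equal. field. intros ->. rewrite Cinv_0 in Hz. auto.
  - apply (cfun_powers (fun z => / (1 - y * / z)) (fun z => - y * (/ (z - y) * / (z - y))) (- (1))); auto.
    + apply (Hol_mul gen1 K); [apply Hol_const|]. apply (Hol_mul gen1 K); auto.
    + intros phi s l Hphi Hp. assert (hz := curve_nz _ Hphi).
      assert (D2 := is_derive_Caffine _ s y _ (is_derive_Cinv phi s l Hp hz)).
      eapply (eq_rect _ _ (is_derive_Cinv _ s _ D2 (nz _ Hphi))). assert (h := nzy _ Hphi). C_eq. field. auto.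
    + intros z Hz. assert (h := nzy z Hz). assert (hz := curve_nz _ Hz). field. auto.
    + apply (cfun_val _ (fun z => / (z - y))).
      * intros z Hz. assert (h := nzy z Hz). assert (hz := curve_nz _ Hz). field. auto.
      * replace (2 * PI * Ci * 1) with (2 * PI * Ci) by ring. exact hy.
Qed.
End Curve.

(** * Winding numbers *)

Lemma C_open_of_balls (U : C -> Prop) : (forall x, U x -> exists d, (0 < d)%R /\ forall y, (Cmod (y - x) < d)%R -> U y) -> open U.
Proof.
  intros H x Hx. destruct (H x Hx) as (d & Hd & HH).
  (* The uniform structure on C has square balls; the square of half-side d / 2 lies in the disc of
     radius d. *)
  assert (Hp : (0 < d / 2)%R) by lra. exists (mkposreal _ Hp). intros y [h1 h2]. apply HH.
  assert (hm := Cmod_2Rmax (y - x)).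
  assert (hmx : (Rmax (Rabs (fst (y - x)%C)) (Rabs (snd (y - x)%C)) < d / 2)%R) by (apply Rmax_lub_lt; [exact h1|exact h2]).
  assert (hs : (sqrt 2 <= 2)%R).
  { rewrite <- (sqrt_Rsqr 2) at 2 by lra. apply sqrt_le_1_alt. unfold Rsqr; lra. }
  assert (0 <= Rmax (Rabs (fst (y - x)%C)) (Rabs (snd (y - x)%C)))%R.
  { eapply Rle_trans; [|apply Rmax_l]. apply Rabs_pos. }
  nra.
Qed.

Section Winding.
Context (gamma : R -> C) (a b : R) (hC1 : piecewise_C1 gamma a b) (hcl : gamma a = gamma b).
Local Notation K := (on_curve gamma a b).

Lemma curve_Hol_sub : forall w : C, Hol gen1 K (fun z => z - w).
Proof.
  intros w. destruct (curve_bounded gamma a b hC1) as (M & HM & HB).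
  apply (Hol_sub gen1 K (fun z => z)); [|apply Hol_const]. apply Hol_gen with M; auto. reflexivity.
Qed.

Lemma curve_Hol_inv_sub (w : C) : ~ K w -> Hol gen1 K (fun z => / (z - w)).
Proof.
  intros Hw. destruct (curve_away gamma a b w hC1 Hw) as (d & Hd & HH). apply Hol_inv with d; auto. apply curve_Hol_sub.
Qed.

(** Unnormalised: this is 2 pi i times the winding number. *)
Definition winding (w : C) : C := CRInt (fun s => / (gamma s - w) * velocity gamma s) a b.

Lemma winding_correct (w : C) : ~ K w -> is_contour_int (fun z => / (z - w)) gamma a b (winding w).
Proof.
  intros Hw. destruct (contour_int_exists gamma a b K (fun z => / (z - w)) hC1) as [l Hl].
  - intros s Hs. exists s. auto.
  - apply curve_Hol_inv_sub; auto.
  - unfold winding. rewrite (CRInt_unique _ _ _ _ Hl). exact Hl.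
Qed.

(** The integrand has the primitive -1/(z - w) and the curve is closed. This integral is also the
    derivative of [winding] in w. *)
Lemma winding_sq (w : C) : ~ K w -> is_contour_int (fun z => / (z - w) * / (z - w)) gamma a b 0.
Proof.
  intros Hw. assert (HI := curve_Hol_inv_sub w Hw).
  assert (H := contour_FTC gamma a b K (fun z => - / (z - w)) (fun z => / (z - w) * / (z - w)) hC1 (fun s Hs => ex_intro _ s (conj Hs eq_refl))).
  replace (RtoC 0) with (- / (gamma b - w) - - / (gamma a - w)) by (rewrite hcl; ring). apply H.
  - apply (Hol_mul gen1 K); auto.
  - intros phi s l Hphi Hp. assert (nz : phi s - w <> 0). { intros h. apply Ceq_minus in h. subst w. auto. }
    assert (D := is_derive_minus (V := C_R_NormedModule) phi (fun _ => w) s _ _ Hp (is_derive_const (V := C_R_NormedModule) w s)).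
    assert (D2 := is_derive_Cinv _ s _ D nz).
    assert (D3 := is_derive_opp (V := C_R_NormedModule) _ s _ D2).
    eapply (eq_rect _ (is_derive (V := C_R_NormedModule) (fun s => - / (phi s - w)) s) D3).
    cbv [minus plus opp zero]. change (- (- (l + - RtoC 0) / ((phi s - w) * (phi s - w))) = / (phi s - w) * / (phi s - w) * l).
    field. auto.
Qed.

(** By [winding_sq] the first-order term of the difference integrates to 0. The difference is then
    quadratic in the distance, and [quadratic_constant] applies on the segment from w0 to w. *)
Lemma winding_local (w0 : C) : ~ K w0 -> exists d, (0 < d)%R /\ forall w, (Cmod (w - w0) < d)%R -> ~ K w /\ winding w = winding w0.
Proof.
  intros Hw. destruct (curve_away gamma a b w0 hC1 Hw) as (d & Hd & HH).
  destruct (contour_int_bound gamma a b hC1) as (M & HM & HMB).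
  exists (d / 2)%R. split; [lra|]. 
  assert (far : forall w z, (Cmod (w - w0) < d / 2)%R -> K z -> (d / 2 <= Cmod (z - w))%R).
  { intros w z h Hz. specialize (HH z Hz). assert (T := Cmod_triangle (z - w) (w - w0)). replace (z - w + (w - w0)) with (z - w0) in T by ring. lra. }
  assert (nK : forall w, (Cmod (w - w0) < d / 2)%R -> ~ K w).
  { intros w h Hz. assert (f := far w w h Hz). replace (w - w) with (RtoC 0) in f by ring. rewrite Cmod_0 in f. lra. }
  intros w h. split; auto.
  assert (Q : forall u v : C, (Cmod (u - w0) < d / 2)%R -> (Cmod (v - w0) < d / 2)%R ->
    (Cmod (winding u - winding v) <= M * (Cmod (u - v) ^ 2 * (/ (d / 2)) ^ 3))%R).
  { intros u v hu hv.
    apply (HMB (fun z => / (z - u) - / (z - v) - (u - v) * (/ (z - v) * / (z - v)))).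
    - intros s Hs. assert (Kz : K (gamma s)) by (exists s; auto). set (z := gamma s) in *.
      assert (fu := far u z hu Kz). assert (fv := far v z hv Kz).
      assert (nu : z - u <> 0) by (apply Cmod_nz; lra). assert (nv : z - v <> 0) by (apply Cmod_nz; lra).
      replace (/ (z - u) - / (z - v) - (u - v) * (/ (z - v) * / (z - v))) with ((u - v) ^ 2 * (/ (z - u) * (/ (z - v) * / (z - v)))) by (field; auto).
      assert (iu : (Cmod (/ (z - u)) <= / (d / 2))%R) by (rewrite Cmod_inv by auto; apply Rinv_le_contravar; lra).
      assert (iv : (Cmod (/ (z - v)) <= / (d / 2))%R) by (rewrite Cmod_inv by auto; apply Rinv_le_contravar; lra).
      rewrite !Cmod_mult, Cmod_pow. apply Rmult_le_compat_l; [apply pow_le, Cmod_ge_0|].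
      replace ((/ (d / 2)) ^ 3)%R with (/ (d / 2) * (/ (d / 2) * / (d / 2)))%R by ring.
      repeat first [apply Rmult_le_compat | apply Cmod_ge_0 | apply Rmult_le_pos | assumption].
    - assert (I1 := winding_correct u (nK u hu)). assert (I2 := winding_correct v (nK v hv)). assert (I3 := winding_sq v (nK v hv)).
      assert (I4 := is_RInt_minus (V := C_R_NormedModule) _ _ _ _ _ _ (is_RInt_minus (V := C_R_NormedModule) _ _ _ _ _ _ I1 I2) (is_RInt_Cmult _ _ _ (u - v) _ I3)).
      unfold is_contour_int.
      replace (winding u - winding v) with (winding u + - winding v + - ((u - v) * 0)) by ring.
      eapply (@is_RInt_ext C_R_NormedModule); [|exact I4]. intros s _. cbv [minus plus opp].
      change (/ (gamma s - u) * velocity gamma s + - (/ (gamma s - v) * velocity gamma s) + - ((u - v) * (/ (gamma s - v) * / (gamma s - v) * velocity gamma s)) = (/ (gamma s - u) - / (gamma s - v) - (u - v) * (/ (gamma s - v) * / (gamma s - v))) * velocity gamma s).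
      ring. }
  symmetry. set (phi := fun s : R => winding (w0 + RtoC s * (w - w0))).
  replace (winding w0) with (phi 0%R) by (unfold phi; f_equal; ring).
  replace (winding w) with (phi 1%R) by (unfold phi; f_equal; ring).
  apply (quadratic_constant phi (M * (Cmod (w - w0) ^ 2 * (/ (d / 2)) ^ 3))).
  intros s t Hs Ht. unfold phi.
  assert (inb : forall r, (0 <= r <= 1)%R -> (Cmod (w0 + RtoC r * (w - w0) - w0) < d / 2)%R).
  { intros r Hr. replace (w0 + RtoC r * (w - w0) - w0) with (RtoC r * (w - w0)) by ring. rewrite Cmod_mult, Cmod_R, Rabs_pos_eq by lra.
    assert (g := Cmod_ge_0 (w - w0)). nra. }
  eapply Rle_trans; [apply Q; apply inb; auto|]. right.
  replace (w0 + RtoC s * (w - w0) - (w0 + RtoC t * (w - w0))) with (RtoC (s - t) * (w - w0)) by (rewrite RtoC_minus; ring).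
  rewrite Cmod_mult, Cmod_R. rewrite Rpow_mult_distr. rewrite RPow_abs. rewrite (Rabs_pos_eq ((s - t) ^ 2)) by apply pow2_ge_0. ring.
Qed.

(** By [winding_local] the set where the value is attained and the set where it is not are both open
    off the curve, so a connected set cannot meet both. *)
Lemma winding_component (v w : C) : component (fun u => ~ K u) v w -> winding v = winding w.
Proof.
  intros (S & Hc & HD & Hv & Hw).
  destruct (Ceq_dec (winding w) (winding v)) as [h|h]; auto. exfalso.
  apply (Hc (fun u => ~ K u /\ winding u = winding v) (fun u => ~ K u /\ winding u <> winding v)).
  - apply C_open_of_balls. intros x [Kx Ex]. destruct (winding_local x Kx) as (d & Hd & HH). exists d. split; auto.
    intros y Hy. destruct (HH y Hy) as [Ky Ey]. split; auto. congruence.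
  - apply C_open_of_balls. intros x [Kx Ex]. destruct (winding_local x Kx) as (d & Hd & HH). exists d. split; auto.
    intros y Hy. destruct (HH y Hy) as [Ky Ey]. split; auto. congruence.
  - intros z Hz. destruct (Ceq_dec (winding z) (winding v)); [left|right]; split; auto.
  - intros z _ [_ h1] [_ h2]. auto.
  - exists v. auto.
  - exists w. auto.
Qed.

(** The integral is constant on the component and tends to 0 at infinity. *)
Lemma winding_exterior (w : C) : exterior_of gamma a b w -> is_contour_int (fun z => / (z - w)) gamma a b 0.
Proof.
  intros [Kw Hub]. replace (RtoC 0) with (winding w); [apply winding_correct; auto|].
  destruct (contour_int_bound gamma a b hC1) as (M & HM & HMB). destruct (curve_bounded gamma a b hC1) as (N & HN & HNB).
  apply C_eq_of_small. intros e He.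
  (* If the value at w exceeded e, no point of the component could lie beyond radius N + (M + 1)/e,
     where the integral is at most M e/(M + 1) in modulus. The component would be bounded. *)
  apply Classical_Prop.NNPP. intros Hbig. apply Hub.
  exists (N + (M + 1) / e)%R. intros z Hz. apply Rnot_lt_le. intros hz. apply Hbig.
  rewrite (winding_component w z Hz). replace (winding z - 0) with (winding z) by ring.
  assert (Kz : ~ K z). { destruct Hz as (S & _ & HD & _ & h). apply (HD z h). }
  assert (hp : (0 < (M + 1) / e)%R) by (apply Rdiv_lt_0_compat; lra).
  assert (Q : (Cmod (winding z) <= M * (/ ((M + 1) / e)))%R).
  { apply (HMB (fun u => / (u - z))); [|apply winding_correct; auto].
    intros s Hs. assert (Ks : K (gamma s)) by (exists s; auto). specialize (HNB _ Ks).
    assert (T := Cmod_triangle_rev z (gamma s)). rewrite Cmod_sub_sym in T.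
    rewrite Cmod_inv by (apply Cmod_nz; lra). apply Rinv_le_contravar; lra. }
  eapply Rle_trans; [exact Q|]. replace (M * / ((M + 1) / e))%R with (e * (M / (M + 1)))%R by (field; lra).
  rewrite <- (Rmult_1_r e) at 2. apply Rmult_le_compat_l; [lra|]. apply Rle_div_l; lra.
Qed.
End Winding.

(** * Continuation in the parameters *)

Section Continuation.
Context (r1 r2 rho1 rho2 s1 s2 T : R) (H : C * C -> C).
Context (hr1 : (0 < r1)%R) (hr1' : (r1 < rho1)%R) (hr : (rho1 <= rho2)%R) (hr2 : (rho2 < r2)%R).
Context (hT : (0 <= T)%R) (hT1 : (T * rho1 < 1)%R) (hT2 : (T < rho2)%R) (HH : Hol2 r1 r2 s1 s2 H).

(** A pole that moves with l. The bound T with T rho1 < 1 and T < rho2 puts every outer pole 1/x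
    outside the circle of radius rho1 and every inner pole inside the circle of radius rho2. *)
Definition par (x : C -> C) : Prop :=
  Hol1 s1 s2 x /\ forall l, ann s1 s2 l -> x l <> 0 /\ (Cmod (x l) <= T)%R.

Definition at_par (X : list (C -> C)) (l : C) : list C := map (fun x => x l) X.

Fixpoint cross1 (x : C) (Y : list C) : C :=
  match Y with nil => 1 | y :: Y' => (1 - x * y) * cross1 x Y' end.

(** The common denominator of all partial fraction steps: each step that separates an outer from an
    inner pole costs one factor 1 - x y. *)
Fixpoint cross (X Y : list C) : C :=
  match X with nil => 1 | x :: X' => cross1 x Y * cross X' Y end.

Lemma cross_nil_r X : cross X nil = 1.
Proof. induction X; simpl; [reflexivity|]. rewrite IHX. ring. Qed.

Lemma cross_cons_r X y Y : cross X (y :: Y) = cross1 y X * cross X Y.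
Proof. induction X as [|x X IH]; simpl; [ring|]. rewrite IH. ring. Qed.

Lemma cross1_Hol (x : C -> C) (Y : list (C -> C)) : Hol1 s1 s2 x -> (forall y, In y Y -> Hol1 s1 s2 y) ->
  Hol1 s1 s2 (fun l => cross1 (x l) (at_par Y l)).
Proof.
  intros Hx. induction Y as [|y Y IH]; intros HY; simpl.
  - apply Hol_const.
  - apply (Hol_mul gen1 (ann s1 s2)); [|apply IH; intros; apply HY; right; auto].
    assert (Hy := HY y (or_introl eq_refl)). hol.
Qed.

Lemma iprod_Hol2 (X : list (C -> C)) rho : (0 < rho)%R -> (T * rho < 1)%R -> (forall x, In x X -> par x) ->
  Hol2 rho rho s1 s2 (fun u => iprod (at_par X (snd u)) (fst u)).
Proof.
  intros hrho hTr. induction X as [|x X IH]; intros HX.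
  - apply (Hol_const gen2 (ann2 rho rho s1 s2) 1).
  - apply Hol_ext with (fun u => / (1 - x (snd u) * fst u) * iprod (at_par X (snd u)) (fst u)); [reflexivity|].
    apply (Hol_mul gen2 (ann2 rho rho s1 s2)); [|apply IH; intros; apply HX; right; auto].
    destruct (HX x (or_introl eq_refl)) as [Hx Bx].
    assert (h1 := Hol1_snd rho rho s1 s2 x Hx). assert (h2 := Hol2_fst rho rho s1 s2).
    apply Hol_inv with (1 - T * rho)%R; [lra| |hol].
    intros [z l] [[_ Hz] Hl]. simpl in *. destruct (Bx l Hl) as [_ B].
    assert (h := Cmod_triangle_rev 1 (x l * z)). rewrite Cmod_1, Cmod_mult in h.
    assert (Cmod (x l) * Cmod z <= T * rho)%R by (apply Rmult_le_compat; auto using Cmod_ge_0). lra.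
Qed.

Lemma Cmod_pos_real (r : R) : (0 < r)%R -> Cmod (RtoC r) = r.
Proof. intros h. rewrite Cmod_R, Rabs_pos_eq; lra. Qed.

(** [Phi] is fixed before [l], [K] and [L]. Contours for different l may thus be unrelated, and no
    contour has to be moved continuously along with the poles. *)
Definition continues (X Y : list (C -> C)) (Phi : C -> C) : Prop :=
  Hol1 s1 s2 Phi /\ forall l, ann s1 s2 l -> forall K L, adm K L -> (forall z, K z -> ann rho1 rho2 z) ->
    (forall x, In x X -> polefree K L (x l)) ->
    (forall y, In y Y -> polefree (fun z => K (/ z)) (fun f => L (fun z => f (/ z))) (y l)) ->
    cross (at_par X l) (at_par Y l) * L (fun z => H (z, l) * (iprod (at_par X l) z * iprod (at_par Y l) (/ z))) = Phi l.

Lemma in_at_par X l x : In x (at_par X l) -> exists f, In f X /\ x = f l.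
Proof. intros h. apply in_map_iff in h. destruct h as (f & E & h). exists f. auto. Qed.

(** With outer poles only, [adm_unique] replaces the contour by the circle of radius rho1, which
    separates the poles for every l. *)
Lemma continue_outer X : (forall x, In x X -> par x) -> exists Phi, continues X nil Phi.
Proof.
  intros HX. exists (fun l => mean (fun z => H (z, l) * iprod (at_par X l) z) (RtoC rho1)).
  assert (hrho : (0 < rho1)%R) by lra. assert (hm := Cmod_pos_real rho1 hrho).
  assert (nz : RtoC rho1 <> 0) by (apply Cmod_nz; lra).
  split.
  - apply (Hol2_mean rho1 rho1 s1 s2 (fun u => H u * iprod (at_par X (snd u)) (fst u)) (RtoC rho1)); [|unfold ann; lra].
    apply (Hol_mul gen2 (ann2 rho1 rho1 s1 s2) H); [|apply iprod_Hol2; auto].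
    apply Hol_subset with (ann2 r1 r2 s1 s2); auto. intros [z l] [[h1 h2] h3]. split; auto. simpl in *. split; lra.
  - intros l Hl K L HA HK Hx _. simpl. rewrite cross_nil_r, Cmult_1_l.
    assert (HA' := adm_mean (RtoC rho1) nz).
    rewrite (adm_ext _ _ HA _ (fun z => H (z, l) * iprod (at_par X l) z)) by (intros; ring).
    apply (adm_unique _ _ _ _ HA HA' r1 r2 rho1 rho2 (fun z => H (z, l))); auto.
    + exact (Hol2_slice_r r1 r2 s1 s2 H l Hl HH).
    + rewrite hm. intros z [h1 h2]. split; lra.
    + intros x Hin. apply in_at_par in Hin. destruct Hin as (f & Hf & ->). destruct (HX f Hf) as [_ B]. destruct (B l Hl) as [B1 B2].
      split; [|split]; auto. apply polefree_mean; auto. rewrite Cmod_mult, hm.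
      eapply Rle_lt_trans; [|exact hT1]. apply Rmult_le_compat_r; lra.
Qed.

(** After the inversion z -> 1/z the inner poles are outer ones, and the circle of radius rho2
    becomes that of radius 1/rho2. *)
Lemma continue_inner Y : (forall y, In y Y -> par y) -> exists Phi, continues nil Y Phi.
Proof.
  intros HY. assert (hrho : (0 < / rho2)%R) by (apply Rinv_0_lt_compat; lra).
  exists (fun l => mean (fun z => H (/ z, l) * iprod (at_par Y l) z) (RtoC (/ rho2))).
  assert (hm := Cmod_pos_real _ hrho).
  assert (nz : RtoC (/ rho2) <> 0) by (apply Cmod_nz; lra).
  assert (hTi : (T * / rho2 < 1)%R) by (apply (Rmult_lt_reg_r rho2); [lra|]; rewrite Rmult_assoc, Rinv_l; lra).
  assert (i1 : (/ r2 < / rho2)%R) by (apply Rinv_lt_contravar; auto; apply Rmult_lt_0_compat; lra).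
  assert (i2 : (/ rho2 <= / rho1)%R) by (apply Rinv_le_contravar; lra).
  assert (i3 : (/ rho1 < / r1)%R) by (apply Rinv_lt_contravar; auto; apply Rmult_lt_0_compat; lra).
  assert (i0 : (0 < / r2)%R) by (apply Rinv_0_lt_compat; lra).
  assert (flip : forall a b z, (0 < a)%R -> ann a b z -> ann (/ b) (/ a) (/ z)).
  { intros a b z Ha [h1 h2]. assert (z <> 0) by (apply Cmod_nz; lra). unfold ann. rewrite Cmod_inv by auto. split; apply Rinv_le_contravar; lra. }
  assert (flip' : forall z, ann (/ r2) (/ r1) z -> ann r1 r2 (/ z)).
  { intros z Hz. rewrite <- (Rinv_inv r1), <- (Rinv_inv r2). apply flip; auto. }
  assert (HHi : Hol2 (/ r2) (/ r1) s1 s2 (fun u => H (/ fst u, snd u))).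
  { apply (Hol_comp gen2 (ann2 r1 r2 s1 s2) gen2 (ann2 (/ r2) (/ r1) s1 s2) H (fun u => (/ fst u, snd u))); auto.
    - intros [z l] [h1 h2]. split; auto. simpl in *. auto.
    - intros g [-> | ->]; simpl.
      + apply (Hol1_fst (/ r2) (/ r1) s1 s2 (fun z => / z)). apply Hol1_inv; auto.
      + apply Hol2_snd. }
  split.
  - apply (Hol2_mean (/ rho2) (/ rho2) s1 s2 (fun u => H (/ fst u, snd u) * iprod (at_par Y (snd u)) (fst u)) (RtoC (/ rho2))); [|unfold ann; lra].
    apply (Hol_mul gen2 (ann2 (/ rho2) (/ rho2) s1 s2) (fun u => H (/ fst u, snd u))); [|apply iprod_Hol2; auto].
    apply Hol_subset with (ann2 (/ r2) (/ r1) s1 s2); auto. intros [z l] [[h1 h2] h3]. split; auto. simpl in *. split; lra.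
  - intros l Hl K L HA HK _ Hy. simpl. rewrite Cmult_1_l.
    assert (HA' := adm_mean _ nz). assert (HAi := adm_inversion K L HA).
    rewrite (adm_ext _ _ HA _ (fun z => (fun u => H (/ u, l) * iprod (at_par Y l) u) (/ z))).
    2: { intros z Hz. assert (h := adm_nz K L z HA Hz). cbv beta. replace (/ / z) with z by (field; auto). change (iprod (at_par nil l) z) with (RtoC 1). ring. }
    apply (adm_unique _ _ _ _ HAi HA' (/ r2) (/ r1) (/ rho2) (/ rho1) (fun z => H (/ z, l))); auto.
    + exact (Hol2_slice_r (/ r2) (/ r1) s1 s2 _ l Hl HHi).
    + intros z Hz. assert (h := flip rho1 rho2 _ ltac:(lra) (HK _ Hz)).
      replace z with (/ / z); auto. assert (z <> 0) by (intros ->; rewrite Cinv_0 in Hz; apply (adm_nz K L 0 HA Hz); auto). field. auto.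
    + rewrite hm. intros z [h1 h2]. split; lra.
    + intros x Hin. apply in_at_par in Hin. destruct Hin as (f & Hf & ->). destruct (HY f Hf) as [_ B]. destruct (B l Hl) as [B1 B2].
      split; [|split]; auto. apply polefree_mean; auto. rewrite Cmod_mult, hm.
      eapply Rle_lt_trans; [|exact hTi]. apply Rmult_le_compat_r; lra.
Qed.

Lemma adm_Hol_integrand K L X Y l : ann s1 s2 l -> adm K L -> (forall z, K z -> ann rho1 rho2 z) ->
    (forall x, In x X -> polefree K L (x l)) ->
    (forall y, In y Y -> polefree (fun z => K (/ z)) (fun f => L (fun z => f (/ z))) (y l)) ->
  Hol gen1 K (fun z => H (z, l) * (iprod (at_par X l) z * iprod (at_par Y l) (/ z))).
Proof.
  intros Hl HA HK HX HY. apply (Hol_mul gen1 K (fun z => H (z, l))).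
  - apply Hol_subset with (ann r1 r2); [intros z Hz; destruct (HK z Hz); split; lra|]. exact (Hol2_slice_r r1 r2 s1 s2 H l Hl HH).
  - apply (Hol_mul gen1 K).
    + apply iprod_Hol with L; auto. intros x Hin. apply in_at_par in Hin. destruct Hin as (f & Hf & ->). auto.
    + assert (h : Hol gen1 (fun z => K (/ z)) (iprod (at_par Y l))).
      { apply iprod_Hol with (fun f => L (fun z => f (/ z))); [apply adm_inversion; auto|].
        intros x Hin. apply in_at_par in Hin. destruct Hin as (f & Hf & ->). auto. }
      apply (Hol_comp gen1 (fun z => K (/ z)) gen1 K (iprod (at_par Y l)) (fun z => / z)); auto.
      * intros z Hz. assert (hz := adm_nz K L z HA Hz). replace (/ / z) with z by (field; auto). auto.
      * intros g ->. exact (proj2 (adm_id_inv K L HA)).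
Qed.

(* (1 - x y) / ((1 - x z) (1 - y / z)) = 1 / (1 - x z) + 1 / (1 - y / z) - 1 separates the outer
   poles from the inner ones; with only outer (inner) poles left, [K] can be deformed to a small
   (large) circle. The resulting [Phi] does not depend on [K] and [L]. *)
Lemma continuation_exists : forall n X Y, (length X + length Y <= n)%nat -> (forall x, In x X -> par x) ->
  (forall y, In y Y -> par y) -> exists Phi, continues X Y Phi.
Proof.
  induction n as [|n IH]; intros X Y Hn HX HY.
  - destruct X; [|simpl in Hn; lia]. apply continue_inner; auto.
  - destruct X as [|x X]; [apply continue_inner; auto|]. destruct Y as [|y Y]; [apply continue_outer; auto|].
    simpl in Hn.
    assert (HX' : forall x, In x X -> par x) by (intros; apply HX; right; auto).
    assert (HY' : forall y, In y Y -> par y) by (intros; apply HY; right; auto).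
    destruct (IH (x :: X) Y ltac:(simpl; lia) HX HY') as (P1 & HP1 & E1).
    destruct (IH X (y :: Y) ltac:(simpl; lia) HX' HY) as (P2 & HP2 & E2).
    destruct (IH X Y ltac:(lia) HX' HY') as (P3 & HP3 & E3).
    assert (cX : Hol1 s1 s2 (fun l => cross1 (y l) (at_par X l))) by (apply cross1_Hol; [apply HY; left; auto|intros; apply HX'; auto]).
    assert (cY : Hol1 s1 s2 (fun l => cross1 (x l) (at_par Y l))) by (apply cross1_Hol; [apply HX; left; auto|intros; apply HY'; auto]).
    exists (fun l => cross1 (y l) (at_par X l) * P1 l + cross1 (x l) (at_par Y l) * P2 l - cross1 (y l) (at_par X l) * cross1 (x l) (at_par Y l) * P3 l).
    split; [hol|]. intros l Hl K L HA HK px py.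
    assert (px' : forall x, In x X -> polefree K L (x l)) by (intros; apply px; right; auto).
    assert (py' : forall y, In y Y -> polefree (fun z => K (/ z)) (fun f => L (fun z => f (/ z))) (y l)) by (intros; apply py; right; auto).
    rewrite <- (E1 l Hl K L HA HK px py'), <- (E2 l Hl K L HA HK px' py), <- (E3 l Hl K L HA HK px' py').
    assert (F1 := adm_Hol_integrand K L (x :: X) Y l Hl HA HK px py').
    assert (F2 := adm_Hol_integrand K L X (y :: Y) l Hl HA HK px' py).
    assert (F3 := adm_Hol_integrand K L X Y l Hl HA HK px' py').
    assert (F0 := adm_Hol_integrand K L (x :: X) (y :: Y) l Hl HA HK px py).
    set (f1 := fun z => H (z, l) * (iprod (at_par (x :: X) l) z * iprod (at_par Y l) (/ z))) in *.
    set (f2 := fun z => H (z, l) * (iprod (at_par X l) z * iprod (at_par (y :: Y) l) (/ z))) in *.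
    set (f3 := fun z => H (z, l) * (iprod (at_par X l) z * iprod (at_par Y l) (/ z))) in *.
    set (f0 := fun z => H (z, l) * (iprod (at_par (x :: X) l) z * iprod (at_par (y :: Y) l) (/ z))) in *.
    assert (E : (1 - x l * y l) * L f0 = L f1 + L f2 - L f3).
    { rewrite <- (adm_scal _ _ HA) by auto. rewrite <- (adm_add _ _ HA) by auto.
      rewrite <- (adm_sub K L) by (auto; apply (Hol_add gen1 K); auto).
      apply (adm_ext _ _ HA). intros z Hz. assert (hz := adm_nz K L z HA Hz).
      assert (n1 := polefree_nz K L _ z (px x (or_introl eq_refl)) Hz).
      assert (Kz : K (/ / z)) by (replace (/ / z) with z by (field; auto); auto).
      assert (n2 := polefree_nz _ _ _ (/ z) (py y (or_introl eq_refl)) Kz).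
      unfold f0, f1, f2, f3. unfold at_par; simpl map. fold (at_par X l) (at_par Y l). rewrite !iprod_cons.
      assert (n3 : z - y l <> 0). { intros h. apply n2. replace (1 - y l * / z) with ((z - y l) * / z) by (field; auto). rewrite h. ring. }
      field. auto. }
    assert (C1 : cross (at_par (x :: X) l) (at_par (y :: Y) l) = (1 - x l * y l) * (cross1 (x l) (at_par Y l) * (cross1 (y l) (at_par X l) * cross (at_par X l) (at_par Y l)))).
    { unfold at_par; simpl map. fold (at_par X l) (at_par Y l). simpl cross. rewrite cross_cons_r. ring. }
    assert (C2 : cross (at_par (x :: X) l) (at_par Y l) = cross1 (x l) (at_par Y l) * cross (at_par X l) (at_par Y l)) by reflexivity.
    assert (C3 : cross (at_par X l) (at_par (y :: Y) l) = cross1 (y l) (at_par X l) * cross (at_par X l) (at_par Y l)) by (unfold at_par; simpl map; fold (at_par X l) (at_par Y l); rewrite cross_cons_r; reflexivity).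
    rewrite C1, C2, C3.
    transitivity (cross1 (x l) (at_par Y l) * (cross1 (y l) (at_par X l) * cross (at_par X l) (at_par Y l)) * ((1 - x l * y l) * L f0)); [ring|].
    rewrite E. ring.
Qed.
End Continuation.

(** * Splitting finitely many poles off the kernel *)

Lemma Cinv_mul (x y : C) : / (x * y) = / x * / y.
Proof.
  destruct (Ceq_dec x 0) as [->|hx]; [rewrite Cmult_0_l, Cinv_0; ring|].
  destruct (Ceq_dec y 0) as [->|hy]; [rewrite Cmult_0_r, Cinv_0; ring|]. field. auto.
Qed.

Lemma Cinv_Cinv (x : C) : / / x = x.
Proof. destruct (Ceq_dec x 0) as [->|hx]; [rewrite !Cinv_0; auto|field; auto]. Qed.

Lemma Cinv_Cprod (f : nat -> C) n : / Cprod f n = Cprod (fun i => / f i) n.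
Proof. induction n; simpl; [field|]. rewrite Cinv_mul, IHn. reflexivity. Qed.

(** What remains of (u; q, p)_oo without the N by N block of first factors: the rows j < N from
    column N on, and all rows from N on. For large N it has no zeros on a given bounded set. *)
Definition dtail (q p : C) (N : nat) (u : C) : C :=
  Cprod (fun j => poch p (u * q ^ j * p ^ N)) N * dpoch q p (u * q ^ N).

Lemma poch_split (p u : C) N : (Cmod p < 1)%R -> poch p u = Cprod (fun k => 1 - u * p ^ k) N * poch p (u * p ^ N).
Proof.
  intros hp. induction N; simpl.
  - replace (u * 1) with u by ring. ring.
  - rewrite IHN, (poch_rec p (u * p ^ N)) by auto. replace (p * (u * p ^ N)) with (u * (p * p ^ N)) by ring. ring.
Qed.

Lemma dpoch_split (q p u : C) N : (Cmod q < 1)%R -> (Cmod p < 1)%R ->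
  dpoch q p u = Cprod (fun j => Cprod (fun k => 1 - u * q ^ j * p ^ k) N) N * dtail q p N u.
Proof.
  intros hq hp. unfold dtail. rewrite Cmult_assoc, <- Cprod_mul.
  rewrite (Cprod_ext _ (fun j => poch p (u * q ^ j))) by (intros; symmetry; apply poch_split; auto).
  induction N as [|N IH]; simpl.
  - replace (u * 1) with u by ring. ring.
  - rewrite IH, (dpoch_rec q p (u * q ^ N)) by auto. replace (q * (u * q ^ N)) with (u * (q * q ^ N)) by ring. ring.
Qed.

Lemma dtail_inv_Hol {X} gen (K : X -> Prop) (q p : C) (u : X -> C) N (B c : R) : (Cmod q < 1)%R -> (Cmod p < 1)%R ->
  (0 <= c < 1)%R -> (forall x, K x -> (Cmod (u x) <= B)%R) -> (B * Cmod q ^ N <= c)%R -> (B * Cmod p ^ N <= c)%R ->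
  Hol gen K u -> Hol gen K (fun x => / dtail q p N (u x)).
Proof.
  intros hq hp hc hB hBq hBp Hu. unfold dtail.
  apply Hol_ext with (fun x => Cprod (fun j => / poch p (u x * q ^ j * p ^ N)) N * / dpoch q p (u x * q ^ N)).
  { intros x _. rewrite Cinv_mul, Cinv_Cprod. reflexivity. }
  apply (Hol_mul gen K (fun x => Cprod (fun j => / poch p (u x * q ^ j * p ^ N)) N)).
  - apply Hol_Cprod. intros j. apply dpoch_inv_Hol with c; auto using Cmod_0_lt_1.
    + intros x Hx. rewrite !Cmod_mult, (Cmod_pow p). assert (h := Cmod_pow_le_1 q j hq).
      eapply Rle_trans; [|exact hBp]. apply Rmult_le_compat_r; [apply pow_le, Cmod_ge_0|].
      assert (h2 := hB x Hx). assert (h3 := Cmod_ge_0 (u x)). assert (h4 := Cmod_ge_0 (q ^ j)). nra.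
    + apply (Hol_mul gen K (fun x => u x * q ^ j)); [|apply Hol_const]. apply (Hol_mul gen K u); [auto|apply Hol_const].
  - apply dpoch_inv_Hol with c; auto.
    + intros x Hx. rewrite Cmod_mult, Cmod_pow. eapply Rle_trans; [|exact hBq]. apply Rmult_le_compat_r; auto. apply pow_le, Cmod_ge_0.
    + apply (Hol_mul gen K u); [auto|apply Hol_const].
Qed.

Lemma iprod_app X Y z : iprod (X ++ Y) z = iprod X z * iprod Y z.
Proof. induction X; simpl; [ring|]. rewrite IHX. ring. Qed.

Definition poles (q p : C) (N : nat) (x : C -> C) : list (C -> C) :=
  flat_map (fun j => map (fun k l => x l * q ^ j * p ^ k) (seq 0 N)) (seq 0 N).

Lemma in_poles q p N x y : In y (poles q p N x) -> exists j k, y = fun l => x l * q ^ j * p ^ k.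
Proof.
  intros h. apply in_flat_map in h. destruct h as (j & _ & h). apply in_map_iff in h. destruct h as (k & E & _). exists j, k. auto.
Qed.

Lemma iprod_poles q p N x l z : iprod (at_par (poles q p N x) l) z = / Cprod (fun j => Cprod (fun k => 1 - (x l * z) * q ^ j * p ^ k) N) N.
Proof.
  unfold poles, at_par. rewrite Cinv_Cprod.
  generalize N at 1 3. intros M. induction N as [|N IH]; [reflexivity|].
  rewrite seq_S, flat_map_app, map_app, iprod_app, IH. simpl. f_equal. rewrite app_nil_r, map_map, Cinv_Cprod.
  clear IH. induction M as [|M IH]; [reflexivity|].
  rewrite seq_S, map_app, iprod_app, IH. simpl. f_equal. rewrite Cmult_1_r. f_equal. ring.
Qed.

(** The part of Gamma(t z) Gamma(t / z) left over when the poles with j, k < N are split off. It is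
    regular on a prescribed annulus once N is large. *)
Definition Hfac (q p : C) (N : nat) (t z : C) : C :=
  dpoch q p (p * q / (t * z)) * dpoch q p (p * q / (t / z)) * (/ dtail q p N (t * z) * / dtail q p N (t / z)).

Lemma GG_split q p N t z : (Cmod q < 1)%R -> (Cmod p < 1)%R ->
  GG q p t z = Hfac q p N t z * (/ Cprod (fun j => Cprod (fun k => 1 - (t * z) * q ^ j * p ^ k) N) N *
    / Cprod (fun j => Cprod (fun k => 1 - (t * / z) * q ^ j * p ^ k) N) N).
Proof.
  intros hq hp. unfold GG, Gam, Hfac. rewrite (dpoch_split q p (t * z) N), (dpoch_split q p (t / z) N) by auto.
  rewrite !Cinv_mul. unfold Cdiv. ring.
Qed.

Lemma Hfac_Hol {X} gen (K : X -> Prop) (q p : C) (u v : X -> C) N (B c : R) : (Cmod q < 1)%R -> (Cmod p < 1)%R ->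
  (0 <= c < 1)%R -> (forall x, K x -> (Cmod (u x * v x) <= B)%R) -> (forall x, K x -> (Cmod (u x / v x) <= B)%R) ->
  (B * Cmod q ^ N <= c)%R -> (B * Cmod p ^ N <= c)%R ->
  Hol gen K u -> Hol gen K (fun x => / u x) -> Hol gen K v -> Hol gen K (fun x => / v x) ->
  Hol gen K (fun x => Hfac q p N (u x) (v x)).
Proof.
  intros hq hp hc B1 B2 hBq hBp Hu Hui Hv Hvi.
  assert (H1 : Hol gen K (fun x => u x * v x)) by (apply (Hol_mul gen K); auto).
  assert (H2 : Hol gen K (fun x => u x / v x)) by (apply (Hol_mul gen K); auto).
  unfold Hfac. apply (Hol_mul gen K (fun x => dpoch q p (p * q / (u x * v x)) * dpoch q p (p * q / (u x / v x)))).
  - apply (Hol_mul gen K (fun x => dpoch q p (p * q / (u x * v x)))); apply dpoch_comp_Hol; auto.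
    + apply Hol_ext with (fun x => p * q * (/ u x * / v x)); [intros x _; unfold Cdiv; rewrite Cinv_mul; reflexivity|hol].
    + apply Hol_ext with (fun x => p * q * (/ u x * v x)); [intros x _; unfold Cdiv; rewrite Cinv_mul, Cinv_Cinv; reflexivity|hol].
  - apply (Hol_mul gen K (fun x => / dtail q p N (u x * v x))).
    + apply (dtail_inv_Hol gen K q p (fun x => u x * v x) N B c); auto.
    + apply (dtail_inv_Hol gen K q p (fun x => u x / v x) N B c); auto.
Qed.

(** * The path of parameters and the value for a general contour *)

Lemma Cmod_zpow (z : C) n : z <> 0 -> Cmod (zpow z n) = exp (IZR n * ln (Cmod z)).
Proof.
  intros hz. assert (hm := proj1 (Cmod_gt_0 z) hz).
  assert (E : forall r k, (0 < r)%R -> (r ^ Pos.to_nat k)%R = exp (IZR (Z.pos k) * ln r)).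
  { intros r k hr. rewrite <- Rpower_pow by auto. unfold Rpower. rewrite INR_IZR_INZ, positive_nat_Z. reflexivity. }
  destruct n as [|k|k]; simpl zpow.
  - rewrite Cmod_1, Rmult_0_l, exp_0. reflexivity.
  - rewrite Cmod_pow. apply E; auto.
  - rewrite Cmod_pow, Cmod_inv, E, ln_Rinv by (auto; apply Rinv_0_lt_compat; auto).
    f_equal. change (Z.neg k) with (- Z.pos k)%Z. rewrite opp_IZR. ring.
Qed.

Lemma exponent_exists (t : C) (sg : R) : t <> 0 -> (0 < sg < 1)%R ->
  exists k, forall l, Cmod l = sg -> (sg ^ 2 < Cmod (t * zpow l k) <= sg)%R.
Proof.
  intros ht hs. assert (hm := proj1 (Cmod_gt_0 t) ht).
  assert (hl : (ln sg < 0)%R) by (rewrite <- ln_1; apply ln_increasing; lra).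
  set (v := (ln (Cmod t) / ln sg)%R). destruct (archimed v) as [a1 a2].
  (* Here |t| = sg^v and v < up v <= v + 1, so the resulting exponent v + 2 - up v lies in [1,
     2). *)
  exists (2 - up v)%Z. intros l hsl. assert (hl0 : l <> 0) by (apply Cmod_nz; lra).
  rewrite Cmod_mult, Cmod_zpow, hsl, minus_IZR by auto.
  replace (Cmod t) with (exp (v * ln sg)) by (unfold v; replace (ln (Cmod t) / ln sg * ln sg)%R with (ln (Cmod t)) by (field; lra); apply exp_ln; auto).
  rewrite <- exp_plus.
  replace (sg ^ 2)%R with (exp (2 * ln sg)) by (replace (2 * ln sg)%R with (ln sg + ln sg)%R by ring; rewrite exp_plus, exp_ln by lra; ring).
  split.
  - apply exp_increasing. nra.
  - rewrite <- (exp_ln sg) at 3 by lra. apply Rnot_lt_le. intros h. apply exp_lt_inv in h. nra.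
Qed.

Lemma zpow_1 n : zpow 1 n = 1.
Proof. destruct n; simpl; [reflexivity|apply Cpow_1_l|]. replace (/ RtoC 1) with (RtoC 1) by field. apply Cpow_1_l. Qed.

Lemma cross_Hol s1 s2 (X Y : list (C -> C)) : (forall x, In x X -> Hol1 s1 s2 x) -> (forall y, In y Y -> Hol1 s1 s2 y) ->
  Hol1 s1 s2 (fun l => cross (at_par X l) (at_par Y l)).
Proof.
  intros HX HY. induction X as [|x X IH]; simpl.
  - apply Hol_const.
  - apply (Hol_mul gen1 (ann s1 s2) (fun l => cross1 (x l) (at_par Y l))); [|apply IH; intros; apply HX; right; auto].
    apply cross1_Hol; auto. apply HX. left; auto.
Qed.

Lemma cross1_nz (x : C) Y : (forall y, In y Y -> 1 - x * y <> 0) -> cross1 x Y <> 0.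
Proof.
  induction Y as [|y Y IH]; intros H; simpl; [apply C1_nz|]. apply Cmult_neq_0; [apply H; left; auto|apply IH; intros; apply H; right; auto].
Qed.

Lemma cross_nz (X Y : list C) : (forall x y, In x X -> In y Y -> 1 - x * y <> 0) -> cross X Y <> 0.
Proof.
  induction X as [|x X IH]; intros H; simpl; [apply C1_nz|]. apply Cmult_neq_0.
  - apply cross1_nz. intros; apply H; auto. left; auto.
  - apply IH. intros; apply H; auto. right; auto.
Qed.

Lemma polefree_mean_inv (x : C) : (Cmod x < 1)%R ->
  polefree (fun z => ann (Cmod 1) (Cmod 1) (/ z)) (fun f => mean (fun z => f (/ z)) 1) x.
Proof.
  intros hx. assert (hP : polefree (ann (Cmod 1) (Cmod 1)) (fun f => mean f 1) x).
  { apply polefree_mean; [apply C1_nz|]. rewrite Cmult_1_r. auto. }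
  destruct hP as [(d & Hd & HH) HP].
  assert (i1 : / RtoC 1 = 1) by field.
  split.
  - exists d. split; auto. intros z Hz. apply HH. rewrite ann_point_iff in *. rewrite Cmod_1 in *.
    rewrite <- (Cinv_Cinv z), Cmod_inv, Hz; [apply Rinv_1|]. apply Cmod_nz. lra.
  - intros k. cbv beta. etransitivity; [|exact (HP k)].
    rewrite (mean_inv (fun z => (/ (1 - x * z)) ^ k) 1); [rewrite i1; reflexivity|apply C1_nz|].
    rewrite i1. apply circ_ok_point. apply Hol_pow. apply Hol_inv with d; auto. assert (h := Hol1_id (Cmod 1) (Cmod 1)). hol.
Qed.

Lemma Hol_pairs6 {X} gen (K : X -> Prop) (f : C -> C) (a b c d e g : X -> C) :
  (forall u v, Hol gen K u -> Hol gen K (fun x => / u x) -> Hol gen K v -> Hol gen K (fun x => / v x) -> Hol gen K (fun x => f (u x * v x))) ->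
  Hol gen K a -> Hol gen K (fun x => / a x) -> Hol gen K b -> Hol gen K (fun x => / b x) ->
  Hol gen K c -> Hol gen K (fun x => / c x) -> Hol gen K d -> Hol gen K (fun x => / d x) ->
  Hol gen K e -> Hol gen K (fun x => / e x) -> Hol gen K g -> Hol gen K (fun x => / g x) ->
  Hol gen K (fun x => pairs6 f (a x) (b x) (c x) (d x) (e x) (g x)).
Proof.
  intros H. intros. unfold pairs6.
  repeat match goal with |- Hol _ _ (fun x => f _) => apply H; assumption | |- Hol _ _ (fun x => @?u x * @?v x) => apply (Hol_mul gen K u v) end.
Qed.

Lemma Hol_prod6 {X} gen (K : X -> Prop) (f : X -> C -> C) (a b c d e g : X -> C) :
  Hol gen K (fun x => f x (a x)) -> Hol gen K (fun x => f x (b x)) -> Hol gen K (fun x => f x (c x)) ->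
  Hol gen K (fun x => f x (d x)) -> Hol gen K (fun x => f x (e x)) -> Hol gen K (fun x => f x (g x)) ->
  Hol gen K (fun x => prod6 (f x) (a x) (b x) (c x) (d x) (e x) (g x)).
Proof.
  intros. unfold prod6.
  repeat match goal with |- Hol _ _ (fun x => f x _) => assumption | |- Hol _ _ (fun x => @?u x * @?v x) => apply (Hol_mul gen K u v) end.
Qed.

Lemma pairs6_iGam q p a b c d e g :
  pairs6 (iGam q p) a b c d e g = pairs6 (dpoch q p) a b c d e g * / pairs6 (fun x => dpoch q p (p * q / x)) a b c d e g.
Proof. unfold pairs6, iGam. rewrite !Cinv_mul. ring. Qed.

Lemma Ker_split q p N (a b c d e g : C -> C) l z : (Cmod q < 1)%R -> (Cmod p < 1)%R ->
  let X := flat_map (poles q p N) [a; b; c; d; e; g] in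
  Ker q p (a l) (b l) (c l) (d l) (e l) (g l) z =
  Vfac q p z * prod6 (fun t => Hfac q p N t z) (a l) (b l) (c l) (d l) (e l) (g l) *
  (iprod (at_par X l) z * iprod (at_par X l) (/ z)).
Proof.
  intros hq hp X. unfold X, at_par. simpl flat_map. rewrite app_nil_r, !map_app, !iprod_app.
  fold (at_par (poles q p N a) l) (at_par (poles q p N b) l) (at_par (poles q p N c) l) (at_par (poles q p N d) l) (at_par (poles q p N e) l) (at_par (poles q p N g) l).
  rewrite !iprod_poles. unfold Ker, prod6. rewrite !(GG_split q p N) by auto. ring.
Qed.

Lemma monomial_Hol (t : C) k s1 s2 : (0 < s1)%R -> t <> 0 ->
  Hol1 s1 s2 (fun l => t * zpow l k) /\ Hol1 s1 s2 (fun l => / (t * zpow l k)).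
Proof.
  intros hs ht. assert (h := fun n => Hol1_zpow s1 s2 n hs). split.
  - apply (Hol_mul gen1 (ann s1 s2)); [apply Hol_const|auto].
  - apply Hol_ext with (fun l => / t * zpow l (- k)).
    + intros l [Hl _]. rewrite Cinv_mul, zpow_opp by (apply Cmod_nz; lra). reflexivity.
    + apply (Hol_mul gen1 (ann s1 s2)); [apply Hol_const|auto].
Qed.

(** Five moduli above sg^2 give |A| > sg^10. The choice sg^20 = |p| makes this the condition |p| <
    |A|^2. *)
Lemma root20 (p : C) : (0 < Cmod p < 1)%R -> exists sg, (0 < sg < 1)%R /\ (sg ^ 20 = Cmod p)%R.
Proof.
  intros hp. exists (exp (ln (Cmod p) / 20)).
  assert (hl : (ln (Cmod p) < 0)%R) by (rewrite <- ln_1; apply ln_increasing; lra). split.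
  - split; [apply exp_pos|]. rewrite <- exp_0. apply exp_increasing. lra.
  - rewrite <- Rpower_pow by apply exp_pos. unfold Rpower. rewrite ln_exp.
    replace (INR 20 * (ln (Cmod p) / 20))%R with (ln (Cmod p)) by (simpl; field). apply exp_ln. lra.
Qed.

Lemma product_lower (x1 x2 x3 x4 x5 : C) (m : R) : (0 < m)%R -> (m < Cmod x1)%R -> (m < Cmod x2)%R -> (m < Cmod x3)%R -> (m < Cmod x4)%R -> (m < Cmod x5)%R ->
  (m ^ 5 < Cmod (x1 * x2 * x3 * x4 * x5))%R.
Proof.
  intros hm h1 h2 h3 h4 h5. rewrite !Cmod_mult. replace (m ^ 5)%R with (m * m * m * m * m)%R by ring.
  repeat first [apply Rmult_le_0_lt_compat | apply Rmult_le_pos | lra]; auto using Cmod_ge_0.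
Qed.

Lemma Cmod_pole_lt (q p x : C) j k : (Cmod q < 1)%R -> (Cmod p < 1)%R -> (Cmod x < 1)%R -> (Cmod (x * q ^ j * p ^ k) < 1)%R.
Proof.
  intros hq hp hx. rewrite !Cmod_mult. assert (h1 := Cmod_pow_le_1 q j hq). assert (h2 := Cmod_pow_le_1 p k hp).
  assert (g1 := Cmod_ge_0 x). assert (g2 := Cmod_ge_0 (q ^ j)). assert (g3 := Cmod_ge_0 (p ^ k)).
  assert (Cmod x * Cmod (q ^ j) <= Cmod x)%R by nra. assert (0 <= Cmod x * Cmod (q ^ j))%R by nra. nra.
Qed.

Lemma Cmod_pole_le (q p x : C) j k T : (Cmod q < 1)%R -> (Cmod p < 1)%R -> (Cmod x <= T)%R -> (Cmod (x * q ^ j * p ^ k) <= T)%R.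
Proof.
  intros hq hp hx. rewrite !Cmod_mult. assert (h1 := Cmod_pow_le_1 q j hq). assert (h2 := Cmod_pow_le_1 p k hp).
  assert (g1 := Cmod_ge_0 x). assert (g2 := Cmod_ge_0 (q ^ j)). assert (g3 := Cmod_ge_0 (p ^ k)).
  assert (Cmod x * Cmod (q ^ j) <= Cmod x)%R by nra. assert (0 <= Cmod x * Cmod (q ^ j))%R by nra. nra.
Qed.

Lemma value_nz (q p : C) : (Cmod q < 1)%R -> (Cmod p < 1)%R -> RtoC 2 / (poch p p * poch q q) <> 0.
Proof.
  intros hq hp. apply Cdiv_nz; [apply Cmod_nz; rewrite Cmod_R, Rabs_pos_eq; lra|]. apply Cmult_neq_0; apply poch_nz; auto.
Qed.

(** The denominators are cleared because they may vanish elsewhere along the path, whereas both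
    sides of the cleared identity continue holomorphically. *)
Lemma value_small (q p t1 t2 t3 t4 t5 t6 : C) : (0 < Cmod q < 1)%R -> (0 < Cmod p < 1)%R ->
  (0 < Cmod t1 < 1)%R -> (0 < Cmod t2 < 1)%R -> (0 < Cmod t3 < 1)%R -> (0 < Cmod t4 < 1)%R -> (0 < Cmod t5 < 1)%R ->
  (Cmod p < Cmod (t1 * t2 * t3 * t4 * t5) ^ 2)%R -> t6 = p * q / (t1 * t2 * t3 * t4 * t5) ->
  mean (Ker q p t1 t2 t3 t4 t5 t6) 1 * pairs6 (dpoch q p) t1 t2 t3 t4 t5 t6 =
  RtoC 2 / (poch p p * poch q q) * pairs6 (fun x => dpoch q p (p * q / x)) t1 t2 t3 t4 t5 t6.
Proof.
  intros hq hp h1 h2 h3 h4 h5 hA E. assert (V := F5_value q p t1 t2 t3 t4 t5 hq hp h1 h2 h3 h4 h5 hA).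
  unfold F5, F6 in V. rewrite <- E, pairs6_iGam in V.
  assert (nv := value_nz q p (proj2 hq) (proj2 hp)).
  set (M := mean _ _) in *. set (P := pairs6 (dpoch q p) t1 t2 t3 t4 t5 t6) in *. set (D := pairs6 (fun x => dpoch q p (p * q / x)) t1 t2 t3 t4 t5 t6) in *.
  (* As the inverse of 0 is 0, a vanishing [D] would make the nonzero constant in [V] equal to 0. *)
  assert (nD : D <> 0). { intros h. rewrite h, Cinv_0 in V. apply nv. rewrite <- V. ring. }
  rewrite <- V. field. auto.
Qed.

(* The path t_m(l) = t_m l^(k_m), t_6(l) = p q / A(l) joins l = 1 to the circle |l| = |p|^(1/20), on
   which |l|^2 < |t_m(l)| <= |l| for m <= 5, so that |A(l)|^2 > |p| as [value_small] requires. *)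
Lemma contour_value (q p t1 t2 t3 t4 t5 : C) K L : (0 < Cmod q < 1)%R -> (0 < Cmod p < 1)%R ->
  t1 <> 0 -> t2 <> 0 -> t3 <> 0 -> t4 <> 0 -> t5 <> 0 -> adm K L ->
  let t6 := p * q / (t1 * t2 * t3 * t4 * t5) in
  (forall t j k, In t [t1; t2; t3; t4; t5; t6] -> polefree K L (t * q ^ j * p ^ k) /\
    polefree (fun z => K (/ z)) (fun f => L (fun z => f (/ z))) (t * q ^ j * p ^ k)) ->
  (forall t j k t' j' k', In t [t1; t2; t3; t4; t5; t6] -> In t' [t1; t2; t3; t4; t5; t6] ->
    1 - (t * q ^ j * p ^ k) * (t' * q ^ j' * p ^ k') <> 0) ->
  pairs6 (fun x => dpoch q p (p * q / x)) t1 t2 t3 t4 t5 t6 <> 0 ->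
  Hol gen1 K (Ker q p t1 t2 t3 t4 t5 t6) /\
  L (Ker q p t1 t2 t3 t4 t5 t6) * pairs6 (iGam q p) t1 t2 t3 t4 t5 t6 = RtoC 2 / (poch p p * poch q q).
Proof.
  intros hq hp n1 n2 n3 n4 n5 HA t6 HP HX HD.
  assert (nq : q <> 0) by (apply Cmod_nz; lra). assert (np : p <> 0) by (apply Cmod_nz; lra).
  assert (n6 : t6 <> 0) by (unfold t6; nz).
  destruct (root20 p hp) as (sg & hsg & Esg).
  destruct (exponent_exists t1 sg n1 hsg) as [k1 B1]. destruct (exponent_exists t2 sg n2 hsg) as [k2 B2].
  destruct (exponent_exists t3 sg n3 hsg) as [k3 B3]. destruct (exponent_exists t4 sg n4 hsg) as [k4 B4].
  destruct (exponent_exists t5 sg n5 hsg) as [k5 B5].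
  (* This exponent keeps the product of the six moving parameters equal to p q. *)
  set (k6 := (- (k1 + k2 + k3 + k4 + k5))%Z).
  set (a1 := fun l => t1 * zpow l k1). set (a2 := fun l => t2 * zpow l k2). set (a3 := fun l => t3 * zpow l k3).
  set (a4 := fun l => t4 * zpow l k4). set (a5 := fun l => t5 * zpow l k5). set (a6 := fun l => t6 * zpow l k6).
  (* The annulus contains the circle |l| = sg, where the value is known, and has l = 1 in its
     interior. *)
  set (s1 := (sg / 2)%R). set (s2 := 2%R). assert (hs1 : (0 < s1)%R) by (unfold s1; lra).
  destruct (monomial_Hol t1 k1 s1 s2 hs1 n1) as [H1 I1]. destruct (monomial_Hol t2 k2 s1 s2 hs1 n2) as [H2 I2].
  destruct (monomial_Hol t3 k3 s1 s2 hs1 n3) as [H3 I3]. destruct (monomial_Hol t4 k4 s1 s2 hs1 n4) as [H4 I4].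
  destruct (monomial_Hol t5 k5 s1 s2 hs1 n5) as [H5 I5]. destruct (monomial_Hol t6 k6 s1 s2 hs1 n6) as [H6 I6].
  fold a1 in H1. fold a2 in H2. fold a3 in H3. fold a4 in H4. fold a5 in H5. fold a6 in H6.
  destruct (Hol_bounded _ _ _ H1) as (T1 & P1 & Q1). destruct (Hol_bounded _ _ _ H2) as (T2 & P2 & Q2).
  destruct (Hol_bounded _ _ _ H3) as (T3 & P3 & Q3). destruct (Hol_bounded _ _ _ H4) as (T4 & P4 & Q4).
  destruct (Hol_bounded _ _ _ H5) as (T5 & P5 & Q5). destruct (Hol_bounded _ _ _ H6) as (T6 & P6 & Q6).
  set (T := (T1 + T2 + T3 + T4 + T5 + T6)%R). assert (hT : (0 <= T)%R) by (unfold T; lra).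
  assert (nzl : forall l, ann s1 s2 l -> l <> 0) by (intros l [h _]; apply Cmod_nz; lra).
  assert (Ha : forall a, In a [a1; a2; a3; a4; a5; a6] -> Hol1 s1 s2 a /\ Hol1 s1 s2 (fun l => / a l) /\
    forall l, ann s1 s2 l -> a l <> 0 /\ (Cmod (a l) <= T)%R).
  { intros a Hin. simpl in Hin.
    repeat (destruct Hin as [<-|Hin]; [split; [assumption|split; [assumption|intros l Hl; split; [apply Cmult_neq_0; [assumption|apply zpow_nz; auto]|]]]|]); try contradiction.
    - specialize (Q1 l Hl). unfold T; lra.
    - specialize (Q2 l Hl). unfold T; lra.
    - specialize (Q3 l Hl). unfold T; lra.
    - specialize (Q4 l Hl). unfold T; lra.
    - specialize (Q5 l Hl). unfold T; lra.
    - specialize (Q6 l Hl). unfold T; lra. }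
  destruct (adm_ann _ _ HA) as (c1 & c2 & hc1 & HK).
  assert (hi : (0 < / (2 * (T + 1)))%R) by (apply Rinv_0_lt_compat; lra).
  (* The annulus contains the contour, and its bounding circles satisfy T rho1 < 1 and T < rho2, as
     the continuation requires of the moving poles. *)
  set (rho1 := Rmin c1 (/ (2 * (T + 1)))). set (rho2 := Rmax c2 (T + 1)).
  assert (hrho1 : (0 < rho1)%R) by (apply Rmin_glb_lt; auto).
  assert (e1 := Rmin_l c1 (/ (2 * (T + 1)))). assert (e2 := Rmin_r c1 (/ (2 * (T + 1)))). fold rho1 in e1, e2.
  assert (e3 := Rmax_l c2 (T + 1)). assert (e4 := Rmax_r c2 (T + 1)). fold rho2 in e3, e4.
  assert (e5 : ((T + 1) * / (2 * (T + 1)) = / 2)%R) by (field; lra).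
  assert (hT1 : (T * rho1 < 1)%R) by nra.
  assert (e6 : (/ (2 * (T + 1)) <= / 2)%R) by (apply Rinv_le_contravar; lra).
  set (r1 := (rho1 / 2)%R). set (r2 := (2 * rho2)%R).
  assert (hr1 : (0 < r1)%R) by (unfold r1; lra).
  assert (hir1 : (0 < / r1)%R) by (apply Rinv_0_lt_compat; auto).
  set (B := (T * r2 + T * / r1)%R).
  assert (hB1 : (0 <= T * r2)%R) by (apply Rmult_le_pos; unfold r2; lra).
  assert (hB2 : (0 <= T * / r1)%R) by (apply Rmult_le_pos; lra).
  destruct (common_bound q p (proj2 hq) (proj2 hp)) as (r & hr & hqr & hpr).
  (* [B] bounds all arguments t z and t / z over the two annuli. From index N on the terms in the
     remaining factors have modulus at most 1/2, so [Hfac] has no poles there. *)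
  destruct (pow_small r B (1 / 2) hr ltac:(unfold B; lra) ltac:(lra)) as [N HN].
  assert (pw : forall x, (Cmod x <= r)%R -> (B * Cmod x ^ N <= 1 / 2)%R).
  { intros x hx. assert (Cmod x ^ N <= r ^ N)%R by (apply pow_incr; split; auto using Cmod_ge_0).
    assert (B * Cmod x ^ N <= B * r ^ N)%R by (apply Rmult_le_compat_l; auto; unfold B; lra). lra. }
  set (H := fun u => Vfac q p (fst u) * prod6 (fun t => Hfac q p N t (fst u)) (a1 (snd u)) (a2 (snd u)) (a3 (snd u)) (a4 (snd u)) (a5 (snd u)) (a6 (snd u))).
  assert (HH : Hol2 r1 r2 s1 s2 H).
  { assert (g1 := Hol1_fst r1 r2 s1 s2 _ (Hol1_id r1 r2)). assert (g2 := Hol1_fst r1 r2 s1 s2 _ (Hol1_inv r1 r2 hr1)).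
    apply (Hol_mul gen2 (ann2 r1 r2 s1 s2) (fun u => Vfac q p (fst u))).
    - apply Vfac_Hol; try tauto. intros [z l] [[hz _] _]. simpl in *. apply Cmod_nz. lra.
    - assert (HF : forall a, In a [a1; a2; a3; a4; a5; a6] -> Hol2 r1 r2 s1 s2 (fun u => Hfac q p N (a (snd u)) (fst u))).
      { intros a Hin. destruct (Ha a Hin) as (x1 & x2 & x3).
        apply (Hfac_Hol gen2 (ann2 r1 r2 s1 s2) q p (fun u => a (snd u)) (fun u => fst u) N B (1 / 2)); try tauto; try lra; auto.
        - intros [z l] [[z1 z2] hl]. simpl in *. rewrite Cmod_mult. destruct (x3 l hl) as [_ x4].
          assert (Cmod (a l) * Cmod z <= T * r2)%R by (apply Rmult_le_compat; auto using Cmod_ge_0). unfold B. lra.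
        - intros [z l] [[z1 z2] hl]. simpl in *. destruct (x3 l hl) as [_ x4].
          assert (nz : z <> 0) by (apply Cmod_nz; lra). unfold Cdiv. rewrite Cmod_mult, Cmod_inv by auto.
          assert (Cmod (a l) * / Cmod z <= T * / r1)%R.
          { apply Rmult_le_compat; auto using Cmod_ge_0. left; apply Rinv_0_lt_compat; lra. apply Rinv_le_contravar; lra. } unfold B. lra.
        - apply (Hol1_snd r1 r2 s1 s2 a); auto.
        - apply (Hol1_snd r1 r2 s1 s2 (fun l => / a l)); auto. }
      apply (Hol_prod6 gen2 (ann2 r1 r2 s1 s2) (fun u t => Hfac q p N t (fst u)) (fun u => a1 (snd u)) (fun u => a2 (snd u)) (fun u => a3 (snd u)) (fun u => a4 (snd u)) (fun u => a5 (snd u)) (fun u => a6 (snd u)));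
        apply HF; simpl; tauto. }
  set (X := flat_map (poles q p N) [a1; a2; a3; a4; a5; a6]).
  assert (inX : forall x, In x X -> exists a j k, In a [a1; a2; a3; a4; a5; a6] /\ x = fun l => a l * q ^ j * p ^ k).
  { intros x Hx. apply in_flat_map in Hx. destruct Hx as (a & Hin & Hx). apply in_poles in Hx. destruct Hx as (j & k & ->). exists a, j, k. auto. }
  assert (pX : forall x, In x X -> par s1 s2 T x).
  { intros x Hx. destruct (inX x Hx) as (a & j & k & Hin & ->). destruct (Ha a Hin) as (x1 & x2 & x3). split.
    - apply (Hol_mul gen1 (ann s1 s2) (fun l => a l * q ^ j)); [|apply Hol_const]. apply (Hol_mul gen1 (ann s1 s2) a); [auto|apply Hol_const].
    - intros l Hl. destruct (x3 l Hl) as [y1 y2]. split.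
      + repeat apply Cmult_neq_0; auto; apply Cpow_nz; auto.
      + apply Cmod_pole_le; tauto. }
  destruct (continuation_exists r1 r2 rho1 rho2 s1 s2 T H hr1 ltac:(unfold r1; lra) ltac:(lra) ltac:(unfold r2; lra) hT1 ltac:(lra) HH _ X X (le_n _) pX pX) as (Phi & HPhi & EPhi).
  assert (KS : forall l z, Ker q p (a1 l) (a2 l) (a3 l) (a4 l) (a5 l) (a6 l) z = H (z, l) * (iprod (at_par X l) z * iprod (at_par X l) (/ z))).
  { intros l z. exact (Ker_split q p N a1 a2 a3 a4 a5 a6 l z (proj2 hq) (proj2 hp)). }
  set (kappa := RtoC 2 / (poch p p * poch q q)).
  set (num := fun l => pairs6 (dpoch q p) (a1 l) (a2 l) (a3 l) (a4 l) (a5 l) (a6 l)).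
  set (den := fun l => pairs6 (fun x => dpoch q p (p * q / x)) (a1 l) (a2 l) (a3 l) (a4 l) (a5 l) (a6 l)).
  set (cr := fun l => cross (at_par X l) (at_par X l)).
  assert (Hnum : Hol1 s1 s2 num).
  { apply (Hol_pairs6 gen1 (ann s1 s2) (dpoch q p) a1 a2 a3 a4 a5 a6); try assumption. intros u v hu _ hv _. apply dpoch_comp_Hol; try tauto. apply (Hol_mul gen1 (ann s1 s2)); assumption. }
  assert (Hden : Hol1 s1 s2 den).
  { apply (Hol_pairs6 gen1 (ann s1 s2) (fun x => dpoch q p (p * q / x)) a1 a2 a3 a4 a5 a6); try assumption. intros u v _ hu _ hv. apply dpoch_comp_Hol; try tauto.
    apply Hol_ext with (fun x => p * q * (/ u x * / v x)); [intros x _; unfold Cdiv; rewrite Cinv_mul; reflexivity|hol]. }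
  assert (Hcr : Hol1 s1 s2 cr) by (apply cross_Hol; intros x Hx; apply (pX x Hx)).
  (* [den] and [cr] may have zeros along the path, so the identity is continued in multiplied form
     and divided only at l = 1. *)
  assert (HG : Hol1 s1 s2 (fun l => Phi l * num l - kappa * (cr l * den l))) by hol.
  assert (Asg : ann s1 s2 (RtoC sg)) by (unfold ann, s1, s2; rewrite Cmod_R, Rabs_pos_eq; lra).
  assert (G1 : Phi 1 * num 1 - kappa * (cr 1 * den 1) = 0).
  { apply (identity_annulus s1 s2 (fun l => Phi l * num l - kappa * (cr l * den l)) (RtoC sg) 1 hs1 HG Asg).
    - rewrite Cmod_1. unfold s1, s2; lra.
    - intros l El. rewrite Cmod_R, Rabs_pos_eq in El by lra.
      assert (Al : ann s1 s2 l) by (unfold ann, s1, s2; lra). assert (nl := nzl l Al).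
      specialize (B1 l El). specialize (B2 l El). specialize (B3 l El). specialize (B4 l El). specialize (B5 l El).
      fold (a1 l) in B1. fold (a2 l) in B2. fold (a3 l) in B3. fold (a4 l) in B4. fold (a5 l) in B5.
      assert (hsg2 : (0 < sg ^ 2)%R) by (apply pow_lt; lra).
      assert (PL := product_lower (a1 l) (a2 l) (a3 l) (a4 l) (a5 l) (sg ^ 2) hsg2 (proj1 B1) (proj1 B2) (proj1 B3) (proj1 B4) (proj1 B5)).
      assert (hs10 : (0 < (sg ^ 2) ^ 5)%R) by (apply pow_lt; auto).
      assert (E6 : a6 l = p * q / (a1 l * a2 l * a3 l * a4 l * a5 l)).
      { unfold a1, a2, a3, a4, a5, a6, t6, k6. rewrite zpow_opp, !zpow_add by auto. assert (zz := fun n => zpow_nz l n nl). field. repeat split; auto. }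
      assert (Ep : (Cmod p = (sg ^ 2) ^ 5 * (sg ^ 2) ^ 5)%R) by (rewrite <- Esg; ring).
      assert (hA : (Cmod p < Cmod (a1 l * a2 l * a3 l * a4 l * a5 l) ^ 2)%R) by (rewrite Ep; simpl (_ ^ 2)%R at 3; nra).
      assert (h6 : (Cmod (a6 l) < 1)%R).
      { rewrite E6, Cmod_div by (apply Cmod_nz; lra). apply Rlt_div_l; [lra|]. rewrite Cmod_mult.
        assert ((sg ^ 2) ^ 5 < 1)%R. { assert (hh := pow_lt_1_compat (sg ^ 2) 5 ltac:(split; [lra|]; assert (hx := pow_lt_1_compat sg 2 ltac:(lra) ltac:(lia)); lra) ltac:(lia)). lra. }
        assert (Cmod p * Cmod q < Cmod p)%R by nra. assert (Cmod p < (sg ^ 2) ^ 5)%R by (rewrite Ep; nra). lra. }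
      assert (b1 : (0 < Cmod (a1 l) < 1)%R) by lra. assert (b2 : (0 < Cmod (a2 l) < 1)%R) by lra. assert (b3 : (0 < Cmod (a3 l) < 1)%R) by lra.
      assert (b4 : (0 < Cmod (a4 l) < 1)%R) by lra. assert (b5 : (0 < Cmod (a5 l) < 1)%R) by lra.
      assert (VS := value_small q p (a1 l) (a2 l) (a3 l) (a4 l) (a5 l) (a6 l) hq hp b1 b2 b3 b4 b5 hA E6).
      fold (num l) (den l) kappa in VS.
      assert (small : forall x, In x X -> (Cmod (x l) < 1)%R).
      { intros x Hx. destruct (inX x Hx) as (a & j & k & Hin & ->). apply Cmod_pole_lt; try tauto.
        simpl in Hin. repeat (destruct Hin as [<-|Hin]; [lra|]). contradiction. }
      (* On |l| = sg all six parameters have modulus below 1, so the unit circle is an admissible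
         contour and computes the same [Phi] as the given one. *)
      assert (EP := EPhi l Al _ _ (adm_mean 1 C1_nz)).
      fold (cr l) in EP. rewrite <- EP; clear EP.
      + rewrite (adm_ext _ _ (adm_mean 1 C1_nz) _ (Ker q p (a1 l) (a2 l) (a3 l) (a4 l) (a5 l) (a6 l))) by (intros z _; symmetry; apply KS).
        replace (kappa * (cr l * den l)) with (cr l * (kappa * den l)) by ring. rewrite <- VS. ring.
      + rewrite Cmod_1. intros z [z1 z2]. split; lra.
      + intros x Hx. apply polefree_mean; [apply C1_nz|]. rewrite Cmult_1_r. auto.
      + intros x Hx. apply polefree_mean_inv; auto. }
  assert (A1 : ann s1 s2 1) by (unfold ann, s1, s2; rewrite Cmod_1; lra).
  assert (v1 : a1 1 = t1) by (unfold a1; rewrite zpow_1; ring). assert (v2 : a2 1 = t2) by (unfold a2; rewrite zpow_1; ring).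
  assert (v3 : a3 1 = t3) by (unfold a3; rewrite zpow_1; ring). assert (v4 : a4 1 = t4) by (unfold a4; rewrite zpow_1; ring).
  assert (v5 : a5 1 = t5) by (unfold a5; rewrite zpow_1; ring). assert (v6 : a6 1 = t6) by (unfold a6; rewrite zpow_1; ring).
  assert (X1 : forall x, In x X -> exists t j k, In t [t1; t2; t3; t4; t5; t6] /\ x 1 = t * q ^ j * p ^ k).
  { intros x Hx. destruct (inX x Hx) as (a & j & k & Hin & ->). exists (a 1), j, k. split; auto.
    replace [t1; t2; t3; t4; t5; t6] with (map (fun a : C -> C => a 1) [a1; a2; a3; a4; a5; a6]) by (simpl; congruence). 
    apply (in_map (fun a : C -> C => a 1)). auto. }
  assert (ncr : cr 1 <> 0).
  { apply cross_nz. intros x y Hx Hy. apply in_at_par in Hx. apply in_at_par in Hy. destruct Hx as (f & Hf & ->). destruct Hy as (g & Hg & ->).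
    destruct (X1 f Hf) as (t & j & k & Ht & ->). destruct (X1 g Hg) as (t' & j' & k' & Ht' & ->). apply HX; auto. }
  assert (HKr : forall z, K z -> ann rho1 rho2 z) by (intros z Hz; destruct (HK z Hz); split; lra).
  assert (PX : forall x, In x X -> polefree K L (x 1)) by (intros x Hx; destruct (X1 x Hx) as (t & j & k & Ht & ->); apply HP; auto).
  assert (PY : forall x, In x X -> polefree (fun z => K (/ z)) (fun f => L (fun z => f (/ z))) (x 1)) by (intros x Hx; destruct (X1 x Hx) as (t & j & k & Ht & ->); apply HP; auto).
  assert (HI := adm_Hol_integrand r1 r2 rho1 rho2 s1 s2 H ltac:(unfold r1; lra) ltac:(unfold r2; lra) HH K L X X 1 A1 HA HKr PX PY).
  split.
  { apply Hol_ext with (fun z => H (z, RtoC 1) * (iprod (at_par X 1) z * iprod (at_par X 1) (/ z))); [|exact HI].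
    intros z _. rewrite <- KS, v1, v2, v3, v4, v5, v6. reflexivity. }
  assert (EP := EPhi 1 A1 K L HA HKr PX PY).
  rewrite (adm_ext _ _ HA _ (Ker q p (a1 1) (a2 1) (a3 1) (a4 1) (a5 1) (a6 1))) in EP by (intros z _; symmetry; apply KS).
  unfold num, den in G1. fold (cr 1) in EP. rewrite <- EP in G1; clear EP.
  rewrite v1, v2, v3, v4, v5, v6 in G1.
  rewrite pairs6_iGam. set (P := pairs6 (dpoch q p) t1 t2 t3 t4 t5 t6) in *. set (D := pairs6 (fun x => dpoch q p (p * q / x)) t1 t2 t3 t4 t5 t6) in *.
  fold kappa. set (M := L (Ker q p t1 t2 t3 t4 t5 t6)) in *.
  assert (Z : M * P - kappa * D = 0). { apply (Cmult_cancel (cr 1)); auto. rewrite <- G1. ring. }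
  apply Ceq_minus. change (M * (P * / D) - kappa = 0). replace (M * (P * / D) - kappa) with ((M * P - kappa * D) * / D) by (field; auto). rewrite Z. ring.
Qed.

(** * The integrand near the contour *)

Definition punct (P : C -> Prop) (z : C) : Prop :=
  exists d, (0 < d)%R /\ forall w, (0 < Cmod (w - z) < d)%R -> P w.

Lemma punct_and P Q z : punct P z -> punct Q z -> punct (fun w => P w /\ Q w) z.
Proof.
  intros (d & Hd & HP) (d' & Hd' & HQ). exists (Rmin d d'). split; [apply Rmin_glb_lt; auto|].
  intros w [h1 h2]. assert (l := Rmin_l d d'). assert (r := Rmin_r d d'). split; [apply HP|apply HQ]; lra.
Qed.

Lemma punct_imp (P Q : C -> Prop) z : (forall w, P w -> Q w) -> punct P z -> punct Q z.
Proof. intros H (d & Hd & HP). exists d. split; auto. Qed.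

(** [C_lim] takes the limits of the real and imaginary parts along the horizontal line, and a
    punctured disc contains the punctured segment of that line. *)
Lemma C_lim_eq f z l : (forall e, (0 < e)%R -> punct (fun w => (Cmod (f w - l) < e)%R) z) -> C_lim f z = l.
Proof.
  intros H.
  assert (E : forall e, (0 < e)%R -> Rbar_locally' (fst z) (fun x => (Cmod (f (x, snd z) - l) < e)%R)).
  { intros e He. destruct (H e He) as (d & Hd & HH). exists (mkposreal d Hd). intros x Hx Hne. apply (HH (x, snd z)).
    assert (Q : ((x, snd z) - z)%C = RtoC (x - fst z)) by (apply injective_projections; simpl; ring).
    rewrite Q, Cmod_R. split; [apply Rabs_pos_lt; lra|exact Hx]. }
  unfold C_lim. apply injective_projections; simpl.
  - rewrite (is_lim_unique _ _ (Finite (fst l))); [reflexivity|]. apply is_lim_spec. intros e.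
    apply (filter_imp (fun x => (Cmod (f (x, snd z) - l) < e)%R)); [|apply E, cond_pos].
    intros x Hx. eapply Rle_lt_trans; [|exact Hx]. apply (re_le_Cmod (f (x, snd z) - l)).
  - rewrite (is_lim_unique _ _ (Finite (snd l))); [reflexivity|]. apply is_lim_spec. intros e.
    apply (filter_imp (fun x => (Cmod (f (x, snd z) - l) < e)%R)); [|apply E, cond_pos].
    intros x Hx. eapply Rle_lt_trans; [|exact Hx]. eapply Rle_trans; [|apply Rmax_Cmod]. apply (Rmax_r (Rabs (fst (f (x, snd z) - l)))).
Qed.

Definition disc (z : C) (d : R) (w : C) : Prop := (Cmod (w - z) <= d)%R.
Definition locHol (u : C -> C) (z : C) : Prop := exists d, (0 < d)%R /\ Hol gen1 (disc z d) u.

Lemma locHol_const c z : locHol (fun _ => c) z.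
Proof. exists 1%R. split; [lra|apply Hol_const]. Qed.

Lemma locHol_id z : locHol (fun w => w) z.
Proof.
  exists 1%R. split; [lra|]. apply Hol_gen with (Cmod z + 1)%R; [reflexivity|]. intros w Hw. unfold disc in Hw.
  assert (h := Cmod_triangle (w - z) z). replace (w - z + z) with w in h by ring. lra.
Qed.

Lemma locHol_mul u v z : locHol u z -> locHol v z -> locHol (fun w => u w * v w) z.
Proof.
  intros (d & Hd & Hu) (d' & Hd' & Hv). exists (Rmin d d'). split; [apply Rmin_glb_lt; auto|].
  assert (l := Rmin_l d d'). assert (r := Rmin_r d d').
  apply (Hol_mul gen1 (disc z (Rmin d d'))); [apply Hol_subset with (disc z d)|apply Hol_subset with (disc z d')]; auto; unfold disc; intros; lra.
Qed.

Lemma locHol_dpoch q p u z : (Cmod q < 1)%R -> (Cmod p < 1)%R -> locHol u z -> locHol (fun w => dpoch q p (u w)) z.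
Proof. intros hq hp (d & Hd & Hu). exists d. split; auto. apply dpoch_comp_Hol; auto. Qed.

Lemma locHol_continuous u z : locHol u z -> forall e, (0 < e)%R -> exists d, (0 < d)%R /\ forall w, (Cmod (w - z) < d)%R -> (Cmod (u w - u z) < e)%R.
Proof.
  intros (d & Hd & Hu) e He. destruct (Hol1_unif_cont _ _ Hu e He) as (d' & Hd' & HH).
  exists (Rmin d d'). split; [apply Rmin_glb_lt; auto|]. intros w Hw. assert (l := Rmin_l d d'). assert (r := Rmin_r d d').
  apply HH; unfold disc; try lra. replace (z - z) with (RtoC 0) by ring. rewrite Cmod_0. lra.
Qed.

Lemma locHol_inv u z : locHol u z -> u z <> 0 -> locHol (fun w => / u w) z.
Proof.
  intros Hu hz. assert (hm := proj1 (Cmod_gt_0 _) hz).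
  destruct (locHol_continuous u z Hu (Cmod (u z) / 2) ltac:(lra)) as (d' & Hd' & HH). destruct Hu as (d & Hd & Hu).
  exists (Rmin d (d' / 2)). split; [apply Rmin_glb_lt; lra|]. assert (l := Rmin_l d (d' / 2)). assert (r := Rmin_r d (d' / 2)).
  apply Hol_inv with (Cmod (u z) / 2)%R; [lra| |].
  - intros w Hw. unfold disc in Hw. specialize (HH w ltac:(lra)). assert (h := Cmod_triangle_rev (u z) (u w)). rewrite Cmod_sub_sym in h. lra.
  - apply Hol_subset with (disc z d); auto. unfold disc; intros; lra.
Qed.

Lemma locHol_ext u v z : (forall w, u w = v w) -> locHol u z -> locHol v z.
Proof. intros E (d & Hd & Hu). exists d. split; auto. apply Hol_ext with u; auto. Qed.

Lemma locHol_punct_nz u z : locHol u z -> u z <> 0 -> punct (fun w => u w <> 0) z.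
Proof.
  intros Hu hz. destruct (locHol_continuous u z Hu _ (proj1 (Cmod_gt_0 _) hz)) as (d & Hd & HH). exists d. split; auto.
  intros w [_ hw] h. specialize (HH w hw). rewrite h in HH. replace (0 - u z) with (- u z) in HH by ring. rewrite Cmod_opp in HH. lra.
Qed.

(* [rho_expr] breaks down where some factor of a gamma function vanishes; these points are isolated. *)
Lemma punct_Cprod_nz (f : nat -> C -> C) z n : (forall i, punct (fun w => f i w <> 0) z) -> punct (fun w => Cprod (fun i => f i w) n <> 0) z.
Proof.
  intros H. induction n as [|n IH]; simpl.
  - exists 1%R. split; [lra|]. intros. apply C1_nz.
  - eapply punct_imp; [|exact (punct_and _ _ _ IH (H n))]. intros w [h1 h2]. apply Cmult_neq_0; auto.
Qed.

Lemma dpoch_zero (q p x : C) j k : (Cmod q < 1)%R -> (Cmod p < 1)%R -> 1 - x * q ^ j * p ^ k = 0 -> dpoch q p x = 0.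
Proof.
  intros hq hp E. apply (Ccv_unique (sqp q p x)); [apply dpoch_cv; auto|].
  assert (Z : forall (f : nat -> C) n i, (i < n)%nat -> f i = 0 -> Cprod f n = 0).
  { intros f n. induction n as [|n IH]; intros i Hi Hf; [lia|]. simpl. destruct (Nat.eq_dec i n) as [->|h]; [rewrite Hf; ring|].
    rewrite (IH i) by (auto; lia). ring. }
  intros e He. exists (S (j + k)). intros n Hn.
  replace (sqp q p x n) with (RtoC 0); [replace (0 - 0) with (RtoC 0) by ring; rewrite Cmod_0; auto|].
  symmetry. unfold sqp. apply (Z _ n j); [lia|]. apply (Z _ n k); [lia|]. auto.
Qed.

Lemma dpoch_factor_nz (q p x : C) : (Cmod q < 1)%R -> (Cmod p < 1)%R -> dpoch q p x <> 0 -> forall j k, 1 - x * q ^ j * p ^ k <> 0.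
Proof. intros hq hp h j k E. apply h. eapply dpoch_zero; eauto. Qed.

(** Near z the function u is bounded, so by [dpoch_tail] only the finitely many factors of one
    square product can vanish, each of them at most at z itself. *)
Lemma punct_dpoch (q p : C) u z : (Cmod q < 1)%R -> (Cmod p < 1)%R -> locHol u z ->
  (forall c, punct (fun w => 1 - u w * c <> 0) z) -> punct (fun w => dpoch q p (u w) <> 0) z.
Proof.
  intros hq hp Hu HP. destruct (locHol_continuous u z Hu 1 ltac:(lra)) as (d & Hd & HH).
  assert (hT : (0 <= Cmod (u z) + 1)%R) by (assert (h := Cmod_ge_0 (u z)); lra).
  destruct (dpoch_tail q p _ hq hp hT) as [N HN].
  assert (PB : punct (fun w => (Cmod (u w) <= Cmod (u z) + 1)%R) z).
  { exists d. split; auto. intros w [_ hw]. specialize (HH w hw). assert (h := Cmod_triangle (u w - u z) (u z)). replace (u w - u z + u z) with (u w) in h by ring. lra. }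
  assert (PS : punct (fun w => sqp q p (u w) N <> 0) z).
  { unfold sqp. apply punct_Cprod_nz. intros j. apply punct_Cprod_nz. intros k. eapply punct_imp; [|exact (HP (q ^ j * p ^ k))].
    intros w h. rewrite <- Cmult_assoc. exact h. }
  eapply punct_imp; [|exact (punct_and _ _ _ PB PS)]. intros w [h1 h2]. apply Cmod_nz. specialize (HN _ h1).
  assert (h3 := proj1 (Cmod_gt_0 _) h2). lra.
Qed.

(** A local form of nonconstancy: u takes no value 1/c at points accumulating at z. *)
Definition generic (u : C -> C) (z : C) : Prop := locHol u z /\ forall c, punct (fun w => 1 - u w * c <> 0) z.

Lemma punct_zpow (c z : C) (n : nat) : z <> 0 -> n = 1%nat \/ n = 2%nat -> punct (fun w => w <> 0 /\ 1 - c * w ^ n <> 0) z.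
Proof.
  intros hz hn. assert (hm := proj1 (Cmod_gt_0 _) hz).
  apply punct_and.
  - exact (locHol_punct_nz (fun w => w) z (locHol_id z) hz).
  - destruct (Ceq_dec (1 - c * z ^ n) 0) as [E|E].
    + exists (Cmod z). split; auto. intros w [w1 w2] F.
      assert (hc : c <> 0). { intros ->. apply C1_nz. rewrite <- E. ring. }
      assert (G : z ^ n - w ^ n = 0). { apply (Cmult_cancel c); auto. replace (c * (z ^ n - w ^ n)) with ((1 - c * w ^ n) - (1 - c * z ^ n)) by ring. rewrite E, F. ring. }
      assert (wz : w - z <> 0) by (apply Cmod_nz; auto).
      destruct hn as [hn | hn]; subst n.
      * apply wz. replace (w - z) with (- (z ^ 1 - w ^ 1)) by (simpl; ring). rewrite G. ring.
      (* For n = 2 the only other solution is w = - z, at distance 2 |z| from z and so outside the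
         disc of radius |z|. *)
      * assert (G2 : w + z = 0). { apply (Cmult_cancel (w - z)); auto. replace ((w - z) * (w + z)) with (- (z ^ 2 - w ^ 2)) by (simpl; ring). rewrite G. ring. }
        assert (hh : w - z = - (2 * z)) by (replace (w - z) with ((w + z) - 2 * z) by ring; rewrite G2; ring).
        rewrite hh, Cmod_opp, Cmod_mult, Cmod_R, Rabs_pos_eq in w2; lra.
    + assert (L : locHol (fun w => 1 - c * w ^ n) z).
      { assert (L1 : locHol (fun w => - c * w ^ n) z).
        { apply locHol_mul; [apply locHol_const|]. destruct hn; subst n; simpl; repeat (apply (locHol_mul (fun w => w)); [apply locHol_id|]); apply locHol_const. }
        destruct L1 as (d & Hd & HL). exists d. split; auto. apply Hol_ext with (fun w => 1 + - c * w ^ n); [intros; ring|].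
        apply (Hol_add gen1 (disc z d) (fun _ => 1)); [apply Hol_const|auto]. }
      exact (locHol_punct_nz _ _ L E).
Qed.

Lemma locHol_Cinv (z : C) : z <> 0 -> locHol (fun w => / w) z.
Proof. intros hz. exact (locHol_inv (fun w => w) z (locHol_id z) hz). Qed.

Lemma generic_pow (a z : C) (n : nat) : z <> 0 -> n = 1%nat \/ n = 2%nat -> generic (fun w => a * w ^ n) z /\ generic (fun w => a * (/ w) ^ n) z.
Proof.
  intros hz hn. split; split.
  - apply locHol_mul; [apply locHol_const|]. destruct hn; subst n; simpl; repeat (apply (locHol_mul (fun w => w)); [apply locHol_id|]); apply locHol_const.
  - intros c. eapply punct_imp; [|exact (punct_zpow (a * c) z n hz hn)]. intros w [h1 h2] h. apply h2. rewrite <- h. ring.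
  - apply locHol_mul; [apply locHol_const|]. assert (h := locHol_Cinv z hz). destruct hn; subst n; simpl; repeat (apply (locHol_mul (fun w => / w)); [auto|]); apply locHol_const.
  - intros c. destruct (Ceq_dec (a * c) 0) as [E|E].
    + exists 1%R. split; [lra|]. intros w _ h. apply C1_nz. rewrite <- h. replace (a * (/ w) ^ n * c) with (a * c * (/ w) ^ n) by ring. rewrite E. ring.
    + eapply punct_imp; [|exact (punct_zpow (/ (a * c)) z n hz hn)]. intros w [h1 h2] h. apply h2.
      assert (e1 : a * c = w ^ n). 
      { replace (a * c) with (a * (/ w) ^ n * c * w ^ n).
        - replace (a * (/ w) ^ n * c) with (RtoC 1); [ring|]. symmetry. apply Ceq_minus. replace (a * (/ w) ^ n * c - 1) with (- (1 - a * (/ w) ^ n * c)) by ring. rewrite h. ring.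
        - replace (a * (/ w) ^ n * c * w ^ n) with (a * c * ((/ w) ^ n * w ^ n)) by ring. rewrite <- Cpow_mult_l. replace (/ w * w) with (RtoC 1) by (field; auto). rewrite Cpow_1_l. ring. }
      rewrite <- e1. rewrite Cinv_l by auto. ring.
Qed.

(** * The integrand in terms of the symmetric kernel *)

Lemma egamma_Gam (q p u : C) : (Cmod q < 1)%R -> (Cmod p < 1)%R -> dpoch q p u <> 0 -> egamma q p u = Gam q p u.
Proof. intros hq hp h. rewrite egamma_dpoch; auto. apply dpoch_factor_nz; auto. Qed.

Lemma Cinv_Gam (q p u : C) : / Gam q p u = iGam q p u.
Proof. unfold Gam, iGam. rewrite Cinv_mul, Cinv_Cinv. ring. Qed.

Lemma iGam_Gam (q p u v : C) : u * v = p * q -> u <> 0 -> v <> 0 -> iGam q p u = Gam q p v.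
Proof.
  intros E hu hv. unfold iGam, Gam. replace (p * q / u) with v by (rewrite <- E; field; auto).
  replace (p * q / v) with u by (rewrite <- E; field; auto). reflexivity.
Qed.

(** Splitting off the row j = 0 and then the column k = 0 leaves the double product at p q x. *)
Lemma dpoch_quot (q p x : C) : (Cmod q < 1)%R -> (Cmod p < 1)%R -> dpoch q p (p * q * x) <> 0 ->
  dpoch q p x * / dpoch q p (p * q * x) = poch p x * poch q (q * x).
Proof.
  intros hq hp h. rewrite (dpoch_rec q p x) by auto. rewrite (dpoch_sym q p (q * x)), (dpoch_rec p q (q * x)), (dpoch_sym p q (p * (q * x))) by auto.
  replace (p * (q * x)) with (p * q * x) by ring. field. auto.
Qed.

Lemma iGam_Vfac (q p w : C) : (Cmod q < 1)%R -> (Cmod p < 1)%R -> w <> 0 ->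
  dpoch q p (p * q * (w * w)) <> 0 -> dpoch q p (p * q * (/ (w * w))) <> 0 ->
  iGam q p (w * w) * iGam q p (/ (w * w)) = Vfac q p w.
Proof.
  intros hq hp hw h1 h2. assert (E1 := dpoch_quot q p _ hq hp h1). assert (E2 := dpoch_quot q p _ hq hp h2).
  unfold iGam, Vfac. replace (p * q / (w * w)) with (p * q * / (w * w)) by reflexivity.
  replace (p * q / / (w * w)) with (p * q * (w * w)) by (field; auto).
  replace (q / (w * w)) with (q * / (w * w)) by reflexivity.
  transitivity ((dpoch q p (w * w) * / dpoch q p (p * q * (w * w))) * (dpoch q p (/ (w * w)) * / dpoch q p (p * q * / (w * w)))); [ring|].
  rewrite E1, E2. ring.
Qed.

(** With A t_6 = p q the reflection of Gamma turns 1/Gamma(A z) into Gamma(t_6 / z), 1/Gamma(A / z)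
    into Gamma(t_6 z), and Gamma(A / t_m) into 1/Gamma(t_m t_6). The nonvanishing hypotheses allow
    each gamma function to be evaluated separately. *)
Lemma rho_expr_Ker (q p w : C) (t : nat -> C) : (0 < Cmod q < 1)%R -> (0 < Cmod p < 1)%R -> (forall m, (m < 5)%nat -> t m <> 0) ->
  w <> 0 ->
  (forall m, (m < 5)%nat -> dpoch q p (t m * w) <> 0 /\ dpoch q p (t m * / w) <> 0 /\ dpoch q p (Aprod t * / t m) <> 0) ->
  (forall m s, (m < s)%nat -> (s < 5)%nat -> dpoch q p (t m * t s) <> 0) ->
  dpoch q p (Aprod t * w) <> 0 -> dpoch q p (Aprod t * / w) <> 0 ->
  dpoch q p (w * w) <> 0 -> dpoch q p (/ (w * w)) <> 0 ->
  dpoch q p (p * q * (w * w)) <> 0 -> dpoch q p (p * q * / (w * w)) <> 0 ->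
  let t6 := p * q / (t 0%nat * t 1%nat * t 2%nat * t 3%nat * t 4%nat) in
  rho_expr q p t w = Ker q p (t 0%nat) (t 1%nat) (t 2%nat) (t 3%nat) (t 4%nat) t6 w *
    pairs6 (iGam q p) (t 0%nat) (t 1%nat) (t 2%nat) (t 3%nat) (t 4%nat) t6.
Proof.
  intros hq hp ht hw h1 h2 h3 h4 h5 h6 h7 h8 t6.
  assert (nq : q <> 0) by (apply Cmod_nz; lra). assert (np : p <> 0) by (apply Cmod_nz; lra).
  assert (EA : Aprod t = t 0%nat * t 1%nat * t 2%nat * t 3%nat * t 4%nat) by (unfold Aprod; simpl; ring).
  assert (e := fun u h => egamma_Gam q p u (proj2 hq) (proj2 hp) h).
  assert (n0 := ht 0%nat ltac:(lia)). assert (n1 := ht 1%nat ltac:(lia)). assert (n2 := ht 2%nat ltac:(lia)).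
  assert (n3 := ht 3%nat ltac:(lia)). assert (n4 := ht 4%nat ltac:(lia)).
  assert (nA : Aprod t <> 0) by (rewrite EA; nz).
  assert (n6 : t6 <> 0) by (unfold t6; nz).
  assert (EA6 : Aprod t * t6 = p * q) by (unfold t6; rewrite EA; field; repeat split; auto).
  unfold rho_expr. cbv zeta. cbn [Cprod].
  destruct (h1 0%nat ltac:(lia)) as (a0 & b0 & c0). destruct (h1 1%nat ltac:(lia)) as (a1 & b1 & c1).
  destruct (h1 2%nat ltac:(lia)) as (a2 & b2 & c2). destruct (h1 3%nat ltac:(lia)) as (a3 & b3 & c3).
  destruct (h1 4%nat ltac:(lia)) as (a4 & b4 & c4).
  replace (w ^ 2) with (w * w) by (simpl; ring).
  rewrite (e _ a0), (e _ b0), (e _ c0), (e _ a1), (e _ b1), (e _ c1), (e _ a2), (e _ b2), (e _ c2), (e _ a3), (e _ b3), (e _ c3), (e _ a4), (e _ b4), (e _ c4).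
  rewrite (e _ h3), (e _ h4), (e _ h5), (e _ h6).
  rewrite (e _ (h2 0 1 ltac:(lia) ltac:(lia))%nat), (e _ (h2 0 2 ltac:(lia) ltac:(lia))%nat), (e _ (h2 0 3 ltac:(lia) ltac:(lia))%nat), (e _ (h2 0 4 ltac:(lia) ltac:(lia))%nat),
    (e _ (h2 1 2 ltac:(lia) ltac:(lia))%nat), (e _ (h2 1 3 ltac:(lia) ltac:(lia))%nat), (e _ (h2 1 4 ltac:(lia) ltac:(lia))%nat),
    (e _ (h2 2 3 ltac:(lia) ltac:(lia))%nat), (e _ (h2 2 4 ltac:(lia) ltac:(lia))%nat), (e _ (h2 3 4 ltac:(lia) ltac:(lia))%nat).
  assert (g : forall x : C, x <> 0 -> Gam q p (Aprod t * / x) = iGam q p (x * t6)).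
  { intros x hx. symmetry. apply iGam_Gam; nz. rewrite <- EA6. field. auto. }
  rewrite (g _ n0), (g _ n1), (g _ n2), (g _ n3), (g _ n4).
  unfold Cdiv at 1. rewrite !Cinv_mul, !Cinv_Gam.
  rewrite (iGam_Gam q p (Aprod t * w) (t6 / w)) by (first [solve [nz] | rewrite <- EA6; field; auto]).
  rewrite (iGam_Gam q p (Aprod t * / w) (t6 * w)) by (first [solve [nz] | rewrite <- EA6; field; auto]).
  unfold Ker, prod6, pairs6, GG. rewrite <- (iGam_Vfac q p w) by tauto.
  replace (/ RtoC 1) with (RtoC 1) by field. unfold Cdiv. rewrite !Cinv_mul. ring.
Qed.

Lemma Ker_locHol (q p t1 t2 t3 t4 t5 t6 z : C) : (Cmod q < 1)%R -> (Cmod p < 1)%R -> z <> 0 ->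
  (forall t, In t [t1; t2; t3; t4; t5; t6] -> t <> 0 /\ dpoch q p (t * z) <> 0 /\ dpoch q p (t / z) <> 0) ->
  locHol (Ker q p t1 t2 t3 t4 t5 t6) z.
Proof.
  intros hq hp hz H.
  assert (Li := locHol_Cinv z hz). assert (Lz := locHol_id z).
  assert (LD : forall u : C -> C, locHol u z -> forall q' p' : C, (Cmod q' < 1)%R -> (Cmod p' < 1)%R -> locHol (fun w => dpoch q' p' (u w)) z)
    by (intros; apply locHol_dpoch; auto).
  assert (LC := fun c => locHol_const c z).
  assert (LV : locHol (Vfac q p) z).
  { unfold Vfac. assert (A1 : locHol (fun w => w * w) z) by (apply locHol_mul; auto).
    assert (A2 : locHol (fun w => / (w * w)) z) by (apply locHol_ext with (fun w => / w * / w); [intros; rewrite Cinv_mul; auto|apply locHol_mul; auto]).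
    repeat (apply (locHol_mul (fun w => poch _ _ * poch _ _)) || apply (locHol_mul (fun w => poch _ _)));
      apply locHol_dpoch; auto using Cmod_0_lt_1; try (apply (locHol_mul (fun _ => q)); auto). }
  assert (LG : forall t, In t [t1; t2; t3; t4; t5; t6] -> locHol (fun w => GG q p t w) z).
  { intros t Ht. destruct (H t Ht) as (h0 & h1 & h2). unfold GG, Gam.
    assert (B1 : locHol (fun w => t * w) z) by (apply (locHol_mul (fun _ => t)); auto).
    assert (B2 : locHol (fun w => t / w) z) by (apply (locHol_mul (fun _ => t)); auto).
    assert (B3 : locHol (fun w => p * q / (t * w)) z).
    { apply locHol_ext with (fun w => p * q / t * / w); [intros; unfold Cdiv; rewrite Cinv_mul; ring|]. apply (locHol_mul (fun _ => p * q / t)); auto. }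
    assert (B4 : locHol (fun w => p * q / (t / w)) z).
    { apply locHol_ext with (fun w => p * q / t * w); [intros; unfold Cdiv; rewrite Cinv_mul, Cinv_Cinv; ring|]. apply (locHol_mul (fun _ => p * q / t)); auto. }
    apply (locHol_mul (fun w => dpoch q p (p * q / (t * w)) * / dpoch q p (t * w))).
    - apply (locHol_mul (fun w => dpoch q p (p * q / (t * w)))); [auto|]. apply (locHol_inv (fun w => dpoch q p (t * w))); auto.
    - apply (locHol_mul (fun w => dpoch q p (p * q / (t / w)))); [auto|]. apply (locHol_inv (fun w => dpoch q p (t / w))); auto. }
  unfold Ker, prod6. apply (locHol_mul (Vfac q p)); auto.
  repeat match goal with
  | |- locHol (fun w => GG q p _ w) z => apply LG; simpl; tauto
  | |- locHol (fun w => @?u w * @?v w) z => apply (locHol_mul u v)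
  end.
Qed.

Lemma punct_forall (P : nat -> C -> Prop) z n : (forall m, (m < n)%nat -> punct (P m) z) -> punct (fun w => forall m, (m < n)%nat -> P m w) z.
Proof.
  induction n as [|n IH]; intros H.
  - exists 1%R. split; [lra|]. intros; lia.
  - eapply punct_imp; [|exact (punct_and _ _ _ (IH (fun m hm => H m (Nat.lt_lt_succ_r _ _ hm))) (H n (Nat.lt_succ_diag_r n)))].
    intros w [h1 h2] m hm. destruct (Nat.eq_dec m n) as [->|h]; [auto|apply h1; lia].
Qed.

Lemma punct_dpoch_pow (q p a z : C) : (Cmod q < 1)%R -> (Cmod p < 1)%R -> z <> 0 ->
  punct (fun w => (dpoch q p (a * w) <> 0 /\ dpoch q p (a * / w) <> 0) /\ (dpoch q p (a * (w * w)) <> 0 /\ dpoch q p (a * / (w * w)) <> 0)) z.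
Proof.
  intros hq hp hz.
  destruct (generic_pow a z 1 hz (or_introl eq_refl)) as [[l1 g1] [l2 g2]]. destruct (generic_pow a z 2 hz (or_intror eq_refl)) as [[l3 g3] [l4 g4]].
  assert (h1 := punct_dpoch q p _ z hq hp l1 g1). assert (h2 := punct_dpoch q p _ z hq hp l2 g2).
  assert (h3 := punct_dpoch q p _ z hq hp l3 g3). assert (h4 := punct_dpoch q p _ z hq hp l4 g4).
  eapply punct_imp; [|exact (punct_and _ _ _ (punct_and _ _ _ h1 h2) (punct_and _ _ _ h3 h4))].
  intros w [[x1 x2] [x3 x4]]. simpl in *. rewrite !Cmult_1_r in *. rewrite Cinv_mul. auto.
Qed.

(** At isolated points factors of [rho_expr] may be undefined, but on a punctured neighbourhood of z
    it equals the right side, which is continuous at z. *)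
Lemma rho_regular (q p z : C) (t : nat -> C) : (0 < Cmod q < 1)%R -> (0 < Cmod p < 1)%R -> (forall m, (m < 5)%nat -> t m <> 0) -> z <> 0 ->
  (forall m, (m < 5)%nat -> dpoch q p (Aprod t * / t m) <> 0) ->
  (forall m s, (m < s)%nat -> (s < 5)%nat -> dpoch q p (t m * t s) <> 0) ->
  let t6 := p * q / (t 0%nat * t 1%nat * t 2%nat * t 3%nat * t 4%nat) in
  (forall u, In u [t 0%nat; t 1%nat; t 2%nat; t 3%nat; t 4%nat; t6] -> u <> 0 /\ dpoch q p (u * z) <> 0 /\ dpoch q p (u / z) <> 0) ->
  rho q p t z = Ker q p (t 0%nat) (t 1%nat) (t 2%nat) (t 3%nat) (t 4%nat) t6 z *
    pairs6 (iGam q p) (t 0%nat) (t 1%nat) (t 2%nat) (t 3%nat) (t 4%nat) t6.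
Proof.
  intros hq hp ht hz hA hts t6 Hu.
  set (kappa := pairs6 (iGam q p) (t 0%nat) (t 1%nat) (t 2%nat) (t 3%nat) (t 4%nat) t6).
  set (Kr := Ker q p (t 0%nat) (t 1%nat) (t 2%nat) (t 3%nat) (t 4%nat) t6).
  assert (LK : locHol (fun w => Kr w * kappa) z).
  { apply (locHol_mul Kr); [apply Ker_locHol; tauto|apply locHol_const]. }
  unfold rho. apply C_lim_eq. intros e He.
  destruct (locHol_continuous _ z LK e He) as (d & Hd & HH).
  assert (P0 : punct (fun w => (Cmod (Kr w * kappa - Kr z * kappa) < e)%R) z).
  { exists d. split; auto. intros w [_ hw]. apply HH; auto. }
  assert (P1 := fun a => punct_dpoch_pow q p a z (proj2 hq) (proj2 hp) hz).
  assert (P2 : punct (fun w => forall m, (m < 5)%nat -> dpoch q p (t m * w) <> 0 /\ dpoch q p (t m * / w) <> 0) z).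
  { apply punct_forall. intros m _. eapply punct_imp; [|exact (P1 (t m))]. intros w [h _]. exact h. }
  assert (P3 : punct (fun w => w <> 0) z) by exact (locHol_punct_nz (fun w => w) z (locHol_id z) hz).
  eapply punct_imp; [|exact (punct_and _ _ _ (punct_and _ _ _ P0 (punct_and _ _ _ P2 P3)) (punct_and _ _ _ (P1 (Aprod t)) (punct_and _ _ _ (P1 1) (P1 (p * q)))))].
  intros w [[w0 [w2 w3]] [[w4 _] [[_ w5] [_ w6]]]]. rewrite !Cmult_1_l in w5.
  rewrite rho_expr_Ker; try tauto.
  intros m hm. destruct (w2 m hm). specialize (hA m hm). tauto.
Qed.

Theorem theorem1 (q p : C) (t : nat -> C) (gamma : R -> C) (a b : R)
    (hq : (0 < Cmod q < 1)%R) (hp : (0 < Cmod p < 1)%R)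
    (ht : forall m : nat, (m < 5)%nat -> t m <> 0%C)
    (hfin : forall m : nat, (m < 5)%nat ->
      egamma_finite q p (Aprod t * / t m)%C)
    (hinvfin : forall m s : nat, (m < s)%nat -> (s < 5)%nat ->
      inv_egamma_finite q p (t m * t s)%C)
    (hC1 : piecewise_C1 gamma a b)
    (hsimple : simple_closed gamma a b)
    (horient : positively_oriented gamma a b)
    (hsep : separates gamma a b
      (poles_to_zero q p t) (poles_to_infinity q p t)) :
  is_contour_int (fun z => (rho q p t z / z)%C) gamma a b
    (4 * PI * Ci / (qpoch_inf q q * qpoch_inf p p))%C.
Proof.
  destruct hsimple as [hcl _]. destruct hsep as (h0 & hi0 & hin & hout).
  assert (hw := horient 0 hi0).
  assert (nq : q <> 0) by (apply Cmod_nz; lra). assert (np : p <> 0) by (apply Cmod_nz; lra).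
  assert (n0 := ht 0%nat ltac:(lia)). assert (n1 := ht 1%nat ltac:(lia)). assert (n2 := ht 2%nat ltac:(lia)).
  assert (n3 := ht 3%nat ltac:(lia)). assert (n4 := ht 4%nat ltac:(lia)).
  set (t6 := p * q / (t 0%nat * t 1%nat * t 2%nat * t 3%nat * t 4%nat)).
  assert (EA : Aprod t = t 0%nat * t 1%nat * t 2%nat * t 3%nat * t 4%nat) by (unfold Aprod; simpl; ring).
  assert (n6 : t6 <> 0) by (unfold t6; nz).
  set (six := [t 0%nat; t 1%nat; t 2%nat; t 3%nat; t 4%nat; t6]).
  assert (nsix : forall u, In u six -> u <> 0).
  { intros u Hu. unfold six in Hu. simpl in Hu. repeat (destruct Hu as [<-|Hu]; [assumption|]). contradiction. }
  assert (Hpole : forall u j k, In u six -> poles_to_zero q p t (u * q ^ j * p ^ k)).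
  { intros u j k Hu. unfold six in Hu. simpl in Hu.
    destruct Hu as [<-|[<-|[<-|[<-|[<-|[<-|[]]]]]]].
    1: left; exists 0%nat, j, k; split; [lia|reflexivity].
    1: left; exists 1%nat, j, k; split; [lia|reflexivity].
    1: left; exists 2%nat, j, k; split; [lia|reflexivity].
    1: left; exists 3%nat, j, k; split; [lia|reflexivity].
    1: left; exists 4%nat, j, k; split; [lia|reflexivity].
    (* The exponents j + 1 and k + 1 in the poles coming from A^-1 absorb the factor p q of t_6. *)
    right. exists j, k. unfold t6. rewrite EA. simpl. field. repeat split; auto. }
  assert (Hinf : forall x, poles_to_zero q p t x -> exterior_of gamma a b (/ x)).
  { intros x Hx. apply hout. exists x. auto. }
  assert (pnz : forall u j k, In u six -> u * q ^ j * p ^ k <> 0).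
  { intros u j k Hu. repeat apply Cmult_neq_0; auto; apply Cpow_nz; auto. }
  (* A relation x y = 1 would make the point x = 1/y both interior and exterior to the curve. *)
  assert (Hxy : forall u j k u' j' k', In u six -> In u' six -> 1 - (u * q ^ j * p ^ k) * (u' * q ^ j' * p ^ k') <> 0).
  { intros u j k u' j' k' Hu Hu' E. assert (I := hin _ (Hpole u j k Hu)). assert (O := Hinf _ (Hpole u' j' k' Hu')).
    assert (N' := pnz u' j' k' Hu'). set (x := u * q ^ j * p ^ k) in *. set (y := u' * q ^ j' * p ^ k') in *.
    assert (Exy : x = / y). { apply Ceq_minus. replace (x - / y) with (- ((1 - x * y) * / y)) by (field; auto). rewrite E. ring. }
    rewrite Exy in I. apply (proj2 O). apply (proj2 I). }
  set (K := on_curve gamma a b). set (L := cfun gamma a b).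
  assert (HA : adm K L) by exact (adm_cfun gamma a b hC1 hcl h0 hw).
  assert (HP : forall u j k, In u six -> polefree K L (u * q ^ j * p ^ k) /\
    polefree (fun z => K (/ z)) (fun f => L (fun z => f (/ z))) (u * q ^ j * p ^ k)).
  (* The first half uses that 1/x is exterior and has winding number 0. The second uses that x is
     interior, where the orientation gives winding number 1. *)
  { intros u j k Hu. assert (I := hin _ (Hpole u j k Hu)). assert (O := Hinf _ (Hpole u j k Hu)). split.
    - apply (polefree_exterior gamma a b hC1 hcl h0 hw); auto; [apply O|]. apply (winding_exterior gamma a b hC1 hcl); auto.
    - apply (polefree_interior gamma a b hC1 hcl h0 hw); [apply I|]. apply horient; auto. }
  assert (fA : forall m, (m < 5)%nat -> dpoch q p (Aprod t * / t m) <> 0).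
  { intros m hm. apply dpoch_nz; try tauto. intros j k. apply hfin; auto. }
  assert (fts : forall m s, (m < s)%nat -> (s < 5)%nat -> dpoch q p (p * q / (t m * t s)) <> 0).
  { intros m s h1 h2. apply dpoch_nz; try tauto. intros j k. 
    replace (p * q / (t m * t s) * q ^ j * p ^ k) with (/ (t m * t s) * q ^ S j * p ^ S k) by (simpl; unfold Cdiv; ring). apply hinvfin; auto. }
  (* Pairs with t_6 are covered by the finiteness of Gamma(A / t_m), since p q / (t_m t_6) = A /
     t_m; the other pairs by the finiteness of 1/Gamma(t_m t_s). *)
  assert (f6 : forall m, (m < 5)%nat -> dpoch q p (p * q / (t m * t6)) <> 0).
  { intros m hm. assert (hm0 := ht m hm). replace (p * q / (t m * t6)) with (Aprod t * / t m); [auto|].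
    unfold t6. rewrite EA. field. repeat split; auto. }
  assert (HD : pairs6 (fun x => dpoch q p (p * q / x)) (t 0%nat) (t 1%nat) (t 2%nat) (t 3%nat) (t 4%nat) t6 <> 0).
  { unfold pairs6. cbv beta. repeat match goal with |- Cmult _ _ <> _ => apply Cmult_neq_0 end; match goal with |- dpoch _ _ (_ / (_ * t6)) <> _ => apply f6; lia | |- _ => apply fts; lia end. }
  destruct (contour_value q p (t 0%nat) (t 1%nat) (t 2%nat) (t 3%nat) (t 4%nat) K L hq hp n0 n1 n2 n3 n4 HA HP Hxy HD) as [HK HV].
  fold t6 in HK, HV.
  set (kappa := pairs6 (iGam q p) (t 0%nat) (t 1%nat) (t 2%nat) (t 3%nat) (t 4%nat) t6) in *.
  set (Kr := Ker q p (t 0%nat) (t 1%nat) (t 2%nat) (t 3%nat) (t 4%nat) t6) in *.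
  assert (HR : forall z, K z -> rho q p t z = kappa * Kr z).
  { intros z Hz. assert (hz : z <> 0) by exact (adm_nz K L z HA Hz).
    rewrite Cmult_comm. apply rho_regular; auto.
    - intros m s h1 h2. apply dpoch_nz; try tauto. intros j k.
      assert (im : forall i, (i < 5)%nat -> In (t i) six).
      { intros i hi. unfold six. simpl. do 5 (destruct i as [|i]; [tauto|]). lia. }
      (* A zero of this factor would be a relation x y = 1 between the poles t_m q^j p^k and t_s, so
         the separation of the poles also keeps Gamma(t_m t_s) finite. *)
      replace (t m * t s * q ^ j * p ^ k) with ((t m * q ^ j * p ^ k) * (t s * q ^ 0 * p ^ 0)) by (simpl; ring).
      apply Hxy; apply im; lia.
    - intros u Hu. split; [apply nsix; auto|]. split.
      + apply dpoch_nz; try tauto. intros j k. replace (u * z * q ^ j * p ^ k) with (u * q ^ j * p ^ k * z) by ring.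
        apply (polefree_nz K L); auto. apply HP; auto.
      + apply dpoch_nz; try tauto. intros j k. replace (u / z * q ^ j * p ^ k) with (u * q ^ j * p ^ k * / z) by (unfold Cdiv; ring).
        apply (polefree_nz (fun z => K (/ z)) (fun f => L (fun z => f (/ z)))); [apply HP; auto|]. rewrite Cinv_Cinv. auto. }
  assert (Hk : Hol gen1 K (fun z => kappa * Kr z)) by (apply (Hol_mul gen1 K); [apply Hol_const|exact HK]).
  assert (HI := cfun_int gamma a b hC1 h0 (fun z => kappa * Kr z) Hk).
  fold L in HI. rewrite (adm_scal _ _ HA kappa Kr HK), (Cmult_comm kappa), HV in HI.
  rewrite !qpoch_inf_poch by tauto.
  replace (4 * PI * Ci / (poch q q * poch p p)) with (2 * PI * Ci * (RtoC 2 / (poch p p * poch q q))).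
  - apply (contour_int_ext gamma a b hC1 (fun z => kappa * Kr z / z)); [|exact HI].
    intros z Hz. cbv beta. rewrite HR; auto.
  - assert (e1 := poch_nz p p (proj2 hp) (proj2 hp)). assert (e2 := poch_nz q q (proj2 hq) (proj2 hq)).
    replace (RtoC 4) with (RtoC 2 * RtoC 2) by (rewrite <- RtoC_mult; f_equal; ring). field. auto.
Qed.
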